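(* Let $\mathcal Y=\mathcal T^*+\boldsymbol\Xi+\mathcal S\in\mathbb R^{d_1\times\cdots\times d_m}$, where $\mathcal T^*$ has Tucker rank $\mathbf r$, incoherence parameter $\mu^*=\mu(\mathcal T^* )$ and condition number $\kappa$. Suppose the noise tensor $\boldsymbol\Xi$ has i.i.d. centered entries, distributed as $\xi$, with a finite $(4+\varepsilon)$-th moment for some $\varepsilon>0$, and $\mathcal S$ has independent entries with $[\mathcal S]_\omega\sim(1-\alpha)\delta_0+\alpha Q_\omega$, where $\delta_0$ is the point mass at zero and $Q_\omega$ is an arbitrary distribution. Write $\|\xi\|_4=(\mathbb E\xi^4)^{1/4}$ and $\bar d=\max_kd_k$. Let $\widehat{\mathcal Y}$ be the truncation of $\mathcal Y$ at level $\tau$ and $\mathcal T_0=\mathrm{HOSVD}_{\mathbf r}(\widehat{\mathcal Y})$ (see context). There exist constants $c,c_1,C_1,C_2,C_3>0$ such that if $d^*\ge\mu^{*m}r^*\kappa\,\bar d\log\bar d$, the truncation level satisfies $\tau\in(\|\mathcal T^*\|_\infty+d^{*1/8}\|\xi\|_4)\cdot[C_1,C_2]$, the signal strength satisfies $$\underline\lambda^*/\|\xi\|_4\ge C_3m\kappa\sqrt{r^*}\max\{(\bar d\log\bar d)^{1/2},\ d^{*1/4}(\log\bar d)^{1/4}\},$$ and the corruption rate satisfies $$\alpha\le c_1\min\{(\underline\lambda^*/\|\xi\|_4)/d^{*5/8},\ 1/(\mu^{*m}r^* )\}/(m\kappa^2\sqrt{r^*}),$$ then with probability at least $1-cd^{*-\varepsilon/4}-\sum_{k=1}^md_k^-\exp(-\alpha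 d_k)$, $$\|\mathcal T_0-\mathcal T^*\|_{\mathrm F}\le C_3m\kappa\sqrt{r^*}\Big((\|\xi\|_4+\|\mathcal T^*\|_\infty)\big(\sqrt{\bar d\log\bar d}+4d^{*1/4}(\log\bar d)^{1/4}\big)+2\alpha\tau\sqrt{d^*}\Big),$$ $$\|\mathcal T_0-\mathcal T^*\|_\infty\le C_3m^2\kappa^2\sqrt{r^*}\sqrt{\frac{\mu^{*m}r^*}{d^*}}\Big((\|\xi\|_4+\|\mathcal T^*\|_\infty)\big(\sqrt{\bar d\log\bar d}+4d^{*1/4}(\log\bar d)^{1/4}\big)+2\alpha\tau\sqrt{d^*}\Big).$$
   Context: Notation. $d^*=d_1\cdots d_m$, $d_k^-=d^*/d_k$, $r^*=r_1\cdots r_m$. $\mathcal M_k(\mathcal T)\in\mathbb R^{d_k\times d_k^-}$ is the mode-$k$ matricization; $\mathcal T$ has Tucker rank $\mathbf r=(r_1,\dots,r_m)$ if $\mathrm{rank}(\mathcal M_k(\mathcal T))=r_k$ for all $k$, and then $\mathcal T=\mathcal C\times_1\mathbf U_1\times_2\cdots\times_m\mathbf U_m$ with core $\mathcal C\in\mathbb R^{r_1\times\cdots\times r_m}$ and $\mathbf U_k\in\mathbb R^{d_k\times r_k}$ with orthonormal columns. $\mu(\mathcal T)=\max_k\|\mathbf U_k\|_{2,\infty}^2d_k/r_k$ with $\|\cdot\|_{2,\infty}$ the maximal Euclidean row norm. $\underline\lambda^*=\min_k\sigma_{r_k}(\mathcal M_k(\mathcal T^* ))$, $\overline\lambda^*=\max_k\sigma_1(\mathcal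 M_k(\mathcal T^* ))$, $\kappa=\overline\lambda^*/\underline\lambda^*$. $\|\cdot\|_{\mathrm F}$ and $\|\cdot\|_\infty$ are the entrywise $\ell_2$ and $\ell_\infty$ norms. Truncation: $[\widehat{\mathcal Y}]_\omega=[\mathcal Y]_\omega$ if $|[\mathcal Y]_\omega|\le\tau$ and $[\widehat{\mathcal Y}]_\omega=\tau\,\mathrm{sign}([\mathcal Y]_\omega)$ otherwise. $\mathrm{HOSVD}_{\mathbf r}(\mathcal X)=\mathcal X\times_1\mathbf V_1\mathbf V_1^\top\cdots\times_m\mathbf V_m\mathbf V_m^\top$, where $\mathbf V_k$ consists of the top $r_k$ left singular vectors of $\mathcal M_k(\mathcal X)$. *)

(* Defs.v *)
From HB Require Import structures.
From mathcomp Require Import all_boot all_order all_algebra.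
From mathcomp Require Import all_classical all_reals all_analysis.

Set Implicit Arguments.
Unset Strict Implicit.
Unset Printing Implicit Defensive.

Import Order.TTheory GRing.Theory Num.Theory.

Local Open Scope classical_set_scope.
Local Open Scope ring_scope.

(* Modes, rows, columns and singular values are all numbered from 0. *)

Definition tidx (m : nat) (d : 'I_m -> nat) : finType :=
  {dffun forall k : 'I_m, 'I_(d k)}.

Definition tensor (R : realType) (m : nat) (d : 'I_m -> nat) :=
  {ffun tidx d -> R}.

Definition dstar (m : nat) (d : 'I_m -> nat) : nat := (\prod_(k < m) d k)%N.

Definition dminus (m : nat) (d : 'I_m -> nat) (k : 'I_m) : nat :=
  (\prod_(j < m | j != k) d j)%N.

Definition dbar (m : nat) (d : 'I_m -> nat) : nat := (\max_(k < m) d k)%N.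

(* Multi-indices in all the modes but k: the columns of the mode-k
   matricization. *)
Definition cotidx (m : nat) (d : 'I_m -> nat) (k : 'I_m) : finType :=
  {dffun forall j : {j : 'I_m | j != k}, 'I_(d (val j))}.

Lemma card_cotidx (m : nat) (d : 'I_m -> nat) (k : 'I_m) :
  #|cotidx d k| = dminus d k.
Proof.
rewrite card_dep_ffun foldrE big_map big_enum /= /dminus.
rewrite (eq_bigr (fun j : {j : 'I_m | j != k} => d (val j))); last first.
  by move=> j _; rewrite card_ord.
by rewrite -(big_sub [pred j : 'I_m | j != k]).
Qed.

(* The multi-index equal to i in mode k and to c in the other modes. *)
Definition insert_idx (m : nat) (d : 'I_m -> nat) (k : 'I_m)
    (i : 'I_(d k)) (c : cotidx d k) : tidx d :=
  [ffun j : 'I_m =>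
     match boolP (j == k) return 'I_(d j) with
     | AltTrue eq_jk => cast_ord (congr1 d (esym (eqP eq_jk))) i
     | AltFalse neq_jk => c (exist _ j neq_jk)
     end].

(* The columns are ordered by the enumeration of cotidx d k; permuting them
   changes neither the rank, nor the singular values, nor the left singular
   vectors. *)
Definition matricize (R : realType) (m : nat) (d : 'I_m -> nat) (k : 'I_m)
    (T : tensor R d) : 'M[R]_(d k, #|cotidx d k|) :=
  \matrix_(i, c) T (insert_idx i (enum_val c)).

Definition has_tucker_rank (R : realType) (m : nat) (d r : 'I_m -> nat)
    (T : tensor R d) : Prop :=
  forall k : 'I_m, \rank (matricize k T) = r k.

(* C x_1 U_1 x_2 ... x_m U_m *)
Definition multilinear_prod (R : realType) (m : nat) (d r : 'I_m -> nat)
    (C : tensor R r) (U : forall k : 'I_m, 'M[R]_(d k, r k)) : tensor R d :=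
  [ffun w : tidx d => \sum_(v : tidx r) C v * \prod_(k < m) U k (w k) (v k)].

Definition orthonormal_cols (R : realType) (p q : nat) (U : 'M[R]_(p, q)) :
    Prop :=
  U^T *m U = 1%:M.

Definition tucker_decomposition (R : realType) (m : nat) (d r : 'I_m -> nat)
    (T : tensor R d) (C : tensor R r)
    (U : forall k : 'I_m, 'M[R]_(d k, r k)) : Prop :=
  (forall k : 'I_m, orthonormal_cols (U k)) /\ T = multilinear_prod C U.

Definition norm_2inf (R : realType) (p q : nat) (U : 'M[R]_(p, q)) : R :=
  \big[Num.max/0]_(i < p) Num.sqrt (\sum_(j < q) U i j ^+ 2).

(* The factors of a Tucker decomposition of a tensor of Tucker rank r are
   unique up to right multiplication by orthogonal matrices, which leave this
   number unchanged. *)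
Definition incoherence (R : realType) (m : nat) (d r : 'I_m -> nat)
    (U : forall k : 'I_m, 'M[R]_(d k, r k)) : R :=
  \big[Num.max/0]_(k < m) (norm_2inf (U k) ^+ 2 * (d k)%:R / (r k)%:R).

(* A = U Sigma W^T, with s i the (i+1)-th largest singular value, and s i = 0
   beyond the last one. *)
Definition is_svd (R : realType) (p q : nat) (A : 'M[R]_(p, q))
    (U : 'M[R]_p) (s : nat -> R) (W : 'M[R]_q) : Prop :=
  [/\ orthonormal_cols U,
      orthonormal_cols W,
      forall i : nat, 0 <= s i.+1 <= s i,
      forall i : nat, (minn p q <= i)%N -> s i = 0 &
      A = U *m (\matrix_(i < p, j < q) (s i *+ (i == j :> nat))) *m W^T].

(* The (i+1)-th largest singular value of A. *)
Definition singular_value (R : realType) (p q : nat) (A : 'M[R]_(p, q))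
    (i : nat) : R :=
  xget 0 [set x | exists U s W, is_svd A U s W /\ x = s i].

(* Not unique when the r-th and the (r+1)-th singular values coincide. *)
Definition top_left_singular_vectors (R : realType) (p q r : nat)
    (A : 'M[R]_(p, q)) (V : 'M[R]_(p, r)) : Prop :=
  exists U s W (le_rp : (r <= p)%N),
    is_svd A U s W /\ V = colsub (widen_ord le_rp) U.

(* T0 is a value of HOSVD_r(X), for some choice of the singular vectors. *)
Definition is_hosvd (R : realType) (m : nat) (d r : 'I_m -> nat)
    (X T0 : tensor R d) : Prop :=
  exists V : forall k : 'I_m, 'M[R]_(d k, r k),
    (forall k : 'I_m, top_left_singular_vectors (matricize k X) (V k)) /\
    T0 = multilinear_prod X (fun k => V k *m (V k)^T).

Definition lambda_min (R : realType) (m : nat) (d r : 'I_m -> nat)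
    (T : tensor R d) : R :=
  inf (range (fun k : 'I_m => singular_value (matricize k T) (r k).-1)).

Definition lambda_max (R : realType) (m : nat) (d : 'I_m -> nat)
    (T : tensor R d) : R :=
  sup (range (fun k : 'I_m => singular_value (matricize k T) 0)).

Definition frobenius_norm (R : realType) (m : nat) (d : 'I_m -> nat)
    (T : tensor R d) : R :=
  Num.sqrt (\sum_(w : tidx d) T w ^+ 2).

Definition max_norm (R : realType) (m : nat) (d : 'I_m -> nat)
    (T : tensor R d) : R :=
  \big[Num.max/0]_(w : tidx d) `|T w|.

Definition truncate (R : realType) (m : nat) (d : 'I_m -> nat) (tau : R)
    (T : tensor R d) : tensor R d :=
  [ffun w => if `|T w| <= tau then T w else tau * Num.sg (T w)].

(* For a finite family, the product rule over the whole index set yields the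
   product rule over every subfamily, by taking A i = setT. *)
Definition mutually_independent (R : realType) (disp : measure_display)
    (Omega : measurableType disp) (P : probability Omega R) (I : finType)
    (X : I -> {RV P >-> R}) : Prop :=
  forall A : I -> set R, (forall i, measurable (A i)) ->
    P [set o | forall i, A i (X i o)] = (\prod_(i : I) P (X i @^-1` A i))%E.

Definition identically_distributed (R : realType) (disp : measure_display)
    (Omega : measurableType disp) (P : probability Omega R)
    (X Y : {RV P >-> R}) : Prop :=
  forall A : set R, measurable A -> distribution P X A = distribution P Y A.

(* X ~ (1 - alpha) delta_0 + alpha Q *)
Definition contaminated (R : realType) (disp : measure_display)
    (Omega : measurableType disp) (P : probability Omega R) (alpha : R)
    (Q : probability (measurableTypeR R) R) (X : {RV P >-> R}) : Prop :=
  forall A : set R, measurable A ->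
    distribution P X A =
      ((1 - alpha)%:E * \d_(0%R : R) A + alpha%:E * Q A)%E.

Definition norm_L4 (R : realType) (disp : measure_display)
    (Omega : measurableType disp) (P : probability Omega R)
    (xi : {RV P >-> R}) : R :=
  fine ('N[P]_(4%:R%:E) [EFin \o xi])%E.

(* Main.v *)
(* Unless the probability bound is vacuous, the number N of entries is large and
   2 alpha d_k >= log N for every k. Rounding the entries of the noise and of
   the corruptions reduces everything to a finite product space, up to an
   arbitrarily small error, where the truncated noise tensor E has bounded
   independent entries, of small mean and of nearly constant variance v.

   For m >= 3, X X^T - D v I - M M^T, with X = M + E the matricization in mode k
   and D its number of columns, is small in operator norm: E E^T - D v I has a
   small diagonal, and the trace moments of its off-diagonal part are bounded by
   exchangeable pairs. The eigenvectors V of X X^T are compared with the factor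
   U of M by the Neumann series of the eigenvector equation; its rows are
   controlled by leave-one-out, since the iterates H^p U computed without row i
   of E are independent of that row. For m = 2, where X need not have more columns than
   rows, the dilation [0, X; X^T, 0] replaces X X^T in this last step.

   The norm of E against rank-one tensors is split: the entries that are small
   and uncorrupted are subgaussian, and a union bound over a grid applies; the
   others are so rare that the Gram bound above, with their small variance,
   suffices. Telescoping the multilinear forms of T0 - T* mode by mode then gives
   both the Frobenius and the entrywise bounds. *)

(* The obstacle is the target level nu sqrt(d log d) + alpha tau sqrt N, with d the largest
   dimension and nu the fourth-moment norm of the noise: it contains log d only and no term tau log
   N, although a union bound over N entries of size tau costs both. The rate alpha p >= (log N) / 2,
   with p the smallest dimension, pays for the second: tau log N <= 2 alpha tau p <= 2 alpha tau
   sqrt N. The level tau >= 4 nu N^(1/8) pays for the logarithms that multiply nu: in squares it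
   leaves a spare factor N^(1/4).

   Small entries are those below nu alpha^(-1/4). By the fourth moment, the noise exceeds this with
   probability at most alpha, so large noise is as rare as corruption and both are treated alike.

   Gram matrices are compared rather than matricizations because a matricization with D columns
   carries noise of operator norm about nu sqrt D, which may exceed the signal. Most of it is the
   multiple D v I of the identity, which moves no eigenvector; what remains is of the order of the
   signal times the target level. *)
Require Import Defs.
From HB Require Import structures.
From mathcomp Require Import all_boot all_order all_algebra.
From mathcomp Require Import all_classical all_reals all_analysis.
From mathcomp Require Import measurable_realfun.
From mathcomp Require Import zify ring lra.

Set Implicit Arguments.
Unset Strict Implicit.
Unset Printing Implicit Defensive.

Import Order.TTheory GRing.Theory Num.Theory.

Local Open Scope classical_set_scope.
Local Open Scope ring_scope.

(** * Frobenius norm and operator bounds *)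

Ltac nonneg := repeat first
  [ exact: ler0n | done | assumption | by apply: ltW | exact: sqr_ge0 | exact: sqrtr_ge0 | exact: expR_ge0
  | exact: normr_ge0 | apply: addr_ge0 | apply: mulr_ge0 | apply: exprn_ge0
  | rewrite invr_ge0 ].

Ltac pos_tac := repeat first
  [ done | assumption | exact: expR_gt0 | apply: mulr_gt0 | apply: exprn_gt0
  | rewrite invr_gt0 | rewrite sqrtr_gt0 | rewrite ltr0n
  | apply: ltr_wpDr; [by nonneg|] | apply: ltr_wpDl; [by nonneg|] ].

Section FrobeniusNorm.
Variable R : realType.

Definition dotmx (p q : nat) (A B : 'M[R]_(p, q)) : R :=
  \sum_i \sum_j A i j * B i j.

(** The Frobenius norm. Vectors are rows throughout, with matrices acting from the right, and on a
    row this is the Euclidean norm. *)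
Definition fn (p q : nat) (A : 'M[R]_(p, q)) : R := Num.sqrt (dotmx A A).

Lemma dotmxE p q (A B : 'M[R]_(p, q)) : dotmx A B = \tr (A *m B^T).
Proof.
rewrite /mxtrace; apply: eq_bigr => i _; rewrite mxE.
by apply: eq_bigr => j _; rewrite mxE.
Qed.

Lemma dotmxC p q (A B : 'M[R]_(p, q)) : dotmx A B = dotmx B A.
Proof. by apply: eq_bigr => i _; apply: eq_bigr => j _; rewrite mulrC. Qed.

Lemma dotmxDl p q (A B C : 'M[R]_(p, q)) :
  dotmx (A + B) C = dotmx A C + dotmx B C.
Proof. by rewrite !dotmxE mulmxDl mxtraceD. Qed.

Lemma dotmxZl p q (a : R) (A B : 'M[R]_(p, q)) : dotmx (a *: A) B = a * dotmx A B.
Proof. by rewrite !dotmxE -scalemxAl mxtraceZ. Qed.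

Lemma dotmxDr p q (A B C : 'M[R]_(p, q)) :
  dotmx C (A + B) = dotmx C A + dotmx C B.
Proof. by rewrite dotmxC dotmxDl !(dotmxC C). Qed.

Lemma dotmxZr p q (a : R) (A B : 'M[R]_(p, q)) : dotmx A (a *: B) = a * dotmx A B.
Proof. by rewrite dotmxC dotmxZl dotmxC. Qed.

Lemma dotmxNl p q (A B : 'M[R]_(p, q)) : dotmx (- A) B = - dotmx A B.
Proof. by rewrite -scaleN1r dotmxZl mulN1r. Qed.

Lemma dotmxNr p q (A B : 'M[R]_(p, q)) : dotmx A (- B) = - dotmx A B.
Proof. by rewrite dotmxC dotmxNl dotmxC. Qed.

Lemma dotmx0l p q (B : 'M[R]_(p, q)) : dotmx 0 B = 0.
Proof. by rewrite -(scale0r 0) dotmxZl mul0r. Qed.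

Lemma dotmx_ge0 p q (A : 'M[R]_(p, q)) : 0 <= dotmx A A.
Proof. by rewrite sumr_ge0 // => i _; rewrite sumr_ge0 // => j _; rewrite -expr2 sqr_ge0. Qed.

Lemma dotmx_trmx p q (A B : 'M[R]_(p, q)) : dotmx A^T B^T = dotmx A B.
Proof.
rewrite /dotmx exchange_big; apply: eq_bigr => i _; apply: eq_bigr => j _.
by rewrite !mxE.
Qed.

Lemma dotmx_mulr p q s (A : 'M[R]_(p, q)) (B : 'M[R]_(q, s)) (C : 'M[R]_(p, s)) :
  dotmx (A *m B) C = dotmx A (C *m B^T).
Proof. by rewrite !dotmxE trmx_mul trmxK mulmxA. Qed.

Lemma dotmx_mull p q s (A : 'M[R]_(p, q)) (B : 'M[R]_(q, s)) (C : 'M[R]_(p, s)) :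
  dotmx (A *m B) C = dotmx B (A^T *m C).
Proof. by rewrite -dotmx_trmx trmx_mul dotmx_mulr trmxK -dotmx_trmx trmxK trmx_mul !trmxK. Qed.

Lemma dotmx_eq0 p q (A : 'M[R]_(p, q)) : dotmx A A = 0 -> A = 0.
Proof.
move=> /eqP; rewrite psumr_eq0; last first.
  by move=> i _; rewrite sumr_ge0 // => j _; rewrite -expr2 sqr_ge0.
move=> /allP A0; apply/matrixP => i j; rewrite mxE.
have := A0 i (mem_index_enum _); rewrite /= psumr_eq0; last first.
  by move=> k _; rewrite -expr2 sqr_ge0.
by move=> /allP /(_ j (mem_index_enum _)); rewrite /= -expr2 sqrf_eq0 => /eqP.
Qed.

Lemma fn_ge0 p q (A : 'M[R]_(p, q)) : 0 <= fn A.
Proof. exact: sqrtr_ge0. Qed.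

Lemma fn_sqr p q (A : 'M[R]_(p, q)) : fn A ^+ 2 = dotmx A A.
Proof. by rewrite sqr_sqrtr // dotmx_ge0. Qed.

Lemma fn_eq0 p q (A : 'M[R]_(p, q)) : fn A = 0 -> A = 0.
Proof. by move=> A0; apply: dotmx_eq0; rewrite -fn_sqr A0 expr0n. Qed.

Lemma fn0 p q : fn (0 : 'M[R]_(p, q)) = 0.
Proof. by rewrite /fn dotmx0l sqrtr0. Qed.

Lemma fn_tr p q (A : 'M[R]_(p, q)) : fn A^T = fn A.
Proof. by rewrite /fn dotmx_trmx. Qed.

Lemma fnZ p q (a : R) (A : 'M[R]_(p, q)) : fn (a *: A) = `|a| * fn A.
Proof.
rewrite /fn dotmxZl dotmxZr mulrA -expr2 sqrtrM ?sqr_ge0 //.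
by rewrite sqrtr_sqr.
Qed.

Lemma fnN p q (A : 'M[R]_(p, q)) : fn (- A) = fn A.
Proof. by rewrite /fn dotmxNl dotmxNr opprK. Qed.

(** Expand the square of [fn B *: A - fn A *: B], which vanishes for parallel A and B; what remains
    is a positive multiple of the gap. *)
Lemma cauchy_schwarz p q (A B : 'M[R]_(p, q)) : dotmx A B <= fn A * fn B.
Proof.
have [A0|A0] := eqVneq (fn A) 0.
  by rewrite (fn_eq0 A0) dotmx0l fn0 mul0r.
have [B0|B0] := eqVneq (fn B) 0.
  by rewrite (fn_eq0 B0) dotmxC dotmx0l fn0 mulr0.
have Ap : 0 < fn A by rewrite lt_neqAle eq_sym A0 fn_ge0.
have Bp : 0 < fn B by rewrite lt_neqAle eq_sym B0 fn_ge0.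
have := dotmx_ge0 (fn B *: A - fn A *: B).
rewrite !(dotmxDl, dotmxDr, dotmxZl, dotmxZr, dotmxNl, dotmxNr).
rewrite (dotmxC B A) -!fn_sqr => h.
have : 0 <= 2 * (fn A * fn B) * (fn A * fn B - dotmx A B) by nra.
by rewrite pmulr_rge0 ?subr_ge0 // ?mulr_gt0.
Qed.

Lemma cauchy_schwarz_norm p q (A B : 'M[R]_(p, q)) : `|dotmx A B| <= fn A * fn B.
Proof.
rewrite ler_norml cauchy_schwarz andbT lerNl -dotmxNl.
by rewrite -(fnN A) cauchy_schwarz.
Qed.

Lemma fnD p q (A B : 'M[R]_(p, q)) : fn (A + B) <= fn A + fn B.
Proof.
rewrite -(@ler_pXn2r _ 2) ?nnegrE ?addr_ge0 ?fn_ge0 // sqrrD !fn_sqr.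
rewrite dotmxDl !dotmxDr (dotmxC B A).
have := cauchy_schwarz A B; lra.
Qed.

Lemma fnB p q (A B : 'M[R]_(p, q)) : fn (A - B) <= fn A + fn B.
Proof. by rewrite -(fnN B) fnD. Qed.

Lemma fn_sqr_rows p q (A : 'M[R]_(p, q)) : fn A ^+ 2 = \sum_i fn (row i A) ^+ 2.
Proof.
rewrite fn_sqr; apply: eq_bigr => i _; rewrite fn_sqr /dotmx big_ord1.
by apply: eq_bigr => j _; rewrite !mxE.
Qed.

Lemma fn_row_le p q (A : 'M[R]_(p, q)) i : fn (row i A) <= fn A.
Proof.
rewrite -(@ler_pXn2r _ 2) ?nnegrE ?fn_ge0 // (fn_sqr_rows A) (bigD1 i) //=.
by rewrite lerDl sumr_ge0 // => j _; rewrite sqr_ge0.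
Qed.

Lemma fn_entry_le p q (A : 'M[R]_(p, q)) i j : `|A i j| <= fn A.
Proof.
apply: le_trans (fn_row_le A i).
rewrite -(@ler_pXn2r _ 2) ?nnegrE ?fn_ge0 // real_normK ?num_real // fn_sqr.
rewrite /dotmx big_ord1 (bigD1 j) //= !mxE -expr2.
by rewrite lerDl sumr_ge0 // => k _; rewrite -expr2 sqr_ge0.
Qed.

Lemma fn_le_sqr p q (A : 'M[R]_(p, q)) (g : R) :
  0 <= g -> fn A ^+ 2 <= g ^+ 2 -> fn A <= g.
Proof. by move=> g0; rewrite ler_pXn2r ?nnegrE ?fn_ge0. Qed.

(** Operator norm at most g, as a predicate: it passes through sums, products and transposes without
    handling a supremum. *)
Definition opb (p q : nat) (g : R) (A : 'M[R]_(p, q)) : Prop :=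
  forall x : 'rV[R]_p, fn (x *m A) <= g * fn x.

Lemma fn_mulmx_opb s p q g (B : 'M[R]_(s, p)) (A : 'M[R]_(p, q)) :
  0 <= g -> opb g A -> fn (B *m A) <= g * fn B.
Proof.
move=> g0 Ag; apply: fn_le_sqr; first by rewrite mulr_ge0 ?fn_ge0.
rewrite exprMn !fn_sqr_rows mulr_sumr; apply: ler_sum => i _.
by rewrite row_mul -exprMn ler_pXn2r ?nnegrE ?mulr_ge0 ?fn_ge0.
Qed.

(** The square of [fn (x *m A^T)] is the product of x with x A^T A, hence at most
    [fn x * (g * fn (x *m A^T))]; divide by [fn (x *m A^T)]. *)
Lemma opb_tr p q g (A : 'M[R]_(p, q)) : 0 <= g -> opb g A -> opb g A^T.
Proof.
move=> g0 Ag x; have [->|x0] := eqVneq (fn (x *m A^T)) 0.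
  by rewrite mulr_ge0 ?fn_ge0.
have xp : 0 < fn (x *m A^T) by rewrite lt_neqAle eq_sym x0 fn_ge0.
rewrite -(ler_pM2r xp) -expr2 fn_sqr {1}dotmx_mulr trmxK.
apply: (le_trans (cauchy_schwarz _ _)).
by rewrite -mulrA mulrCA ler_wpM2l ?fn_ge0.
Qed.

Lemma fn_opb_mulmx p q s g (A : 'M[R]_(p, q)) (B : 'M[R]_(q, s)) :
  0 <= g -> opb g A -> fn (A *m B) <= g * fn B.
Proof.
move=> g0 Ag; rewrite -fn_tr trmx_mul -(fn_tr B).
by apply: fn_mulmx_opb => //; apply: opb_tr.
Qed.

Lemma opb_fn p q (A : 'M[R]_(p, q)) : opb (fn A) A.
Proof.
move=> x; apply: fn_le_sqr; first by rewrite mulr_ge0 ?fn_ge0.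
rewrite exprMn -(fn_tr A) (fn_sqr_rows A^T) fn_sqr {1}/dotmx big_ord1 mulr_suml.
apply: ler_sum => j _; rewrite -expr2.
have -> : (x *m A) 0 j = dotmx (row j A^T) x.
  rewrite mxE /dotmx big_ord1; apply: eq_bigr => k _.
  by rewrite !mxE mulrC.
by rewrite -exprMn -real_normK ?num_real // ler_pXn2r ?nnegrE ?mulr_ge0 ?fn_ge0 //
   cauchy_schwarz_norm.
Qed.

Lemma fn_mulmx p q s (A : 'M[R]_(p, q)) (B : 'M[R]_(q, s)) : fn (A *m B) <= fn A * fn B.
Proof. by rewrite mulrC; apply: fn_mulmx_opb (fn_ge0 _) (opb_fn B). Qed.

Lemma opb_le p q g h (A : 'M[R]_(p, q)) : g <= h -> opb g A -> opb h A.
Proof. by move=> gh Ag x; apply: (le_trans (Ag x)); rewrite ler_wpM2r ?fn_ge0. Qed.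

Lemma opbD p q g h (A B : 'M[R]_(p, q)) : opb g A -> opb h B -> opb (g + h) (A + B).
Proof.
by move=> Ag Bh x; rewrite mulmxDr mulrDl (le_trans (fnD _ _)) // lerD.
Qed.

Lemma opbN p q g (A : 'M[R]_(p, q)) : opb g A -> opb g (- A).
Proof. by move=> Ag x; rewrite mulmxN fnN. Qed.

Lemma opbB p q g h (A B : 'M[R]_(p, q)) : opb g A -> opb h B -> opb (g + h) (A - B).
Proof. by move=> Ag Bh; apply: opbD => //; apply: opbN. Qed.

Lemma opbM p q s g h (A : 'M[R]_(p, q)) (B : 'M[R]_(q, s)) :
  0 <= h -> opb g A -> opb h B -> opb (g * h) (A *m B).
Proof.
move=> h0 Ag Bh x; rewrite mulmxA (le_trans (Bh _)) // mulrAC [g * _ * _]mulrC.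
by rewrite ler_wpM2l.
Qed.

Lemma opb1 p : opb 1 (1%:M : 'M[R]_p).
Proof. by move=> x; rewrite mulmx1 mul1r. Qed.

Lemma opb0 p q : opb 0 (0 : 'M[R]_(p, q)).
Proof. by move=> x; rewrite mulmx0 fn0 mul0r. Qed.

Lemma opb_row p q g (A : 'M[R]_(p, q)) i : opb g A -> fn (row i A) <= g.
Proof.
move=> Ag; have := Ag (delta_mx 0 i); rewrite -rowE.
suff -> : fn (delta_mx 0 i : 'rV[R]_p) = 1 by rewrite mulr1.
rewrite /fn /dotmx big_ord1 (bigD1 i) //= big1 => [|j ji]; rewrite !mxE !eqxx /=.
  by rewrite mulr1 addr0 sqrtr1.
by rewrite (negbTE ji) mul0r.
Qed.

Lemma fn_mulmxT p q s (U : 'M[R]_(p, q)) (x : 'M[R]_(s, q)) :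
  orthonormal_cols U -> fn (x *m U^T) = fn x.
Proof. by move=> U1; rewrite /fn dotmx_mulr trmxK -mulmxA U1 mulmx1. Qed.

Lemma opb_orthonormalT p q (U : 'M[R]_(p, q)) : orthonormal_cols U -> opb 1 U^T.
Proof. by move=> U1 x; rewrite fn_mulmxT // mul1r. Qed.

Lemma opb_orthonormal p q (U : 'M[R]_(p, q)) : orthonormal_cols U -> opb 1 U.
Proof.
move=> U1; rewrite -[U]trmxK; apply: opb_tr; first exact: ler01.
exact: opb_orthonormalT.
Qed.

Lemma fn_orthonormal p q (U : 'M[R]_(p, q)) :
  orthonormal_cols U -> fn U = Num.sqrt q%:R.
Proof. by move=> U1; rewrite -fn_tr /fn dotmxE trmxK U1 mxtrace1. Qed.

End FrobeniusNorm.

(** * Singular value decomposition *)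

Section SingularValueDecomposition.
Import numFieldNormedType.Exports.
Variable R : realType.

Lemma continuous_big_add (T : topologicalType) (I : Type) (s : seq I)
    (F : I -> T -> R) :
  (forall i, continuous (F i)) -> continuous (fun x => \sum_(i <- s) F i x).
Proof.
move=> Fc; elim: s => [|i s IH] x.
  under eq_fun do rewrite big_nil; exact: cvg_cst.
under eq_fun do rewrite big_cons; by apply: continuousD; [exact: Fc|exact: IH].
Qed.

Lemma continuous_dotmx (p q : nat) (M N : 'M[R]_(p, q)) :
  continuous (fun x : 'rV[R]_p => dotmx (x *m M) (x *m N)).
Proof.
have lin (L : 'M[R]_(p, q)) j : continuous (fun x : 'rV[R]_p => (x *m L) 0 j).
  under eq_fun do rewrite mxE.
  apply: continuous_big_add => k x.
  apply: (@continuousM R _ (fun x : 'rV[R]_p => x 0 k) (fun=> L k j)).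
    exact: coord_continuous.
  exact: cst_continuous.
apply: continuous_big_add => i; rewrite (ord1 i).
apply: continuous_big_add => j x.
exact: (@continuousM R _ (fun x : 'rV[R]_p => (x *m M) 0 j) _ x (lin M j x) (lin N j x)).
Qed.

(** The unit sphere is compact, so the quadratic form of M M^T has a maximizer on it; homogeneity
    extends the bound to all vectors. *)
Lemma opb_attained (p q : nat) (M : 'M[R]_(p.+1, q)) :
  exists u : 'rV[R]_p.+1, fn u = 1 /\ opb (fn (u *m M)) M.
Proof.
(* The factors [1%:M] present the sphere as a level set of a function covered by
   [continuous_dotmx]. *)
pose S : set 'rV[R]_p.+1 := [set x | dotmx (x *m 1%:M) (x *m 1%:M) = 1].
pose f (x : 'rV[R]_p.+1) := dotmx (x *m M) (x *m M).
have e0S : S (delta_mx 0 0).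
  rewrite /S /= mulmx1 dotmxE trmx_delta mul_delta_mx.
  by rewrite /mxtrace big_ord1 mxE.
have Scl : closed S.
  have -> : S = (fun x : 'rV[R]_p.+1 => dotmx (x *m 1%:M) (x *m 1%:M)) @^-1` [set 1].
    by [].
  apply: closed_comp; last exact: closed_eq.
  by move=> x _; exact: continuous_dotmx.
have Sbd : bounded_set S.
  exists 1; split; first exact: num_real.
  move=> y y1 x Sx /=; rewrite [leLHS]/Num.Def.normr /= mx_normrE.
  apply/bigmax_leP; split => [|ij _ /=]; first by rewrite (le_trans ler01) // ltW.
  apply: (le_trans (fn_entry_le x _ _)).
  by rewrite /fn -(mulmx1 x) Sx sqrtr1 ltW.
have Scp := bounded_closed_compact Sbd Scl.
have [u uS umax] := @compact_EVT_max _ R f S (ex_intro _ _ e0S) Scp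
  (continuous_subspaceT (@continuous_dotmx _ _ M M)).
have u1 : fn u = 1.
  by move: uS; rewrite inE /S /= mulmx1 /fn => ->; rewrite sqrtr1.
exists u; split => // x.
have [x0|x0] := eqVneq (fn x) 0.
  by rewrite (fn_eq0 x0) mul0mx !fn0 mulr0.
have xp : 0 < fn x by rewrite lt_neqAle eq_sym x0 fn_ge0.
pose y := (fn x)^-1 *: x.
have yS : y \in S.
  rewrite inE /S /= mulmx1 -fn_sqr fnZ ger0_norm ?invr_ge0 ?fn_ge0 //.
  by rewrite mulVf // expr1n.
have := umax y yS; rewrite /f -!fn_sqr ler_pXn2r ?nnegrE ?fn_ge0 //.
rewrite -scalemxAl fnZ ger0_norm ?invr_ge0 ?fn_ge0 //.
by rewrite ler_pdivrMl // mulrC.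
Qed.

(** The reflection along w = e0 - u exchanges the unit vectors e0 and u; it is symmetric and its own
    inverse. *)
Lemma householder (p : nat) (u : 'rV[R]_p.+1) :
  fn u = 1 -> exists Q : 'M[R]_p.+1, Q *m Q^T = 1%:M /\ row 0 Q = u.
Proof.
move=> u1; pose e0 : 'rV[R]_p.+1 := delta_mx 0 0; pose w := e0 - u.
have [w0|w0] := eqVneq (dotmx w w) 0.
  exists 1%:M; split; first by rewrite trmx1 mulmx1.
  have /eqP := dotmx_eq0 w0; rewrite subr_eq0 => /eqP <-.
  by rewrite row1.
have wwT : w *m w^T = (dotmx w w)%:M.
  apply/matrixP => i j; rewrite !ord1 [RHS]mxE eqxx mulr1n.
  by rewrite dotmxE /mxtrace big_ord1.
pose Q : 'M[R]_p.+1 := 1%:M - (2 / dotmx w w) *: (w^T *m w).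
have QT : Q^T = Q by rewrite /Q linearB /= trmx1 linearZ /= trmx_mul trmxK.
have ww : (w^T *m w) *m (w^T *m w) = dotmx w w *: (w^T *m w).
  by rewrite mulmxA -(mulmxA w^T) wwT mul_mx_scalar -scalemxAl.
exists Q; split.
  rewrite QT /Q; set G := _ *: _.
  have GG : G *m G = G + G.
    rewrite /G -scalemxAl -scalemxAr ww !scalerA -scalerDl; congr (_ *: _).
    by field.
  by rewrite mulmxBl mul1mx mulmxBr mulmx1 GG opprB addrK subrK.
have e0u : dotmx w w = 2 * dotmx e0 w.
  have e01 : dotmx e0 e0 = 1.
    by rewrite dotmxE trmx_delta mul_delta_mx /mxtrace big_ord1 mxE.
  have uu : dotmx u u = 1 by rewrite -fn_sqr u1 expr1n.
  rewrite /w !(dotmxDl, dotmxDr, dotmxNl, dotmxNr) e01 uu (dotmxC u e0); ring.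
have e0wT : e0 *m w^T = (dotmx e0 w)%:M.
  apply/matrixP => i j; rewrite !ord1 [RHS]mxE eqxx mulr1n.
  by rewrite dotmxE /mxtrace big_ord1.
rewrite rowE -/e0 /Q mulmxBr mulmx1 -scalemxAr mulmxA e0wT mul_scalar_mx scalerA.
have -> : 2 / dotmx w w * dotmx e0 w = 1.
  by rewrite e0u; field; move: w0; rewrite e0u mulf_eq0 negb_or => /andP[].
by rewrite scale1r /w opprB addrC subrK.
Qed.

(** First-order condition at a maximizer: along u + t w the image gains a term linear in t, which
    must vanish, while the constraint changes only at order t^2. *)
Lemma opb_attained_orth (p q : nat) (M : 'M[R]_(p, q)) (u w : 'rV[R]_p) :
  opb (fn (u *m M)) M -> fn u = 1 -> dotmx u w = 0 -> dotmx (u *m M) (w *m M) = 0.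
Proof.
move=> uM u1 uw; apply/eqP; rewrite -[_ == _]negbK; apply/negP => b0.
set b := dotmx _ _ in b0.
have key t : 2 * t * b + t ^+ 2 * dotmx (w *m M) (w *m M)
             <= dotmx (u *m M) (u *m M) * (t ^+ 2 * dotmx w w).
  have := uM (u + t *: w).
  rewrite -(@ler_pXn2r _ 2) ?nnegrE ?mulr_ge0 ?fn_ge0 // exprMn !fn_sqr.
  rewrite mulmxDl -scalemxAl !(dotmxDl, dotmxDr, dotmxZl, dotmxZr).
  rewrite (dotmxC w u) uw (dotmxC (w *m M) (u *m M)) -/b.
  rewrite -(fn_sqr u) u1 expr1n; nra.
pose c := dotmx (u *m M) (u *m M) * dotmx w w.
have c0 : 0 <= c by rewrite mulr_ge0 ?dotmx_ge0.
have wM0 := dotmx_ge0 (w *m M).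
(* This t is small enough for the linear term to win; c + 1 rather than c keeps the denominator
   positive. *)
have := key (b / (c + 1)).
rewrite [leRHS]mulrCA -/c => h.
have c1 : 0 < c + 1 by lra.
have bp : 0 < b ^+ 2 by rewrite exprn_even_gt0.
have : 2 * (b / (c + 1)) * b <= (b / (c + 1)) ^+ 2 * c.
  apply: le_trans h; rewrite lerDl mulr_ge0 ?sqr_ge0 //.
rewrite expr_div_n -(ler_pM2r (exprn_gt0 2 c1)).
have -> : 2 * (b / (c + 1)) * b * (c + 1) ^+ 2 = 2 * b ^+ 2 * (c + 1).
  by field; rewrite gt_eqF.
have -> : b ^+ 2 / (c + 1) ^+ 2 * c * (c + 1) ^+ 2 = b ^+ 2 * c.
  by field; rewrite gt_eqF.
nra.
Qed.

Lemma orthonormal_square (p : nat) (U : 'M[R]_p) :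
  orthonormal_cols U -> U *m U^T = 1%:M.
Proof. exact: mulmx1C. Qed.

(** Complete u and the normalized image v of u to orthogonal matrices. The first row is s v,
    orthogonal to the other rows of Z; the first column vanishes below the corner by
    [opb_attained_orth]. *)
Lemma svd_deflate (p q : nat) (A : 'M[R]_(p.+1, q.+1)) (u : 'rV[R]_p.+1) :
  fn u = 1 -> opb (fn (u *m A)) A -> fn (u *m A) != 0 ->
  exists (Q : 'M[R]_(1 + p)) (Z : 'M[R]_(1 + q)) (B : 'M[R]_(p, q)),
    [/\ Q *m Q^T = 1%:M, Z *m Z^T = 1%:M &
       Q *m A *m Z^T = block_mx (fn (u *m A))%:M 0 0 B].
Proof.
move=> u1 uA; set s := fn _ in uA * => s0.
have sp : 0 < s by rewrite lt_neqAle eq_sym s0 fn_ge0.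
pose v := s^-1 *: (u *m A).
have v1 : fn v = 1 by rewrite fnZ ger0_norm ?invr_ge0 ?fn_ge0 // -/s mulVf.
have [Q [QQ Qu]] := householder u1; have [Z [ZZ Zv]] := householder v1.
exists Q, Z, (drsubmx (Q *m A *m Z^T : 'M[R]_(1 + p, 1 + q))); split => //.
rewrite -[LHS](@submxK _ 1 p 1 q); set C : 'M[R]_(1 + p, 1 + q) := Q *m A *m Z^T.
have CE i j : C i j = dotmx (row i Q *m A) (row j Z).
  rewrite -row_mul /dotmx big_ord1 /C mxE.
  apply: eq_bigr => k _; rewrite [(row i (Q *m A)) 0 k]mxE [(row j Z) 0 k]mxE.
  by rewrite [Z^T k j]mxE.
have uAv : u *m A = s *: v by rewrite scalerA divff // scale1r.
have C0j j : C 0 j = s * (j == 0)%:R.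
  rewrite CE Qu uAv dotmxZl -Zv; congr (_ * _).
  rewrite dotmxE /mxtrace big_ord1.
  have /matrixP /(_ 0 j) := ZZ; rewrite !mxE => h.
  by rewrite eq_sym -h; apply: eq_bigr => k _; rewrite !mxE.
have Ci0 (i : 'I_p) : C (lift 0 i) 0 = 0.
  rewrite CE Zv dotmxZr dotmxC (opb_attained_orth uA u1) ?mulr0 //.
  rewrite -Qu dotmxE /mxtrace big_ord1.
  have /matrixP /(_ 0 (lift 0 i)) := QQ; rewrite !mxE => h.
  rewrite [RHS](_ : 0 = (0 == lift 0 i)%:R) //.
  by rewrite -h; apply: eq_bigr => k _; rewrite !mxE.
congr block_mx.
- apply/matrixP => i j; rewrite !ord1 [LHS]mxE [LHS]mxE [RHS]mxE eqxx mulr1n.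
  have -> : lshift p 0 = 0 :> 'I_(1 + p) by apply/val_inj.
  have -> : lshift q 0 = 0 :> 'I_(1 + q) by apply/val_inj.
  by rewrite C0j eqxx mulr1.
- apply/matrixP => i j; rewrite !ord1 [LHS]mxE [LHS]mxE [RHS]mxE.
  have -> : lshift p 0 = 0 :> 'I_(1 + p) by apply/val_inj.
  by rewrite C0j (_ : (_ == 0) = false) ?mulr0.
- apply/matrixP => i j; rewrite !ord1 [LHS]mxE [LHS]mxE [RHS]mxE.
  have -> : lshift q 0 = 0 :> 'I_(1 + q) by apply/val_inj.
  have -> : rshift 1 i = lift 0 i :> 'I_(1 + p) by apply/val_inj; rewrite /= /bump leq0n.
  exact: Ci0.
Qed.

Lemma is_svd0 (p q : nat) : is_svd (0 : 'M[R]_(p, q)) 1%:M (fun=> 0) 1%:M.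
Proof.
split => //; rewrite ?/orthonormal_cols ?trmx1 ?mulmx1 //.
  by move=> i; rewrite lexx.
by apply/matrixP => i j; rewrite mul1mx !mxE mul0rn.
Qed.

Lemma svd_row_norm (p q : nat) (A : 'M[R]_(p, q)) U s W i :
  is_svd A U s W -> fn (row i (U^T *m A)) = s i.
Proof.
case=> U1 W1 smono s0 ->.
rewrite !mulmxA U1 mul1mx row_mul fn_mulmxT //.
rewrite /fn /dotmx big_ord1.
have si0 : 0 <= s i by have /andP[h1 h2] := smono i; exact: le_trans h2.
have [ltq|leq] := ltnP i q; last first.
  rewrite big1 => [|j _]; last first.
    by rewrite !mxE (gtn_eqF (leq_trans (ltn_ord j) leq)) mulr0n mul0r.
  by rewrite sqrtr0 s0 // geq_min leq orbT.
rewrite (bigD1 (Ordinal ltq)) //= !mxE eqxx mulr1n big1 => [|j /eqP jn].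
  by rewrite addr0 -expr2 sqrtr_sqr ger0_norm.
rewrite !mxE; case: eqP => [ij|_]; last by rewrite mulr0n mul0r.
by case: jn; apply: val_inj.
Qed.

Lemma orthonormal_block1 (p : nat) (U : 'M[R]_p) : orthonormal_cols U ->
  (block_mx 1%:M 0 0 U)^T *m block_mx 1%:M 0 0 U = 1%:M :> 'M[R]_(1 + p).
Proof.
move=> oU; rewrite tr_block_mx !trmx0 trmx1 mulmx_block.
by rewrite !(mulmx0, mul0mx, mulmx1) !(addr0, add0r) oU -scalar_mx_block.
Qed.

Lemma svd_exists (p q : nat) (A : 'M[R]_(p, q)) : exists U s W, is_svd A U s W.
Proof.
elim: p q A => [|p IH] q A.
  exists 1%:M, (fun=> 0), 1%:M; have -> : A = 0 by apply/matrixP => -[].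
  exact: is_svd0.
case: q A => [|q] A.
  exists 1%:M, (fun=> 0), 1%:M; have -> : A = 0 by apply/matrixP => i [].
  exact: is_svd0.
have [u [u1 uA]] := opb_attained A.
have [s0|s0] := eqVneq (fn (u *m A)) 0.
  exists 1%:M, (fun=> 0), 1%:M; suff -> : A = 0 by exact: is_svd0.
  apply/row_matrixP => i; rewrite row0 rowE; apply: fn_eq0.
  apply/eqP; rewrite eq_le fn_ge0 andbT.
  by have := uA (delta_mx 0 i); rewrite s0 mul0r.
have [Q [Z [B [QQ ZZ QAZ]]]] := svd_deflate u1 uA s0.
set sg := fn (u *m A) in uA s0 QAZ.
have [U [s [W Bsvd]]] := IH q B.
have QtQ : Q^T *m Q = 1%:M by exact: mulmx1C.
have ZtZ : Z^T *m Z = 1%:M by exact: mulmx1C.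
(* The deflated block inherits the bound sg, so its singular values do not exceed the one split off
   and the sequence stays sorted. *)
have BU : opb sg B.
  move=> x; pose y : 'rV[R]_(1 + p) := row_mx 0 x.
  have -> : fn x = fn (y *m Q).
    rewrite -[Q]trmxK fn_mulmxT; last by rewrite /orthonormal_cols trmxK.
    rewrite /fn /dotmx !big_ord1 /= (@big_split_ord _ _ _ 1 p) /= big_ord1.
    rewrite row_mxEl mxE mulr0 add0r; congr Num.sqrt.
    by apply: eq_bigr => j _; rewrite row_mxEr.
  apply: le_trans (uA _); rewrite -(fn_mulmxT _ ZtZ).
  rewrite -!mulmxA [Q *m _]mulmxA QAZ mul_row_block !mul0mx mulmx0 !add0r.
  rewrite /fn /dotmx !big_ord1 (@big_split_ord _ _ _ 1 q) /= big_ord1.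
  rewrite row_mxEl mxE mulr0 add0r le_eqVlt; apply/orP; left; apply/eqP.
  congr Num.sqrt.
  by apply: eq_bigr => j _; rewrite row_mxEr.
have s'0 : s 0%N <= sg.
  have [p0|p0] := posnP p.
    have -> : s 0%N = 0 by case: Bsvd => _ _ _ h _; apply: h; rewrite p0 min0n.
    exact: fn_ge0.
  rewrite -(svd_row_norm (Ordinal p0) Bsvd) row_mul.
  apply: (le_trans (BU _)); rewrite -[leRHS]mulr1 ler_wpM2l ?fn_ge0 //.
  apply: opb_row; apply: opb_orthonormalT; by case: Bsvd.
pose U1 : 'M[R]_(1 + p) := block_mx 1%:M 0 0 U.
pose W1 : 'M[R]_(1 + q) := block_mx 1%:M 0 0 W.
pose s1 (i : nat) := if i is j.+1 then s j else sg.
case: Bsvd => oU oW smono sz BE.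
exists (Q^T *m U1), s1, (Z^T *m W1); split.
- rewrite /orthonormal_cols trmx_mul trmxK -mulmxA (mulmxA Q) QQ mul1mx.
  exact: orthonormal_block1.
- rewrite /orthonormal_cols trmx_mul trmxK -mulmxA (mulmxA Z) ZZ mul1mx.
  exact: orthonormal_block1.
- case=> [|i] /=; last exact: smono.
  by rewrite s'0 andbT; have /andP[h1 h2] := smono 0%N; exact: le_trans h2.
- case=> [|i] /=; first by rewrite minnSS.
  by rewrite minnSS ltnS; exact: sz.
- have -> : A = Q^T *m (Q *m A *m Z^T) *m Z.
    by rewrite !mulmxA QtQ mul1mx -mulmxA ZtZ mulmx1.
  rewrite QAZ trmx_mul trmxK !mulmxA; congr (_ *m _); rewrite -!mulmxA; congr (_ *m _).
  have W1T : W1^T = block_mx 1%:M 0 0 W^T.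
    by rewrite /W1 tr_block_mx !trmx0 trmx1.
  rewrite W1T.
  have -> : (\matrix_(i < 1 + p, j < 1 + q) (s1 i *+ (i == j :> nat)))
     = block_mx sg%:M 0 0 (\matrix_(i < p, j < q) (s i *+ (i == j :> nat))).
    apply/matrixP => i j; rewrite !mxE; case: splitP => i' ii'; rewrite !mxE.
      case: splitP => j' jj'; rewrite !mxE ii' jj' ?ord1 //.
    case: splitP => j' jj'; rewrite !mxE ii' jj' ?ord1 //=.
  have key (S : 'M[R]_(p, q)) : block_mx sg%:M 0 0 (U *m S *m W^T) =
      U1 *m (block_mx sg%:M 0 0 S *m block_mx 1%:M 0 0 W^T) :> 'M[R]_(1 + p, 1 + q).
    rewrite mulmx_block /U1 mulmx_block.
    by rewrite !(mulmx0, mul0mx, mulmx1, mul1mx, addr0, add0r) mulmxA.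
  rewrite {1}BE; exact: key.
Qed.

End SingularValueDecomposition.

(** * Finite product probability spaces *)

Section FiniteProduct.
Variables (R : realType) (I A : finType) (p : I -> A -> R).
Hypothesis p_ge0 : forall i a, 0 <= p i a.
Hypothesis p_sum1 : forall i, \sum_a p i a = 1.
Local Notation X := {ffun I -> A}.

Definition pweight (x : X) : R := \prod_i p i (x i).

Definition Ex (f : X -> R) : R := \sum_x pweight x * f x.

Definition Pr (B : pred X) : R := Ex (fun x => (B x)%:R).

Definition upd (x : X) (i : I) (a : A) : X := [ffun j => if j == i then a else x j].

Lemma upd_id x i a : upd x i a i = a. Proof. by rewrite ffunE eqxx. Qed.

Lemma upd_neq x i a j : j != i -> upd x i a j = x j.
Proof. by rewrite ffunE => /negbTE ->. Qed.

Lemma updK x i a : upd (upd x i a) i (x i) = x.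
Proof. by apply/ffunP => j; rewrite !ffunE; case: eqP => // ->. Qed.

Lemma pweight_ge0 x : 0 <= pweight x.
Proof. by apply: prodr_ge0 => i _. Qed.

Lemma pweight_upd x i a : pweight (upd x i a) * p i (x i) = pweight x * p i a.
Proof.
rewrite /pweight (bigD1 i) //= [\prod_i p i (x i)](bigD1 i) //= upd_id.
under eq_bigr => j ji do rewrite upd_neq //.
ring.
Qed.

Lemma Ex_le f g : (forall x, f x <= g x) -> Ex f <= Ex g.
Proof. by move=> fg; apply: ler_sum => x _; rewrite ler_wpM2l ?pweight_ge0. Qed.

Lemma eq_Ex f g : (forall x, f x = g x) -> Ex f = Ex g.
Proof. by move=> fg; apply: eq_bigr => x _; rewrite fg. Qed.

Lemma ExD f g : Ex (fun x => f x + g x) = Ex f + Ex g.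
Proof. by rewrite /Ex -big_split; apply: eq_bigr => x _; rewrite mulrDr. Qed.

Lemma ExZ c f : Ex (fun x => c * f x) = c * Ex f.
Proof. by rewrite /Ex mulr_sumr; apply: eq_bigr => x _; rewrite mulrCA. Qed.

Lemma ExB f g : Ex (fun x => f x - g x) = Ex f - Ex g.
Proof.
by rewrite -[- Ex g]mulN1r -ExZ -ExD; apply: eq_Ex => x; rewrite mulN1r.
Qed.

Lemma Ex_sum (T : Type) (s : seq T) (P : pred T) (F : T -> X -> R) :
  Ex (fun x => \sum_(t <- s | P t) F t x) = \sum_(t <- s | P t) Ex (F t).
Proof. by rewrite /Ex exchange_big; apply: eq_bigr => x _; rewrite mulr_sumr. Qed.

Lemma Ex_cst c : Ex (fun=> c) = c.
Proof.
rewrite /Ex -mulr_suml -[RHS]mul1r; congr (_ * _).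
rewrite -(bigA_distr_bigA (fun i a => p i a)) /=.
by rewrite big1.
Qed.

Lemma Pr_le B C : subpred B C -> Pr B <= Pr C.
Proof.
by move=> BC; apply: Ex_le => x; rewrite ler_nat; case Bx: (B x); rewrite ?(BC _ Bx).
Qed.

Lemma Pr_has (T : finType) (B : T -> pred X) :
  Pr (fun x => [exists t, B t x]) <= \sum_t Pr (B t).
Proof.
rewrite /Pr -Ex_sum; apply: Ex_le => x.
case: existsP => [[t Btx]|_]; last by apply: sumr_ge0 => t _; rewrite ler0n.
by rewrite (bigD1 t) //= Btx lerDl sumr_ge0 // => u _; rewrite ler0n.
Qed.

Lemma Pr_or B C : Pr (fun x => B x || C x) <= Pr B + Pr C.
Proof.
by rewrite /Pr -ExD; apply: Ex_le => x; case: (B x); case: (C x); rewrite /= -?natrD ler_nat.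
Qed.

Lemma Pr_markov (B : pred X) f c :
  0 < c -> (forall x, 0 <= f x) -> (forall x, B x -> c <= f x) -> Pr B <= Ex f / c.
Proof.
move=> c0 f0 Bf; rewrite ler_pdivlMr // mulrC -ExZ; apply: Ex_le => x.
by case Bx: (B x); rewrite ?mulr1 ?mulr0 ?Bf.
Qed.

(* Resampling the i-th coordinate gives an exchangeable pair. *)
Lemma Ex_exchange i (F : X -> X -> R) :
  Ex (fun x => \sum_a p i a * F x (upd x i a))
  = Ex (fun x => \sum_a p i a * F (upd x i a) x).
Proof.
rewrite /Ex; under eq_bigr do rewrite mulr_sumr.
under [RHS]eq_bigr do rewrite mulr_sumr.
rewrite !pair_big /=; pose h (q : X * A) := (upd q.1 i q.2, q.1 i).
have hK : involutive h by case=> x a; rewrite /h /= updK upd_id.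
rewrite (reindex_inj (inv_inj hK)); apply: eq_bigr => -[x a] _ /=.
by rewrite updK !mulrA pweight_upd.
Qed.

Lemma Ex_resample i f : Ex f = Ex (fun x => \sum_a p i a * f (upd x i a)).
Proof.
rewrite (Ex_exchange i (fun _ y => f y)); apply: eq_Ex => x.
by rewrite -mulr_suml p_sum1 mul1r.
Qed.

Lemma Ex_expR_le1 (J : finType) (io : J -> I) (G : J -> X -> A -> R) :
  injective io ->
  (forall j k x a b, G k (upd x (io j) a) b = G k x b) ->
  (forall j x, \sum_a p (io j) a * expR (G j x a) <= 1) ->
  Ex (fun x => expR (\sum_j G j x (x (io j)))) <= 1.
Proof.
move=> io_inj Gupd G1.
suff H (s : seq J) : uniq s ->
    Ex (fun x => expR (\sum_(j <- s) G j x (x (io j)))) <= 1.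
  by rewrite H // index_enum_uniq.
elim: s => [_|j s IH /= /andP[js us]].
  rewrite -[leRHS](Ex_cst 1); apply: Ex_le => x; by rewrite big_nil expR0.
apply: le_trans (IH us); rewrite (Ex_resample (io j)); apply: Ex_le => x.
have E a : expR (\sum_(k <- j :: s) G k (upd x (io j) a) (upd x (io j) a (io k)))
  = expR (G j x a) * expR (\sum_(k <- s) G k x (x (io k))).
  rewrite big_cons expRD Gupd upd_id; congr (_ * expR _).
  rewrite big_seq [RHS]big_seq; apply: eq_bigr => k ks.
  rewrite Gupd upd_neq //; apply: contra js => /eqP /io_inj <- //.
under eq_bigr do rewrite E mulrA.
by rewrite -mulr_suml ler_piMl ?expR_ge0.
Qed.

(** From [expR (- t) >= 1 - t] and (1 - t)(1 + t + 2 t^2) = 1 + t^2 (1 - 2 t). *)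
Lemma expR_le_quad (t : R) : t <= 1 / 2 -> expR t <= 1 + t + 2 * t ^+ 2.
Proof.
move=> t2; have h : 0 < 1 - t by lra.
have : expR t <= (1 - t)^-1.
  rewrite -[leLHS]invrK lef_pV2 ?posrE ?invr_gt0 ?expR_gt0 //.
  by rewrite -expRN; have := expR_ge1Dx (- t); lra.
move=> /le_trans; apply; rewrite -(ler_pM2r h) mulVf ?gt_eqF //; nra.
Qed.

(** The linear term stands apart because it averages to zero for a centered variable; the rest is
    Gaussian, with no restriction on t. *)
Lemma expR_le_subgauss (t : R) : expR t <= t + expR (2 * t ^+ 2).
Proof.
have h1 := expR_ge1Dx (2 * t ^+ 2).
have [t2|t2] := lerP `|t| (1 / 2).
  have [_ t2'] := andP (etrans (esym (ler_norml _ _)) t2).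
  by have := expR_le_quad t2'; lra.
have [t0|t0] := lerP 0 t.
  rewrite ger0_norm // in t2.
  have : expR t <= expR (2 * t ^+ 2) by rewrite ler_expR; nra.
  lra.
rewrite ltr0_norm // in t2.
have : expR t <= 1 by rewrite expR_le1 ltW.
nra.
Qed.

Lemma mgf_le1 (i : I) (f : A -> R) (v y : R) :
  \sum_a p i a * f a = 0 -> \sum_a p i a * f a ^+ 2 <= v ->
  (forall a, y * f a <= 1 / 2) ->
  \sum_a p i a * expR (y * f a - 2 * v * y ^+ 2) <= 1.
Proof.
move=> f0 fv yf.
under eq_bigr do rewrite expRD mulrA.
rewrite -mulr_suml -(@ler_pM2r _ (expR (2 * v * y ^+ 2))) ?expR_gt0 //.
rewrite -[X in X <= _]mulrA -expRD addNr expR0 mulr1 mul1r.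
apply: (@le_trans _ _ (1 + 2 * v * y ^+ 2)); last exact: expR_ge1Dx.
apply: (@le_trans _ _ (\sum_a (p i a + y * (p i a * f a) + 2 * y ^+ 2 * (p i a * f a ^+ 2)))).
  apply: ler_sum => a _.
  have -> : p i a + y * (p i a * f a) + 2 * y ^+ 2 * (p i a * f a ^+ 2)
     = p i a * (1 + y * f a + 2 * (y * f a) ^+ 2) by ring.
  by rewrite ler_wpM2l // expR_le_quad.
rewrite !big_split /= p_sum1 -!mulr_sumr f0 mulr0 addr0 lerD2l.
have -> : 2 * v * y ^+ 2 = 2 * y ^+ 2 * v by ring.
by rewrite ler_wpM2l // mulr_ge0 // sqr_ge0.
Qed.

Lemma mgf_bounded_le1 (i : I) (f : A -> R) (L y : R) :
  \sum_a p i a * f a = 0 -> (forall a, `|f a| <= L) ->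
  \sum_a p i a * expR (y * f a - 2 * L ^+ 2 * y ^+ 2) <= 1.
Proof.
move=> f0 fL.
under eq_bigr do rewrite expRD mulrA.
rewrite -mulr_suml -(@ler_pM2r _ (expR (2 * L ^+ 2 * y ^+ 2))) ?expR_gt0 //.
rewrite -[X in X <= _]mulrA -expRD addNr expR0 mulr1 mul1r.
apply: (@le_trans _ _ (\sum_a (y * (p i a * f a) + p i a * expR (2 * L ^+ 2 * y ^+ 2)))).
  apply: ler_sum => a _; rewrite mulrCA -mulrDr ler_wpM2l //.
  apply: (le_trans (expR_le_subgauss _)); rewrite lerD2l ler_expR.
  have : f a ^+ 2 <= L ^+ 2.
    by rewrite -real_normK ?num_real // ler_pXn2r ?nnegrE // (le_trans _ (fL a)).
  have := sqr_ge0 y; rewrite exprMn; nra.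
by rewrite big_split /= -mulr_sumr f0 mulr0 add0r -mulr_suml p_sum1 mul1r.
Qed.

(** * Bernstein's inequality with random coefficients *)

Section Bernstein.
Variables (J : finType) (io : J -> I) (f : J -> A -> R) (z : J -> X -> R).
Hypothesis io_inj : injective io.
Hypothesis z_upd : forall j k x a, z k (upd x (io j) a) = z k x.
Hypothesis f_mean : forall j, \sum_a p (io j) a * f j a = 0.

(** The coefficients z are random but do not change when a coordinate of the sum is resampled; their
    norms share this property. *)
Definition vnorm (x : X) : R := Num.sqrt (\sum_j z j x ^+ 2).
Definition vmax (x : X) : R := \big[Num.max/0]_j `|z j x|.

Lemma vmax_ge0 x : 0 <= vmax x.
Proof. by rewrite /vmax; elim/big_ind: _ => // a b a0 _; rewrite le_max a0. Qed.

Lemma z_le_vmax j x : `|z j x| <= vmax x.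
Proof. exact: (@le_bigmax _ _ _ _ (fun j => `|z j x|)). Qed.

Lemma vnorm_sqr x : vnorm x ^+ 2 = \sum_j z j x ^+ 2.
Proof. by rewrite sqr_sqrtr // sumr_ge0 // => j _; rewrite sqr_ge0. Qed.

Lemma bernstein1 (sg B l Q : R) :
  0 < sg -> 0 < B -> 0 < l -> 0 <= Q ->
  (forall j, \sum_a p (io j) a * f j a ^+ 2 <= sg ^+ 2) ->
  (forall j a, `|f j a| <= B) ->
  Pr (fun x => (2 * Q + 4) * (sg * Num.sqrt l * vnorm x + B * l * vmax x)
       < \sum_j z j x * f j (x (io j))) <= expR (- (Q * l)).
Proof.
move=> sg0 B0 l0 Q0 fv fB.
(* The Chernoff parameter adapts to the coefficients: its first term keeps the variance part of the
   exponent below 2 l, its second keeps each h z f below 1/2. Being a function of z, it is frozen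
   under resampling; both quotients are 0 when z = 0. *)
pose h x := Num.min (Num.sqrt l / (sg * vnorm x)) (1 / (2 * B * vmax x)).
have nz_upd x j a : vnorm (upd x (io j) a) = vnorm x.
  by rewrite /vnorm; congr Num.sqrt; apply: eq_bigr => k _; rewrite z_upd.
have mz_upd x j a : vmax (upd x (io j) a) = vmax x.
  by rewrite /vmax; apply: eq_bigr => k _; rewrite z_upd.
have h_upd x j a : h (upd x (io j) a) = h x by rewrite /h nz_upd mz_upd.
have h0 x : 0 <= h x.
  by rewrite /h le_min !divr_ge0 ?sqrtr_ge0 ?mulr_ge0 ?sqrtr_ge0 ?vmax_ge0 // ltW.
have hz x : h x * (2 * B * vmax x) <= 1.
  have [m0|m0] := eqVneq (vmax x) 0; first by rewrite m0 !mulr0.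
  have m1 : 0 < vmax x by rewrite lt_neqAle eq_sym m0 vmax_ge0.
  rewrite -ler_pdivlMr ?mulr_gt0 // ge_min lexx orbT //.
have hn x : h x * (sg * vnorm x) <= Num.sqrt l.
  have [m0|m0] := eqVneq (vnorm x) 0; first by rewrite m0 !mulr0 sqrtr_ge0.
  have m1 : 0 < vnorm x by rewrite lt_neqAle eq_sym m0 sqrtr_ge0.
  by rewrite -ler_pdivlMr ?mulr_gt0 // ge_min lexx.
pose G j x a := h x * z j x * f j a - 2 * sg ^+ 2 * (h x * z j x) ^+ 2.
have E1 : Ex (fun x => expR (\sum_j G j x (x (io j)))) <= 1.
  apply: Ex_expR_le1 => // [j k x a b|j x]; first by rewrite /G h_upd z_upd.
  apply: mgf_le1 => // a.
  apply: (le_trans (ler_norm _)); rewrite !normrM (ger0_norm (h0 x)).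
  have := hz x; have := z_le_vmax j x; have := fB j a; have := h0 x.
  have := vmax_ge0 x; move: (normr_ge0 (z j x)) (normr_ge0 (f j a)).
  move: (h x) `|z j x| `|f j a| (vmax x) => H Z F m Z0 F0 m0 H0 FB Zm Hm.
  have : H * Z * F <= H * m * B by rewrite ler_pM ?mulr_ge0 // ler_wpM2l.
  nra.
apply: (@le_trans _ _ (Ex (fun x => expR (\sum_j G j x (x (io j)))) / expR (Q * l))); last first.
  by rewrite expRN ler_pdivrMr ?expR_gt0 // mulVf ?gt_eqF ?expR_gt0.
apply: Pr_markov; [exact: expR_gt0|by move=> x; exact: expR_ge0|move=> x HS].
rewrite ler_expR /G sumrB -mulr_sumr.
under eq_bigr do rewrite -mulrA.
rewrite -mulr_sumr.
under [X in _ <= _ - 2 * _ * X]eq_bigr do rewrite exprMn.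
rewrite -mulr_sumr -vnorm_sqr.
set S := \sum_j z j x * f j (x (io j)); rewrite -/S in HS.
have vn0 : 0 <= vnorm x by exact: sqrtr_ge0.
have vm0 := vmax_ge0 x.
have sl : Num.sqrt l ^+ 2 = l by rewrite sqr_sqrtr // ltW.
have sl0 : 0 < Num.sqrt l by rewrite sqrtr_gt0.
have n0 : vnorm x != 0.
  apply/negP => /eqP n0; move: HS; rewrite /S big1 => [|j _].
    rewrite ltNge mulr_ge0 //; first by rewrite addr_ge0 ?mulr_ge0.
    by rewrite addr_ge0 // !mulr_ge0 // ltW.
  have : \sum_j z j x ^+ 2 = 0 by rewrite -vnorm_sqr n0 expr0n.
  move/eqP; rewrite psumr_eq0 => [/allP /(_ j (mem_index_enum _)) /=|k _]; last exact: sqr_ge0.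
  by rewrite sqrf_eq0 => /eqP ->; rewrite mul0r.
have n1 : 0 < vnorm x by rewrite lt_neqAle eq_sym n0.
have m1 : 0 < vmax x.
  rewrite lt_neqAle vm0 andbT eq_sym; apply: contra n0 => /eqP m0.
  rewrite sqrtr_eq0 big1 // => j _; have := z_le_vmax j x.
  by rewrite m0 normr_le0 => /eqP ->; rewrite expr0n.
have q1 : 2 * sg ^+ 2 * (h x ^+ 2 * vnorm x ^+ 2) <= 2 * l.
  have -> : 2 * sg ^+ 2 * (h x ^+ 2 * vnorm x ^+ 2) = 2 * (h x * (sg * vnorm x)) ^+ 2 by ring.
  have hs : 0 <= h x * (sg * vnorm x) by rewrite mulr_ge0 // mulr_ge0 // ltW.
  rewrite ler_wpM2l // -[X in _ <= X]sl.
  by rewrite ler_pXn2r ?nnegrE ?sqrtr_ge0.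
(* Whichever term is the minimum, h times the deviation scale is at least l / 2. The factor 2 Q + 4
   then yields (Q + 2) l, of which the variance part takes 2 l. *)
have q2 : l / 2 <= h x * (sg * Num.sqrt l * vnorm x + B * l * vmax x).
  rewrite /h /Num.min; case: ifP => _.
    have -> : Num.sqrt l / (sg * vnorm x) * (sg * Num.sqrt l * vnorm x + B * l * vmax x)
       = Num.sqrt l ^+ 2 + Num.sqrt l / (sg * vnorm x) * (B * l * vmax x).
      by field; rewrite gt_eqF // gt_eqF.
    rewrite sl; apply: (@le_trans _ _ l); first lra.
    by rewrite lerDl !mulr_ge0 ?invr_ge0 ?mulr_ge0 // ltW.
  have -> : 1 / (2 * B * vmax x) * (sg * Num.sqrt l * vnorm x + B * l * vmax x)
     = l / 2 + (sg * Num.sqrt l * vnorm x) / (2 * B * vmax x).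
    by field; rewrite !gt_eqF.
  by rewrite lerDl !mulr_ge0 ?invr_ge0 ?mulr_ge0 // ltW.
have q3 : h x * ((2 * Q + 4) * (sg * Num.sqrt l * vnorm x + B * l * vmax x)) <= h x * S.
  by rewrite ler_wpM2l // ltW.
have q4 : (2 * Q + 4) * (l / 2) <= h x * S.
  apply: le_trans q3; rewrite [leRHS]mulrCA ler_wpM2l //; lra.
lra.
Qed.

End Bernstein.

Lemma bernstein (J : finType) (io : J -> I) (f : J -> A -> R) (z : J -> X -> R)
    (sg B l Q : R) :
  injective io -> (forall j k x a, z k (upd x (io j) a) = z k x) ->
  (forall j, \sum_a p (io j) a * f j a = 0) ->
  0 < sg -> 0 < B -> 0 < l -> 0 <= Q ->
  (forall j, \sum_a p (io j) a * f j a ^+ 2 <= sg ^+ 2) ->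
  (forall j a, `|f j a| <= B) ->
  Pr (fun x => (2 * Q + 4) * (sg * Num.sqrt l * vnorm z x + B * l * vmax z x)
       < `|\sum_j z j x * f j (x (io j))|) <= 2 * expR (- (Q * l)).
Proof.
move=> io_inj zu f0 sg0 B0 l0 Q0 fv fB.
have h1 := bernstein1 io_inj zu f0 sg0 B0 l0 Q0 fv fB.
have h2 : Pr (fun x => (2 * Q + 4) * (sg * Num.sqrt l * vnorm z x + B * l * vmax z x)
       < \sum_j z j x * - f j (x (io j))) <= expR (- (Q * l)).
  apply: (@bernstein1 J io (fun j a => - f j a) z) => //.
  - move=> j; rewrite -[RHS]oppr0 -[X in - X](f0 j) -sumrN.
    by apply: eq_bigr => a _; rewrite mulrN.
  - by move=> j; under eq_bigr do rewrite sqrrN.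
  - by move=> j a; rewrite normrN.
have -> : 2 * expR (- (Q * l)) = expR (- (Q * l)) + expR (- (Q * l)).
  by rewrite mulr_natl mulr2n.
apply: le_trans (lerD h1 h2).
apply: le_trans (Pr_or _ _); apply: Pr_le => x /=.
rewrite lter_normr => /orP[->//|h]; apply/orP; right.
by rewrite (lt_le_trans h) // -sumrN; apply: ler_sum => j _; rewrite mulrN.
Qed.

End FiniteProduct.

(** * Moments of random symmetric matrices *)

Section LogConvex.
Variable R : realType.
Variable a : nat -> R.
Hypothesis a_ge0 : forall s, 0 <= a s.
Hypothesis a_logconvex : forall s, a s.+1 ^+ 2 <= a s * a s.+2.

(** The ratios of consecutive terms increase, so each is at least a 1 / a 0; the form without
    division allows vanishing terms. *)
Lemma logconvex_ratio s : a 1%N * a s <= a 0%N * a s.+1.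
Proof.
elim: s => [|s IH]; first by rewrite mulrC.
have [z|z] := eqVneq (a s.+1) 0; first by rewrite z mulr0 mulr_ge0.
have h : 0 < a s.+1 ^+ 2 by rewrite exprn_even_gt0.
have p1 : 0 < a s.
  rewrite lt_neqAle a_ge0 andbT eq_sym; apply/negP => /eqP z0.
  by have := lt_le_trans h (a_logconvex s); rewrite z0 mul0r ltxx.
rewrite -(ler_pM2l p1).
apply: (@le_trans _ _ (a 0%N * a s.+1 * a s.+1)).
  by rewrite mulrA (mulrC (a s)) ler_wpM2r.
rewrite -mulrA -expr2 [leRHS]mulrCA ler_wpM2l //.
Qed.

Lemma logconvex_pow s : a 1%N ^+ s.+1 <= a s.+1 * a 0%N ^+ s.
Proof.
elim: s => [|s IH]; first by rewrite !expr1 expr0 mulr1.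
rewrite exprS; apply: (@le_trans _ _ (a 1%N * (a s.+1 * a 0%N ^+ s))).
  by rewrite ler_wpM2l.
rewrite mulrA [a 0%N ^+ s.+1]exprS mulrA ler_wpM2r ?exprn_ge0 //.
by rewrite [leRHS]mulrC logconvex_ratio.
Qed.

(** Increasing ratios again: a bound on the last one bounds all the previous ones. *)
Lemma logconvex_last_ratio rho s :
  0 <= rho -> a s.+1 <= rho * a s -> a s <= rho ^+ s * a 0%N.
Proof.
move=> rho0; elim: s => [|s IH] h; first by rewrite expr0 mul1r.
have [z|z] := eqVneq (a s.+1) 0; first by rewrite z mulr_ge0 ?exprn_ge0.
have p1 : 0 < a s.+1 by rewrite lt_neqAle eq_sym z a_ge0.
have h1 : a s.+1 <= rho * a s.
  rewrite -(ler_pM2r p1) -expr2; apply: (le_trans (a_logconvex s)).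
  by rewrite [leRHS]mulrAC [leRHS]mulrC ler_wpM2l.
apply: (le_trans h1); rewrite exprS -mulrA ler_wpM2l //; exact: IH.
Qed.

(* From the monotonicity of the ratios [a s.+1 / a s]. *)
Lemma logconvex_young c s :
  0 <= c -> 2 * (c * a s) <= a s.+1 + (2 * c) ^+ s.+1 * a 0%N.
Proof.
move=> c0; have [h|h] := lerP (a s.+1) (2 * c * a s); last first.
  have : 0 <= (2 * c) ^+ s.+1 * a 0%N by rewrite mulr_ge0 ?exprn_ge0 ?mulr_ge0.
  lra.
have c2 : 0 <= 2 * c by rewrite mulr_ge0.
have := logconvex_last_ratio c2 h.
rewrite -(@ler_pM2l _ 2) // => h1.
have : 2 * c * a s <= 2 * c * ((2 * c) ^+ s * a 0%N).
  by rewrite ler_wpM2l //; have := logconvex_last_ratio c2 h.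
rewrite [X in _ <= X -> _]mulrA -exprS.
have := a_ge0 s.+1; lra.
Qed.

End LogConvex.

Lemma convex_le_max (R : realType) (G : nat -> R) (M : R) n :
  (forall s, (s.+2 <= n)%N -> 2 * G s.+1 <= G s + G s.+2) ->
  G 0%N <= M -> G n <= M -> forall s, (s <= n)%N -> G s <= M.
Proof.
elim: n M => [|n IH] M Gc G0 Gn s sn; first by move: sn; rewrite leqn0 => /eqP ->.
have Gc' s' : (s'.+2 <= n)%N -> 2 * G s'.+1 <= G s' + G s'.+2.
  by move=> h; apply: Gc; exact: leqW.
have Gn' : G n <= M.
  case: n IH Gc Gn Gc' sn => // n IH Gc Gn Gc' sn.
  have [//|h] := lerP (G n.+1) M.
  have h1 := IH (G n.+1) Gc' (ltW (le_lt_trans G0 h)) (lexx _) n (leqnSn _).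
  by have := Gc n (leqnn _); lra.
move: sn; rewrite leq_eqVlt => /orP[/eqP -> //|]; rewrite ltnS.
exact: IH.
Qed.

(** * Powers of symmetric matrices and a mean value inequality for their traces *)

Section MatrixPowers.
Variables (R : realType) (n : nat).
Implicit Types K X Y D : 'M[R]_n.

Definition mxp K (s : nat) : 'M[R]_n := iter s (mulmx K) 1%:M.

Lemma mxpS K s : mxp K s.+1 = K *m mxp K s. Proof. by []. Qed.

Lemma mxpD K s t : mxp K (s + t) = mxp K s *m mxp K t.
Proof. by elim: s => [|s IH]; rewrite ?mul1mx // addSn !mxpS IH mulmxA. Qed.

Lemma mxp1 K : mxp K 1 = K. Proof. by rewrite mxpS mulmx1. Qed.

Lemma mxpSr K s : mxp K s.+1 = mxp K s *m K.
Proof. by rewrite -addn1 mxpD mxp1. Qed.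

Lemma mxp_tr K s : K^T = K -> (mxp K s)^T = mxp K s.
Proof.
move=> KT; elim: s => [|s IH]; first by rewrite trmx1.
by rewrite mxpS trmx_mul KT IH -mxpSr.
Qed.

Lemma fn_mxp_logconvex K : K^T = K ->
  forall s, fn (mxp K s.+1) ^+ 2 ^+ 2 <= fn (mxp K s) ^+ 2 * fn (mxp K s.+2) ^+ 2.
Proof.
move=> KT s; rewrite -exprMn ler_pXn2r ?nnegrE ?mulr_ge0 ?sqr_ge0 ?fn_ge0 //.
by rewrite fn_sqr [X in dotmx X _]mxpS dotmx_mull KT -mxpS cauchy_schwarz.
Qed.

Lemma fn_mulmx_mxp_logconvex m (x : 'M[R]_(m, n)) K : K^T = K ->
  forall s, fn (x *m mxp K s.+1) ^+ 2 <= fn (x *m mxp K s) * fn (x *m mxp K s.+2).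
Proof.
move=> KT s; rewrite fn_sqr [in X in dotmx X _]mxpSr mulmxA dotmx_mulr KT.
by rewrite -mulmxA -mxpSr cauchy_schwarz.
Qed.

(** Along the powers of a symmetric K, the norms of x K^s are log-convex, so the (s+1)-st power of
    the first ratio is at most the norm of K^(s+1). This turns a trace moment into an operator
    bound. *)
Lemma opb_of_mxp K (th : R) s : K^T = K -> 0 <= th -> fn (mxp K s.+1) <= th ^+ s.+1 -> opb th K.
Proof.
move=> KT th0 h x.
have := @logconvex_pow _ (fun s => fn (x *m mxp K s)) (fun s => fn_ge0 _)
  (fn_mulmx_mxp_logconvex x KT) s.
rewrite mxp1 /= mulmx1 => h1.
rewrite -(@ler_pXn2r _ s.+1) ?nnegrE ?mulr_ge0 ?fn_ge0 //.
apply: (le_trans h1); rewrite exprMn [fn x ^+ s.+1]exprS mulrA.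
rewrite ler_wpM2r ?exprn_ge0 ?fn_ge0 //.
by apply: (le_trans (fn_mulmx _ _)); rewrite mulrC ler_wpM2r ?fn_ge0.
Qed.

Lemma mxp_subE X Y s :
  mxp X s.+1 - mxp Y s.+1 = \sum_(q < s.+1) mxp X q *m (X - Y) *m mxp Y (s - q).
Proof.
elim: s => [|s IH]; first by rewrite big_ord1 !mxp1 mul1mx mulmx1.
have -> : mxp X s.+2 - mxp Y s.+2 = X *m (mxp X s.+1 - mxp Y s.+1) + (X - Y) *m mxp Y s.+1.
  by rewrite mulmxBr mulmxBl -!mxpS addrA subrK.
rewrite IH [RHS]big_ord_recl mul1mx subn0 addrC mulmx_sumr; congr (_ + _).
by apply: eq_bigr => q _; rewrite !mulmxA lift0 subSS mxpS.
Qed.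

(** The left side is the product of E s and E t for E s = X^s D Y^(r-s) and s + t = q. It depends on
    s + t alone, so the square norms of E s form a midpoint-convex sequence, bounded by its two end
    values. *)
Lemma tropp_term D X Y r q : D^T = D -> X^T = X -> Y^T = Y -> (q <= r.*2)%N ->
  dotmx D (mxp X q *m D *m mxp Y (r.*2 - q)) <= fn (D *m mxp X r) ^+ 2 + fn (D *m mxp Y r) ^+ 2.
Proof.
move=> DT XT YT.
pose E s := mxp X s *m D *m mxp Y (r - s).
pose M := fn (D *m mxp X r) ^+ 2 + fn (D *m mxp Y r) ^+ 2.
have EE s t : (s <= r)%N -> (t <= r)%N ->
    dotmx D (mxp X (s + t) *m D *m mxp Y (r.*2 - (s + t))) = dotmx (E s) (E t).
  move=> sr tr; rewrite /E dotmx_mulr dotmx_mull !mxp_tr // !mulmxA -mxpD.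
  rewrite -[in RHS]mulmxA -[in RHS]mxpD; congr (dotmx _ (_ *m mxp Y _)); lia.
have GM s : (s <= r)%N -> dotmx (E s) (E s) <= M.
  apply: (@convex_le_max _ (fun s => dotmx (E s) (E s))).
  - move=> t tr; cbv beta.
    have -> : dotmx (E t.+1) (E t.+1) = dotmx (E t) (E t.+2).
      have t1 : (t.+1 <= r)%N by lia.
      have t0 : (t <= r)%N by lia.
      rewrite -!EE //.
      by have -> : (t.+1 + t.+1 = t + t.+2)%N by lia.
    have := dotmx_ge0 (E t - E t.+2).
    rewrite !(dotmxDl, dotmxDr, dotmxNl, dotmxNr) (dotmxC (E t.+2) (E t)); lra.
  - by rewrite /M -fn_sqr /E mul1mx subn0 lerDr sqr_ge0.
  - by rewrite /M -fn_sqr /E subnn mulmx1 -(fn_tr (mxp X r *m D)) trmx_mul mxp_tr // DT lerDl sqr_ge0.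
(* Halving q keeps both indices at most r. *)
move=> qr; have -> : q = (q./2 + uphalf q)%N by rewrite uphalf_half addnCA addnn odd_double_half.
have h1 : (q./2 <= r)%N by rewrite -(doubleK r) half_leq.
have h2 : (uphalf q <= r)%N.
  by rewrite -(uphalf_double r) uphalf_leq.
rewrite EE //; have := dotmx_ge0 (E q./2 - E (uphalf q)).
rewrite !(dotmxDl, dotmxDr, dotmxNl, dotmxNr) (dotmxC (E (uphalf q)) (E q./2)).
by have := GM _ h1; have := GM _ h2; rewrite /M; lra.
Qed.

(** Mean value inequality for the odd power: telescope the difference and bound each of its 2 r + 1
    terms by [tropp_term]. *)
Lemma tropp_diff D X Y (c : R) r : D^T = D -> X^T = X -> Y^T = Y -> X - Y = c *: D ->
  c * dotmx D (mxp X r.*2.+1 - mxp Y r.*2.+1)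
  <= c ^+ 2 * (r.*2.+1)%:R * (fn (D *m mxp X r) ^+ 2 + fn (D *m mxp Y r) ^+ 2).
Proof.
move=> DT XT YT XY; rewrite mxp_subE.
set M := fn _ ^+ 2 + fn _ ^+ 2.
have -> : dotmx D (\sum_(q < r.*2.+1) mxp X q *m (X - Y) *m mxp Y (r.*2 - q))
    = c * \sum_(q < r.*2.+1) dotmx D (mxp X q *m D *m mxp Y (r.*2 - q)).
  rewrite (big_morph (dotmx D) (fun A B => dotmxDr A B D) (_ : dotmx D 0 = 0)); last first.
    by rewrite dotmxC dotmx0l.
  rewrite mulr_sumr; apply: eq_bigr => q _.
  by rewrite XY -scalemxAr -scalemxAl dotmxZr.
set S := \sum_(q < _) _.
have -> : c * (c * S) = c ^+ 2 * S by ring.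
rewrite -[leRHS]mulrA ler_wpM2l ?sqr_ge0 //.
have -> : (r.*2.+1)%:R * M = \sum_(q < r.*2.+1) M.
  by rewrite sumr_const card_ord mulr_natl.
by apply: ler_sum => q _; apply: tropp_term => //; rewrite -ltnS.
Qed.

End MatrixPowers.

(** * Trace moments by exchangeable pairs *)

Section TraceMoments.
Variables (R : realType) (I A : finType) (p : I -> A -> R).
Hypothesis p_ge0 : forall i a, 0 <= p i a.
Hypothesis p_sum1 : forall i, \sum_a p i a = 1.
Local Notation X := {ffun I -> A}.

(** Expand the product: the two matched terms have the same mean, and the two crossed ones vanish
    because e is centered. *)
Lemma Ex_centered_mul (i : I) (e : A -> R) (f : X -> R) :
  \sum_a p i a * e a = 0 ->
  2 * Ex p (fun x => e (x i) * f x)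
  = Ex p (fun x => \sum_a p i a * ((e (x i) - e a) * (f x - f (upd x i a)))).
Proof.
move=> e0; pose g x := \sum_a p i a * f (upd x i a).
have -> : Ex p (fun x => \sum_a p i a * ((e (x i) - e a) * (f x - f (upd x i a))))
   = Ex p (fun x => e (x i) * f x + \sum_a p i a * (e a * f (upd x i a)) - e (x i) * g x).
  apply: eq_Ex => x; rewrite /g mulr_sumr.
  have -> : e (x i) * f x = \sum_a p i a * (e (x i) * f x) - f x * \sum_a p i a * e a.
    by rewrite e0 mulr0 subr0 -mulr_suml p_sum1 mul1r.
  rewrite mulr_sumr -sumrB -big_split -sumrB; apply: eq_bigr => a _ /=; ring.
have -> : Ex p (fun x => e (x i) * f x + \sum_a p i a * (e a * f (upd x i a)) - e (x i) * g x)
   = Ex p (fun x => e (x i) * f x) + Ex p (fun x => \sum_a p i a * (e a * f (upd x i a)))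
     - Ex p (fun x => e (x i) * g x).
  by rewrite -ExD -ExB.
have -> : Ex p (fun x => e (x i) * g x) = 0.
  rewrite (Ex_resample p_sum1 i) -[RHS](Ex_cst p_sum1 0); apply: eq_Ex => x.
  rewrite -[RHS](mul0r (g x)) -[X in X * g x]e0 mulr_suml; apply: eq_bigr => a _.
  rewrite upd_id mulrA; congr (_ * _).
  apply: eq_bigr => b _; congr (_ * f _).
  by apply/ffunP => j; rewrite !ffunE; case: eqP.
have -> : Ex p (fun x => \sum_a p i a * (e a * f (upd x i a))) = Ex p (fun x => e (x i) * f x).
  rewrite [RHS](Ex_resample p_sum1 i); apply: eq_Ex => x.
  by apply: eq_bigr => a _; rewrite upd_id.
ring.
Qed.

(** K is affine in each entry e j, with derivative D j, and homogeneous of degree c (Euler's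
    identity). Euler's identity writes the trace of K^(2r+2) as a sum of terms linear in one
    centered entry; each is symmetrized over a resampling and bounded by [tropp_diff]. *)
Lemma tropp_trace (J : finType) (io : J -> I) (e : J -> A -> R) (n : nat) (c : R)
    (K : X -> 'M[R]_n) (D : J -> X -> 'M[R]_n) (r : nat) :
  (forall j, \sum_a p (io j) a * e j a = 0) ->
  (forall x, (K x)^T = K x) -> (forall j x, (D j x)^T = D j x) ->
  (forall j x a, D j (upd x (io j) a) = D j x) ->
  (forall x, c *: K x = \sum_j e j (x (io j)) *: D j x) ->
  (forall j x a, K x - K (upd x (io j) a) = (e j (x (io j)) - e j a) *: D j x) ->
  c * Ex p (fun x => fn (mxp (K x) r.+1) ^+ 2)
  <= (r.*2.+1)%:R * Ex p (fun x => \sum_j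
       (e j (x (io j)) ^+ 2 + \sum_a p (io j) a * e j a ^+ 2)
       * fn (D j x *m mxp (K x) r) ^+ 2).
Proof.
move=> e0 KT DT Du cK dK.
have -> : c * Ex p (fun x => fn (mxp (K x) r.+1) ^+ 2)
   = \sum_j Ex p (fun x => e j (x (io j)) * dotmx (D j x) (mxp (K x) r.*2.+1)).
  rewrite -Ex_sum -ExZ; apply: eq_Ex => x.
  have -> : fn (mxp (K x) r.+1) ^+ 2 = dotmx (K x) (mxp (K x) r.*2.+1).
    rewrite fn_sqr [X in dotmx X _]mxpS dotmx_mulr mxp_tr // -mxpD.
    by congr (dotmx _ (mxp _ _)); lia.
  rewrite -dotmxZl cK (big_morph (fun A => dotmx A _) (fun A B => dotmxDl A B _) (dotmx0l _)).
  by apply: eq_bigr => j _; rewrite dotmxZl.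
rewrite Ex_sum mulr_sumr; apply: ler_sum => j _.
rewrite -(@ler_pM2l _ 2) // (Ex_centered_mul _ (e0 j)).
(* The bound from [tropp_diff] has one part at x and one at the resampled point; exchangeability
   gives both the same mean. *)
pose F (x y : X) : R := (r.*2.+1)%:R * ((e j (x (io j)) - e j (y (io j))) ^+ 2
  * fn (D j x *m mxp (K x) r) ^+ 2).
apply: (@le_trans _ _ (Ex p (fun x => \sum_a p (io j) a * F x (upd x (io j) a))
   + Ex p (fun x => \sum_a p (io j) a * F (upd x (io j) a) x))).
  rewrite -ExD; apply: (Ex_le p_ge0) => x; rewrite -big_split; apply: ler_sum => a _ /=.
  rewrite -mulrDr ler_wpM2l // Du -dotmxNr -dotmxDr.
  apply: (le_trans (tropp_diff r (DT j x) (KT x) (KT (upd x (io j) a)) (dK j x a))).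
  rewrite /F upd_id Du le_eqVlt; apply/orP; left; apply/eqP; ring.
rewrite -Ex_exchange //; set W := Ex p _; have -> : W + W = 2 * W by ring.
rewrite ler_pM2l // -ExZ; apply: (Ex_le p_ge0) => x.
rewrite /F le_eqVlt; apply/orP; left; apply/eqP.
(* Subtracts a multiple of the zero mean, so that the averaged square of e (x) - e (a) splits into
   the square of e (x) plus the variance. *)
have -> : e j (x (io j)) ^+ 2 = \sum_a p (io j) a * e j (x (io j)) ^+ 2
   - 2 * e j (x (io j)) * \sum_a p (io j) a * e j a.
  by rewrite e0 mulr0 subr0 -mulr_suml p_sum1 mul1r.
rewrite [2 * _ * _]mulr_sumr -sumrB -big_split /= mulr_suml mulr_sumr.
by apply: eq_bigr => a _; rewrite upd_id; ring.
Qed.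

End TraceMoments.

(** * Off-diagonal part of a Gram matrix *)

Section OffDiagonalGram.
Variables (R : realType) (d D : nat).
Implicit Types Z : 'M[R]_(d, D).

(** Without its diagonal, the Gram matrix is affine in each entry of Z, as [tropp_trace] requires;
    the diagonal would bring squares of entries. *)
Definition offgram Z : 'M[R]_d :=
  \matrix_(j, k) (if j == k then 0 else \sum_c Z j c * Z k c).

Definition punctured_col Z (ic : 'I_d * 'I_D) : 'rV[R]_d :=
  \row_k (if k == ic.1 then 0 else Z k ic.2).

(* The derivative of [offgram Z] with respect to the entry [ic] of [Z]. *)
Definition offgram_deriv Z (ic : 'I_d * 'I_D) : 'M[R]_d :=
  delta_mx ic.1 0 *m punctured_col Z ic + (punctured_col Z ic)^T *m delta_mx 0 ic.1.

Lemma offgram_tr Z : (offgram Z)^T = offgram Z.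
Proof.
apply/matrixP => j k; rewrite !mxE eq_sym; case: eqP => // _.
by apply: eq_bigr => c _; rewrite mulrC.
Qed.

Lemma offgram_deriv_tr Z ic : (offgram_deriv Z ic)^T = offgram_deriv Z ic.
Proof. by rewrite /offgram_deriv linearD /= !trmx_mul trmxK !trmx_delta addrC. Qed.

Lemma offgram_derivE Z ic j k :
  offgram_deriv Z ic j k = (j == ic.1)%:R * punctured_col Z ic 0 k
                           + punctured_col Z ic 0 j * (k == ic.1)%:R.
Proof.
rewrite !mxE; congr (_ + _); rewrite big_ord1 !mxE ?eqxx ?andbT ?andTb //=.
Qed.

Lemma offgram_euler Z :
  2 *: offgram Z = \sum_ic Z ic.1 ic.2 *: offgram_deriv Z ic.
Proof.
apply/matrixP => j k; rewrite mxE summxE.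
under eq_bigr => ic _ do rewrite mxE offgram_derivE mulrDr.
rewrite big_split /=.
have E (j' k' : 'I_d) : \sum_(ic : 'I_d * 'I_D)
    Z ic.1 ic.2 * ((j' == ic.1)%:R * punctured_col Z ic 0 k') = offgram Z j' k'.
  rewrite -(pair_bigA _ (fun i c => Z i c * ((j' == i)%:R * punctured_col Z (i, c) 0 k'))) /=.
  rewrite (bigD1 j') //= [X in _ + X]big1 ?addr0 => [|i ij]; last first.
    by rewrite big1 // => c _; rewrite eq_sym (negbTE ij) mul0r mulr0.
  rewrite mxE; case: (eqVneq j' k') => [<-|jk]; first by rewrite big1 // => c _; rewrite mxE eqxx !mulr0.
  by apply: eq_bigr => c _; rewrite eqxx mul1r mxE eq_sym (negbTE jk).
rewrite E; under eq_bigr => ic _ do rewrite (mulrC (punctured_col _ _ _ _)).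
by rewrite E -[offgram Z in X in _ + X]offgram_tr [in X in _ + X]mxE; ring.
Qed.

Lemma offgram_diff Z Z' ic : (forall jc, jc != ic -> Z jc.1 jc.2 = Z' jc.1 jc.2) ->
  offgram Z - offgram Z' = (Z ic.1 ic.2 - Z' ic.1 ic.2) *: offgram_deriv Z ic.
Proof.
move=> ZZ; apply/matrixP => j k; rewrite 2!mxE [in RHS]mxE offgram_derivE !mxE.
have Zc i c : c != ic.2 -> Z i c = Z' i c.
  by move=> cc; apply: (ZZ (i, c)); apply: contra cc => /eqP <-.
have Zi i c : i != ic.1 -> Z i c = Z' i c.
  by move=> ii; apply: (ZZ (i, c)); apply: contra ii => /eqP <-.
case: (eqVneq j k) => [<-|jk].
  by rewrite subrr; case: eqVneq; rewrite ?(mulr0, mul0r, addr0).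
rewrite (bigD1 ic.2) //= [X in _ - X](bigD1 ic.2) //=.
have -> : \sum_(c < D | c != ic.2) Z j c * Z k c = \sum_(c < D | c != ic.2) Z' j c * Z' k c.
  by apply: eq_bigr => c cc; rewrite !Zc.
case: (eqVneq j ic.1) => [ji|ji].
  have ki : k != ic.1 by rewrite -ji eq_sym.
  by rewrite (negbTE ki) -!(Zi k) // ji /=; ring.
case: (eqVneq k ic.1) => [ki|ki].
  by rewrite -!(Zi j) // ki /=; ring.
by rewrite -!(Zi j) // -!(Zi k) //=; ring.
Qed.

Lemma fn_delta_mx p q (i : 'I_p) (j : 'I_q) : fn (delta_mx i j : 'M[R]_(p, q)) = 1.
Proof.
rewrite /fn dotmxE trmx_delta mul_delta_mx /mxtrace (bigD1 i) //= big1 => [|k ki].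
  by rewrite mxE !eqxx addr0 sqrtr1.
by rewrite mxE (negbTE ki).
Qed.

Lemma punctured_colE Z ic :
  punctured_col Z ic = row ic.2 Z^T - Z ic.1 ic.2 *: delta_mx 0 ic.1.
Proof.
apply/rowP => k; rewrite !mxE eqxx /=; case: eqVneq => [->|_].
  by rewrite mulr1 subrr.
by rewrite mulr0 subr0.
Qed.

Lemma fn_offgram_deriv Z ic n (L : 'M[R]_(d, n)) :
  fn (offgram_deriv Z ic *m L)
  <= fn (row ic.2 (Z^T *m L)) + 3 * fn (row ic.2 Z^T) * fn (row ic.1 L).
Proof.
rewrite /offgram_deriv mulmxDl -!mulmxA -rowE.
apply: (le_trans (fnD _ _)).
have h1 : `|Z ic.1 ic.2| <= fn (row ic.2 Z^T).
  by have := fn_entry_le (row ic.2 Z^T) 0 ic.1; rewrite !mxE.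
have h2 : fn (punctured_col Z ic) <= 2 * fn (row ic.2 Z^T).
  rewrite punctured_colE; apply: (le_trans (fnB _ _)).
  by rewrite fnZ fn_delta_mx mulr1; lra.
have h3 : fn (punctured_col Z ic *m L)
    <= fn (row ic.2 (Z^T *m L)) + fn (row ic.2 Z^T) * fn (row ic.1 L).
  rewrite punctured_colE mulmxBl -scalemxAl -rowE -row_mul.
  apply: (le_trans (fnB _ _)); rewrite lerD2l fnZ ler_wpM2r ?fn_ge0 //.
have := fn_mulmx (delta_mx ic.1 0 : 'M[R]_(d, 1)) (punctured_col Z ic *m L).
rewrite fn_delta_mx mul1r.
have := fn_mulmx (punctured_col Z ic)^T (row ic.1 L); rewrite fn_tr.
have : fn (punctured_col Z ic) * fn (row ic.1 L)
   <= 2 * fn (row ic.2 Z^T) * fn (row ic.1 L) by rewrite ler_wpM2r ?fn_ge0.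
lra.
Qed.

(** The column parts of the derivatives add up to the square norm of Z^T L, a quadratic form of Z
    Z^T, that is, of [offgram Z] plus a diagonal. The off-diagonal matrix thus reappears on the
    right, which closes the moment recursion. *)
Lemma offgram_tropp_bound Z (W : 'M[R]_(d, D)) (S T : R) n (L : 'M[R]_(d, n)) :
  0 <= S -> (forall i c, Z i c ^+ 2 <= W i c) -> (forall c, \sum_i W i c <= S) ->
  (forall i, \sum_c W i c <= T) ->
  \sum_ic W ic.1 ic.2 * fn (offgram_deriv Z ic *m L) ^+ 2
  <= 2 * S * (fn L * fn (offgram Z *m L)) + 20 * S * T * fn L ^+ 2.
Proof.
move=> S0 ZW WS WT.
have W0 i c : 0 <= W i c by apply: le_trans (ZW i c); exact: sqr_ge0.
have [d0|d0] := posnP d.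
  have absurd : 'I_d -> False by rewrite d0; case.
  rewrite big1 => [|[i c] _]; last by case: (absurd i).
  have -> : L = 0 by apply/matrixP => i; case: (absurd i).
  by rewrite mulmx0 !fn0 !(expr0n, mulr0, addr0).
have T0 : 0 <= T by apply: le_trans (WT (Ordinal d0)); apply: sumr_ge0.
have zc c : fn (row c Z^T) ^+ 2 <= \sum_i W i c.
  rewrite fn_sqr /dotmx big_ord1; apply: ler_sum => i _.
  by rewrite !mxE -expr2.
have zr i : fn (row i Z) ^+ 2 <= \sum_c W i c.
  rewrite fn_sqr /dotmx big_ord1; apply: ler_sum => c _.
  by rewrite !mxE -expr2.
have gram : fn (Z^T *m L) ^+ 2 <= fn L * fn (offgram Z *m L) + T * fn L ^+ 2.
  have ZE : Z *m Z^T = offgram Z + diag_mx (\row_i fn (row i Z) ^+ 2).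
    apply/matrixP => j k; rewrite !mxE; case: eqVneq => [->|_].
      rewrite mulr1n add0r fn_sqr /dotmx big_ord1.
      by apply: eq_bigr => c _; rewrite !mxE.
    by rewrite mulr0n addr0; apply: eq_bigr => c _; rewrite !mxE.
  rewrite fn_sqr dotmx_mull trmxK mulmxA ZE mulmxDl dotmxDr lerD ?cauchy_schwarz //.
  rewrite fn_sqr_rows mulr_sumr /dotmx; apply: ler_sum => i _.
  rewrite mul_diag_mx; under eq_bigr => j _ do rewrite !mxE mulrCA.
  rewrite -mulr_sumr.
  have -> : \sum_j L i j * L i j = fn (row i L) ^+ 2.
    by rewrite fn_sqr /dotmx big_ord1; apply: eq_bigr => j _; rewrite !mxE.
  by rewrite ler_wpM2r ?sqr_ge0 // (le_trans (zr i)).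
apply: (@le_trans _ _ (\sum_ic (2 * (W ic.1 ic.2 * fn (row ic.2 (Z^T *m L)) ^+ 2)
   + 18 * (W ic.1 ic.2 * (S * fn (row ic.1 L) ^+ 2))))).
  apply: ler_sum => -[i c] _ /=.
  have -> : 2 * (W i c * fn (row c (Z^T *m L)) ^+ 2) + 18 * (W i c * (S * fn (row i L) ^+ 2))
   = W i c * (2 * fn (row c (Z^T *m L)) ^+ 2 + 18 * (S * fn (row i L) ^+ 2)) by ring.
  rewrite ler_wpM2l //.
  have h : fn (offgram_deriv Z (i, c) *m L) ^+ 2
     <= (fn (row c (Z^T *m L)) + 3 * fn (row c Z^T) * fn (row i L)) ^+ 2.
    by rewrite ler_pXn2r ?nnegrE ?addr_ge0 ?mulr_ge0 ?fn_ge0 // fn_offgram_deriv.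
  apply: (le_trans h).
  have h2 : fn (row c Z^T) ^+ 2 * fn (row i L) ^+ 2 <= S * fn (row i L) ^+ 2.
    by rewrite ler_wpM2r ?sqr_ge0 // (le_trans (zc c)).
  have := sqr_ge0 (fn (row c (Z^T *m L)) - 3 * fn (row c Z^T) * fn (row i L)).
  nra.
rewrite big_split /= -!mulr_sumr.
rewrite -(pair_bigA _ (fun i c => W i c * fn (row c (Z^T *m L)) ^+ 2)) /=.
rewrite -(pair_bigA _ (fun i c => W i c * (S * fn (row i L) ^+ 2))) /=.
have h1 : \sum_i \sum_c W i c * fn (row c (Z^T *m L)) ^+ 2 <= S * fn (Z^T *m L) ^+ 2.
  rewrite exchange_big /= fn_sqr_rows mulr_sumr; apply: ler_sum => c _.
  by rewrite -mulr_suml ler_wpM2r ?sqr_ge0.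
have h2 : \sum_i \sum_c W i c * (S * fn (row i L) ^+ 2) <= S * T * fn L ^+ 2.
  rewrite (fn_sqr_rows L) mulr_sumr; apply: ler_sum => i _.
  rewrite -mulr_suml mulrCA mulrA ler_wpM2r ?sqr_ge0 // ler_wpM2l //.
have h3 : S * fn (Z^T *m L) ^+ 2 <= S * (fn L * fn (offgram Z *m L) + T * fn L ^+ 2).
  by rewrite ler_wpM2l.
nra.
Qed.

End OffDiagonalGram.

Lemma bigmax_pow_le_sum (R : realType) (T : finType) (F : T -> R) k :
  (forall t, 0 <= F t) -> (\big[Num.max/0]_t F t) ^+ k.+1 <= \sum_t F t ^+ k.+1.
Proof.
move=> F0; pose P (a b : R) := 0 <= a /\ a ^+ k.+1 <= b.
suff : P (\big[Num.max/0]_t F t) (\sum_t F t ^+ k.+1) by case.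
apply: (big_ind2 P).
- by split; rewrite ?expr0n.
- move=> a a' b b' [a0 aa] [b0 bb]; split; first by rewrite le_max a0.
  have a'0 : 0 <= a' by apply: le_trans aa; exact: exprn_ge0.
  have b'0 : 0 <= b' by apply: le_trans bb; exact: exprn_ge0.
  by rewrite /Num.max; case: ifP => _; [apply: (le_trans bb)|apply: (le_trans aa)]; lra.
- by move=> t _; split.
Qed.

(** * Concentration of the off-diagonal Gram matrix *)

Section GramConcentration.
Variables (R : realType) (I A : finType) (p : I -> A -> R).
Hypothesis p_ge0 : forall i a, 0 <= p i a.
Hypothesis p_sum1 : forall i, \sum_a p i a = 1.
Local Notation X := {ffun I -> A}.

(** With h = q / S, the mean of exp(h s) is at most e^q, and s <= S exp(h s / q) turns this into a
    q-th moment. The term 2 q B^2 of S keeps each exponent below 1/2; the factor 3 collects 2 from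
    the exponential moment of the square and 1 from the variance added to it. *)
Lemma sumsq_moment (J : finType) (io : J -> I) (f : J -> A -> R) (B sg : R) (q : nat) :
  injective io -> 0 < B -> (0 < q)%N ->
  (forall j a, `|f j a| <= B) ->
  (forall j, \sum_a p (io j) a * f j a ^+ 2 <= sg ^+ 2) ->
  Ex p (fun x => (\sum_j (f j (x (io j)) ^+ 2 + \sum_a p (io j) a * f j a ^+ 2)) ^+ q)
  <= (expR 1 * (2 * q%:R * B ^+ 2 + 3 * #|J|%:R * sg ^+ 2)) ^+ q.
Proof.
move=> io_inj B0 q0 fB fs.
set S := 2 * q%:R * B ^+ 2 + _; pose h := q%:R / S.
have q1 : 0 < q%:R :> R by rewrite ltr0n.
have B2 : 0 < B ^+ 2 by rewrite exprn_gt0.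
have n0 : 0 <= #|J|%:R * sg ^+ 2 by rewrite mulr_ge0 ?sqr_ge0.
have S0 : 0 < S by rewrite /S; nra.
have h0 : 0 <= h by rewrite divr_ge0 ?ltW.
have hS : h * S = q%:R by rewrite /h divfK ?gt_eqF.
pose v j := \sum_a p (io j) a * f j a ^+ 2.
have v0 j : 0 <= v j by apply: sumr_ge0 => a _; rewrite mulr_ge0 ?sqr_ge0.
pose G j (x : X) a := h * (f j a ^+ 2 + v j) - 3 * h * sg ^+ 2.
have E1 : Ex p (fun x => expR (\sum_j G j x (x (io j)))) <= 1.
  apply: Ex_expR_le1 => // j x.
  have f2 a : f j a ^+ 2 <= B ^+ 2.
    by rewrite -real_normK ?num_real // ler_pXn2r ?nnegrE ?fB // ltW.
  have hf a : h * f j a ^+ 2 <= 1 / 2.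
    have : h * f j a ^+ 2 <= h * B ^+ 2 by rewrite ler_wpM2l.
    have : h * (2 * q%:R * B ^+ 2) <= q%:R by rewrite -[leRHS]hS ler_wpM2l // /S; lra.
    have -> : h * (2 * q%:R * B ^+ 2) = q%:R * (2 * (h * B ^+ 2)) by ring.
    rewrite ger_pMr //; lra.
  have key : \sum_a p (io j) a * expR (h * f j a ^+ 2) <= expR (2 * h * v j).
    apply: (@le_trans _ _ (1 + 2 * h * v j)); last exact: expR_ge1Dx.
    have -> : 1 + 2 * h * v j = \sum_a (p (io j) a + 2 * h * (p (io j) a * f j a ^+ 2)).
      by rewrite big_split /= p_sum1 -mulr_sumr.
    apply: ler_sum => a _.
    have -> : p (io j) a + 2 * h * (p (io j) a * f j a ^+ 2)
       = p (io j) a * (1 + 2 * (h * f j a ^+ 2)) by ring.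
    rewrite ler_wpM2l //; apply: (le_trans (expR_le_quad (hf a))).
    have : 0 <= h * f j a ^+ 2 by rewrite mulr_ge0 ?sqr_ge0.
    have := hf a; nra.
  have -> : \sum_a p (io j) a * expR (G j x a)
     = (\sum_a p (io j) a * expR (h * f j a ^+ 2)) * expR (h * v j - 3 * h * sg ^+ 2).
    rewrite mulr_suml; apply: eq_bigr => a _; rewrite -mulrA -expRD.
    by congr (_ * expR _); rewrite /G; ring.
  apply: (@le_trans _ _ (expR (2 * h * v j) * expR (h * v j - 3 * h * sg ^+ 2))).
    by rewrite ler_wpM2r ?expR_ge0.
  rewrite -expRD expR_le1.
  have : h * v j <= h * sg ^+ 2 by apply: ler_wpM2l => //; exact: fs.
  lra.
pose s x := \sum_j (f j (x (io j)) ^+ 2 + v j).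
have s0 x : 0 <= s x by apply: sumr_ge0 => j _; rewrite addr_ge0 ?sqr_ge0.
have E2 : Ex p (fun x => expR (h * s x)) <= expR q%:R.
  have -> : Ex p (fun x => expR (h * s x))
      = expR (3 * h * #|J|%:R * sg ^+ 2) * Ex p (fun x => expR (\sum_j G j x (x (io j)))).
    rewrite -ExZ; apply: eq_Ex => x; rewrite -expRD; congr expR.
    rewrite /G sumrB -mulr_sumr sumr_const -/(s x).
    rewrite -[(_ * sg ^+ 2) *+ _]mulr_natr; ring.
  apply: (@le_trans _ _ (expR (3 * h * #|J|%:R * sg ^+ 2))).
    by rewrite ler_piMr ?expR_ge0.
  rewrite ler_expR -hS /S.
  have : 0 <= h * (2 * q%:R * B ^+ 2) by nonneg.
  lra.
rewrite exprMn -expRM_natl mulr1 mulrC.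
apply: le_trans (_ : S ^+ q * Ex p (fun x => expR (h * s x)) <= _); last first.
  by rewrite ler_wpM2l // exprn_ge0 ?ltW.
rewrite -ExZ; apply: (Ex_le p_ge0) => x; rewrite -/(s x).
have -> : expR (h * s x) = expR (h * s x / q%:R) ^+ q.
  by rewrite -expRM_natr divfK ?gt_eqF.
rewrite -exprMn ler_pXn2r ?nnegrE ?s0 //; last by nonneg.
have hs : s x = S * (h * s x / q%:R).
  by rewrite mulrA mulrA [S * h]mulrC hS mulrAC divff ?mul1r ?gt_eqF.
rewrite {1}hs ler_wpM2l ?(ltW S0) //.
by have := expR_ge1Dx (h * s x / q%:R); lra.
Qed.

Variables (d D : nat) (io : 'I_d * 'I_D -> I) (e : 'I_d * 'I_D -> A -> R).
Variables (B sg : R).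
Hypothesis io_inj : injective io.
Hypothesis e_mean : forall ic, \sum_a p (io ic) a * e ic a = 0.
Hypothesis B_gt0 : 0 < B.
Hypothesis e_bound : forall ic a, `|e ic a| <= B.
Hypothesis e_var : forall ic, \sum_a p (io ic) a * e ic a ^+ 2 <= sg ^+ 2.

Definition rmat (x : X) : 'M[R]_(d, D) := \matrix_(i, c) e (i, c) (x (io (i, c))).

Definition rwt (x : X) : 'M[R]_(d, D) :=
  \matrix_(i, c) (e (i, c) (x (io (i, c))) ^+ 2
                  + \sum_a p (io (i, c)) a * e (i, c) a ^+ 2).

Lemma rmat_upd x ic a jc : jc != ic -> rmat x jc.1 jc.2 = rmat (upd x (io ic) a) jc.1 jc.2.
Proof.
move=> ji; rewrite !mxE upd_neq -?surjective_pairing //.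
by apply: contra ji => /eqP /io_inj ->.
Qed.

Definition col_scale (pw : nat) : R := expR 1 * (4 * pw%:R * B ^+ 2 + 3 * d%:R * sg ^+ 2).
Definition row_scale (pw : nat) : R := expR 1 * (4 * pw%:R * B ^+ 2 + 3 * D%:R * sg ^+ 2).
(** The constants are those of 2 c in [offgram_moment], namely 40 n and 2 n^2, with n = 2 pw - 1
    replaced by 2 pw. *)
Definition gram_scale (pw : nat) : R :=
  80 * pw%:R * col_scale pw * row_scale pw + 8 * pw%:R ^+ 2 * col_scale pw ^+ 2.

Definition rsum (pw : nat) (x : X) (t : 'I_D + 'I_d) : R :=
  match t with
  | inl c => (\sum_i rwt x i c) / col_scale pw
  | inr i => (\sum_c rwt x i c) / row_scale pw
  end.

Lemma col_scale_gt0 pw : (0 < pw)%N -> 0 < col_scale pw.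
Proof.
move=> pw0; apply: mulr_gt0; first exact: expR_gt0.
apply: ltr_pwDl; first by rewrite !mulr_gt0 ?exprn_gt0 ?ltr0n.
by nonneg.
Qed.

Lemma row_scale_gt0 pw : (0 < pw)%N -> 0 < row_scale pw.
Proof.
move=> pw0; apply: mulr_gt0; first exact: expR_gt0.
apply: ltr_pwDl; first by rewrite !mulr_gt0 ?exprn_gt0 ?ltr0n.
by nonneg.
Qed.

Lemma rwt_ge0 x i c : 0 <= rwt x i c.
Proof.
by rewrite mxE addr_ge0 ?sqr_ge0 // sumr_ge0 // => a _; rewrite mulr_ge0 ?sqr_ge0.
Qed.

Lemma rsum_ge0 pw x t : (0 < pw)%N -> 0 <= rsum pw x t.
Proof.
move=> pw0; have := col_scale_gt0 pw0; have := row_scale_gt0 pw0.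
by case: t => t h1 h2; apply: divr_ge0; rewrite ?(ltW h1) ?(ltW h2) //; apply: sumr_ge0 => u _; exact: rwt_ge0.
Qed.

Lemma rsum_moment pw t : (0 < pw)%N -> Ex p (fun x => rsum pw x t ^+ (2 * pw)) <= 1.
Proof.
move=> pw0; have q0 : (0 < 2 * pw)%N by rewrite muln_gt0.
have cs := col_scale_gt0 pw0; have rs := row_scale_gt0 pw0.
case: t => t /=.
- have inj1 : injective (fun i => io (i, t)) by move=> i j /io_inj [].
  have := @sumsq_moment _ (fun i => io (i, t)) (fun i => e (i, t)) B sg (2 * pw)
    inj1 B_gt0 q0 (fun i => e_bound (i, t))
    (fun i => e_var (i, t)).
  rewrite card_ord natrM mulrA -natrM -[X in X * pw%:R]/(4%:R) -/(col_scale pw) => h.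
  under eq_Ex do rewrite expr_div_n mulrC.
  rewrite ExZ mulrC ler_pdivrMr ?exprn_gt0 // mul1r; apply: le_trans h.
  rewrite le_eqVlt; apply/orP; left; apply/eqP; apply: eq_Ex => x.
  by congr (_ ^+ _); apply: eq_bigr => i _; rewrite mxE.
- have inj2 : injective (fun c => io (t, c)) by move=> i j /io_inj [].
  have := @sumsq_moment _ (fun c => io (t, c)) (fun c => e (t, c)) B sg (2 * pw)
    inj2 B_gt0 q0 (fun c => e_bound (t, c))
    (fun c => e_var (t, c)).
  rewrite card_ord natrM mulrA -natrM -[X in X * pw%:R]/(4%:R) -/(row_scale pw) => h.
  under eq_Ex do rewrite expr_div_n mulrC.
  rewrite ExZ mulrC ler_pdivrMr ?exprn_gt0 // mul1r; apply: le_trans h.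
  rewrite le_eqVlt; apply/orP; left; apply/eqP; apply: eq_Ex => x.
  by congr (_ ^+ _); apply: eq_bigr => i _; rewrite mxE.
Qed.

Lemma offgram_moment pw : (0 < pw)%N ->
  Ex p (fun x => fn (mxp (offgram (rmat x)) pw) ^+ 2)
  <= d%:R * (D + d)%:R * gram_scale pw ^+ pw.
Proof.
case: pw => // r _; set pw := r.+1.
pose mu x := \big[Num.max/0]_t rsum pw x t.
have mu0 x : 0 <= mu x.
  by rewrite /mu; elim/big_ind: _ => // [a b a0 _|t _]; rewrite ?le_max ?a0 ?rsum_ge0.
have cs := col_scale_gt0 (ltn0Sn r : (0 < pw)%N).
have rs := row_scale_gt0 (ltn0Sn r : (0 < pw)%N).
have rsum_mu x t : rsum pw x t <= mu x.
  exact: (@le_bigmax _ _ _ _ (rsum pw x)).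
pose n : R := r.*2.+1%:R.
pose c x := n ^+ 2 * (col_scale pw * mu x) ^+ 2
            + 10 * n * (col_scale pw * mu x) * (row_scale pw * mu x) * 2.
have n0 : 0 <= n by rewrite ler0n.
have c0 x : 0 <= c x.
  have h1 := ltW cs; have h2 := ltW rs.
  by rewrite /c; nonneg.
pose f x s := fn (mxp (offgram (rmat x)) s).
(* The cross term of [offgram_tropp_bound] is split by 2 x y <= x^2 + y^2, and half of the left side
   absorbs the higher moment. *)
have T1 : Ex p (fun x => f x pw ^+ 2) <= Ex p (fun x => c x * f x r ^+ 2).
  have := @tropp_trace R I A p p_ge0 p_sum1 _ io e d 2 (fun x => offgram (rmat x))
    (fun ic x => offgram_deriv (rmat x) ic) r e_mean.
  move=> /(_ (fun x => offgram_tr _)) /(_ (fun ic x => offgram_deriv_tr _ _)) T.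
  have {}T := T _ _ _.
  have : 2 * Ex p (fun x => f x pw ^+ 2)
     <= Ex p (fun x => f x pw ^+ 2) + Ex p (fun x => c x * f x r ^+ 2).
    apply: le_trans (T _ _ _) _.
    - move=> ic x a.
      suff E : punctured_col (rmat (upd x (io ic) a)) ic = punctured_col (rmat x) ic.
        by rewrite /offgram_deriv E.
      apply/rowP => k; rewrite [LHS]mxE [RHS]mxE; case: eqP => // /eqP ki.
      apply/esym; apply: (@rmat_upd x ic a (k, ic.2)).
      by apply: contra ki => /eqP <-.
    - move=> x; rewrite offgram_euler; apply: eq_bigr => ic _.
      by rewrite mxE -surjective_pairing.
    - move=> ic x a; rewrite (@offgram_diff _ _ _ _ _ ic); last first.
        by move=> jc; exact: rmat_upd.
      by rewrite !mxE -!surjective_pairing upd_id.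
    rewrite -ExD -ExZ; apply: (Ex_le p_ge0) => x.
    have := @offgram_tropp_bound R d D (rmat x) (rwt x) (col_scale pw * mu x)
      (row_scale pw * mu x) d (mxp (offgram (rmat x)) r).
    rewrite -mxpS -/(f x r) -/(f x r.+1) -/pw => T'.
    have {}T' := T' _ _ _ _.
    apply: (@le_trans _ _ (n * (2 * (col_scale pw * mu x) * (f x r * f x pw) +
       20 * (col_scale pw * mu x) * (row_scale pw * mu x) * f x r ^+ 2))).
      rewrite ler_wpM2l //; apply: le_trans (T' _ _ _ _).
      - rewrite le_eqVlt; apply/orP; left; apply/eqP; apply: eq_bigr => ic _.
        by rewrite mxE -surjective_pairing.
      - by rewrite mulr_ge0 // ltW.
      - move=> i j; rewrite !mxE lerDl sumr_ge0 // => a _.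
        by rewrite mulr_ge0 ?sqr_ge0.
      - by move=> j; rewrite mulrC -ler_pdivrMr //; exact: (rsum_mu x (inl j)).
      - by move=> i; rewrite mulrC -ler_pdivrMr //; exact: (rsum_mu x (inr i)).
    rewrite /c; have := sqr_ge0 (f x pw - n * (col_scale pw * mu x) * f x r).
    lra.
  lra.
(* Young's inequality along the log-convex moments trades the moment of order r for half the one of
   order r + 1 and for the zeroth one, which is d. *)
have T2 : Ex p (fun x => f x pw ^+ 2) <= Ex p (fun x => (2 * c x) ^+ pw * d%:R).
  have : Ex p (fun x => 2 * (c x * f x r ^+ 2))
      <= Ex p (fun x => f x pw ^+ 2 + (2 * c x) ^+ pw * d%:R).
    apply: (Ex_le p_ge0) => x.
    have := @logconvex_young R (fun s => f x s ^+ 2) (fun s => sqr_ge0 _)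
      (fn_mxp_logconvex (offgram_tr (rmat x))) (c x) r (c0 x).
    have -> : f x 0%N ^+ 2 = d%:R; last by [].
    by rewrite fn_sqr dotmxE trmx1 mulmx1 mxtrace1.
  rewrite ExZ ExD; lra.
apply: (le_trans T2).
have c_mu x : 2 * c x <= gram_scale pw * mu x ^+ 2.
  rewrite /c /gram_scale.
  have npw : n <= 2 * pw%:R.
    by rewrite -natrM ler_nat /pw; lia.
  have n2 : n ^+ 2 <= (2 * pw%:R) ^+ 2 by rewrite ler_pXn2r ?nnegrE ?mulr_ge0.
  have h1 : n ^+ 2 * (col_scale pw * mu x) ^+ 2 <= (2 * pw%:R) ^+ 2 * (col_scale pw * mu x) ^+ 2.
    by rewrite ler_wpM2r ?sqr_ge0.
  have h2 : n * ((col_scale pw * mu x) * (row_scale pw * mu x))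
     <= 2 * pw%:R * ((col_scale pw * mu x) * (row_scale pw * mu x)).
    by rewrite ler_wpM2r // mulr_ge0 // mulr_ge0 // ltW.
  lra.
have g0 : 0 <= gram_scale pw.
  by rewrite /gram_scale; nonneg.
(* The random scale mu is a maximum over rows and columns; its power is at most the sum of the
   powers, each of mean at most 1. *)
apply: (@le_trans _ _ (Ex p (fun x => d%:R * gram_scale pw ^+ pw
    * \sum_t rsum pw x t ^+ (2 * pw)))).
  apply: (Ex_le p_ge0) => x; rewrite -mulrA mulrC ler_wpM2l //.
  apply: (@le_trans _ _ ((gram_scale pw * mu x ^+ 2) ^+ pw)).
    by rewrite ler_pXn2r ?nnegrE ?mulr_ge0 ?sqr_ge0.
  rewrite exprMn -exprM ler_wpM2l ?exprn_ge0 //.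
  have -> : (2 * pw = (r.*2.+1).+1)%N by rewrite /pw; lia.
  by apply: bigmax_pow_le_sum => t; rewrite rsum_ge0.
rewrite ExZ Ex_sum [leRHS]mulrAC ler_wpM2l ?mulr_ge0 ?exprn_ge0 //.
apply: (@le_trans _ _ (\sum_(t : 'I_D + 'I_d) 1)).
  by apply: ler_sum => t _; exact: rsum_moment.
by rewrite sumr_const card_sum !card_ord.
Qed.

Definition gram_good (pw : nat) (x : X) : bool :=
  (fn (mxp (offgram (rmat x)) pw) <= (expR 1 * Num.sqrt (gram_scale pw)) ^+ pw)
  && [forall t, rsum pw x t <= expR 1].

Lemma gram_goodP pw x : (0 < pw)%N -> gram_good pw x ->
  [/\ opb (expR 1 * Num.sqrt (gram_scale pw)) (offgram (rmat x)),
      forall c, \sum_i rwt x i c <= expR 1 * col_scale pw &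
      forall i, \sum_c rwt x i c <= expR 1 * row_scale pw].
Proof.
move=> pw0 /andP[h1 /forallP h2]; split.
- case: pw pw0 h1 h2 => // r _ h1 h2; apply: (opb_of_mxp (offgram_tr _) _ h1).
  by rewrite mulr_ge0 ?expR_ge0 ?sqrtr_ge0.
- by move=> c; rewrite -ler_pdivrMr ?col_scale_gt0 //; exact: (h2 (inl c)).
- by move=> i; rewrite -ler_pdivrMr ?row_scale_gt0 //; exact: (h2 (inr i)).
Qed.

(** Markov's inequality at e times each moment scale: the power 2 pw produces exp(- 2 pw). *)
Lemma gram_concentration pw : (0 < pw)%N ->
  Pr p (fun x => ~~ gram_good pw x) <= (d.+1)%:R * (D + d)%:R * expR (- (2 * pw%:R)).
Proof.
move=> pw0.
have cs := col_scale_gt0 pw0; have rs := row_scale_gt0 pw0.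
have g0 : 0 < gram_scale pw.
  by rewrite /gram_scale; pos_tac.
have e2 : expR (- (2 * pw%:R)) = (expR 1 ^+ (2 * pw))^-1 :> R.
  by rewrite -expRM_natl mulr1 natrM expRN.
have P1 : Pr p (fun x => ~~ (fn (mxp (offgram (rmat x)) pw)
     <= (expR 1 * Num.sqrt (gram_scale pw)) ^+ pw)) <= d%:R * (D + d)%:R * expR (- (2 * pw%:R)).
  pose th := (expR 1 * Num.sqrt (gram_scale pw)) ^+ pw.
  have th0 : 0 < th by rewrite exprn_gt0 // mulr_gt0 ?expR_gt0 ?sqrtr_gt0.
  apply: (@le_trans _ _ (Ex p (fun x => fn (mxp (offgram (rmat x)) pw) ^+ 2) / th ^+ 2)).
    apply: (Pr_markov p_ge0); [by rewrite exprn_gt0|by move=> x; rewrite sqr_ge0|move=> x].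
    by rewrite -ltNge => /ltW h; rewrite ler_pXn2r ?nnegrE ?fn_ge0 ?(ltW th0).
  rewrite ler_pdivrMr; last by apply: exprn_gt0.
  apply: (le_trans (offgram_moment pw0)).
  rewrite -[leRHS]mulrA ler_wpM2l // /th -exprM mulnC exprMn e2 mulKf ?gt_eqF ?exprn_gt0 ?expR_gt0 //.
  by rewrite exprM sqr_sqrtr // ltW.
have P2 : Pr p (fun x => [exists t, ~~ (rsum pw x t <= expR 1)])
    <= (D + d)%:R * expR (- (2 * pw%:R)).
  apply: (le_trans (Pr_has p_ge0 _)).
  have -> : (D + d)%:R * expR (- (2 * pw%:R)) = \sum_(t : 'I_D + 'I_d) expR (- (2 * pw%:R)) :> R.
    by rewrite sumr_const card_sum !card_ord mulr_natl.
  apply: ler_sum => t _.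
  apply: (@le_trans _ _ (Ex p (fun x => rsum pw x t ^+ (2 * pw)) / expR 1 ^+ (2 * pw))).
    apply: (Pr_markov p_ge0); [by rewrite exprn_gt0 ?expR_gt0| |move=> x].
      by move=> x; rewrite exprn_ge0 ?rsum_ge0.
    by rewrite -ltNge => /ltW h; rewrite ler_pXn2r ?nnegrE ?rsum_ge0 ?expR_ge0 ?muln_gt0.
  rewrite e2 ler_pdivrMr ?exprn_gt0 ?expR_gt0 // mulVf ?gt_eqF ?exprn_gt0 ?expR_gt0 //.
  exact: rsum_moment.
apply: (@le_trans _ _ (d%:R * (D + d)%:R * expR (- (2 * pw%:R))
                      + (D + d)%:R * expR (- (2 * pw%:R)))); last first.
  by rewrite le_eqVlt; apply/orP; left; apply/eqP; rewrite -[d.+1%:R]natr1; ring.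
apply: le_trans (lerD P1 P2); apply: le_trans (Pr_or p_ge0 _ _).
by apply: (Pr_le p_ge0) => x /=; rewrite /gram_good negb_and negb_forall.
Qed.

End GramConcentration.

(** * Leave-one-out iterates and rows of singular vectors *)

Section LeaveOneOut.
Variables (R : realType) (n r : nat).

Definition mxdrop (i : 'I_n) : 'M[R]_n := \matrix_(j, k) ((j == k) && (j != i))%:R.

Lemma mxdropE i : mxdrop i = 1%:M - delta_mx i i.
Proof.
apply/matrixP => j k; rewrite !mxE; case: (eqVneq j k) => [<-|jk] /=.
  by rewrite andbb; case: (j == i); rewrite ?subrr ?subr0.
case: (eqVneq j i) => [ji|_] /=; last by rewrite subr0.
by case: (eqVneq k i) => [ki|_]; rewrite ?subr0 //; rewrite ji ki eqxx in jk.
Qed.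

Lemma mul_delta_row p (i : 'I_n) (W : 'M[R]_(n, p)) :
  delta_mx i i *m W = delta_mx i 0 *m row i W.
Proof. by rewrite rowE mulmxA mul_delta_mx. Qed.

Lemma mxdrop_mulE p (i : 'I_n) (W : 'M[R]_(n, p)) j k :
  (mxdrop i *m W) j k = if j == i then 0 else W j k.
Proof.
rewrite mxdropE mulmxBl mul1mx mul_delta_row !mxE big_ord1 !mxE eqxx andbT.
by case: eqVneq => [->|_]; rewrite ?mul1r ?subrr ?mul0r ?subr0.
Qed.

Lemma mxdrop_tr i : (mxdrop i)^T = mxdrop i.
Proof. by rewrite mxdropE linearB /= trmx1 trmx_delta. Qed.

Lemma mul_mxdropE p (i : 'I_n) (W : 'M[R]_(p, n)) j k :
  (W *m mxdrop i) j k = if k == i then 0 else W j k.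
Proof. by rewrite -[W]trmxK -mxdrop_tr -trmx_mul mxE mxdrop_mulE; case: eqP; rewrite ?mxE. Qed.

Lemma opb_mxdrop i : opb 1 (mxdrop i).
Proof.
move=> x; rewrite mul1r; apply: fn_le_sqr; first exact: fn_ge0.
rewrite !fn_sqr; apply: ler_sum => a _; apply: ler_sum => j _.
by rewrite mul_mxdropE; case: eqP => // _; rewrite mul0r -expr2 sqr_ge0.
Qed.

Definition loo_mx (i : 'I_n) (H : 'M[R]_n) : 'M[R]_n := mxdrop i *m H *m mxdrop i.

(** The starting matrix loses its row i too. Hence row i of every iterate is zero, and a multiple of
    the identity in H contributes nothing to row i of H times an iterate. *)
Definition loo_iter (i : 'I_n) (H : 'M[R]_n) (U : 'M[R]_(n, r)) (q : nat) : 'M[R]_(n, r) :=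
  mxp (loo_mx i H) q *m (mxdrop i *m U).

Lemma loo_mxE i H j k : loo_mx i H j k = if (j == i) || (k == i) then 0 else H j k.
Proof.
by rewrite /loo_mx mul_mxdropE mxdrop_mulE; case: (j == i); case: (k == i).
Qed.

Lemma loo_iterS i H U q : loo_iter i H U q.+1 = loo_mx i H *m loo_iter i H U q.
Proof. by rewrite /loo_iter mxpS !mulmxA. Qed.

Lemma loo_iter_row i H U q : row i (loo_iter i H U q) = 0.
Proof.
have dr p (W : 'M[R]_(n, p)) : row i (mxdrop i *m W) = 0.
  by apply/rowP => k; rewrite mxE mxdrop_mulE eqxx mxE.
by case: q => [|q]; rewrite ?loo_iterS /loo_iter ?mul1mx /loo_mx -?mulmxA dr.
Qed.

Variables (H : 'M[R]_n) (U : 'M[R]_(n, r)) (gam : R).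
Hypothesis H_sym : H^T = H.
Hypothesis gam_ge0 : 0 <= gam.
Hypothesis H_opb : opb gam H.

Lemma opb_loo_mx i : opb gam (loo_mx i H).
Proof.
have := opbM ler01 (opbM gam_ge0 (opb_mxdrop i) H_opb) (opb_mxdrop i).
by rewrite mul1r mulr1.
Qed.

Lemma opb_mxp q : opb (gam ^+ q) (mxp H q).
Proof.
elim: q => [|q IH]; first by rewrite expr0; exact: opb1.
by rewrite mxpS exprS; apply: opbM => //; exact: exprn_ge0.
Qed.

(** The two matrices differ in row i, which produces row i of H W, and in column i, which meets only
    row i of W. *)
Lemma fn_loo_sub p i (W : 'M[R]_(n, p)) :
  fn ((H - loo_mx i H) *m W) <= fn (row i (H *m W)) + gam * fn (row i W).
Proof.
have -> : (H - loo_mx i H) *m W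
   = delta_mx i i *m (H *m W) + mxdrop i *m (H *m (delta_mx i i *m W)).
  have -> : delta_mx i i = 1%:M - mxdrop i by rewrite mxdropE opprB addrC subrK.
  by rewrite /loo_mx !mulmxBl !mul1mx !mulmxBr !mulmxA addrA subrK.
apply: (le_trans (fnD _ _)); rewrite !mul_delta_row.
apply: lerD.
  by apply: (le_trans (fn_mulmx _ _)); rewrite fn_delta_mx mul1r.
apply: (le_trans (fn_opb_mulmx _ ler01 (opb_mxdrop i))); rewrite mul1r.
apply: (le_trans (fn_opb_mulmx _ gam_ge0 H_opb)); rewrite ler_wpM2l //.
by apply: (le_trans (fn_mulmx _ _)); rewrite fn_delta_mx mul1r.
Qed.

Variables (g : R).
Hypothesis g_large : 8 * gam <= g.

Lemma loo_close i (th : R) q : 0 <= th ->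
  (forall s, (s <= q)%N -> fn (row i (mxp H s *m U)) <= g ^+ s * th) ->
  fn (mxp H q *m U - loo_iter i H U q) <= 2 * (g ^+ q * th).
Proof.
move=> th0; have g0 : 0 <= g by apply: le_trans g_large; nonneg.
elim: q => [|q IH] hq.
  have := hq 0%N isT; rewrite /loo_iter !mul1mx expr0 mul1r => h.
  have -> : U - mxdrop i *m U = delta_mx i 0 *m row i U.
    by rewrite mxdropE mulmxBl mul1mx opprB addrC subrK mul_delta_row.
  apply: (le_trans (fn_mulmx _ _)); rewrite fn_delta_mx mul1r; lra.
have {}IH := IH (fun s sq => hq s (leqW sq)).
rewrite loo_iterS mxpS -mulmxA.
have -> : H *m (mxp H q *m U) - loo_mx i H *m loo_iter i H U q
  = loo_mx i H *m (mxp H q *m U - loo_iter i H U q) + (H - loo_mx i H) *m (mxp H q *m U).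
  by rewrite mulmxBr mulmxBl [RHS]addrC addrA subrK.
apply: (le_trans (fnD _ _)).
have h1 := fn_opb_mulmx (mxp H q *m U - loo_iter i H U q) gam_ge0 (opb_loo_mx i).
have h2 := fn_loo_sub i (mxp H q *m U).
have h3 := hq q.+1 (leqnn _); have h4 := hq q (leqnSn _).
rewrite mxpS -mulmxA exprS in h3.
have gq : 0 <= g ^+ q * th by nonneg.
have h5 : gam * fn (mxp H q *m U - loo_iter i H U q) <= gam * (2 * (g ^+ q * th)).
  by rewrite ler_wpM2l.
have h6 : gam * fn (row i (mxp H q *m U)) <= gam * (g ^+ q * th) by rewrite ler_wpM2l.
have h7 : 8 * gam * (g ^+ q * th) <= g * (g ^+ q * th) by rewrite ler_wpM2r.
have h8 : 0 <= gam * (g ^+ q * th) by nonneg.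
rewrite exprS; lra.
Qed.

(** All rows advance together. Row i of H meets the leave-one-out iterate, which takes half of the
    budget by [step], and its difference with the true iterate, which takes at most a quarter by
    [loo_close]. *)
Lemma loo_row_bound (th : 'I_n -> R) (q0 : nat) :
  (forall i, fn (row i U) <= th i) ->
  (forall i q, (q < q0)%N ->
     (forall j s, (s <= q)%N -> fn (row j (mxp H s *m U)) <= g ^+ s * th j) ->
     fn (row i H *m loo_iter i H U q) <= g ^+ q.+1 * th i / 2) ->
  forall q, (q <= q0)%N -> forall i, fn (row i (mxp H q *m U)) <= g ^+ q * th i.
Proof.
move=> U0 step.
have th0 i : 0 <= th i by apply: le_trans (U0 i); exact: fn_ge0.
suff K q : (q <= q0)%N -> forall j s, (s <= q)%N -> fn (row j (mxp H s *m U)) <= g ^+ s * th j.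
  by move=> q qq i; exact: (K q qq i q (leqnn _)).
elim: q => [|q IH] qq i s; first by rewrite leqn0 => /eqP ->; rewrite mul1mx expr0 mul1r.
rewrite leq_eqVlt ltnS => /orP[/eqP ->|]; last exact: (IH (ltnW qq)).
have {}IH := IH (ltnW qq).
have h1 := step i q qq IH.
have h2 := loo_close (th0 i) (IH i).
rewrite mxpS -mulmxA row_mul.
have -> : row i H *m (mxp H q *m U) = row i H *m loo_iter i H U q
   + row i H *m (mxp H q *m U - loo_iter i H U q).
  by rewrite mulmxBr addrC subrK.
apply: (le_trans (fnD _ _)).
have h3 : fn (row i H *m (mxp H q *m U - loo_iter i H U q)) <= gam * (2 * (g ^+ q * th i)).
  apply: (le_trans (fn_mulmx _ _)).
  by apply: ler_pM; rewrite ?fn_ge0 ?(opb_row _ H_opb).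
have h4 : 8 * gam * (g ^+ q * th i) <= g * (g ^+ q * th i).
  have g0 : 0 <= g by apply: le_trans g_large; nonneg.
  by rewrite ler_wpM2r //; nonneg.
have -> : g ^+ q.+1 * th i = g * (g ^+ q * th i) by rewrite exprS mulrA.
have h5 : 0 <= gam * (g ^+ q * th i).
  by have := le_trans (fn_ge0 _) h3; lra.
rewrite exprS -mulrA in h1; lra.
Qed.

Lemma loo_iter_row_le i j (thi thj : R) q : 0 <= thi ->
  (forall s, (s <= q)%N -> fn (row i (mxp H s *m U)) <= g ^+ s * thi) ->
  fn (row j (mxp H q *m U)) <= g ^+ q * thj ->
  fn (row j (loo_iter i H U q)) <= g ^+ q * (thj + 2 * thi).
Proof.
move=> thi0 hi hj; have h := loo_close thi0 hi.
have -> : loo_iter i H U q = mxp H q *m U - (mxp H q *m U - loo_iter i H U q).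
  by rewrite opprB addrC subrK.
rewrite linearB /=; apply: (le_trans (fnB _ _)).
have := fn_row_le (mxp H q *m U - loo_iter i H U q) j; lra.
Qed.

Lemma loo_iter_opb i q : opb 1 U -> opb (gam ^+ q) (loo_iter i H U q).
Proof.
move=> U1; have h : opb 1 (mxdrop i *m U).
  by have := opbM ler01 (opb_mxdrop i) U1; rewrite mul1r.
elim: q => [|q IH]; first by rewrite /loo_iter mul1mx expr0.
by rewrite loo_iterS exprS; apply: opbM (opb_loo_mx i) IH; exact: exprn_ge0.
Qed.

End LeaveOneOut.

Section RowPerturbation.
Variables (R : realType) (n q r : nat).
Variables (A H : 'M[R]_n) (U : 'M[R]_(n, q)) (V : 'M[R]_(n, r)) (S T : 'M[R]_r).
Variables (E : 'M[R]_(n, r)) (gam g ell v rho th : R) (q0 : nat) (i : 'I_n).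
Hypothesis U_orth : orthonormal_cols U.
Hypothesis UA : U *m U^T *m A = A.
Hypothesis eigenV : (A + H) *m V = V *m S + E.
Hypothesis ST : S *m T = 1%:M.
Hypothesis ell_gt0 : 0 < ell.
Hypothesis T_opb : opb ell^-1 T.
Hypothesis H_opb : opb gam H.
Hypothesis V_opb : opb v V.
Hypothesis E_opb : opb rho E.
Hypothesis gam_ge0 : 0 <= gam.
Hypothesis v_ge0 : 0 <= v.
Hypothesis rho_ge0 : 0 <= rho.
Hypothesis gam_le : gam <= ell / 2.
Hypothesis g_ge0 : 0 <= g.
Hypothesis g_le : g <= ell / 2.
Hypothesis rows : forall p, (p <= q0)%N -> fn (row i (mxp H p *m U)) <= g ^+ p * th.

(* The Neumann series V = sum_p H^p A V S^-(p+1) of the eigenvector equation,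
   truncated at order q0; only its first term is not small. *)
Lemma row_perturbation :
  fn (row i (V - U *m (U^T *m V)))
  <= th * (gam * v + rho) / ell + 2 * (g / ell) * (2 * v + rho / ell) * th
     + v * (1 / 2) ^+ q0.+1 + 2 * (rho / ell).
Proof.
have v0 := v_ge0; have rho0 := rho_ge0; have g0 := g_ge0; have gam0 := gam_ge0.
have elli : 0 <= ell^-1 by nonneg.
have rD (P Q : 'M[R]_(n, r)) : fn (row i (P + Q)) <= fn (row i P) + fn (row i Q).
  by rewrite linearD fnD.
have rB (P Q : 'M[R]_(n, r)) : fn (row i (P - Q)) <= fn (row i P) + fn (row i Q).
  by rewrite linearB fnB.
have half k (a : R) : 0 <= a -> a <= 1 / 2 -> a ^+ k <= (1 / 2) ^+ k.
  by move=> a0 ah; apply: lerXn2r; rewrite ?nnegrE.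
have th0 : 0 <= th.
  by have := le_trans (fn_ge0 _) (rows (leq0n _)); rewrite expr0 mul1r.
have th1 : fn (row i U) <= th by have := rows (leq0n _); rewrite mul1mx expr0 mul1r.
(* The coefficient of U in the zeroth term of the series. Multiplying the equation by U^T shows that
   it is U^T V up to small errors. *)
pose B := U^T *m A *m V *m T.
have VE : V = U *m B + H *m V *m T - E *m T.
  rewrite /B -mulmxA -[in X in X + _]mulmxA.
  have -> : U *m (U^T *m (A *m (V *m T))) = A *m V *m T by rewrite !mulmxA UA.
  rewrite -mulmxDl -mulmxBl -mulmxDl eigenV addrK -mulmxA ST mulmx1 //.
have BE : B = U^T *m V - U^T *m H *m V *m T + U^T *m E *m T.
  have /(congr1 (mulmx U^T)) := VE.
  rewrite mulmxBr mulmxDr mulmxA U_orth mul1mx !mulmxA => ->.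
  by rewrite addrAC subrK addrK.
have UT1 := opb_orthonormalT U_orth.
pose b := 2 * v + rho / ell.
have b0 : 0 <= b by rewrite /b; nonneg.
have ge : gam / ell <= 1 / 2 by rewrite ler_pdivrMr // mul1r mulrC.
have gle : g / ell <= 1 / 2 by rewrite ler_pdivrMr // mul1r mulrC.
have UHVT : opb (gam * v / ell) (U^T *m H *m V *m T).
  have := opbM elli (opbM v_ge0 (opbM gam_ge0 UT1 H_opb) V_opb) T_opb.
  by rewrite mul1r.
have UET : opb (rho / ell) (U^T *m E *m T).
  by have := opbM elli (opbM rho_ge0 UT1 E_opb) T_opb; rewrite mul1r.
have B_opb : opb b B.
  rewrite BE; apply: opb_le (opbD (opbB (opbM v_ge0 UT1 V_opb) UHVT) UET).
  rewrite mul1r /b lerD2r.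
  have : gam * v / ell <= 1 / 2 * v by rewrite mulrAC ler_wpM2r.
  lra.
pose x := g / ell.
have x0 : 0 <= x by rewrite /x; nonneg.
have Tp k : opb (ell^-1 ^+ k) (mxp T k).
  elim: k => [|k IH]; first by rewrite expr0; exact: opb1.
  by rewrite mxpS exprS; apply: opbM => //; exact: exprn_ge0.
have Hp := opb_mxp gam_ge0 H_opb.
have rem k : fn (row i (mxp H k *m E *m mxp T k.+1)) <= (1 / 2) ^+ k * (rho / ell).
  apply: (le_trans (opb_row i (opbM (exprn_ge0 _ elli) (opbM rho_ge0 (Hp k) E_opb) (Tp k.+1)))).
  have -> : gam ^+ k * rho * ell^-1 ^+ k.+1 = (gam / ell) ^+ k * (rho / ell).
    by rewrite exprMn exprS; ring.
  by apply: ler_wpM2r; [nonneg|apply: half => //; nonneg].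
(* Each substitution of the equation into its own last term adds one term of the series; the errors
   are geometric of ratio 1/2. *)
have main k : (k <= q0)%N ->
  fn (row i (V - U *m B - mxp H k.+1 *m V *m mxp T k.+1))
   <= 2 * x * b * th * (1 - (1 / 2) ^+ k) + 2 * (rho / ell) * (1 - (1 / 2) ^+ k.+1).
  elim: k => [_|k IH kq].
    have -> : V - U *m B - mxp H 1 *m V *m mxp T 1 = - (E *m T).
      by rewrite !mxp1 {1}VE -[LHS]addrA -opprD addrAC subrr add0r.
    rewrite linearN /= fnN expr0 subrr mulr0 add0r expr1.
    by have := rem 0%N; rewrite mul1mx mxp1 expr0; lra.
  have -> : V - U *m B - mxp H k.+2 *m V *m mxp T k.+2
     = (V - U *m B - mxp H k.+1 *m V *m mxp T k.+1)
       + (mxp H k.+1 *m U *m (B *m mxp T k.+1) - mxp H k.+1 *m E *m mxp T k.+2).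
    have -> : mxp H k.+1 *m V *m mxp T k.+1 = mxp H k.+1 *m U *m (B *m mxp T k.+1)
       + mxp H k.+2 *m V *m mxp T k.+2 - mxp H k.+1 *m E *m mxp T k.+2.
      rewrite {1}VE mulmxBr mulmxDr mulmxBl mulmxDl.
      by rewrite [mxp T k.+2]mxpS [mxp H k.+2]mxpSr !mulmxA.
    set a := _ *m (B *m _); set c := mxp H k.+2 *m V *m _; set e' := mxp H k.+1 *m E *m _.
    rewrite (addrAC a) -[RHS]addrA; congr (_ + _).
    by rewrite opprD addrAC addNr add0r.
  apply: (le_trans (rD _ _)).
  have h1 := IH (ltnW kq).
  have h2 := rem k.+1.
  have h3 : fn (row i (mxp H k.+1 *m U *m (B *m mxp T k.+1))) <= x * (1 / 2) ^+ k * b * th.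
    rewrite row_mul; apply: (le_trans (fn_mulmx_opb _ _ (opbM (exprn_ge0 _ elli) B_opb (Tp k.+1)))).
      by nonneg.
    apply: (@le_trans _ _ (b * ell^-1 ^+ k.+1 * (g ^+ k.+1 * th))).
      by rewrite ler_wpM2l ?rows //; nonneg.
    have -> : b * ell^-1 ^+ k.+1 * (g ^+ k.+1 * th) = x * x ^+ k * b * th.
      by rewrite /x exprMn !exprS; ring.
    by do 2! (apply: ler_wpM2r; first by nonneg); apply: ler_wpM2l => //; apply: half.
  have h4 := rB (mxp H k.+1 *m U *m (B *m mxp T k.+1)) (mxp H k.+1 *m E *m mxp T k.+2).
  have e1 : (1 / 2 : R) ^+ k.+1 = (1 / 2) ^+ k / 2 by rewrite exprS; lra.
  have e2 : (1 / 2 : R) ^+ k.+2 = (1 / 2) ^+ k / 4 by rewrite exprS e1; lra.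
  rewrite e1 in h1 h2; rewrite e1 e2; lra.
have := main q0 (leqnn _).
have -> : V - U *m (U^T *m V) = (V - U *m B - mxp H q0.+1 *m V *m mxp T q0.+1)
   + mxp H q0.+1 *m V *m mxp T q0.+1 - U *m (U^T *m H *m V *m T - U^T *m E *m T).
  rewrite subrK BE [U *m (_ + _)]mulmxDr [U *m (_ - _)]mulmxBr.
  rewrite [U *m (_ - _) in RHS]mulmxBr.
  move: (U *m (U^T *m V)) (U *m (U^T *m H *m V *m T)) (U *m (U^T *m E *m T)) => a b' c.
  rewrite -[RHS]addrA -opprD; congr (_ - _).
  have -> : a - b' + c = a - (b' - c) by rewrite opprB addrA addrAC.
  by rewrite subrK.
move=> h1; apply: (le_trans (rB _ _)).
have h2 : fn (row i (mxp H q0.+1 *m V *m mxp T q0.+1)) <= v * (1 / 2) ^+ q0.+1.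
  apply: (le_trans (opb_row i (opbM (exprn_ge0 _ elli) (opbM v_ge0 (Hp _) V_opb) (Tp _)))).
  have -> : gam ^+ q0.+1 * v * ell^-1 ^+ q0.+1 = v * (gam / ell) ^+ q0.+1.
    by rewrite exprMn; ring.
  by apply: ler_wpM2l => //; apply: half => //; nonneg.
have h3 : fn (row i (U *m (U^T *m H *m V *m T - U^T *m E *m T))) <= th * (gam * v + rho) / ell.
  rewrite row_mul; apply: (le_trans (fn_mulmx_opb _ _ (opbB UHVT UET))); first by nonneg.
  have -> : th * (gam * v + rho) / ell = (gam * v / ell + rho / ell) * th by ring.
  by rewrite ler_wpM2l //; nonneg.
have h5 := rD (V - U *m B - mxp H q0.+1 *m V *m mxp T q0.+1)
  (mxp H q0.+1 *m V *m mxp T q0.+1).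
have p0 : 0 <= (1 / 2 : R) ^+ q0 by nonneg.
have h6 : 0 <= 2 * x * b * th * (1 / 2) ^+ q0 by nonneg.
have h7 : 0 <= rho / ell * (1 / 2) ^+ q0.+1 by nonneg.
rewrite -/b -/x; lra.
Qed.

End RowPerturbation.

(** * Spectral gap of the shifted Gram matrix and projections on its top eigenspace *)

Section SpectralGap.
Variables (R : realType) (d D r : nat).
Variables (X M : 'M[R]_(d, D)) (U : 'M[R]_(d, r)) (v lam gam : R).
Variables (F : 'M[R]_d) (s : nat -> R) (W : 'M[R]_D) (le_rd : (r <= d)%N).
Hypothesis svdX : is_svd X F s W.
Hypothesis U_orth : orthonormal_cols U.
Hypothesis UM : U *m U^T *m M = M.
Hypothesis lam_gt0 : 0 < lam.
Hypothesis lam_le : forall y : 'rV[R]_r, lam * fn y <= fn (y *m U^T *m M).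
Hypothesis gam_ge0 : 0 <= gam.

Local Notation V := (colsub (widen_ord le_rd) F).
Local Notation H := (X *m X^T - v%:M - M *m M^T).
Local Notation G := (X *m X^T - v%:M).

Hypothesis H_opb : opb gam H.

Lemma svd_form : X *m X^T = F *m diag_mx (\row_j s j ^+ 2) *m F^T.
Proof.
case: svdX => F1 W1 smono s0 XE.
rewrite XE !trmx_mul !trmxK -!mulmxA; congr (_ *m _).
rewrite [W^T *m _]mulmxA W1 mul1mx mulmxA; congr (_ *m _).
apply/matrixP => j k; rewrite !mxE.
have [jD|Dj] := ltnP j D; last first.
  rewrite s0 ?geq_min ?Dj ?orbT // expr0n /= mul0rn big1 // => c _.
  by rewrite !mxE s0 ?geq_min ?Dj ?orbT // mul0rn mul0r.
rewrite (bigD1 (Ordinal jD)) //= !mxE eqxx mulr1n big1 ?addr0 => [|c cj].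
  case: (eqVneq j k) => [<-|jk]; first by rewrite eqxx !mulr1n expr2.
  rewrite mulr0n; case: eqP => [kj|_]; last by rewrite mulr0n mulr0.
  by case/negP: jk; apply/eqP/val_inj.
rewrite !mxE; case: eqP => [jc|_]; last by rewrite mulr0n mul0r.
by case/negP: cj; apply/eqP/val_inj.
Qed.

Lemma F_orth : orthonormal_cols F. Proof. by case: svdX. Qed.

Lemma FFT : F *m F^T = 1%:M. Proof. exact: orthonormal_square F_orth. Qed.

Lemma G_form : G = F *m diag_mx (\row_j (s j ^+ 2 - v)) *m F^T.
Proof.
rewrite svd_form.
have -> : diag_mx (\row_j (s j ^+ 2 - v)) = diag_mx (\row_j s j ^+ 2) - v%:M :> 'M[R]_d.
  by apply/matrixP => j k; rewrite !mxE mulrnBl.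
by rewrite mulmxBr mulmxBl mul_mx_scalar -scalemxAl FFT scalemx1.
Qed.

Lemma s_antitone i j : (i <= j)%N -> s j <= s i.
Proof.
case: svdX => _ _ smono _ _; elim: j => [|j IH]; first by rewrite leqn0 => /eqP ->.
rewrite leq_eqVlt => /orP[/eqP -> //|]; rewrite ltnS => /IH.
by apply: le_trans; have /andP[] := smono j.
Qed.

Lemma s_ge0 j : 0 <= s j.
Proof. by case: svdX => _ _ smono _ _; have /andP[h1 h2] := smono j; exact: le_trans h2. Qed.

Lemma quad_form (y : 'rV[R]_d) :
  dotmx (y *m X *m X^T) y = \sum_j (y *m F) 0 j ^+ 2 * s j ^+ 2.
Proof.
rewrite -mulmxA svd_form !mulmxA dotmx_mulr trmxK /dotmx big_ord1.
apply: eq_bigr => j _; rewrite mul_mx_diag !mxE; ring.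
Qed.

Lemma fn_coord (y : 'rV[R]_d) : fn y ^+ 2 = \sum_j (y *m F) 0 j ^+ 2.
Proof.
have -> : fn y = fn (y *m F).
  by rewrite -[F]trmxK fn_mulmxT // /orthonormal_cols trmxK FFT.
by rewrite fn_sqr /dotmx big_ord1; apply: eq_bigr => j _; rewrite expr2.
Qed.

Lemma dot_H (y : 'rV[R]_d) : `|dotmx (y *m H) y| <= gam * fn y ^+ 2.
Proof.
apply: (le_trans (cauchy_schwarz_norm _ _)).
by rewrite expr2 mulrA ler_wpM2r ?fn_ge0.
Qed.

Lemma dot_XX (y : 'rV[R]_d) :
  dotmx (y *m X *m X^T) y = dotmx (y *m H) y + fn (y *m M) ^+ 2 + v * fn y ^+ 2.
Proof.
have -> : y *m X *m X^T = y *m H + y *m M *m M^T + v *: y.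
  by rewrite -!mulmxA -mulmxDr subrK mulmxBr mul_mx_scalar subrK.
by rewrite !dotmxDl dotmxZl [dotmx (y *m M *m M^T) y]dotmx_mulr trmxK -!fn_sqr.
Qed.

Lemma kernel_vector p q (B : 'M[R]_(p, q)) : (q < p)%N ->
  exists2 c : 'rV[R]_p, fn c != 0 & c *m B = 0.
Proof.
move=> qp; have : kermx B != 0.
  rewrite -mxrank_eq0 mxrank_ker -lt0n subn_gt0.
  by apply: leq_ltn_trans qp; exact: rank_leq_col.
move=> /eqP k0; have [i ki] : exists i, row i (kermx B) != 0.
  apply/existsP; rewrite -negb_forall; apply/negP => /forallP h; apply: k0.
  by apply/row_matrixP => i; rewrite row0; exact/eqP.
exists (row i (kermx B)); last by rewrite -row_mul mulmx_ker row0.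
by apply: contra ki => /eqP h; rewrite (fn_eq0 h).
Qed.

(** Courant-Fischer: the r-dimensional range of U contains a vector orthogonal to the first r - 1
    singular vectors of X. On it M stretches by at least lam, and X by at most the r-th singular
    value. *)
Lemma s_top j : (j < r)%N -> lam ^+ 2 - gam <= s j ^+ 2 - v.
Proof.
move=> jr; have [r' rE] : exists r', r = r'.+1 by case: (r) jr => // r' _; exists r'.
have r'd : (r' <= d)%N by rewrite (leq_trans _ le_rd) // rE.
have [c c0 cF] := @kernel_vector r r' (U^T *m colsub (widen_ord r'd) F) (eq_leq (esym rE)).
pose y := c *m U^T.
have yc : fn y = fn c by rewrite fn_mulmxT.
have yF (k : 'I_d) : (k < r')%N -> (y *m F) 0 k = 0.
  move=> kr; have /rowP /(_ (Ordinal kr)) := cF; rewrite mulmxA -/y.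
  rewrite mulmx_colsub [RHS]mxE mxE => <-; congr (_ 0 _); exact/val_inj.
have h1 : dotmx (y *m X *m X^T) y <= s r' ^+ 2 * fn y ^+ 2.
  rewrite quad_form fn_coord mulr_sumr; apply: ler_sum => k _.
  have [kr|rk] := ltnP k r'; first by rewrite yF // expr0n mul0r mulr0.
  rewrite mulrC ler_wpM2r ?sqr_ge0 // ler_pXn2r ?nnegrE ?s_ge0 //.
  exact: s_antitone.
have h2 := dot_XX y; have := dot_H y; rewrite ler_norml => /andP[h3 _].
have h4 : lam ^+ 2 * fn y ^+ 2 <= fn (y *m M) ^+ 2.
  by rewrite -exprMn ler_pXn2r ?nnegrE ?mulr_ge0 ?fn_ge0 ?(ltW lam_gt0) // yc lam_le.
have y0 : 0 < fn y ^+ 2 by rewrite exprn_even_gt0 //= yc.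
have h5 : (lam ^+ 2 - gam + v) * fn y ^+ 2 <= s r' ^+ 2 * fn y ^+ 2 by lra.
rewrite ler_pM2r // in h5.
have h6 : s r' ^+ 2 <= s j ^+ 2.
  by rewrite ler_pXn2r ?nnegrE ?s_ge0 // s_antitone // -ltnS -rE.
lra.
Qed.

Lemma inj_widen_ord a b (ab : (a <= b)%N) : injective (widen_ord ab).
Proof. by move=> x y /(congr1 val) /= h; exact/val_inj. Qed.

Local Notation f := (widen_ord le_rd).
Definition topsel : 'M[R]_(d, r) := colsub f 1%:M.
Local Notation J := topsel.

Lemma V_topsel : V = F *m J.
Proof. by rewrite mulmx_colsub mulmx1. Qed.

Lemma topselE j k : J j k = (j == f k)%:R.
Proof. by rewrite !mxE. Qed.

Lemma topsel_orth : orthonormal_cols J.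
Proof.
apply/matrixP => j k; rewrite !mxE (bigD1 (f j)) //= !mxE eqxx mul1r big1 ?addr0.
  by congr (_%:R); rewrite (inj_eq (@inj_widen_ord _ _ le_rd)).
by move=> l lj; rewrite !mxE (negbTE lj) mul0r.
Qed.

Lemma topsel_proj : J *m J^T = diag_mx (\row_k (k < r)%:R).
Proof.
apply/matrixP => j k; rewrite !mxE.
have [jr|rj] := ltnP j r; last first.
  rewrite mul0rn big1 // => l _; rewrite !mxE.
  have -> : (j == f l) = false; last by rewrite mul0r.
  by apply/negbTE/negP => /eqP jl; move: rj; rewrite jl /= leqNgt ltn_ord.
rewrite (bigD1 (Ordinal jr)) //= !mxE big1 ?addr0.
  have -> : f (Ordinal jr) = j by exact/val_inj.
  by rewrite eqxx mul1r eq_sym.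
move=> l lj; rewrite !mxE; case: eqP => [jl|_]; last by rewrite mul0r.
by case/negP: lj; apply/eqP/val_inj; rewrite /= jl.
Qed.

Lemma V_orth : orthonormal_cols V.
Proof.
rewrite /orthonormal_cols V_topsel trmx_mul -mulmxA (mulmxA F^T) F_orth mul1mx.
exact: topsel_orth.
Qed.

(** From below, test the j-th singular vector and drop the nonnegative term of M. From above, the
    first r + 1 singular vectors span a vector orthogonal to U, on which M vanishes. *)
Lemma s_bottom (j : 'I_d) : (r <= j)%N -> `|s j ^+ 2 - v| <= gam.
Proof.
move=> rj; rewrite ler_norml; apply/andP; split.
  pose y : 'rV[R]_d := row j F^T.
  have yF : y *m F = delta_mx 0 j by rewrite /y -row_mul F_orth row1.
  have y1 : fn y ^+ 2 = 1.
    rewrite fn_coord yF (bigD1 j) //= big1 => [|k kj]; rewrite !mxE ?eqxx /=.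
      by rewrite expr1n addr0.
    by rewrite (negbTE kj) expr0n.
  have := quad_form y; rewrite yF (bigD1 j) //= big1 => [|k kj]; last first.
    by rewrite !mxE (negbTE kj) /= expr0n mul0r.
  rewrite !mxE !eqxx expr1n mul1r addr0 => h1.
  have := dot_XX y; have := dot_H y; rewrite ler_norml h1 y1 => /andP[h3 _].
  have := sqr_ge0 (fn (y *m M)); lra.
have rd : (r < d)%N by exact: leq_ltn_trans rj _.
pose Fr := colsub (widen_ord rd) F.
have FrF : Fr^T *m F = rowsub (widen_ord rd) 1%:M.
  by rewrite -F_orth -mul_rowsub_mx; congr (_ *m _); apply/matrixP => a b; rewrite !mxE.
have FrFr : Fr^T *m Fr = 1%:M.
  rewrite /Fr mulmx_colsub -/Fr FrF; apply/matrixP => a b; rewrite !mxE.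
  by rewrite (inj_eq (@inj_widen_ord _ _ rd)).
have [c c0 cF] := @kernel_vector r.+1 r (Fr^T *m U) (leqnn _).
pose y := c *m Fr^T.
have yc : fn y = fn c by rewrite fn_mulmxT.
have yM : y *m M = 0 by rewrite -UM !mulmxA -(mulmxA c) cF !mul0mx.
have yF (k : 'I_d) : (r < k)%N -> (y *m F) 0 k = 0.
  move=> rk; rewrite -mulmxA FrF mxE big1 // => l _; rewrite !mxE.
  have -> : (widen_ord rd l == k) = false; last by rewrite mulr0.
  by apply/negbTE/negP => /eqP lk; move: rk; rewrite -lk /= ltnNge -ltnS ltn_ord.
have h1 : s r ^+ 2 * fn y ^+ 2 <= dotmx (y *m X *m X^T) y.
  rewrite quad_form fn_coord mulr_sumr; apply: ler_sum => k _.
  have [rk|kr] := ltnP r k; first by rewrite yF // expr0n mul0r mulr0.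
  rewrite mulrC ler_wpM2l ?sqr_ge0 // ler_pXn2r ?nnegrE ?s_ge0 //.
  exact: s_antitone.
have h2 := dot_XX y; have := dot_H y; rewrite ler_norml => /andP[_ h3].
rewrite yM fn0 expr0n addr0 in h2.
have y0 : 0 < fn y ^+ 2 by rewrite exprn_even_gt0 //= yc.
have h5 : s r ^+ 2 * fn y ^+ 2 <= (gam + v) * fn y ^+ 2 by lra.
rewrite ler_pM2r // in h5.
have h6 : s j ^+ 2 <= s r ^+ 2.
  by rewrite ler_pXn2r ?nnegrE ?s_ge0 // s_antitone.
lra.
Qed.

Local Notation P := (V *m V^T).

Lemma opb_diag p c (t : 'rV[R]_p) : 0 <= c -> (forall k, `|t 0 k| <= c) -> opb c (diag_mx t).
Proof.
move=> c0 tc x; apply: fn_le_sqr; first by nonneg; exact: fn_ge0.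
rewrite exprMn !fn_sqr /dotmx !big_ord1 mulr_sumr; apply: ler_sum => k _.
rewrite mul_mx_diag mxE -expr2 exprMn -expr2 mulrC ler_wpM2r ?sqr_ge0 //.
by rewrite -real_normK ?num_real // ler_pXn2r ?nnegrE.
Qed.

(** 1 - P and G are diagonal in the basis F: the top r eigenvalues are erased and [s_bottom] bounds
    the others. *)
Lemma opb_compG : opb gam ((1%:M - P) *m G).
Proof.
have -> : (1%:M - P) *m G = F *m diag_mx (\row_k (if (k < r)%N then 0 else s k ^+ 2 - v)) *m F^T.
  have -> : 1%:M - P = F *m (1%:M - J *m J^T) *m F^T.
    by rewrite V_topsel trmx_mul mulmxBr mulmxBl mulmx1 FFT !mulmxA.
  rewrite G_form -!mulmxA (mulmxA F^T) F_orth mul1mx; congr (_ *m _); rewrite !mulmxA; congr (_ *m _).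
  rewrite topsel_proj; apply/matrixP => j k; rewrite mulmxBl mul1mx mul_diag_mx !mxE.
  case: ltnP => _; case: eqP => [->|_]; rewrite ?mulr1n ?mulr0n ?mul1r ?mul0r ?mulr0 ?subrr ?subr0 //.
have F1 : opb 1 F by apply: opb_orthonormal; exact: F_orth.
have FT1 : opb 1 F^T by apply: opb_orthonormalT; exact: F_orth.
have := opbM ler01 (opbM gam_ge0 F1 (@opb_diag _ gam (\row_k (if (k < r)%N then 0 else s k ^+ 2 - v)) gam_ge0 _)) FT1.
rewrite mul1r mulr1; apply => k; rewrite mxE; case: ltnP => kr; first by rewrite normr0.
exact: s_bottom.
Qed.

Lemma comp_MMT : (1%:M - P) *m (M *m M^T) = (1%:M - P) *m G - (1%:M - P) *m H.
Proof. by rewrite -mulmxBr; congr (_ *m _); rewrite opprB addrCA subrr addr0. Qed.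

Lemma opb_compMMT : opb (2 * gam) ((1%:M - P) *m (M *m M^T)).
Proof.
rewrite comp_MMT; have -> : 2 * gam = gam + 1 * gam by ring.
apply: opbB; first exact: opb_compG.
apply: opbM => // x; rewrite mul1r; apply: fn_le_sqr; first exact: fn_ge0.
rewrite fn_sqr mulmxBr mulmx1 !(dotmxDl, dotmxDr, dotmxNl, dotmxNr).
have -> : dotmx (x *m P) (x *m P) = dotmx (x *m P) x.
  rewrite [LHS]dotmx_mulr [RHS]dotmx_mulr trmx_mul trmxK.
  by rewrite -!mulmxA (mulmxA V^T V) V_orth mul1mx.
rewrite (dotmxC x (x *m P)) -(fn_sqr x).
have : 0 <= dotmx (x *m P) x by rewrite mulmxA dotmx_mulr trmxK dotmx_ge0.
lra.
Qed.

Lemma lam_gram (y : 'rV[R]_r) :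
  lam * fn (y *m U^T *m M) <= fn (y *m U^T *m M *m M^T *m U).
Proof.
have [y0|y0] := eqVneq (fn (y *m U^T *m M)) 0; first by rewrite y0 mulr0 fn_ge0.
have yp : 0 < fn (y *m U^T *m M) by rewrite lt_neqAle eq_sym y0 fn_ge0.
rewrite -(ler_pM2r yp) -mulrA -expr2 fn_sqr.
have -> : dotmx (y *m U^T *m M) (y *m U^T *m M) = dotmx (y *m U^T *m M *m M^T *m U) y.
  by rewrite [RHS]dotmx_mulr [RHS]dotmx_mulr trmxK.
apply: (@le_trans _ _ (lam * (fn (y *m U^T *m M *m M^T *m U) * fn y))).
  by rewrite ler_pM2l // cauchy_schwarz.
by rewrite mulrCA ler_wpM2l ?fn_ge0 // lam_le.
Qed.

(** M M^T differs from G by H, so (1 - P) M M^T is small. Undoing the singular values of M costs 1 /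
    lam, and the r columns of U cost sqrt r in Frobenius norm. *)
Lemma fn_compM : fn ((1%:M - P) *m M) <= 2 * gam * Num.sqrt r%:R / lam.
Proof.
rewrite ler_pdivlMr // mulrC.
have key : lam * fn ((1%:M - P) *m M) <= fn ((1%:M - P) *m (M *m M^T) *m U).
  have l0 := ltW lam_gt0.
  rewrite -(@ler_pXn2r _ 2) ?nnegrE ?mulr_ge0 ?fn_ge0 // exprMn !fn_sqr_rows mulr_sumr.
  apply: ler_sum => i _; rewrite -exprMn ler_pXn2r ?nnegrE ?mulr_ge0 ?fn_ge0 //.
  rewrite !row_mul; set y := row i _.
  have -> : y *m M = y *m U *m U^T *m M by rewrite -!mulmxA (mulmxA U) UM.
  apply: (le_trans (lam_gram _)).
  by rewrite -!mulmxA (mulmxA U U^T) (mulmxA (U *m U^T)) UM.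
apply: (le_trans key).
apply: (le_trans (fn_opb_mulmx _ _ opb_compMMT)); first by nonneg.
by rewrite fn_orthonormal.
Qed.

Lemma opb_compU : opb (2 * gam / lam ^+ 2) ((1%:M - P) *m U).
Proof.
have l2 : 0 < lam ^+ 2 by rewrite exprn_gt0.
move=> x; rewrite mulrAC ler_pdivlMr // mulrC.
have h1 := lam_le (x *m ((1%:M - P) *m U)).
have h2 := lam_gram (x *m ((1%:M - P) *m U)).
have h3 : fn (x *m ((1%:M - P) *m (M *m M^T)) *m U) <= 2 * gam * fn x.
  apply: (le_trans (fn_mulmx_opb _ ler01 (opb_orthonormal U_orth))).
  by rewrite mul1r; exact: opb_compMMT.
have e : x *m ((1%:M - P) *m U) *m U^T *m M *m M^T *m U
   = x *m ((1%:M - P) *m (M *m M^T)) *m U.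
  by rewrite -!mulmxA (mulmxA U U^T) (mulmxA (U *m U^T)) UM.
rewrite e in h2; apply: le_trans h3; apply: le_trans h2.
by rewrite expr2 -mulrA ler_wpM2l // ltW.
Qed.

Lemma G_eigen : G *m V = V *m diag_mx (\row_(j < r) (s j ^+ 2 - v)).
Proof.
rewrite G_form V_topsel -!mulmxA (mulmxA F^T) F_orth mul1mx; congr (_ *m _).
apply/matrixP => j k; rewrite mul_diag_mx mul_mx_diag !mxE.
by case: eqP => [->|_]; rewrite ?mulr1 ?mul1r ?mulr0 ?mul0r.
Qed.

(** Split (P - 1) U into the rows of V - U U^T V, followed by the contraction V^T U, and U times a
    small matrix, whose rows are bounded by those of U. *)
Lemma row_compU th i : fn (row i U) <= th ->
  fn (row i ((P - 1%:M) *m U)) <= fn (row i (V - U *m (U^T *m V))) + th * (2 * gam / lam ^+ 2).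
Proof.
move=> Uth; have l2 : 0 < lam ^+ 2 by rewrite exprn_gt0.
have -> : (P - 1%:M) *m U = (V - U *m (U^T *m V)) *m (V^T *m U) - U *m (U^T *m ((1%:M - P) *m U)).
  have e1 : (V - U *m (U^T *m V)) *m (V^T *m U) = P *m U - U *m (U^T *m (P *m U)).
    by rewrite mulmxBl !mulmxA.
  have e2 : U *m (U^T *m ((1%:M - P) *m U)) = U - U *m (U^T *m (P *m U)).
    by rewrite [(1%:M - P) *m U]mulmxBl mul1mx mulmxBr U_orth mulmxBr mulmx1.
  by rewrite e1 e2 mulmxBl mul1mx opprB addrA subrK.
apply: (le_trans (_ : _ <= fn (row i ((V - U *m (U^T *m V)) *m (V^T *m U)))
    + fn (row i (U *m (U^T *m ((1%:M - P) *m U)))))).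
  by rewrite linearB fnB.
rewrite !row_mul; apply: lerD.
  have := opbM ler01 (opb_orthonormalT V_orth) (opb_orthonormal U_orth).
  by rewrite mulr1 => h; apply: (le_trans (h _)); rewrite mul1r.
have := opbM _ (opb_orthonormalT U_orth) opb_compU; rewrite mul1r => h.
have g0 : 0 <= 2 * gam / lam ^+ 2 by nonneg.
apply: (le_trans (h g0 _)); rewrite mulrC; apply: ler_wpM2r => //.
Qed.

End SpectralGap.

Lemma subr_sub2 (V : zmodType) (x a b : V) : x - (x - a - b) = a + b.
Proof. by rewrite -addrA -opprD opprB addrC subrK. Qed.

Section SingularValues.
Variable R : realType.

(** The chosen value is attained by some decomposition, which may vary with i; every later fact is
    therefore proved for an arbitrary decomposition. *)
Lemma singular_value_spec d D (M : 'M[R]_(d, D)) i :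
  exists F s W, is_svd M F s W /\ singular_value M i = s i.
Proof.
have [F [s [W h]]] := svd_exists M.
have /(@xgetPex _ 0) : exists x, [set x | exists U s W, is_svd M U s W /\ x = s i] x.
  by exists (s i), F, s, W.
by [].
Qed.

Lemma fn_mulmx_svd d D (M : 'M[R]_(d, D)) F s W (x : 'rV[R]_d) : is_svd M F s W ->
  fn (x *m M) ^+ 2 = \sum_j (x *m F) 0 j ^+ 2 * s j ^+ 2.
Proof. by move=> h; rewrite -(quad_form h) fn_sqr [RHS]dotmx_mulr trmxK. Qed.

Lemma singular_value_ge0 d D (M : 'M[R]_(d, D)) i : 0 <= singular_value M i.
Proof. by have [F [s [W [h ->]]]] := singular_value_spec M i; exact: s_ge0 h i. Qed.

Lemma singular_value_opb d D (M : 'M[R]_(d, D)) : opb (singular_value M 0) M.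
Proof.
have [F [s [W [h ->]]]] := singular_value_spec M 0.
move=> x; apply: fn_le_sqr; first by rewrite mulr_ge0 ?fn_ge0 ?(s_ge0 h).
rewrite exprMn (fn_mulmx_svd _ h) (fn_coord h) mulr_sumr; apply: ler_sum => j _.
rewrite mulrC ler_wpM2r ?sqr_ge0 // ler_pXn2r ?nnegrE ?(s_ge0 h) //.
exact: s_antitone h _ _ _.
Qed.

(** Without noise and shift the Gram error is zero, so [opb_compG] at gam = 0 gives V V^T M = M: V
    and U span the same space. A vanishing singular value would give a unit vector of that space
    killed by M, against the right inverse of U^T M. *)
Lemma singular_value_rank d D r (M : 'M[R]_(d, D)) (U : 'M[R]_(d, r)) :
  orthonormal_cols U -> U *m U^T *m M = M -> \rank M = r -> (0 < r)%N ->
  0 < singular_value M r.-1 /\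
  forall y : 'rV[R]_r, singular_value M r.-1 * fn y <= fn (y *m U^T *m M).
Proof.
move=> U1 UM rM r0; have [F [s [W [h ->]]]] := singular_value_spec M r.-1.
have le_rd : (r <= d)%N by rewrite -rM rank_leq_row.
pose V := colsub (widen_ord le_rd) F.
have H0 : opb 0 (M *m M^T - (0 : R)%:M - M *m M^T).
  by rewrite raddf0 subr0 subrr; exact: opb0.
have V1 : orthonormal_cols V := V_orth le_rd h.
have PM : V *m V^T *m M = M.
  have P0 : (1%:M - V *m V^T) *m (M *m M^T) = 0.
    have := opb_compG le_rd h UM (lexx 0) H0; rewrite raddf0 subr0 => h0.
    apply/row_matrixP => i; rewrite row0; apply: fn_eq0; apply/eqP.
    by rewrite eq_le fn_ge0 andbT; exact: (opb_row i h0).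
  have P1 : (1%:M - V *m V^T) *m M = 0.
    apply: fn_eq0; apply/eqP; rewrite -sqrf_eq0 fn_sqr dotmx_mulr -mulmxA.
    by rewrite [_ *m (M *m M^T)]P0 dotmxC dotmx0l.
  by move: P1; rewrite mulmxBl mul1mx => /eqP; rewrite subr_eq0 => /eqP.
have : row_free (U^T *m M).
  rewrite /row_free eqn_leq rank_leq_row /= -{1}rM -[M in X in (X <= _)%N]UM -mulmxA.
  exact: mxrankM_maxr.
move=> /row_freeP[B MB].
have UE : U = M *m B by rewrite -[LHS]mulmx1 -MB !mulmxA UM.
have PU : V *m V^T *m U = U by rewrite UE mulmxA PM.
have O1 : (V^T *m U) *m (V^T *m U)^T = 1%:M.
  apply: orthonormal_square; rewrite /orthonormal_cols trmx_mul trmxK.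
  by rewrite -mulmxA (mulmxA V) PU.
have r1d : (r.-1 < d)%N by rewrite (leq_trans _ le_rd) // ltn_predL.
have r1r : (r.-1 < r)%N by rewrite ltn_predL.
split.
  rewrite lt_neqAle (s_ge0 h) andbT eq_sym; apply/negP => /eqP s0.
  have := svd_row_norm (Ordinal r1d) h; rewrite s0 => /fn_eq0 vM.
  pose e : 'rV[R]_r := delta_mx 0 (Ordinal r1r).
  have eV : e *m V^T *m M = 0.
    rewrite -vM row_mul; congr (_ *m _); rewrite -rowE; apply/rowP => j; rewrite !mxE.
    by congr (F _ _); apply/val_inj.
  have : e *m (V^T *m U) = 0.
    have : e *m (V^T *m U) *m (U^T *m M) *m B = 0.
      by rewrite -!mulmxA (mulmxA U) (mulmxA (U *m U^T)) UM !mulmxA eV mul0mx.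
    by rewrite -mulmxA MB mulmx1.
  move=> /(congr1 (mulmx^~ (V^T *m U)^T)); rewrite -mulmxA O1 mulmx1 mul0mx.
  move=> /matrixP /(_ 0 (Ordinal r1r)); rewrite !mxE !eqxx => /eqP.
  by rewrite oner_eq0.
move=> y; pose x := y *m U^T.
have xy : fn x = fn y by rewrite fn_mulmxT.
have xF (j : 'I_d) : (r <= j)%N -> (x *m F) 0 j = 0.
  move=> rj; have -> : x = x *m V *m V^T.
    have PUT : U^T *m (V *m V^T) = U^T.
      by rewrite -[in RHS]PU trmx_mul trmx_mul trmxK.
    by rewrite /x -!mulmxA PUT.
  have VF : V^T *m F = (topsel R le_rd)^T.
    rewrite /V (V_topsel F le_rd) trmx_mul -mulmxA.
    have -> : F^T *m F = 1%:M by case: h.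
    by rewrite mulmx1.
  rewrite -mulmxA VF mxE big1 // => l _; rewrite [(topsel _ _)^T _ _]mxE topselE.
  case: eqP => [jl|_]; last by rewrite mulr0.
  by move: rj; rewrite jl /= leqNgt ltn_ord.
have s0 := s_ge0 h r.-1.
rewrite -(@ler_pXn2r _ 2) ?nnegrE ?mulr_ge0 ?fn_ge0 // -/x exprMn -xy.
rewrite (fn_mulmx_svd _ h) (fn_coord h) mulr_sumr; apply: ler_sum => j _.
have [jr|rj] := ltnP j r; last by rewrite xF // expr0n mul0r mulr0.
rewrite mulrC ler_wpM2l ?sqr_ge0 // ler_pXn2r ?nnegrE ?(s_ge0 h) //.
by apply: (s_antitone h); rewrite -ltnS prednK.
Qed.

End SingularValues.

Section ModeRows.
Variables (R : realType) (d D r : nat).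
Variables (X M : 'M[R]_(d, D)) (U : 'M[R]_(d, r)) (v lam gam : R).
Variables (F : 'M[R]_d) (s : nat -> R) (W : 'M[R]_D) (le_rd : (r <= d)%N).
Hypothesis svdX : is_svd X F s W.
Hypothesis U_orth : orthonormal_cols U.
Hypothesis UM : U *m U^T *m M = M.
Hypothesis lam_gt0 : 0 < lam.
Hypothesis lam_le : forall y : 'rV[R]_r, lam * fn y <= fn (y *m U^T *m M).
Hypothesis gam_ge0 : 0 <= gam.
Hypothesis gam_lam : gam <= lam ^+ 2 / 2.
Local Notation V := (colsub (widen_ord le_rd) F).
Local Notation H := (X *m X^T - v%:M - M *m M^T).
Hypothesis H_opb : opb gam H.

(** [Hh] is the Gram error of the rounded noise, the one that leave-one-out controls. The rounding
    residual H - Hh enters the eigenvector equation as its error term. *)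
Lemma gram_rows (Hh : 'M[R]_d) (gamh rho g th ell : R) (q0 : nat) (i : 'I_d) :
  0 <= gamh -> opb gamh Hh -> 0 <= rho -> opb rho (H - Hh) ->
  gamh <= lam ^+ 2 / 4 -> 0 <= g -> g <= lam ^+ 2 / 4 ->
  (forall p, (p <= q0)%N -> fn (row i (mxp Hh p *m U)) <= g ^+ p * th) ->
  ell = lam ^+ 2 / 2 ->
  fn (row i (V - U *m (U^T *m V)))
  <= th * (gamh + rho) / ell + 2 * (g / ell) * (2 + rho / ell) * th
     + (1 / 2) ^+ q0.+1 + 2 * (rho / ell).
Proof.
move=> gamh0 Hho rho0 Hd gamhl g0 gl rows ellE.
have ell0 : 0 < ell by rewrite ellE divr_gt0 // exprn_gt0.
pose t : 'rV[R]_r := \row_j (s j ^+ 2 - v)^-1.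
have sj (j : 'I_r) : ell <= s j ^+ 2 - v.
  have := s_top le_rd svdX U_orth lam_gt0 lam_le H_opb (ltn_ord j).
  by rewrite ellE; have gl' := gam_lam; lra.
have ST : diag_mx (\row_(j < r) (s j ^+ 2 - v)) *m diag_mx t = 1%:M.
  apply/matrixP => j k; rewrite mul_diag_mx !mxE; case: eqP => _; last by rewrite !mulr0n mulr0.
  by rewrite !mulr1n divff // gt_eqF // (lt_le_trans ell0).
have T_opb : opb ell^-1 (diag_mx t).
  apply: opb_diag => [|k]; first by nonneg.
  have sk := lt_le_trans ell0 (sj k).
  by rewrite mxE ger0_norm ?invr_ge0 ?(ltW sk) // lef_pV2 ?posrE.
have V1 := V_orth le_rd svdX.
have eig : (M *m M^T + Hh) *m V = V *m diag_mx (\row_(j < r) (s j ^+ 2 - v)) + - ((H - Hh) *m V).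
  rewrite -(G_eigen v le_rd svdX) -mulmxBl; congr (_ *m _).
  by rewrite subr_sub2.
have E_opb : opb rho (- ((H - Hh) *m V)).
  have := opbN (opbM ler01 Hd (opb_orthonormal V1)).
  by rewrite mulr1.
have UA : U *m U^T *m (M *m M^T) = M *m M^T by rewrite mulmxA UM.
have := @row_perturbation R d r r (M *m M^T) Hh U V _ _ _ gamh g ell 1 rho th q0 i
  U_orth UA eig ST ell0 T_opb Hho (opb_orthonormal V1) E_opb gamh0 ler01 rho0.
rewrite !mulr1 mul1r; apply => //; rewrite ellE; lra.
Qed.

End ModeRows.

(** * Symmetric dilation of a rectangular matrix *)

Section Dilation.
Variables (R : realType) (d D : nat).
Implicit Types E : 'M[R]_(d, D).

Definition dilation E : 'M[R]_(d + D) := block_mx 0 E E^T 0.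

Lemma fn_row_mx p m n (A : 'M[R]_(p, m)) (B : 'M[R]_(p, n)) :
  fn (row_mx A B) ^+ 2 = fn A ^+ 2 + fn B ^+ 2.
Proof.
rewrite !fn_sqr /dotmx -big_split; apply: eq_bigr => i _ /=.
rewrite big_split_ord; congr (_ + _); apply: eq_bigr => j _.
  by rewrite row_mxEl.
by rewrite row_mxEr.
Qed.

Lemma opb_dilation g E : 0 <= g -> opb g E -> opb g (dilation E).
Proof.
move=> g0 Eg x; rewrite -[x]hsubmxK /dilation mul_row_block !mulmx0 add0r addr0.
apply: fn_le_sqr; first by rewrite mulr_ge0 ?fn_ge0.
rewrite exprMn !fn_row_mx mulrDr addrC -!exprMn; apply: lerD.
  by rewrite ler_pXn2r ?nnegrE ?mulr_ge0 ?fn_ge0.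
rewrite ler_pXn2r ?nnegrE ?mulr_ge0 ?fn_ge0 //.
exact: opb_tr.
Qed.

Lemma opb_col_mx p g h (A : 'M[R]_(d, p)) (B : 'M[R]_(D, p)) :
  0 <= g -> 0 <= h -> opb g A -> opb h B -> opb (g + h) (col_mx A B).
Proof.
move=> g0 h0 Ag Bh x; rewrite -[x]hsubmxK mul_row_col.
apply: (le_trans (fnD _ _)); rewrite mulrDl.
have h1 : fn (lsubmx x) <= fn (row_mx (lsubmx x) (rsubmx x)).
  by apply: fn_le_sqr; rewrite ?fn_ge0 // fn_row_mx lerDl sqr_ge0.
have h2 : fn (rsubmx x) <= fn (row_mx (lsubmx x) (rsubmx x)).
  by apply: fn_le_sqr; rewrite ?fn_ge0 // fn_row_mx lerDr sqr_ge0.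
apply: lerD; first by apply: (le_trans (Ag _)); rewrite ler_wpM2l.
by apply: (le_trans (Bh _)); rewrite ler_wpM2l.
Qed.

Lemma orthonormal_block r t (U : 'M[R]_(d, r)) (Wm : 'M[R]_(D, t)) :
  orthonormal_cols U -> orthonormal_cols Wm -> orthonormal_cols (block_mx U 0 0 Wm).
Proof.
move=> U1 W1; rewrite /orthonormal_cols tr_block_mx !trmx0 mulmx_block.
by rewrite !(mulmx0, mul0mx) !(addr0, add0r) U1 W1 -scalar_mx_block.
Qed.

Lemma dilation_proj r t (U : 'M[R]_(d, r)) (Wm : 'M[R]_(D, t)) E :
  U *m U^T *m E = E -> E *m (Wm *m Wm^T) = E ->
  block_mx U 0 0 Wm *m (block_mx U 0 0 Wm)^T *m dilation E = dilation E.
Proof.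
move=> UE EW.
have EW' : Wm *m Wm^T *m E^T = E^T by rewrite -[in RHS]EW trmx_mul trmx_mul trmxK.
rewrite tr_block_mx !trmx0 mulmx_block !(mulmx0, mul0mx) !(addr0, add0r).
rewrite /dilation mulmx_block !(mulmx0, mul0mx) !(addr0, add0r) UE.
by rewrite EW'.
Qed.

(** The stacked left and right singular vectors are eigenvectors of the dilation for the singular
    values themselves, so no square of the noise appears. Stacking two isometries gives the bound
    2. *)
Lemma dilation_rows r t (X M Eh : 'M[R]_(d, D)) (U : 'M[R]_(d, r)) (Wm : 'M[R]_(D, t))
    (F : 'M[R]_d) (s : nat -> R) (W : 'M[R]_D) (le_rd : (r <= d)%N)
    (ell gamh rho g th : R) (q0 : nat) (i : 'I_d) :
  is_svd X F s W -> orthonormal_cols U -> orthonormal_cols Wm ->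
  U *m U^T *m M = M -> M *m (Wm *m Wm^T) = M ->
  0 < ell -> (forall j, (j < r)%N -> ell <= s j) ->
  0 <= gamh -> opb gamh Eh -> 0 <= rho -> opb rho (X - M - Eh) ->
  gamh <= ell / 2 -> 0 <= g -> g <= ell / 2 ->
  (forall p, (p <= q0)%N ->
     fn (row (lshift D i) (mxp (dilation Eh) p *m block_mx U 0 0 Wm)) <= g ^+ p * th) ->
  fn (row i (colsub (widen_ord le_rd) F - U *m (U^T *m colsub (widen_ord le_rd) F)))
  <= th * (gamh * 2 + rho * 2) / ell + 2 * (g / ell) * (2 * 2 + rho * 2 / ell) * th
     + 2 * (1 / 2) ^+ q0.+1 + 2 * (rho * 2 / ell).
Proof.
move=> h U1 W1 UM MW ell0 sl gamh0 Eho rho0 Ed gl g0 gg rows; set V := colsub _ F.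
have V1 : orthonormal_cols V := V_orth le_rd h.
pose S : 'M[R]_r := diag_mx (\row_j s j); pose T : 'M[R]_r := diag_mx (\row_j (s j)^-1).
have sj (j : 'I_r) : 0 < s j := lt_le_trans ell0 (sl j (ltn_ord j)).
have ST : S *m T = 1%:M.
  apply/matrixP => j k; rewrite mul_diag_mx !mxE; case: eqP => _; last by rewrite !mulr0n mulr0.
  by rewrite !mulr1n divff // gt_eqF.
have TS : T *m S = 1%:M := mulmx1C ST.
have S2 : X *m X^T *m V = V *m (S *m S).
  have := G_eigen 0 le_rd h; rewrite raddf0 subr0 => ->; congr (_ *m _).
  by apply/matrixP => j k; rewrite mul_diag_mx !mxE; case: eqP => _; rewrite ?mulr0n ?mulr0 // !mulr1n subr0.
have T_opb : opb ell^-1 T.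
  apply: opb_diag => [|k]; first by nonneg.
  by rewrite mxE ger0_norm ?invr_ge0 ?(ltW (sj k)) // lef_pV2 ?posrE ?sl.
pose V2 := X^T *m V *m T.
have TT : T^T = T by apply/matrixP => j k; rewrite !mxE eq_sym; case: eqP => // ->.
have V21 : orthonormal_cols V2.
  rewrite /orthonormal_cols /V2 !trmx_mul trmxK TT -!mulmxA (mulmxA X) (mulmxA (X *m X^T)) S2.
  by rewrite !mulmxA -(mulmxA T V^T) V1 mulmx1 TS mul1mx ST.
pose VV := col_mx V V2.
have V_opb : opb 2 VV.
  have := opb_col_mx ler01 ler01 (opb_orthonormal V1) (opb_orthonormal V21).
  by have -> : 1 + 1 = 2 :> R by ring.
have eig0 : dilation X *m VV = VV *m S.
  rewrite /dilation /VV mul_block_col mul0mx add0r mul0mx addr0 mul_col_mx; congr col_mx.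
    by rewrite /V2 !mulmxA S2 -!mulmxA ST mulmx1.
  by rewrite /V2 -mulmxA TS mulmx1.
have dB (A B : 'M[R]_(d, D)) : dilation (A - B) = dilation A - dilation B.
  by rewrite /dilation linearB /= opp_block_mx add_block_mx !subr0.
have eig : (dilation M + dilation Eh) *m VV = VV *m S + - (dilation (X - M - Eh) *m VV).
  rewrite -eig0 -mulmxBl !dB; congr (_ *m _).
  by rewrite subr_sub2.
have E_opb : opb (rho * 2) (- (dilation (X - M - Eh) *m VV)).
  apply: opbN; apply: opbM => //; exact: opb_dilation.
have := @row_perturbation R (d + D) (r + t) r (dilation M) (dilation Eh) (block_mx U 0 0 Wm) VV S T _
  gamh g ell 2 (rho * 2) th q0 (lshift D i) (orthonormal_block U1 W1) (dilation_proj UM MW) eig ST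
  ell0 T_opb (opb_dilation gamh0 Eho) V_opb E_opb gamh0 (ler0n _ 2).
have r2 : 0 <= rho * 2 by nonneg.
move=> /(_ r2 gl g0 gg rows); apply: le_trans.
rewrite le_eqVlt; apply/orP; left; apply/eqP; congr fn.
rewrite tr_block_mx !trmx0 /VV mul_block_col !mul0mx addr0 add0r mul_block_col !mul0mx addr0 add0r.
by rewrite opp_col_mx add_col_mx rowKu.
Qed.

End Dilation.

(** * Multilinear forms and Tucker decompositions *)

Lemma sum_prod_dffun (R : comNzRingType) (I : finType) (T_ : I -> finType)
    (P : forall i, T_ i -> R) :
  \sum_(v : {dffun forall i, T_ i}) \prod_i P i (v i) = \prod_i \sum_t P i t.
Proof.
rewrite (reindex (@dffun_of_fprod _ T_)); last first.
  by exists (@fprod_of_dffun _ T_) => x _; [exact: dffun_of_fprodK|exact: fprod_of_dffunK].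
pose P' i : {ffun T_ i -> R} := [ffun t => P i t].
under eq_bigr => v _ do under eq_bigr => i _ do rewrite ffunE -[P _ _](ffunE (P i)).
transitivity (\prod_i \sum_t P' i t); last first.
  by apply: eq_bigr => i _; apply: eq_bigr => t _; rewrite ffunE.
under [RHS]eq_bigr => i _ do rewrite (big_tag P' i) /=.
rewrite bigA_distr_big_dep -(@big_fprod R 0 1 *%R +%R I T_ P').
by apply: eq_bigr => v _; apply: eq_bigl.
Qed.

(** Evaluates the dependent match of [insert_idx]; the proof it stores can be replaced by any other
    one. *)
Lemma boolP_true (T : Type) (b : bool) (f : b -> T) (g : ~~ b -> T) (p : b) :
  match boolP b with AltTrue e => f e | AltFalse n => g n end = f p.
Proof.
refine (match boolP b as a in alt_spec _ _ b' return
  match a return T with AltTrue e => f e | AltFalse n => g n end = f p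
  with AltTrue e => _ | AltFalse n => _ end).
  by congr f; exact: bool_irrelevance.
by case/negP: n.
Qed.

Lemma boolP_false (T : Type) (b : bool) (f : b -> T) (g : ~~ b -> T) (p : ~~ b) :
  match boolP b with AltTrue e => f e | AltFalse n => g n end = g p.
Proof.
refine (match boolP b as a in alt_spec _ _ b' return
  match a return T with AltTrue e => f e | AltFalse n => g n end = g p
  with AltTrue e => _ | AltFalse n => _ end).
  by case/negP: p.
by congr g; exact: bool_irrelevance.
Qed.

Lemma sum_enum_val (T : finType) (V : nmodType) (F : T -> V) :
  \sum_(c < #|T|) F (enum_val c) = \sum_c F c.
Proof. by rewrite (reindex _ (onW_bij _ (@enum_val_bij T))). Qed.

Section TensorIndex.
Variables (m : nat) (d : 'I_m -> nat) (k : 'I_m).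

Definition drop_idx (w : tidx d) : cotidx d k := [ffun j => w (val j)].

Lemma insert_idx_at (i : 'I_(d k)) (c : cotidx d k) : insert_idx i c k = i.
Proof.
by rewrite ffunE (boolP_true _ _ (eqxx k)); apply/val_inj.
Qed.

Lemma insert_idx_off (i : 'I_(d k)) (c : cotidx d k) (j : {j : 'I_m | j != k}) :
  insert_idx i c (val j) = c j.
Proof.
case: j => j jk; by rewrite ffunE (boolP_false _ _ jk).
Qed.

Lemma insert_idxK (w : tidx d) : insert_idx (w k) (drop_idx w) = w.
Proof.
apply/ffunP => j; have [->|jk] := eqVneq j k; first by rewrite insert_idx_at.
by rewrite (insert_idx_off _ _ (exist _ j jk)) ffunE.
Qed.

Lemma drop_insert_idx i (c : cotidx d k) : drop_idx (insert_idx i c) = c.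
Proof. by apply/ffunP => j; rewrite ffunE insert_idx_off. Qed.

Lemma sum_insert_idx (V : nmodType) (F : tidx d -> V) :
  \sum_w F w = \sum_i \sum_(c : cotidx d k) F (insert_idx i c).
Proof.
rewrite pair_big /= (reindex (fun q : 'I_(d k) * cotidx d k => insert_idx q.1 q.2)) //.
exists (fun w : tidx d => (w k, drop_idx w)) => [[i c] _|w _] /=.
  by rewrite insert_idx_at drop_insert_idx.
by rewrite insert_idxK.
Qed.

Lemma prod_insert_idx (R : comPzRingType) (F : forall j, 'I_(d j) -> R) i (c : cotidx d k) :
  \prod_j F j (insert_idx i c j) = F k i * \prod_(j : {j : 'I_m | j != k}) F (val j) (c j).
Proof.
rewrite (bigD1 k) //= insert_idx_at; congr (_ * _).
rewrite (big_sub [pred j : 'I_m | j != k]) /=.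
by apply: eq_bigr => j _; rewrite insert_idx_off.
Qed.

Lemma sum_cotidx_enum (V : nmodType) (F : cotidx d k -> V) :
  \sum_(c < #|cotidx d k|) F (enum_val c) = \sum_c F c.
Proof. exact: sum_enum_val. Qed.

End TensorIndex.

Section MultilinearForms.
Variables (R : realType) (m : nat).

Definition mform (d : 'I_m -> nat) (T : tensor R d) (x : forall k, 'I_(d k) -> R) : R :=
  \sum_w T w * \prod_k x k (w k).

Definition vn (n : nat) (x : 'I_n -> R) : R := Num.sqrt (\sum_i x i ^+ 2).

Definition tdot (d : 'I_m -> nat) (S T : tensor R d) : R := \sum_w S w * T w.

Lemma vn_ge0 n (x : 'I_n -> R) : 0 <= vn x. Proof. exact: sqrtr_ge0. Qed.

Lemma vn_sqr n (x : 'I_n -> R) : vn x ^+ 2 = \sum_i x i ^+ 2.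
Proof. by rewrite sqr_sqrtr // sumr_ge0 // => i _; rewrite sqr_ge0. Qed.

Lemma vn_row p q (A : 'M[R]_(p, q)) i : vn (A i) = fn (row i A).
Proof.
rewrite /vn /fn /dotmx big_ord1; congr Num.sqrt; apply: eq_bigr => j _.
by rewrite !mxE expr2.
Qed.

Section OneShape.
Variable (d : 'I_m -> nat).
Implicit Types (T : tensor R d) (k : 'I_m).

Lemma mform_matricize T k (x : forall k, 'I_(d k) -> R) :
  mform T x = dotmx ((\row_i x k i) *m matricize k T)
    (\row_c \prod_(j : {j : 'I_m | j != k}) x (val j) ((enum_val c : cotidx d k) j)).
Proof.
rewrite /mform (sum_insert_idx k) /dotmx big_ord1 exchange_big -sum_cotidx_enum /=.
apply: eq_bigr => c _; rewrite !mxE mulr_suml; apply: eq_bigr => i _.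
by rewrite prod_insert_idx !mxE; ring.
Qed.

(** Cauchy-Schwarz between the k-th vector acted on by the matricization and the product of the
    other vectors, whose norm factorizes. *)
Lemma mform_le T k g x : 0 <= g -> opb g (matricize k T) -> `|mform T x| <= g * \prod_j vn (x j).
Proof.
move=> g0 Tg; rewrite (mform_matricize T k); apply: (le_trans (cauchy_schwarz_norm _ _)).
rewrite (bigD1 k) //= mulrA; apply: ler_pM; rewrite ?fn_ge0 //.
  apply: (le_trans (Tg _)); rewrite ler_wpM2l // le_eqVlt; apply/orP; left; apply/eqP.
  rewrite /fn /vn /dotmx big_ord1; congr Num.sqrt; apply: eq_bigr => i _.
  by rewrite !mxE expr2.
rewrite -(@ler_pXn2r _ 2) ?nnegrE ?fn_ge0 ?prodr_ge0 // => [|j _]; last exact: vn_ge0.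
rewrite fn_sqr /dotmx big_ord1 -prodrXl.
under [leRHS]eq_bigr => j _ do rewrite vn_sqr.
rewrite (big_sub [pred j : 'I_m | j != k]) /=.
rewrite -(@sum_prod_dffun R {j : 'I_m | j != k} (fun j => 'I_(d (val j)))
   (fun j i => x (val j) i ^+ 2)).
rewrite -(sum_cotidx_enum (fun c : cotidx d k => \prod_j x (val j) (c j) ^+ 2)).
apply: ler_sum => c _; rewrite !mxE -expr2 -prodrXl //.
Qed.

Lemma frobeniusE T : frobenius_norm T ^+ 2 = tdot T T.
Proof.
rewrite sqr_sqrtr; first by apply: eq_bigr => w _; rewrite expr2.
by apply: sumr_ge0 => w _; rewrite sqr_ge0.
Qed.

Lemma frobenius_matricize T k : frobenius_norm T = fn (matricize k T).
Proof.
rewrite /frobenius_norm /fn /dotmx (sum_insert_idx k); congr Num.sqrt.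
apply: eq_bigr => i _; rewrite -sum_cotidx_enum; apply: eq_bigr => c _.
by rewrite !mxE expr2.
Qed.

Definition tvec T : 'rV[R]_#|tidx d| := \row_c T (enum_val c).

Lemma tdot_tvec S T : tdot S T = dotmx (tvec S) (tvec T).
Proof.
rewrite /dotmx big_ord1 /tdot -sum_enum_val.
by apply: eq_bigr => c _; rewrite !mxE.
Qed.

Lemma frobenius_tvec T : frobenius_norm T = fn (tvec T).
Proof.
rewrite /fn -tdot_tvec /frobenius_norm; by under eq_bigr => w _ do rewrite expr2.
Qed.

Lemma frobenius_ge0 T : 0 <= frobenius_norm T. Proof. exact: sqrtr_ge0. Qed.

Lemma frobeniusD S T : frobenius_norm (S + T) <= frobenius_norm S + frobenius_norm T.
Proof.
rewrite !frobenius_tvec; apply: le_trans (fnD _ _); rewrite le_eqVlt; apply/orP; left.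
by apply/eqP; congr fn; apply/rowP => c; rewrite !mxE ffunE.
Qed.

Lemma tdot_le S T : tdot S T <= frobenius_norm S * frobenius_norm T.
Proof. by rewrite tdot_tvec !frobenius_tvec cauchy_schwarz. Qed.

Lemma mformB S T x : mform (S - T) x = mform S x - mform T x.
Proof. by rewrite /mform -sumrB; apply: eq_bigr => w _; rewrite !ffunE mulrBl. Qed.

End OneShape.

Lemma mprodE (d r : 'I_m -> nat) (C : tensor R r) (U : forall k, 'M[R]_(d k, r k)) w :
  multilinear_prod C U w = mform C (fun k i => U k (w k) i).
Proof. by rewrite ffunE. Qed.

Lemma mform_mprod (d r : 'I_m -> nat) (C : tensor R r) (U : forall k, 'M[R]_(d k, r k)) x :
  mform (multilinear_prod C U) x = mform C (fun k v => \sum_i x k i * U k i v).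
Proof.
rewrite /mform; under eq_bigr => w _ do rewrite ffunE mulr_suml.
rewrite exchange_big; apply: eq_bigr => v _ /=.
rewrite -(@sum_prod_dffun R 'I_m (fun k => 'I_(d k)) (fun k i => x k i * U k i (v k))).
rewrite mulr_sumr; apply: eq_bigr => w _; rewrite big_split /=; ring.
Qed.

Lemma mprod_comp (d r t : 'I_m -> nat) (C : tensor R t) (A : forall k, 'M[R]_(r k, t k))
    (B : forall k, 'M[R]_(d k, r k)) :
  multilinear_prod (multilinear_prod C A) B = multilinear_prod C (fun k => B k *m A k).
Proof.
apply/ffunP => w; rewrite mprodE mform_mprod ffunE; apply: eq_bigr => v _.
by congr (_ * _); apply: eq_bigr => k _; rewrite mxE.
Qed.

Lemma eq_mprod (d r : 'I_m -> nat) (C : tensor R r) (A B : forall k, 'M[R]_(d k, r k)) :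
  (forall k, A k = B k) -> multilinear_prod C A = multilinear_prod C B.
Proof.
move=> AB; apply/ffunP => w; rewrite !ffunE; apply: eq_bigr => v _.
by congr (_ * _); apply: eq_bigr => k _; rewrite AB.
Qed.

Lemma mprod1 (d : 'I_m -> nat) (T : tensor R d) : multilinear_prod T (fun k => 1%:M) = T.
Proof.
apply/ffunP => w; rewrite ffunE (bigD1 w) //= [X in _ + X]big1 => [|v vw].
  by rewrite big1 => [|k _]; rewrite ?mulr1 ?addr0 // mxE eqxx.
suff -> : \prod_k (1%:M : 'M[R]_(d k)) (w k) (v k) = 0 by rewrite mulr0.
have [k wk] : exists k, v k != w k.
  apply/existsP; rewrite -negb_forall; apply: contra vw => /forallP h.
  by apply/eqP/ffunP => k; apply/eqP; exact: h.
by rewrite (bigD1 k) //= mxE eq_sym (negbTE wk) mul0r.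
Qed.

Lemma mprodB (d r : 'I_m -> nat) (S T : tensor R r) (U : forall k, 'M[R]_(d k, r k)) :
  multilinear_prod (S - T) U = multilinear_prod S U - multilinear_prod T U.
Proof. by apply/ffunP => w; rewrite mprodE mformB -!mprodE [RHS]ffunE [X in _ = _ + X]ffunE. Qed.

Lemma tdot_mprod (d r : 'I_m -> nat) (C : tensor R r) (U : forall k, 'M[R]_(d k, r k))
    (T : tensor R d) :
  tdot (multilinear_prod C U) T = tdot C (multilinear_prod T (fun k => (U k)^T)).
Proof.
rewrite /tdot; under eq_bigr => w _ do rewrite ffunE mulr_suml.
rewrite exchange_big; apply: eq_bigr => v _; rewrite ffunE mulr_sumr.
apply: eq_bigr => w _; under [in RHS]eq_bigr => k _ do rewrite mxE; ring.
Qed.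

Lemma frobenius_mprod_orth (d r : 'I_m -> nat) (C : tensor R r) (V : forall k, 'M[R]_(d k, r k)) :
  (forall k, orthonormal_cols (V k)) ->
  frobenius_norm (multilinear_prod C V) = frobenius_norm C.
Proof.
move=> V1; apply/eqP; rewrite -(@eqrXn2 _ 2) ?frobenius_ge0 // !frobeniusE tdot_mprod.
by rewrite mprod_comp (eq_mprod _ (B := fun k => 1%:M)) ?mprod1.
Qed.

Lemma frobenius_mprod_proj (d : 'I_m -> nat) (T : tensor R d) (P : forall k, 'M[R]_(d k)) :
  (forall k, (P k)^T = P k) -> (forall k, P k *m P k = P k) ->
  frobenius_norm (multilinear_prod T P) <= frobenius_norm T.
Proof.
move=> PT PP; have [->|h] := eqVneq (frobenius_norm (multilinear_prod T P)) 0.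
  exact: frobenius_ge0.
have hp : 0 < frobenius_norm (multilinear_prod T P) by rewrite lt_neqAle eq_sym h frobenius_ge0.
rewrite -(ler_pM2r hp) -expr2 frobeniusE tdot_mprod mprod_comp.
rewrite (eq_mprod _ (B := P)) ?tdot_le // => k; by rewrite PT PP.
Qed.

Definition in_mode (d : 'I_m -> nat) (k : 'I_m) (A : forall j, 'M[R]_(d j)) : forall j, 'M[R]_(d j) :=
  fun j => if j == k then A j else 1%:M.

Lemma matricize_in_mode (d : 'I_m -> nat) (T : tensor R d) k A :
  matricize k (multilinear_prod T (in_mode k A)) = A k *m matricize k T.
Proof.
apply/matrixP => i c; rewrite !mxE ffunE (sum_insert_idx k); apply: eq_bigr => i' _.
rewrite (bigD1 (enum_val c)) //= [X in _ + X]big1 => [|c' cc].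
  rewrite (prod_insert_idx (fun j => in_mode k A j (insert_idx i (enum_val c) j))) addr0.
  rewrite /in_mode eqxx insert_idx_at big1 ?mulr1 => [|j _]; first by rewrite !mxE mulrC.
  by rewrite (negbTE (valP j)) insert_idx_off mxE eqxx.
rewrite (prod_insert_idx (fun j => in_mode k A j (insert_idx i (enum_val c) j))).
have [j jc] : exists j, c' j != (enum_val c : cotidx d k) j.
  apply/existsP; rewrite -negb_forall; apply: contra cc => /forallP h.
  by apply/eqP/ffunP => j; apply/eqP; exact: h.
rewrite [X in _ * (_ * X)](bigD1 j) //= /in_mode (negbTE (valP j)) insert_idx_off mxE.
by rewrite eq_sym (negbTE jc) mul0r !mulr0.
Qed.

Lemma matricizeB (d : 'I_m -> nat) (S T : tensor R d) k :
  matricize k (S - T) = matricize k S - matricize k T.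
Proof. by apply/matrixP => i c; rewrite !mxE !ffunE. Qed.

(** Insert the projections one mode at a time; those already inserted are contractions and do not
    increase the new error. *)
Lemma frobenius_mprod_sub (d : 'I_m -> nat) (T : tensor R d) (P : forall k, 'M[R]_(d k)) :
  (forall k, (P k)^T = P k) -> (forall k, P k *m P k = P k) ->
  frobenius_norm (multilinear_prod T P - T) <= \sum_k fn ((P k - 1%:M) *m matricize k T).
Proof.
move=> PT PP; pose Q n j : 'M[R]_(d j) := if (j < n)%N then P j else 1%:M.
have QT n j : (Q n j)^T = Q n j by rewrite /Q; case: ifP => // _; rewrite trmx1.
have QQ n j : Q n j *m Q n j = Q n j by rewrite /Q; case: ifP => // _; rewrite mulmx1.
suff H n : (n <= m)%N -> frobenius_norm (multilinear_prod T (Q n) - T)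
    <= \sum_(k < m | (k < n)%N) fn ((P k - 1%:M) *m matricize k T).
  have := H m (leqnn m); rewrite (eq_mprod T (B := P)).
    by rewrite (eq_bigl predT) // => k; rewrite ltn_ord.
  by move=> k; rewrite /Q ltn_ord.
elim: n => [_|n IH nm].
  rewrite (eq_mprod T (B := fun k => 1%:M)) // mprod1 subrr big1 // /frobenius_norm.
  by rewrite big1 ?sqrtr0 // => w _; rewrite ffunE expr0n.
pose kn := Ordinal nm.
have -> : multilinear_prod T (Q n.+1) - T
   = multilinear_prod (multilinear_prod T (in_mode kn P) - T) (Q n) + (multilinear_prod T (Q n) - T).
  rewrite mprodB addrA subrK mprod_comp; congr (_ - _); apply: eq_mprod => j.
  rewrite /Q /in_mode ltnS leq_eqVlt; case: (eqVneq j kn) => [->|jk].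
    by rewrite /= eqxx ltnn mul1mx.
  have -> : (j == n :> nat) = false by apply/negbTE; apply: contra jk => /eqP jn; apply/eqP/val_inj.
  by rewrite mulmx1.
apply: (le_trans (frobeniusD _ _)); rewrite (bigD1 kn) //=; apply: lerD.
  apply: (le_trans (frobenius_mprod_proj _ (QT n) (QQ n))).
  by rewrite (frobenius_matricize _ kn) matricizeB matricize_in_mode mulmxBl mul1mx.
apply: (le_trans (IH (ltnW nm))); rewrite le_eqVlt; apply/orP; left; apply/eqP.
apply: eq_bigl => k; rewrite ltnS ltn_neqAle andbC; congr (_ && _).
Qed.

(** Spectral (injective) norm of a tensor at most g. *)
Definition spec_le (d : 'I_m -> nat) (g : R) (T : tensor R d) : Prop :=
  forall x : forall k, 'I_(d k) -> R, `|mform T x| <= g * \prod_k vn (x k).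

(** The projected tensor has as many core entries as the product of the ranks, and each is the form
    evaluated at unit vectors, the columns of the factors. *)
Lemma frobenius_mprod_spec (d r : 'I_m -> nat) (E : tensor R d) (V : forall k, 'M[R]_(d k, r k)) g :
  0 <= g -> spec_le g E -> (forall k, orthonormal_cols (V k)) ->
  frobenius_norm (multilinear_prod E (fun k => V k *m (V k)^T)) <= Num.sqrt (dstar r)%:R * g.
Proof.
move=> g0 Eg V1; rewrite -mprod_comp frobenius_mprod_orth //.
rewrite -(@ler_pXn2r _ 2) ?nnegrE ?frobenius_ge0 ?mulr_ge0 ?sqrtr_ge0 //.
rewrite frobeniusE exprMn sqr_sqrtr ?ler0n //.
have card_r : (dstar r = #|tidx r|)%N.
  rewrite card_dep_ffun foldrE big_map big_enum /= /dstar.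
  by apply: eq_bigr => k _; rewrite card_ord.
have -> : (dstar r)%:R * g ^+ 2 = \sum_(v : tidx r) g ^+ 2.
  by rewrite sumr_const card_r mulr_natl.
apply: ler_sum => v _; rewrite -expr2 mprodE -real_normK ?num_real //.
rewrite ler_pXn2r ?nnegrE //; apply: (le_trans (Eg _)).
rewrite big1 ?mulr1 // => k _.
have -> : vn (fun i => (V k)^T (v k) i) = fn (row (v k) (V k)^T) by rewrite vn_row.
apply/eqP; rewrite -(@eqrXn2 _ 2) ?fn_ge0 // fn_sqr expr1n.
have /matrixP /(_ (v k) (v k)) := V1 k; rewrite !mxE eqxx => h; apply/eqP.
by rewrite -[RHS]h /dotmx big_ord1; apply: eq_bigr => j _; rewrite !mxE.
Qed.

(* Telescoping of a multilinear form: x in the modes before k, x - y in mode k,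
   y afterwards. *)
Lemma mform_telescope (d : 'I_m -> nat) (T : tensor R d) (x y : forall k, 'I_(d k) -> R) :
  mform T x - mform T y = \sum_(k < m) mform T (fun j i =>
    if (j < k)%N then x j i else if j == k then x j i - y j i else y j i).
Proof.
pose h n (j : 'I_m) i := if (j < n)%N then x j i else y j i.
have -> : mform T x = mform T (h m).
  by apply: eq_bigr => w _; congr (_ * _); apply: eq_bigr => k _; rewrite /h ltn_ord.
have -> : mform T y = mform T (h 0%N) by [].
rewrite -(telescope_sumr (fun n => mform T (h n)) (leq0n m)) big_mkord.
apply: eq_bigr => k _; rewrite /mform -sumrB; apply: eq_bigr => w _.
rewrite -mulrBr; congr (_ * _).
rewrite (bigD1 k) //= [X in _ - X](bigD1 k) //= [RHS](bigD1 k) //=.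
rewrite /h ltnSn ltnn eqxx.
have E (b : bool) : \prod_(j < m | j != k) (if (j < k + b)%N then x j (w j) else y j (w j))
  = \prod_(j < m | j != k) (if (j < k)%N then x j (w j) else
       if j == k then x j (w j) - y j (w j) else y j (w j)).
  apply: eq_bigr => j jk; rewrite (negbTE jk); have : j != k :> nat by apply: contra jk => /eqP h'; apply/eqP/val_inj.
  by case: b => jk'; rewrite ?addn1 ?addn0 // ltnS leq_eqVlt (negbTE jk').
have := E true; have := E false; rewrite addn0 addn1 => -> ->.
by rewrite mulrBl.
Qed.

(** * Matricizations of a Tucker decomposition *)

Section Tucker.
Variables (d r : 'I_m -> nat) (T : tensor R d) (C : tensor R r).
Variable (U : forall k, 'M[R]_(d k, r k)).
Hypothesis tucker : tucker_decomposition T C U.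

Lemma tucker_proj : multilinear_prod T (fun k => U k *m (U k)^T) = T.
Proof.
case: tucker => U1 ->; rewrite mprod_comp; apply: eq_mprod => k.
by rewrite -mulmxA U1 mulmx1.
Qed.

Lemma tucker_matricize k : U k *m (U k)^T *m matricize k T = matricize k T.
Proof.
rewrite -(matricize_in_mode T k (fun j => U j *m (U j)^T)); congr matricize.
case: tucker => U1 ->; rewrite mprod_comp; apply: eq_mprod => j.
by rewrite /in_mode; case: eqP => _; rewrite ?mul1mx // -mulmxA U1 mulmx1.
Qed.

(** The Kronecker product of the factors of the other modes: its orthonormal columns span a space
    containing the rows of the mode-k matricization. *)
Definition cofactor_mx k : 'M[R]_(#|cotidx d k|, #|cotidx r k|) :=
  \matrix_(c, c') \prod_(j : {j : 'I_m | j != k}) U (val j) ((enum_val c : cotidx d k) j) ((enum_val c' : cotidx r k) j).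

Lemma matricize_factor k : matricize k T = U k *m matricize k C *m (cofactor_mx k)^T.
Proof.
case: tucker => U1 ->; apply/matrixP => i c; rewrite !mxE ffunE (sum_insert_idx k).
rewrite exchange_big -sum_cotidx_enum; apply: eq_bigr => c' _; rewrite !mxE mulr_suml.
apply: eq_bigr => i' _; rewrite !mxE.
rewrite (prod_insert_idx (fun j t => U j (insert_idx i (enum_val c) j) t)) insert_idx_at.
under eq_bigr => j _ do rewrite insert_idx_off.
ring.
Qed.

Lemma cofactor_orth k : orthonormal_cols (cofactor_mx k).
Proof.
apply/matrixP => c c'; rewrite !mxE.
under eq_bigr => a _ do rewrite !mxE -big_split /=.
rewrite (sum_cotidx_enum (fun a : cotidx d k => \prod_j (U (val j) (a j) ((enum_val c : cotidx r k) j)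
  * U (val j) (a j) ((enum_val c' : cotidx r k) j)))).
rewrite (@sum_prod_dffun R {j : 'I_m | j != k} (fun j => 'I_(d (val j)))
  (fun j a => U (val j) a ((enum_val c : cotidx r k) j) * U (val j) a ((enum_val c' : cotidx r k) j))).
have UU j (a b : 'I_(r j)) : \sum_i U j i a * U j i b = (a == b)%:R.
  case: tucker => U1 _; have /matrixP /(_ a b) := U1 j; rewrite !mxE => <-.
  by apply: eq_bigr => i _; rewrite mxE.
under eq_bigr => j _ do rewrite UU.
have [<-|cc] := eqVneq c c'; first by rewrite big1 // => j _; rewrite eqxx.
have [j jc] : exists j, (enum_val c : cotidx r k) j != (enum_val c' : cotidx r k) j.
  apply/existsP; rewrite -negb_forall; apply: contra cc => /forallP h.
  by apply/eqP/enum_val_inj/ffunP => j; exact/eqP.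
by rewrite (bigD1 j) //= (negbTE jc) mul0r.
Qed.

Lemma matricize_cofactor k :
  matricize k T *m (cofactor_mx k *m (cofactor_mx k)^T) = matricize k T.
Proof.
by rewrite {1}matricize_factor -!mulmxA (mulmxA _^T (cofactor_mx k)) cofactor_orth mul1mx mulmxA -matricize_factor.
Qed.

Lemma rank_matricize_le k : (\rank (matricize k T) <= dminus r k)%N.
Proof.
rewrite matricize_factor -(card_cotidx r k).
by apply: (leq_trans (mxrankM_maxr _ _)); rewrite mxrank_tr rank_leq_col.
Qed.

Lemma fn_cofactor_row k (th : 'I_m -> R) c : (forall j, 0 <= th j) ->
  (forall j (i : 'I_(d j)), fn (row i (U j)) <= th j) ->
  fn (row c (cofactor_mx k)) <= \prod_(j < m | j != k) th j.
Proof.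
move=> th0 Uth; apply: fn_le_sqr; first by apply: prodr_ge0.
rewrite fn_sqr /dotmx big_ord1 -prodrXl.
under [leLHS]eq_bigr => c' _ do rewrite !mxE -expr2 -prodrXl.
rewrite (sum_cotidx_enum (fun c' : cotidx r k => \prod_j U (val j) ((enum_val c : cotidx d k) j) (c' j) ^+ 2)).
rewrite (@sum_prod_dffun R {j : 'I_m | j != k} (fun j => 'I_(r (val j)))
  (fun j a => U (val j) ((enum_val c : cotidx d k) j) a ^+ 2)).
rewrite [leRHS](big_sub [pred j : 'I_m | j != k]) /=.
apply: ler_prod => j _; apply/andP; split.
  by apply: sumr_ge0 => a _; rewrite sqr_ge0.
rewrite -vn_sqr vn_row ler_pXn2r ?nnegrE ?fn_ge0 //.
Qed.

End Tucker.

End MultilinearForms.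

(** * Noise in one mode *)

Lemma sqrt_le (R : realType) (x y : R) : 0 <= y -> x <= y ^+ 2 -> Num.sqrt x <= y.
Proof. by move=> y0 xy; rewrite -[leRHS](ger0_norm y0) -sqrtr_sqr ler_wsqrtr. Qed.

Lemma expR1_le3 (R : realType) : expR 1 <= 3 :> R.
Proof.
have h : 5 / 6 <= expR (- (1 / 6)) :> R by have := expR_ge1Dx (- (1 / 6) : R); lra.
have e6 : expR (1 / 6) <= 6 / 5 :> R.
  by rewrite -(opprK (1 / 6)) expRN -(invrK (6 / 5)) lef_pV2 ?posrE ?expR_gt0 //; lra.
have -> : expR 1 = expR (1 / 6) ^+ 6 :> R by rewrite -expRM_natl; congr expR; lra.
apply: (@le_trans _ _ ((6 / 5) ^+ 6)); first by rewrite ler_pXn2r ?nnegrE ?expR_ge0 //; lra.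
lra.
Qed.

(** * Moment scales in terms of the noise level w *)

Section GramScale.
Variables (R : realType) (B sg l Q w dd DD pw : R).
Hypotheses (B0 : 0 <= B) (sg0 : 0 <= sg) (l1 : 1 <= l) (Q1 : 1 <= Q) (w0 : 0 <= w).
Hypotheses (d0 : 0 <= dd) (D0 : 0 <= DD) (pw0 : 0 <= pw) (pwQ : pw <= 2 * Q * l).
Hypothesis Bl : B * l <= w.
Hypothesis dl : dd * l * sg ^+ 2 <= w ^+ 2.
Hypothesis dDl : sg ^+ 2 * (Num.sqrt dd * Num.sqrt DD) * l <= w ^+ 2.
Hypothesis BlD : (B * l) ^+ 2 * (DD * sg ^+ 2) <= w ^+ 4.

Let u := l * B ^+ 2.
Let s := dd * sg ^+ 2.
Let S := DD * sg ^+ 2.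

Lemma gram_scale_col : 3 * (4 * pw * B ^+ 2 + 3 * dd * sg ^+ 2) <= 99 * Q * w ^+ 2.
Proof.
have l0 : 0 <= l by apply: le_trans l1. have Q0 : 0 <= Q by apply: le_trans Q1.
have u1 : u <= w ^+ 2.
  apply: (@le_trans _ _ ((B * l) ^+ 2)); last by rewrite ler_pXn2r ?nnegrE ?mulr_ge0.
  by rewrite /u exprMn mulrC expr2 ler_wpM2l ?mulr_ge0 // ler_peMl.
have s1 : s <= w ^+ 2.
  apply: le_trans dl; rewrite /s [leRHS]mulrAC ler_peMr ?mulr_ge0 ?sqr_ge0 //.
have pB : pw * B ^+ 2 <= 2 * (Q * w ^+ 2).
  apply: (@le_trans _ _ (2 * Q * l * B ^+ 2)); first by rewrite ler_wpM2r ?sqr_ge0.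
  by rewrite -!mulrA ler_wpM2l // ler_wpM2l.
have Qw : w ^+ 2 <= Q * w ^+ 2 by rewrite ler_peMl ?sqr_ge0.
have s2 : dd * sg ^+ 2 <= w ^+ 2 := s1.
rewrite (_ : 3 * _ = 12 * (pw * B ^+ 2) + 9 * (dd * sg ^+ 2)); last by ring.
rewrite -mulrA; have := sqr_ge0 w; lra.
Qed.

Lemma gram_scale_row : 3 * (4 * pw * B ^+ 2 + 3 * DD * sg ^+ 2) <= 24 * Q * w ^+ 2 + 9 * (DD * sg ^+ 2).
Proof.
have l0 : 0 <= l by apply: le_trans l1. have Q0 : 0 <= Q by apply: le_trans Q1.
have u1 : u <= w ^+ 2.
  apply: (@le_trans _ _ ((B * l) ^+ 2)); last by rewrite ler_pXn2r ?nnegrE ?mulr_ge0.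
  by rewrite /u exprMn mulrC expr2 ler_wpM2l ?mulr_ge0 // ler_peMl.
have pB : pw * B ^+ 2 <= 2 * (Q * w ^+ 2).
  apply: (@le_trans _ _ (2 * Q * l * B ^+ 2)); first by rewrite ler_wpM2r ?sqr_ge0.
  by rewrite -!mulrA ler_wpM2l // ler_wpM2l.
rewrite (_ : 3 * _ = 12 * (pw * B ^+ 2) + 9 * (DD * sg ^+ 2)); last by ring.
rewrite -[24 * Q * _]mulrA; lra.
Qed.

(** After expansion only l u u, l u s, l u S and l s S occur, each at most w^4; the last one comes
    from squaring [dDl]. The constant is 460 since 80 * 18 * 121 + 8 * 66^2 <= 460^2. *)
Lemma gram_scale_mixed :
  80 * pw * (3 * (4 * pw * B ^+ 2 + 3 * dd * sg ^+ 2)) * (3 * (4 * pw * B ^+ 2 + 3 * DD * sg ^+ 2))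
  + 8 * pw ^+ 2 * (3 * (4 * pw * B ^+ 2 + 3 * dd * sg ^+ 2)) ^+ 2 <= (460 * Q ^+ 2 * w ^+ 2) ^+ 2.
Proof.
have l0 : 0 <= l by apply: le_trans l1. have Q0 : 0 <= Q by apply: le_trans Q1.
have u0 : 0 <= u by rewrite /u; nonneg. have s0 : 0 <= s by rewrite /s; nonneg.
have S0 : 0 <= S by rewrite /S; nonneg.
have lu : l * u <= w ^+ 2.
  by rewrite /u mulrA -expr2 -exprMn mulrC ler_pXn2r ?nnegrE ?mulr_ge0.
have ls : l * s <= w ^+ 2 by apply: le_trans dl; rewrite le_eqVlt /s; apply/orP; left; apply/eqP; ring.
have t1 : l * u * u <= w ^+ 4.
  rewrite (_ : w ^+ 4 = w ^+ 2 * w ^+ 2); last by ring.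
  by apply: ler_pM => //; [nonneg|apply: le_trans lu; rewrite ler_peMl].
have t2 : l * u * s <= w ^+ 4.
  rewrite (_ : w ^+ 4 = w ^+ 2 * w ^+ 2); last by ring.
  by apply: ler_pM => //; [nonneg|apply: le_trans ls; rewrite ler_peMl].
have t3 : l * u * S <= w ^+ 4.
  by apply: le_trans BlD; rewrite le_eqVlt /u /S; apply/orP; left; apply/eqP; ring.
have t4 : l * s * S <= w ^+ 4.
  have h : (sg ^+ 2 * (Num.sqrt dd * Num.sqrt DD) * l) ^+ 2 <= w ^+ 4.
    rewrite (_ : w ^+ 4 = (w ^+ 2) ^+ 2); last by ring.
    by rewrite ler_pXn2r ?nnegrE ?sqr_ge0 //; nonneg.
  apply: le_trans h; rewrite !exprMn !sqr_sqrtr //.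
  rewrite (_ : _ * l ^+ 2 = l * (l * s * S)); last by rewrite /s /S; ring.
  by rewrite ler_peMl // /s /S; nonneg.
set cs := 3 * (4 * pw * B ^+ 2 + 3 * dd * sg ^+ 2).
set rs := 3 * (4 * pw * B ^+ 2 + 3 * DD * sg ^+ 2).
have pB : 4 * pw * B ^+ 2 <= 8 * Q * u.
  by rewrite /u mulrA ler_wpM2r ?sqr_ge0 //; have h := pwQ; lra.
have cs1 : cs <= 3 * (8 * Q * u + 3 * s) by rewrite /cs /s; lra.
have rs1 : rs <= 3 * (8 * Q * u + 3 * S) by rewrite /rs /S; lra.
have cs0 : 0 <= cs by rewrite /cs; nonneg. have rs0 : 0 <= rs by rewrite /rs; nonneg.
have w4 : 0 <= w ^+ 4 by nonneg.
have QQ : Q <= Q ^+ 2 by rewrite expr2 ler_peMl.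
have Q2 : 1 <= Q ^+ 2 by rewrite (le_trans Q1).
have prod_le (a b : R) : 0 <= a -> 0 <= b -> a <= b -> forall c, c <= Q ^+ 2 -> 0 <= c -> c * a <= Q ^+ 2 * b.
  by move=> a0 b0 ab c cQ c0; apply: ler_pM.
have p1 : pw * cs * rs <= 18 * Q * (121 * (Q ^+ 2 * w ^+ 4)).
  apply: (@le_trans _ _ (2 * Q * l * (3 * (8 * Q * u + 3 * s)) * (3 * (8 * Q * u + 3 * S)))).
    by apply: ler_pM => //; [nonneg|apply: ler_pM].
  rewrite (_ : _ * _ * _ = 18 * Q * (64 * (Q ^+ 2 * (l * u * u)) + 24 * (Q * (l * u * S))
     + 24 * (Q * (l * u * s)) + 9 * (1 * (l * s * S)))); last by ring.
  apply: ler_wpM2l; first by nonneg.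
  have a1 := prod_le (l * u * u) _ ltac:(nonneg) w4 t1 (Q ^+ 2) (lexx _) ltac:(nonneg).
  have a2 := prod_le (l * u * S) _ ltac:(nonneg) w4 t3 Q QQ Q0.
  have a3 := prod_le (l * u * s) _ ltac:(nonneg) w4 t2 Q QQ Q0.
  have a4 := prod_le (l * s * S) _ ltac:(nonneg) w4 t4 1 Q2 ler01.
  lra.
have p2 : pw * cs <= 66 * (Q ^+ 2 * w ^+ 2).
  apply: (@le_trans _ _ (2 * Q * l * (3 * (8 * Q * u + 3 * s)))); first by apply: ler_pM.
  rewrite (_ : _ * _ = 48 * (Q ^+ 2 * (l * u)) + 18 * (Q * (l * s))); last by ring.
  have a1 := prod_le (l * u) _ ltac:(nonneg) (sqr_ge0 w) lu (Q ^+ 2) (lexx _) ltac:(nonneg).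
  have a2 := prod_le (l * s) _ ltac:(nonneg) (sqr_ge0 w) ls Q QQ Q0.
  lra.
have p3 : (pw * cs) ^+ 2 <= (66 * (Q ^+ 2 * w ^+ 2)) ^+ 2.
  by rewrite ler_pXn2r ?nnegrE //; nonneg.
have Q34 : Q * (Q ^+ 2 * w ^+ 4) <= Q ^+ 4 * w ^+ 4.
  rewrite (_ : Q * _ = Q ^+ 3 * w ^+ 4); last by ring.
  by rewrite ler_wpM2r // (exprS Q 3) ler_peMl //; nonneg.
rewrite (_ : 80 * pw * cs * rs = 80 * (pw * cs * rs)); last by ring.
rewrite (_ : 8 * pw ^+ 2 * cs ^+ 2 = 8 * (pw * cs) ^+ 2); last by ring.
rewrite (_ : (460 * _ * _) ^+ 2 = 460 * 460 * (Q ^+ 4 * w ^+ 4)); last by ring.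
rewrite (_ : (66 * _) ^+ 2 = 66 * 66 * (Q ^+ 4 * w ^+ 4)) in p3; last by ring.
have X0 : 0 <= Q ^+ 4 * w ^+ 4 by nonneg.
lra.
Qed.

End GramScale.

Section ProbabilityUnions.
Variables (R : realType) (I A : finType) (p : I -> A -> R).
Hypothesis p_ge0 : forall i a, 0 <= p i a.
Local Notation X := {ffun I -> A}.

Lemma Pr_and (B C : pred X) b c :
  Pr p (fun x => ~~ B x) <= b -> Pr p (fun x => ~~ C x) <= c ->
  Pr p (fun x => ~~ (B x && C x)) <= b + c.
Proof.
move=> Bb Cc; apply: le_trans (lerD Bb Cc); apply: le_trans (Pr_or p_ge0 _ _).
by apply: (Pr_le p_ge0) => x /=; rewrite negb_and.
Qed.

Lemma Pr_forall (T : finType) (B : T -> pred X) b :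
  (forall t, Pr p (fun x => ~~ B t x) <= b) ->
  Pr p (fun x => ~~ [forall t, B t x]) <= #|T|%:R * b.
Proof.
move=> Bb; rewrite mulr_natl -sumr_const.
apply: (@le_trans _ _ (\sum_t Pr p (fun x => ~~ B t x))).
  apply: le_trans (Pr_has p_ge0 _); apply: (Pr_le p_ge0) => x /=.
  by rewrite negb_forall.
by apply: ler_sum => t _; exact: Bb.
Qed.

Lemma Pr_nle (f g : X -> R) b : Pr p (fun x => g x < f x) <= b ->
  Pr p (fun x => ~~ (f x <= g x)) <= b.
Proof. by apply: le_trans; apply: (Pr_le p_ge0) => x /=; rewrite ltNge. Qed.

End ProbabilityUnions.

(** * Noise matrix of one mode: deviations and operator bounds *)

Section ModeNoise.
Variables (R : realType) (I A : finType) (p : I -> A -> R).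
Hypothesis p_ge0 : forall i a, 0 <= p i a.
Hypothesis p_sum1 : forall i, \sum_a p i a = 1.
Local Notation X := {ffun I -> A}.
Variables (d D r : nat) (io : 'I_d * 'I_D -> I) (f : 'I_d * 'I_D -> A -> R).
Hypothesis io_inj : injective io.

Definition entry_mean ic : R := \sum_a p (io ic) a * f ic a.
Definition centered ic (a : A) : R := f ic a - entry_mean ic.
Definition entry_var ic : R := \sum_a p (io ic) a * centered ic a ^+ 2.
Definition mean_mx : 'M[R]_(d, D) := \matrix_(i, c) entry_mean (i, c).
Definition noise_mx (x : X) : 'M[R]_(d, D) := rmat io f x.
Definition centered_mx (x : X) : 'M[R]_(d, D) := rmat io centered x.

Lemma noise_mxE x : noise_mx x = centered_mx x + mean_mx.
Proof. by apply/matrixP => i c; rewrite !mxE subrK. Qed.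

Lemma centered_mean ic : \sum_a p (io ic) a * centered ic a = 0.
Proof.
rewrite /centered; under eq_bigr => a _ do rewrite mulrBr.
by rewrite sumrB -mulr_suml p_sum1 mul1r subrr.
Qed.

Variables (B sg v0 h2 beta l Q : R).
Hypothesis B_gt0 : 0 < B.
Hypothesis sg_gt0 : 0 < sg.
Hypothesis l_ge1 : 1 <= l.
Hypothesis Q_ge1 : 1 <= Q.
Hypothesis f_bound : forall ic a, `|centered ic a| <= B.
Hypothesis f_var : forall ic, entry_var ic <= sg ^+ 2.
Hypothesis beta_ge0 : 0 <= beta.
Hypothesis f_mean : forall ic, `|entry_mean ic| <= beta.

(** The deviation that [bernstein] allows at probability 2 exp(- Q l), for coefficients of Euclidean
    norm s and largest absolute value t. *)
Definition dev (s t : R) : R := (2 * Q + 4) * (sg * Num.sqrt l * s + B * l * t).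

Lemma dev_le s t s' t' : s <= s' -> t <= t' -> dev s t <= dev s' t'.
Proof.
have l0 := le_trans ler01 l_ge1; have Q0 := le_trans ler01 Q_ge1.
have B0 := ltW B_gt0; have sg0 := ltW sg_gt0.
by move=> ss tt; rewrite /dev ler_wpM2l //; [nonneg|apply: lerD; rewrite ler_wpM2l //; nonneg].
Qed.

Lemma row_deviation i (u : 'I_D -> X -> R) :
  (forall c c' x a, u c' (upd x (io (i, c)) a) = u c' x) ->
  Pr p (fun x => ~~ (`|\sum_c u c x * centered_mx x i c| <= dev (vnorm u x) (vmax u x)))
  <= 2 * expR (- (Q * l)).
Proof.
move=> u_upd; apply: (Pr_nle p_ge0).
have inj : injective (fun c => io (i, c)) by move=> c c' /io_inj [].
have := @bernstein R I A p p_ge0 p_sum1 _ (fun c => io (i, c)) (fun c => centered (i, c)) u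
  sg B l Q inj u_upd (fun c => centered_mean _) sg_gt0 B_gt0 (lt_le_trans ltr01 l_ge1)
  (le_trans ler01 Q_ge1) (fun c => f_var _) (fun c => f_bound _).
apply: le_trans; apply: (Pr_le p_ge0) => x /=.
by under eq_bigr => c _ do rewrite mxE.
Qed.

Lemma col_deviation c (u : 'I_d -> X -> R) :
  (forall i i' x a, u i' (upd x (io (i, c)) a) = u i' x) ->
  Pr p (fun x => ~~ (`|\sum_i u i x * centered_mx x i c| <= dev (vnorm u x) (vmax u x)))
  <= 2 * expR (- (Q * l)).
Proof.
move=> u_upd; apply: (Pr_nle p_ge0).
have inj : injective (fun i => io (i, c)) by move=> i i' /io_inj [].
have := @bernstein R I A p p_ge0 p_sum1 _ (fun i => io (i, c)) (fun i => centered (i, c)) u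
  sg B l Q inj u_upd (fun i => centered_mean _) sg_gt0 B_gt0 (lt_le_trans ltr01 l_ge1)
  (le_trans ler01 Q_ge1) (fun i => f_var _) (fun i => f_bound _).
apply: le_trans; apply: (Pr_le p_ge0) => x /=.
by under eq_bigr => i _ do rewrite mxE.
Qed.

Lemma fixed_row_deviation i (u : 'I_D -> R) s t :
  Num.sqrt (\sum_c u c ^+ 2) <= s -> 0 <= t -> (forall c, `|u c| <= t) ->
  Pr p (fun x => ~~ (`|\sum_c u c * centered_mx x i c| <= dev s t)) <= 2 * expR (- (Q * l)).
Proof.
move=> us t0 ut; apply: le_trans (row_deviation (i := i) (u := fun c => fun=> u c) _) => //.
apply: (Pr_le p_ge0) => x /=; apply: contra => /le_trans; apply; apply: dev_le => //.
by apply/bigmax_leP; split=> // c _.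
Qed.

(** Bernstein for centered squares of entries: they are bounded by B^2, and their variance is at
    most B^2 times that of the entry. *)
Lemma row_energy_deviation i :
  Pr p (fun x => ~~ (`|\sum_c (centered_mx x i c ^+ 2 - entry_var (i, c))|
    <= (2 * Q + 4) * (B * sg * Num.sqrt l * Num.sqrt D%:R + B ^+ 2 * l)))
  <= 2 * expR (- (Q * l)).
Proof.
have l0 := lt_le_trans ltr01 l_ge1; have Q0 := le_trans ler01 Q_ge1.
apply: (Pr_nle p_ge0).
have inj : injective (fun c => io (i, c)) by move=> c c' /io_inj [].
have sqB ic a : centered ic a ^+ 2 <= B ^+ 2.
  by rewrite -(real_normK (num_real (centered ic a))) ler_pXn2r ?nnegrE ?normr_ge0 ?(ltW B_gt0).
have var0 ic : 0 <= entry_var ic by apply: sumr_ge0 => a _; rewrite mulr_ge0 ?sqr_ge0.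
have varB ic : entry_var ic <= B ^+ 2.
  rewrite -[leRHS]mul1r -(p_sum1 (io ic)) mulr_suml; apply: ler_sum => a _.
  by rewrite ler_wpM2l.
have := @bernstein R I A p p_ge0 p_sum1 _ (fun c => io (i, c))
  (fun c a => centered (i, c) a ^+ 2 - entry_var (i, c)) (fun=> fun=> 1)
  (B * sg) (B ^+ 2) l Q inj (fun _ _ _ _ => erefl).
move=> /(_ _ _ _ l0 Q0) H.
apply: le_trans (H _ _ _ _ _).
- apply: (Pr_le p_ge0) => x /=; under [in X in _ -> X]eq_bigr => c _ do rewrite mul1r.
  under eq_bigr => c _ do rewrite mxE.
  apply: le_lt_trans; rewrite ler_wpM2l ?addr_ge0 ?mulr_ge0 //.
  apply: lerD; first rewrite ler_wpM2l //.
  + by rewrite !mulr_ge0 ?sqrtr_ge0 ?ltW.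
  + by rewrite /vnorm; under eq_bigr => c _ do rewrite expr1n; rewrite sumr_const card_ord.
  + rewrite ler_piMr ?(mulr_ge0 (sqr_ge0 B) (ltW l0)) //.
    by apply/bigmax_leP; split=> // c _; rewrite normr1.
- move=> c; under eq_bigr => a _ do rewrite mulrBr.
  by rewrite sumrB -mulr_suml p_sum1 mul1r subrr.
- by rewrite mulr_gt0.
- by rewrite exprn_gt0.
- move=> c; rewrite exprMn.
  apply: (@le_trans _ _ (B ^+ 2 * entry_var (i, c))); last by rewrite ler_wpM2l ?sqr_ge0.
  rewrite [leRHS]mulr_sumr.
  have -> : \sum_a p (io (i, c)) a * (centered (i, c) a ^+ 2 - entry_var (i, c)) ^+ 2
    = \sum_a p (io (i, c)) a * (centered (i, c) a ^+ 2) ^+ 2 - entry_var (i, c) ^+ 2.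
    transitivity (\sum_a (p (io (i, c)) a * (centered (i, c) a ^+ 2) ^+ 2
      - 2 * entry_var (i, c) * (p (io (i, c)) a * centered (i, c) a ^+ 2)
      + entry_var (i, c) ^+ 2 * p (io (i, c)) a)); first by apply: eq_bigr => a _; ring.
    by rewrite big_split sumrB /= -!mulr_sumr p_sum1 -/(entry_var (i, c)); ring.
  rewrite lerBlDr; apply: (@le_trans _ _ (\sum_a B ^+ 2 * (p (io (i, c)) a * centered (i, c) a ^+ 2))).
    by apply: ler_sum => a _; rewrite [leRHS]mulrCA ler_wpM2l // expr2 ler_wpM2r ?sqr_ge0.
  by rewrite lerDl sqr_ge0.
- move=> c a; have := sqB (i, c) a; have := var0 (i, c); have := varB (i, c).
  have := sqr_ge0 (centered (i, c) a); rewrite ler_norml; lra.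
Qed.

Variables (At : 'M[R]_(r, D)) (Lam : R) (pw : nat).
Hypothesis Lam_ge0 : 0 <= Lam.
Hypothesis At_opb : opb Lam At.
Hypothesis pw_ge : Q * l <= pw%:R.

(** Truncation and corruption bias the entries, so the mean matrix is not zero and its products with
    the centered noise need an event of their own, like those of the signal. *)
Definition noise_good (x : X) : bool :=
  [&& gram_good p io centered B sg pw x,
      [forall i, `|\sum_c (centered_mx x i c ^+ 2 - entry_var (i, c))|
         <= (2 * Q + 4) * (B * sg * Num.sqrt l * Num.sqrt D%:R + B ^+ 2 * l)],
      [forall ij : 'I_d * 'I_d, `|\sum_c mean_mx ij.2 c * centered_mx x ij.1 c|
         <= dev (fn (row ij.2 mean_mx)) beta] &
      [forall ik : 'I_d * 'I_r, `|\sum_c At ik.2 c * centered_mx x ik.1 c| <= dev Lam Lam]].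

Lemma fn_rowE q n (M : 'M[R]_(q, n)) i : fn (row i M) = Num.sqrt (\sum_c M i c ^+ 2).
Proof.
rewrite /fn /dotmx big_ord1; congr Num.sqrt; apply: eq_bigr => c _.
by rewrite !mxE expr2.
Qed.

Lemma noise_good_prob : (0 < pw)%N ->
  Pr p (fun x => ~~ noise_good x)
  <= ((d.+1)%:R * (D + d)%:R + 2 * d%:R + 2 * (d * d)%:R + 2 * (d * r)%:R) * expR (- (Q * l)).
Proof.
move=> pw0; rewrite /noise_good.
have g1 : Pr p (fun x => ~~ gram_good p io centered B sg pw x)
    <= (d.+1)%:R * (D + d)%:R * expR (- (Q * l)).
  apply: (le_trans (gram_concentration p_ge0 p_sum1 io_inj centered_mean B_gt0 f_bound f_var pw0)).
  rewrite ler_wpM2l // ler_expR lerN2 (le_trans pw_ge) // ler_peMl // ler1n //.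
apply: (le_trans (Pr_and p_ge0 g1 (Pr_and p_ge0 (Pr_forall p_ge0 row_energy_deviation)
   (Pr_and p_ge0 (Pr_forall p_ge0 (b := 2 * expR (- (Q * l))) _)
      (Pr_forall p_ge0 (b := 2 * expR (- (Q * l))) _))))).
- move=> [i j]; apply: fixed_row_deviation => //=; first by rewrite fn_rowE.
  by move=> c; rewrite mxE.
- move=> [i k]; apply: fixed_row_deviation => //=; first by rewrite -fn_rowE; exact: opb_row.
  by move=> c; apply: le_trans (opb_row k At_opb); have := fn_entry_le (row k At) 0 c; rewrite mxE.
rewrite !card_prod !card_ord le_eqVlt; apply/orP; left; apply/eqP; ring.
Qed.

Section Scales.
Variable w : R.
Hypothesis w_gt0 : 0 < w.
Hypothesis pw_le : pw%:R <= 2 * Q * l.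
Hypothesis Bl : B * l <= w.
Hypothesis dl : d%:R * l * sg ^+ 2 <= w ^+ 2.
Hypothesis dDl : sg ^+ 2 * (Num.sqrt d%:R * Num.sqrt D%:R) * l <= w ^+ 2.
Hypothesis BlD : (B * l) ^+ 2 * (D%:R * sg ^+ 2) <= w ^+ 4.
Hypothesis v0_var : forall ic, `|entry_var ic - v0| <= h2.
Hypothesis Dh : D%:R * h2 <= w ^+ 2.
Hypothesis mean_w : beta * (Num.sqrt d%:R * Num.sqrt D%:R) <= w.
Hypothesis Blbd : B * l * beta * d%:R <= w ^+ 2.
Variable x : X.
Hypothesis good : noise_good x.

Local Notation Z := (centered_mx x).
Local Notation b := mean_mx.
Local Notation E := (noise_mx x).

Lemma pw_gt0 : (0 < pw)%N.
Proof. by rewrite -(ltr0n R); apply: lt_le_trans pw_ge; rewrite mulr_gt0 // ?(lt_le_trans ltr01). Qed.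

Lemma gram_goodZ : [/\ opb (1380 * Q ^+ 2 * w ^+ 2) (offgram Z),
  forall c, \sum_i Z i c ^+ 2 <= 297 * Q * w ^+ 2 &
  forall i, \sum_c Z i c ^+ 2 <= 72 * Q * w ^+ 2 + 27 * (D%:R * sg ^+ 2)].
Proof.
have l0 := le_trans ler01 l_ge1; have Q0 := le_trans ler01 Q_ge1.
have B0 := ltW B_gt0; have sg0 := ltW sg_gt0; have w0 := ltW w_gt0.
have /and4P[gg _ _ _] := good.
have [h1 h2' h3] := gram_goodP B_gt0 pw_gt0 gg.
have e3 := @expR1_le3 R; have e0 := @expR_ge0 R 1.
have cs : col_scale d B sg pw <= 3 * (4 * pw%:R * B ^+ 2 + 3 * d%:R * sg ^+ 2).
  by rewrite /col_scale ler_wpM2r //; nonneg.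
have rs : row_scale D B sg pw <= 3 * (4 * pw%:R * B ^+ 2 + 3 * D%:R * sg ^+ 2).
  by rewrite /row_scale ler_wpM2r //; nonneg.
have cs0 : 0 <= col_scale d B sg pw by rewrite /col_scale; nonneg.
have rs0 : 0 <= row_scale D B sg pw by rewrite /row_scale; nonneg.
have Zr i c : Z i c ^+ 2 <= rwt p io centered x i c.
  by rewrite !mxE lerDl sumr_ge0 // => a _; rewrite mulr_ge0 ?sqr_ge0.
split.
- apply: opb_le h1; rewrite (_ : 1380 * _ * _ = 3 * (460 * Q ^+ 2 * w ^+ 2)); last by ring.
  apply: ler_pM => //.
  apply: sqrt_le; first by rewrite !(mulr_ge0 (mulr_ge0 (ler0n _ _) (sqr_ge0 _)) (sqr_ge0 _)).
  apply: le_trans (gram_scale_mixed B0 l_ge1 Q_ge1 w0 _ _ _ pw_le Bl dl dDl BlD) => //.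
  rewrite /gram_scale; apply: lerD.
    by apply: ler_pM => //; [nonneg|apply: ler_pM => //; nonneg].
  by rewrite ler_wpM2l ?ler_pXn2r ?nnegrE //; nonneg.
- move=> c; apply: (@le_trans _ _ (expR 1 * col_scale d B sg pw)).
    by apply: le_trans (h2' c); apply: ler_sum.
  rewrite (_ : 297 * _ * _ = 3 * (99 * Q * w ^+ 2)); last by ring.
  apply: ler_pM => //; apply: (le_trans cs).
  exact: (gram_scale_col B0 sg0 l_ge1 Q_ge1 w0 (ler0n _ _) pw_le Bl dl).
- move=> i; apply: (@le_trans _ _ (expR 1 * row_scale D B sg pw)).
    by apply: le_trans (h3 i); apply: ler_sum.
  rewrite (_ : _ + _ = 3 * (24 * Q * w ^+ 2 + 9 * (D%:R * sg ^+ 2))); last by ring.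
  apply: ler_pM => //; apply: (le_trans rs).
  exact: (gram_scale_row _ _ B0 l_ge1 Q_ge1 w0 pw_le Bl).
Qed.

Lemma opb_gram_diag (G : 'M[R]_d) a : 0 <= a -> (forall i, `|G i i| <= a) ->
  opb a (\matrix_(i, j) (if i == j then G i i else 0)).
Proof.
move=> a0 Ga; have -> : \matrix_(i, j) (if i == j then G i i else 0) = diag_mx (\row_i G i i).
  by apply/matrixP => i j; rewrite !mxE; case: eqP => [->|_]; rewrite ?mulr1n ?mulr0n.
by apply: opb_diag => // i; rewrite mxE.
Qed.

(** A diagonal entry differs from D v0 by the deviation of its row energy plus the spread of the
    variances around v0, which [Dh] bounds; the rest is [offgram]. *)
Lemma opb_centered_gram : opb (1400 * Q ^+ 2 * w ^+ 2) (Z *m Z^T - (D%:R * v0)%:M).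
Proof.
have l0 := le_trans ler01 l_ge1; have Q0 := le_trans ler01 Q_ge1.
have B0 := ltW B_gt0; have sg0 := ltW sg_gt0; have w0 := ltW w_gt0.
have QQ : Q <= Q ^+ 2 by rewrite expr2 ler_peMl.
have [h _ _] := gram_goodZ; have /and4P[_ /forallP gd _ _] := good.
have -> : Z *m Z^T - (D%:R * v0)%:M = offgram Z
   + \matrix_(i, j) (if i == j then (\matrix_(i, j) (\sum_c Z i c ^+ 2 - D%:R * v0) : 'M[R]_d) i i else 0).
  apply/matrixP => i j; rewrite !mxE; case: eqP => [<-|ij]; last first.
    by rewrite mulr0n subr0 addr0; apply: eq_bigr => c _; rewrite !mxE.
  by rewrite mulr1n add0r; congr (_ - _); apply: eq_bigr => c _; rewrite !mxE expr2.
rewrite (_ : 1400 * _ * _ = 1380 * Q ^+ 2 * w ^+ 2 + 20 * Q ^+ 2 * w ^+ 2); last by ring.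
apply: opbD => //; apply: opb_gram_diag; first by nonneg.
move=> i; rewrite mxE.
have Bsg : B * sg * Num.sqrt l * Num.sqrt D%:R <= w ^+ 2.
  rewrite -(@ler_pXn2r _ 2) ?nnegrE; [|done| |]; try by nonneg.
  rewrite !exprMn !sqr_sqrtr // (_ : w ^+ 2 * w ^+ 2 = w ^+ 4); last by ring.
  apply: le_trans BlD.
  rewrite (_ : (B * l) ^+ 2 * _ = l * (B ^+ 2 * sg ^+ 2 * l * D%:R)); last by ring.
  by rewrite ler_peMl //; nonneg.
have B2l : B ^+ 2 * l <= w ^+ 2.
  apply: (@le_trans _ _ ((B * l) ^+ 2)); last by rewrite ler_pXn2r ?nnegrE ?mulr_ge0.
  by rewrite exprMn [l ^+ 2]expr2 ler_wpM2l ?sqr_ge0 // ler_peMl.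
have -> : \sum_c Z i c ^+ 2 - D%:R * v0
  = \sum_c (Z i c ^+ 2 - entry_var (i, c)) + \sum_(c < D) (entry_var (i, c) - v0).
  by rewrite !sumrB sumr_const card_ord addrA subrK mulr_natl.
apply: (le_trans (ler_normD _ _)).
have t1 : `|\sum_(c < D) (entry_var (i, c) - v0)| <= w ^+ 2.
  apply: (le_trans (ler_norm_sum _ _ _)); apply: le_trans Dh.
  rewrite mulr_natl -[X in _ <= _ *+ X]card_ord -sumr_const; apply: ler_sum => c _; exact: v0_var.
have t2 := gd i.
have t3 : (2 * Q + 4) * (B * sg * Num.sqrt l * Num.sqrt D%:R + B ^+ 2 * l) <= 12 * Q * w ^+ 2.
  rewrite (_ : 12 * Q * _ = 6 * Q * (w ^+ 2 + w ^+ 2)); last by ring.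
  by apply: ler_pM; [nonneg|nonneg|have h' := Q_ge1; lra|apply: lerD].
have t4 : Q * w ^+ 2 <= Q ^+ 2 * w ^+ 2 by rewrite ler_wpM2r ?sqr_ge0.
have t5 : w ^+ 2 <= Q * w ^+ 2 by rewrite ler_peMl ?sqr_ge0.
apply: (le_trans (lerD t2 t1)); move: t3; set q := (2 * Q + 4) * _ => t3.
have t6 : 0 <= Q ^+ 2 * w ^+ 2 by nonneg.
lra.
Qed.

Let sd : R := Num.sqrt d%:R.
Let sD : R := Num.sqrt D%:R.

Lemma fn_mean : fn b <= w.
Proof.
have w0 := ltW w_gt0; apply: fn_le_sqr => //.
apply: (@le_trans _ _ ((beta * (sd * sD)) ^+ 2)); last by rewrite ler_pXn2r ?nnegrE //; nonneg.
rewrite fn_sqr !exprMn !sqr_sqrtr // /dotmx.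
apply: (@le_trans _ _ (\sum_(i < d) \sum_(c < D) beta ^+ 2)); last first.
  by rewrite !sumr_const !card_ord -mulrnA -(mulr_natl (beta ^+ 2)) natrM le_eqVlt; apply/orP; left; apply/eqP; ring.
apply: ler_sum => i _; apply: ler_sum => c _; rewrite mxE -expr2.
by rewrite -(real_normK (num_real (entry_mean _))) ler_pXn2r ?nnegrE.
Qed.

Lemma fn_mean_row i : fn (row i b) * sd <= w.
Proof.
apply: le_trans mean_w; rewrite [_ * sd]mulrC mulrCA ler_wpM2l ?sqrtr_ge0 //.
rewrite fn_rowE; apply: sqrt_le; first by nonneg.
rewrite exprMn sqr_sqrtr // mulr_natr -[X in _ *+ X]card_ord -sumr_const; apply: ler_sum => c _.
by rewrite mxE -(real_normK (num_real (entry_mean _))) ler_pXn2r ?nnegrE.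
Qed.

Lemma sg_sqrt : sg * Num.sqrt l * sd <= w.
Proof.
have l0 := le_trans ler01 l_ge1; have sg0 := ltW sg_gt0; have w0 := ltW w_gt0.
rewrite -(@ler_pXn2r _ 2) ?nnegrE; [|done| |]; try by nonneg.
rewrite !exprMn !sqr_sqrtr //; apply: le_trans dl; rewrite le_eqVlt; apply/orP; left; apply/eqP; ring.
Qed.

(** Each entry is bounded by a part proportional to a row norm of the mean matrix and a constant
    part; [dl] and [Blbd] sum the two in Frobenius norm. *)
Lemma fn_centered_mean : fn (Z *m b^T) <= 12 * Q * w ^+ 2.
Proof.
have l0 := le_trans ler01 l_ge1; have Q0 := le_trans ler01 Q_ge1.
have B0 := ltW B_gt0; have sg0 := ltW sg_gt0; have w0 := ltW w_gt0.
have /and4P[_ _ /forallP gd _] := good.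
have -> : 12 * Q * w ^+ 2 = 6 * Q * (w ^+ 2 + w ^+ 2) by ring.
have e (i j : 'I_d) : `|(Z *m b^T) i j| <= 6 * Q * (sg * Num.sqrt l * fn (row j b) + B * l * beta).
  have -> : (Z *m b^T) i j = \sum_c b j c * Z i c.
    by rewrite mxE; apply: eq_bigr => c _; rewrite [b^T _ _]mxE mulrC.
  apply: (le_trans (gd (i, j))); rewrite /dev ler_wpM2r //; first by have h := fn_ge0 (row j b); nonneg.
  by have h := Q_ge1; lra.
pose a := \matrix_(i < d, j < d) (6 * Q * (sg * Num.sqrt l * fn (row j b))).
pose c := const_mx (6 * Q * (B * l * beta)) : 'M[R]_d.
have ea : fn a <= 6 * Q * w ^+ 2.
  apply: fn_le_sqr; first by nonneg.
  rewrite fn_sqr /dotmx.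
  under eq_bigr => i _ do under eq_bigr => j _ do rewrite mxE -expr2 !exprMn sqr_sqrtr //.
  rewrite sumr_const card_ord -!mulr_sumr -fn_sqr_rows -[X in X <= _]mulr_natl.
  rewrite (_ : _ * _ = (6 ^+ 2 * Q ^+ 2) * ((d%:R * l * sg ^+ 2) * fn b ^+ 2)); last by ring.
  rewrite (_ : (6 * Q * _) ^+ 2 = (6 ^+ 2 * Q ^+ 2) * (w ^+ 2 * w ^+ 2)); last by ring.
  apply: ler_wpM2l; first by nonneg.
  apply: ler_pM; [by nonneg|exact: sqr_ge0|exact: dl|].
  by rewrite ler_pXn2r ?nnegrE ?fn_ge0 // fn_mean.
have ec : fn c <= 6 * Q * w ^+ 2.
  apply: fn_le_sqr; first by nonneg.
  rewrite fn_sqr /dotmx.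
  under eq_bigr => i _ do under eq_bigr => j _ do rewrite mxE -expr2.
  rewrite !sumr_const !card_ord -mulrnA -[X in X <= _]mulr_natl natrM.
  rewrite (_ : _ * _ = (6 * Q) ^+ 2 * (B * l * beta * d%:R) ^+ 2); last by ring.
  rewrite (_ : (6 * Q * w ^+ 2) ^+ 2 = (6 * Q) ^+ 2 * (w ^+ 2) ^+ 2); last by ring.
  apply: ler_wpM2l; first exact: sqr_ge0.
  by rewrite ler_pXn2r ?nnegrE //; nonneg.
rewrite mulrDr; apply: le_trans (lerD ea ec); apply: le_trans (fnD _ _).
apply: fn_le_sqr; first exact: fn_ge0.
rewrite !fn_sqr; apply: ler_sum => i _; apply: ler_sum => j _; rewrite -!expr2.
rewrite -(real_normK (num_real ((Z *m b^T) i j))) ler_pXn2r ?nnegrE ?normr_ge0 //.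
  by apply: (le_trans (e i j)); rewrite !mxE -mulrDr.
by rewrite !mxE; have h := fn_ge0 (row j b); nonneg.
Qed.

Lemma opb_mean : opb w b.
Proof. exact: opb_le fn_mean (opb_fn _). Qed.

Lemma opb_noise_gram : opb (1440 * Q ^+ 2 * w ^+ 2) (E *m E^T - (D%:R * v0)%:M).
Proof.
have Q0 := le_trans ler01 Q_ge1; have w0 := ltW w_gt0.
have QQ : Q <= Q ^+ 2 by rewrite expr2 ler_peMl.
have -> : E *m E^T - (D%:R * v0)%:M
    = (Z *m Z^T - (D%:R * v0)%:M) + (Z *m b^T + (Z *m b^T)^T + b *m b^T).
  rewrite noise_mxE linearD /= mulmxDl !mulmxDr trmx_mul trmxK.
  by rewrite -!addrA; congr (_ + _); rewrite [RHS]addrC -!addrA.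
have bb : opb (w * w) (b *m b^T).
  by apply: opbM => //; [exact: opb_mean|apply: opb_tr => //; exact: opb_mean].
have Zb := opb_le fn_centered_mean (opb_fn (Z *m b^T)).
have Zb' := opb_tr _ Zb.
apply: opb_le (opbD opb_centered_gram (opbD (opbD Zb (Zb' _)) bb)); last by nonneg.
have t1 : Q * w ^+ 2 <= Q ^+ 2 * w ^+ 2 by rewrite ler_wpM2r ?sqr_ge0.
have t2 : w ^+ 2 <= Q * w ^+ 2 by rewrite ler_peMl ?sqr_ge0.
have t3 : 0 <= Q ^+ 2 * w ^+ 2 by nonneg.
rewrite -expr2; lra.
Qed.

Lemma opb_sqrt_gram n q a (Y : 'M[R]_(n, q)) : 0 <= a -> opb a (Y *m Y^T) -> opb (Num.sqrt a) Y.
Proof.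
move=> a0 Ya u; apply: fn_le_sqr; first by rewrite mulr_ge0 ?sqrtr_ge0 ?fn_ge0.
rewrite fn_sqr exprMn sqr_sqrtr // dotmx_mulr dotmxC.
apply: (le_trans (cauchy_schwarz _ _)); rewrite -mulmxA expr2 mulrA ler_wpM2r ?fn_ge0 //.
Qed.

Lemma opb_centered : opb (39 * Q * w + 6 * (sD * sg)) Z.
Proof.
have Q0 := le_trans ler01 Q_ge1; have w0 := ltW w_gt0; have sg0 := ltW sg_gt0.
have QQ : Q <= Q ^+ 2 by rewrite expr2 ler_peMl.
have [h1 _ h3] := gram_goodZ.
have a0 : 0 <= 1380 * Q ^+ 2 * w ^+ 2 + (72 * Q * w ^+ 2 + 27 * (D%:R * sg ^+ 2)).
  by rewrite addr_ge0 ?(mulr_ge0 (mulr_ge0 (ler0n _ _) (sqr_ge0 _)) (sqr_ge0 _)) //; nonneg.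
have ZZ : Z *m Z^T = offgram Z
    + \matrix_(i, j) (if i == j then (\matrix_(i, j) (\sum_c Z i c ^+ 2) : 'M[R]_d) i i else 0).
  apply/matrixP => i j; rewrite !mxE; case: eqP => [<-|ij]; last first.
    by rewrite addr0; apply: eq_bigr => c _; rewrite !mxE.
  by rewrite add0r; apply: eq_bigr => c _; rewrite !mxE expr2.
have H : opb (1380 * Q ^+ 2 * w ^+ 2 + (72 * Q * w ^+ 2 + 27 * (D%:R * sg ^+ 2))) (Z *m Z^T).
  rewrite ZZ; apply: opbD => //; apply: opb_gram_diag; first by nonneg.
  by move=> i; rewrite mxE ger0_norm ?sumr_ge0 // => c _; exact: sqr_ge0.
apply: opb_le (opb_sqrt_gram a0 H).
have ss : 0 <= sD * sg by apply: mulr_ge0 => //; exact: sqrtr_ge0.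
have Qw : 0 <= Q * w by nonneg.
apply: sqrt_le; first by nonneg.
have e1 : D%:R * sg ^+ 2 = (sD * sg) ^+ 2 by rewrite exprMn sqr_sqrtr.
have t1 : Q * w ^+ 2 <= Q ^+ 2 * w ^+ 2 by rewrite ler_wpM2r ?sqr_ge0.
rewrite (_ : Q ^+ 2 * w ^+ 2 = (Q * w) ^+ 2) in t1; last by ring.
rewrite e1 (_ : 1380 * _ * _ = 1380 * (Q * w) ^+ 2); last by ring.
rewrite (_ : (_ + 6 * _) ^+ 2 = 39 * 39 * (Q * w) ^+ 2 + 36 * (sD * sg) ^+ 2
   + 468 * (Q * w * (sD * sg))); last by ring.
have t2 : 0 <= Q * w * (sD * sg) by nonneg.
have t3 := sqr_ge0 (Q * w); have t4 := sqr_ge0 (sD * sg).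
rewrite -(mulrA 72); lra.
Qed.

Lemma fn_noise_col c : (0 < D)%N -> fn (row c E^T) <= 19 * Q * w.
Proof.
move=> D0; have Q0 := le_trans ler01 Q_ge1; have w0 := ltW w_gt0.
have [_ h2' _] := gram_goodZ.
have sD1 : 1 <= sD by rewrite -sqrtr1 ler_wsqrtr // ler1n.
have -> : row c E^T = row c Z^T + row c b^T by rewrite noise_mxE !linearD.
apply: (le_trans (fnD _ _)).
have t1 : fn (row c Z^T) <= 18 * Q * w.
  rewrite fn_rowE; apply: sqrt_le; first by nonneg.
  under eq_bigr => i _ do rewrite mxE.
  apply: (le_trans (h2' c)).
  have t1 : Q * w ^+ 2 <= Q ^+ 2 * w ^+ 2 by rewrite ler_wpM2r ?sqr_ge0 // expr2 ler_peMl.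
  have t2 : 0 <= Q * w ^+ 2 by nonneg.
  rewrite (_ : (18 * Q * w) ^+ 2 = 18 * 18 * (Q ^+ 2 * w ^+ 2)); last by ring.
  rewrite -mulrA; lra.
have t2 : fn (row c b^T) <= w.
  rewrite fn_rowE; apply: sqrt_le => //.
  apply: (@le_trans _ _ ((beta * (sd * sD)) ^+ 2)); last by rewrite ler_pXn2r ?nnegrE //; nonneg.
  apply: (@le_trans _ _ ((beta * sd) ^+ 2)); last first.
    rewrite ler_pXn2r ?nnegrE //; try by nonneg.
    by rewrite mulrA ler_peMr //; nonneg.
  rewrite exprMn sqr_sqrtr // mulr_natr -[X in _ *+ X]card_ord -sumr_const.
  apply: ler_sum => i _.
  by rewrite !mxE -(real_normK (num_real (entry_mean _))) ler_pXn2r ?nnegrE.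
have t3 : w <= Q * w by rewrite ler_peMl.
rewrite -mulrA in t1; rewrite -mulrA; lra.
Qed.

Hypothesis cases : B * l * sd <= w \/ D%:R * l * sg ^+ 2 <= w ^+ 2.

Lemma fn_rows_le q n (Y : 'M[R]_(q, n)) a : 0 <= a -> (forall i, fn (row i Y) <= a) ->
  fn Y <= Num.sqrt q%:R * a.
Proof.
move=> a0 h; apply: fn_le_sqr; first by nonneg.
rewrite fn_sqr_rows exprMn sqr_sqrtr // mulr_natl -[X in _ *+ X]card_ord -sumr_const.
by apply: ler_sum => i _; rewrite ler_pXn2r ?nnegrE ?fn_ge0.
Qed.

(** In the first case of [cases], Bernstein bounds every entry of the product, and the sup-norm part
    survives the factor sqrt d. In the second, the number of columns is small enough for the
    operator norm of the noise itself to be of order w. *)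
Lemma fn_signal_noise : fn (At *m E^T) <= 46 * Q * Num.sqrt r%:R * Lam * w.
Proof.
have l0 := le_trans ler01 l_ge1.
have Q0 := le_trans ler01 Q_ge1; have w0 := ltW w_gt0; have sg0 := ltW sg_gt0; have B0 := ltW B_gt0.
have sr0 : 0 <= Num.sqrt r%:R :> R by exact: sqrtr_ge0.
have LL : 0 <= Lam by exact: Lam_ge0.
have [r0|r1] := posnP r.
  rewrite (_ : fn _ = 0) ?mulr_ge0 //.
  apply/eqP; rewrite -(@eqrXn2 _ 2) ?fn_ge0 // expr0n fn_sqr_rows big1 // => k.
  by have := ltn_ord k; rewrite {2}r0.
have r1' : 1 <= Num.sqrt r%:R :> R by rewrite -[leLHS]sqrtr1 ler_wsqrtr // ler1n.
have Ab : fn (At *m b^T) <= Lam * w.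
  apply: (le_trans (fn_opb_mulmx _ Lam_ge0 At_opb)); rewrite fn_tr ler_wpM2l //; exact: fn_mean.
have X0 : 0 <= Lam * w by nonneg.
have rX : Lam * w <= Num.sqrt r%:R * (Lam * w) by rewrite ler_peMl.
have rX0 := le_trans X0 rX.
have QX : Num.sqrt r%:R * (Lam * w) <= Q * (Num.sqrt r%:R * (Lam * w)) by rewrite ler_peMl.
have -> : 46 * Q * Num.sqrt r%:R * Lam * w = 46 * (Q * (Num.sqrt r%:R * (Lam * w))) by ring.
suff AZ : fn (At *m Z^T) <= 45 * (Q * (Num.sqrt r%:R * (Lam * w))).
  rewrite noise_mxE linearD /= mulmxDr; apply: (le_trans (fnD _ _)); lra.
case: cases => c.
- have /and4P[_ _ _ /forallP gd] := good.
  have e k : fn (row k (At *m Z^T)) <= sd * (6 * Q * (sg * Num.sqrt l * Lam + B * l * Lam)).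
    rewrite fn_rowE; apply: sqrt_le; first by nonneg.
    rewrite exprMn sqr_sqrtr // [X in _ <= X]mulr_natl -[X in _ <= _ *+ X]card_ord -sumr_const.
    apply: ler_sum => i _; rewrite -(real_normK (num_real ((At *m Z^T) k i))).
    rewrite ler_pXn2r ?nnegrE ?normr_ge0 //; last by nonneg.
    have -> : (At *m Z^T) k i = \sum_c At k c * Z i c.
      by rewrite mxE; apply: eq_bigr => a _; rewrite [Z^T _ _]mxE.
    apply: (le_trans (gd (i, k))); rewrite /dev /= ler_wpM2r //; first by nonneg.
    by have h := Q_ge1; lra.
  apply: (le_trans (fn_rows_le _ e)); first by nonneg.
  have t1 : sd * (sg * Num.sqrt l) * Lam <= w * Lam.
    by rewrite ler_wpM2r // mulrC; exact: sg_sqrt.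
  have t2 : B * l * sd * Lam <= w * Lam by rewrite ler_wpM2r.
  rewrite [leLHS](_ : _ = 6 * (Q * (Num.sqrt r%:R * (sd * (sg * Num.sqrt l) * Lam + B * l * sd * Lam)))); last by ring.
  apply: (@le_trans _ _ (6 * (Q * (Num.sqrt r%:R * (w * Lam + w * Lam))))).
    by rewrite ler_wpM2l // ler_wpM2l // ler_wpM2l // lerD.
  rewrite (_ : 6 * _ = 12 * (Q * (Num.sqrt r%:R * (Lam * w)))); last by ring.
  have := le_trans rX0 QX; lra.
- have ss : sD * sg <= w.
    rewrite -(@ler_pXn2r _ 2) ?nnegrE; [|done| |]; try by nonneg.
    rewrite exprMn sqr_sqrtr //; apply: le_trans c.
    by rewrite mulrAC ler_peMr //; nonneg.
  have oZ : opb (45 * Q * w) Z.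
    apply: opb_le opb_centered.
    have t3 : w <= Q * w by rewrite ler_peMl.
    rewrite -!mulrA; lra.
  have fA : fn At <= Num.sqrt r%:R * Lam by apply: fn_rows_le => // k; exact: opb_row.
  apply: (le_trans (fn_mulmx_opb _ _ (opb_tr _ oZ))); try by nonneg.
  apply: (@le_trans _ _ (45 * Q * w * (Num.sqrt r%:R * Lam))); first by rewrite ler_wpM2l //; nonneg.
  by rewrite le_eqVlt; apply/orP; left; apply/eqP; ring.
Qed.

Lemma opb_mode (U : 'M[R]_(d, r)) : orthonormal_cols U -> w <= Lam -> (0 < r)%N ->
  opb (1600 * Q ^+ 2 * Num.sqrt r%:R * Lam * w)
    ((U *m At + E) *m (U *m At + E)^T - (D%:R * v0)%:M - (U *m At) *m (U *m At)^T).
Proof.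
move=> U1 wL r1.
have Q0 := le_trans ler01 Q_ge1; have w0 := ltW w_gt0.
have QQ : Q <= Q ^+ 2 by rewrite expr2 ler_peMl.
have r1' : 1 <= Num.sqrt r%:R :> R by rewrite -[leLHS]sqrtr1 ler_wsqrtr // ler1n.
have Y1 : opb (1 * (46 * Q * Num.sqrt r%:R * Lam * w)) (U *m (At *m E^T)).
  apply: opbM; [have LL := Lam_ge0; nonneg|exact: opb_orthonormal|].
  move=> y; apply: (le_trans (opb_fn (At *m E^T) y)).
  by rewrite ler_wpM2r ?fn_ge0 // fn_signal_noise.
rewrite mul1r in Y1.
have Y0 : 0 <= 46 * Q * Num.sqrt r%:R * Lam * w by have LL := Lam_ge0; nonneg.
have -> : (U *m At + E) *m (U *m At + E)^T - (D%:R * v0)%:M - (U *m At) *m (U *m At)^T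
  = (E *m E^T - (D%:R * v0)%:M) + (U *m (At *m E^T) + (U *m (At *m E^T))^T).
  rewrite mulmxA [(U *m At *m E^T)^T]trmx_mul trmxK.
  set M := U *m At; rewrite linearD /= mulmxDl !mulmxDr.
  by apply/matrixP => i j; rewrite !mxE; ring.
apply: opb_le (opbD opb_noise_gram (opbD Y1 (opb_tr Y0 Y1))).
have X0 : 0 <= Lam * w by have LL := Lam_ge0; nonneg.
set X := Num.sqrt r%:R * (Lam * w).
have wX : w ^+ 2 <= X.
  apply: (@le_trans _ _ (Lam * w)); first by rewrite expr2 ler_wpM2r.
  by rewrite ler_peMl.
have QX : Q * X <= Q ^+ 2 * X by rewrite ler_wpM2r // (le_trans (sqr_ge0 w)).
have Q2 : Q ^+ 2 * w ^+ 2 <= Q ^+ 2 * X by rewrite ler_wpM2l // sqr_ge0.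
have Q3 : 0 <= Q ^+ 2 * w ^+ 2 by nonneg.
rewrite (_ : 46 * _ * _ * _ * _ = 46 * (Q * X)); last by rewrite /X; ring.
rewrite (_ : 1600 * _ * _ * _ * _ = 1600 * (Q ^+ 2 * X)); last by rewrite /X; ring.
rewrite -mulrA; lra.
Qed.

(* The deviation of the noise in row [i] from a vector that only incoherence
   in the other rows controls. *)
Lemma fn_row_mean_centered i : fn (row i b *m Z^T) * sd <= 6 * Q * (w * w + B * l * sd * (sd * beta)).
Proof.
have l0 := le_trans ler01 l_ge1; have Q0 := le_trans ler01 Q_ge1.
have B0 := ltW B_gt0; have sg0 := ltW sg_gt0; have w0 := ltW w_gt0.
have /and4P[_ _ /forallP gd _] := good.
have fb := fn_ge0 (row i b).
have h : fn (row i b *m Z^T) <= sd * (6 * Q * (sg * Num.sqrt l * fn (row i b) + B * l * beta)).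
  apply: fn_le_sqr; first by nonneg.
  rewrite exprMn (sqr_sqrtr (ler0n R d)) fn_sqr /dotmx big_ord1 [X in _ <= X]mulr_natl.
  rewrite -[X in _ <= _ *+ X]card_ord -sumr_const.
  apply: ler_sum => j _; rewrite -expr2 -(real_normK (num_real ((_ *m _) _ _))).
  rewrite ler_pXn2r ?nnegrE ?normr_ge0 //; last by nonneg.
  have -> : (row i b *m Z^T) 0 j = \sum_c b i c * Z j c.
    by rewrite mxE; apply: eq_bigr => c _; rewrite [Z^T _ _]mxE [row _ _ _ _]mxE.
  apply: (le_trans (gd (j, i))); rewrite /dev /= ler_wpM2r //; first by nonneg.
  by have h := Q_ge1; lra.
apply: (@le_trans _ _ (sd * (6 * Q * (sg * Num.sqrt l * fn (row i b) + B * l * beta)) * sd)).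
  by rewrite ler_wpM2r // sqrtr_ge0.
rewrite (_ : _ * sd = 6 * Q * ((sg * Num.sqrt l * sd) * (fn (row i b) * sd) + B * l * sd * (sd * beta))); last by ring.
apply: ler_wpM2l; first by nonneg.
have sd0 : 0 <= sd by exact: sqrtr_ge0.
by rewrite lerD2r; apply: ler_pM; [nonneg|nonneg|exact: sg_sqrt|exact: fn_mean_row].
Qed.

End Scales.
End ModeNoise.

Section RowSums.
Variable R : realType.

Lemma fn_row_entries n (y : 'rV[R]_n) a : 0 <= a -> (forall j, `|y 0 j| <= a) ->
  fn y <= Num.sqrt n%:R * a.
Proof.
move=> a0 h; apply: fn_le_sqr; first by nonneg.
rewrite fn_sqr exprMn sqr_sqrtr // [X in _ <= X]mulr_natl -[X in _ <= _ *+ X]card_ord -sumr_const.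
rewrite /dotmx big_ord1; apply: ler_sum => j _.
by rewrite -expr2 -(real_normK (num_real (y 0 j))) ler_pXn2r ?nnegrE.
Qed.

Lemma fn_col_le p q (A : 'M[R]_(p, q)) g j : 0 <= g -> opb g A ->
  Num.sqrt (\sum_i A i j ^+ 2) <= g.
Proof.
move=> g0 Ag; have := opb_row j (opb_tr g0 Ag); rewrite fn_rowE.
by under eq_bigr => i _ do rewrite mxE.
Qed.

Lemma sum_mul_le n (x y : 'I_n -> R) :
  `|\sum_i x i * y i| <= Num.sqrt (\sum_i x i ^+ 2) * Num.sqrt (\sum_i y i ^+ 2).
Proof.
have := cauchy_schwarz_norm (\row_i x i) (\row_i y i).
rewrite /fn /dotmx !big_ord1.
under eq_bigr => i _ do rewrite !mxE.
under [X in _ <= Num.sqrt X * _]eq_bigr => i _ do rewrite !mxE -expr2.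
by under [X in _ <= _ * Num.sqrt X]eq_bigr => i _ do rewrite !mxE -expr2.
Qed.

Lemma vec_mul_deviation n s (z b : 'rV[R]_n) (Y : 'M[R]_(n, s)) (dv be : R) :
  0 <= dv -> (forall j, `|\sum_c Y c j * z 0 c| <= dv) -> fn (b *m Y) <= be ->
  fn ((z + b) *m Y) <= Num.sqrt s%:R * dv + be.
Proof.
move=> dv0 zY bY; rewrite mulmxDl; apply: (le_trans (fnD _ _)); apply: lerD => //.
apply: fn_row_entries => // j; rewrite mxE.
by under eq_bigr => c _ do rewrite mulrC; exact: zY.
Qed.

End RowSums.

(** * The leave-one-out step for Gram matrices *)

Section LooGram.
Variables (R : realType) (d D r : nat).
Variables (U : 'M[R]_(d, r)) (At : 'M[R]_(r, D)) (Z b : 'M[R]_(d, D)).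
Variables (v w Lam Q sg l B beta th gam g : R) (i : 'I_d) (q : nat).
Let sd : R := Num.sqrt d%:R.
Let sD : R := Num.sqrt D%:R.
Local Notation E := (Z + b).
Local Notation M := (U *m At).
Local Notation X := (U *m At + (Z + b)).
Variable H : 'M[R]_d.
Hypothesis HE : H = X *m X^T - v%:M - M *m M^T.
Hypothesis U_orth : orthonormal_cols U.
Hypothesis Q_ge1 : 1 <= Q.
Hypothesis w_gt0 : 0 < w.
Hypothesis w_le : w <= Lam.
Hypothesis sg_gt0 : 0 < sg.
Hypothesis l_ge1 : 1 <= l.
Hypothesis B_gt0 : 0 < B.
Hypothesis beta_ge0 : 0 <= beta.
Hypothesis r_gt0 : (0 < r)%N.
Hypothesis D_gt0 : (0 < D)%N.
Hypothesis At_opb : opb Lam At.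
Hypothesis gam0 : 0 <= gam.
Hypothesis g_large : 8 * gam <= g.
Hypothesis g_ge : 1404 * (Q ^+ 2 * (Num.sqrt r%:R * (Lam * w))) <= g.
Hypothesis H_opb : opb gam H.
Hypothesis AE : fn (At *m E^T) <= 46 * Q * Num.sqrt r%:R * Lam * w.
Hypothesis Z_opb : opb (39 * Q * w + 6 * (sD * sg)) Z.
Hypothesis E_col : forall c, fn (row c E^T) <= 19 * Q * w.
Hypothesis b_opb : opb w b.
Hypothesis b_row : fn (row i b) * sd <= w.
Hypothesis bZ_row : fn (row i b *m Z^T) * sd <= 6 * Q * (w * w + B * l * sd * (sd * beta)).
Hypothesis beta_le : beta * (sd * sD) <= w.
Hypothesis sgl : sg * Num.sqrt l * sd <= w.
Hypothesis sgDl : sg ^+ 2 * (sd * sD) * l <= w ^+ 2.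
Hypothesis Blsd : B * l * sd <= w.
Hypothesis th_sd : 1 <= th * sd.
Hypothesis U_row : fn (row i U) <= th.

Local Notation Y := (loo_iter i H U q).

Hypothesis deviation : forall j,
  `|\sum_c ((mxdrop R i *m X)^T *m Y) c j * Z i c|
  <= (2 * Q + 4) * (sg * Num.sqrt l * Num.sqrt (\sum_c ((mxdrop R i *m X)^T *m Y) c j ^+ 2)
       + B * l * \big[Num.max/0]_c `|((mxdrop R i *m X)^T *m Y) c j|).
Hypothesis rows : forall j s, (s <= q)%N -> fn (row j (mxp H s *m U)) <= g ^+ s * th.

(** Row i of Z is the only fresh randomness; it meets X^T Y, which equals the product without row i
    of X because row i of Y vanishes. Bernstein there needs the Euclidean norm, from the operator
    bound of Y, and the largest entry, from the row bounds of Y. *)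
Lemma loo_gram_step : fn (row i H *m Y) <= g ^+ q.+1 * th / 2.
Proof.
have l0 := le_trans ler01 l_ge1; have Q0 := le_trans ler01 Q_ge1.
have B0 := ltW B_gt0; have sg0 := ltW sg_gt0; have w0 := ltW w_gt0.
have Lam0 := le_trans w0 w_le.
have sd0 : 0 <= sd by exact: sqrtr_ge0. have sD0 : 0 <= sD by exact: sqrtr_ge0.
have sd_gt0 : 0 < sd.
  by rewrite lt_neqAle sd0 andbT; apply: contraTneq th_sd => <-; rewrite mulr0 ler10.
have th0 : 0 <= th by rewrite -(pmulr_lge0 _ sd_gt0) (le_trans ler01).
have sD1 : 1 <= sD by rewrite -[leLHS]sqrtr1 ler_wsqrtr // ler1n.
have r1 : 1 <= Num.sqrt r%:R :> R by rewrite -[leLHS]sqrtr1 ler_wsqrtr // ler1n.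
have sr0 := le_trans ler01 r1.
have gam_g : gam <= g by have h := g_large; have h' := gam0; lra.
have g0 := le_trans gam0 gam_g.
have gg : gam ^+ q <= g ^+ q by rewrite lerXn2r ?nnegrE.
have gq0 : 0 <= gam ^+ q by nonneg. have ggq0 : 0 <= g ^+ q by nonneg.
have HT : H^T = H.
  have tB (P P' : 'M[R]_d) : (P - P')^T = P^T - P'^T by rewrite linearB.
  by rewrite HE !tB tr_scalar_mx !trmx_mul !trmxK.
(* Since th sqrt d is at least 1, a bound by c / sqrt d implies one by c th. *)
have sdth (x c : R) : 0 <= x -> x * sd <= c -> x <= c * th.
  move=> x0 xc; apply: (@le_trans _ _ (x * (th * sd))); first by rewrite ler_peMr.
  by rewrite mulrCA mulrC ler_wpM2r.
have Yop : opb (gam ^+ q) Y by apply: loo_iter_opb => //; exact: opb_orthonormal.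
have dropY : mxdrop R i *m Y = Y.
  apply/matrixP => j k; rewrite mxdrop_mulE; case: eqP => // ->.
  by have /matrixP /(_ 0 k) := loo_iter_row i H U q; rewrite !mxE.
have XY : (mxdrop R i *m X)^T *m Y = X^T *m Y by rewrite [(_ *m X)^T]trmx_mul mxdrop_tr -mulmxA dropY.
have rowY : row i Y = 0 by exact: loo_iter_row.
(* From H = M E^T + E X^T - v; the shift disappears with row i of Y. The last group collects the
   bias of row i. *)
have -> : row i H *m Y = row i U *m (At *m E^T) *m Y
   + (row i Z *m (X^T *m Y) + (row i b *m (At^T *m U^T) *m Y + row i b *m b^T *m Y + row i b *m Z^T *m Y)).
  have HE' : H = M *m E^T + E *m X^T - v%:M.
    rewrite HE; set M0 := M; rewrite [X^T]linearD /= !mulmxDl !mulmxDr.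
    by apply/matrixP => a c; rewrite !mxE; ring.
  move: rowY; move: (loo_iter i H U q) => Y0 rowY; rewrite HE'.
  have rB (P P' : 'M[R]_d) : row i (P - P') = row i P - row i P' by rewrite linearB.
  have rD (P P' : 'M[R]_d) : row i (P + P') = row i P + row i P' by rewrite linearD.
  rewrite rB rD mulmxBl mulmxDl.
  rewrite (_ : row i v%:M *m Y0 = 0) ?subr0; last first.
    by rewrite -scalemx1 rowE -scalemxAr mulmx1 -scalemxAl -rowE rowY scaler0.
  rewrite !row_mul [row i (Z + b)]linearD /= !mulmxA; congr (_ + _).
  rewrite -![_ *m X^T *m Y0]mulmxA mulmxDl; congr (_ + _).
  rewrite mulmxA -!mulmxDl; congr (_ *m _).
  have tD (P P' : 'M[R]_(d, D)) : (P + P')^T = P^T + P'^T by rewrite linearD.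
  rewrite !tD trmx_mul !mulmxDr -addrA mulmxA; congr (_ + _).
  exact: addrC.
have T1 : fn (row i U *m (At *m E^T) *m Y) <= 46 * Q * Num.sqrt r%:R * Lam * w * th * g ^+ q.
  apply: (le_trans (Yop _)); rewrite mulrC; apply: ler_pM => //; first exact: fn_ge0.
  apply: (le_trans (fn_mulmx _ _)); rewrite mulrC; apply: ler_pM => //; exact: fn_ge0.
have bi : fn (row i b) <= w * th by apply: sdth => //; exact: fn_ge0.
have sdbeta : sd * beta <= w.
  apply: le_trans beta_le; rewrite mulrC; apply: ler_wpM2l => //.
  by rewrite ler_peMr.
have T3 : fn (row i b *m (At^T *m U^T) *m Y + row i b *m b^T *m Y + row i b *m Z^T *m Y)
    <= 14 * Q * Lam * w * th * g ^+ q.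
  rewrite -!mulmxDl; apply: (le_trans (Yop _)); rewrite mulrC; apply: ler_pM => //; first exact: fn_ge0.
  have t1 : fn (row i b *m (At^T *m U^T)) <= Lam * (w * th).
    apply: (@le_trans _ _ (Lam * fn (row i b))); last by rewrite ler_wpM2l.
    have h : opb (Lam * 1) (At^T *m U^T).
      by apply: opbM => //; [exact: opb_tr|exact: opb_orthonormalT].
    by have := h (row i b); rewrite mulr1.
  have t2 : fn (row i b *m b^T) <= Lam * (w * th).
    apply: (le_trans (opb_tr w0 b_opb (row i b))); apply: ler_pM => //; exact: fn_ge0.
  have t3 : fn (row i b *m Z^T) <= 12 * Q * (Lam * w) * th.
    apply: sdth; first exact: fn_ge0.
    apply: (le_trans bZ_row).
    rewrite (_ : 12 * _ * _ = 6 * Q * (Lam * w + Lam * w)); last by ring.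
    apply: ler_wpM2l; first by nonneg.
    apply: lerD; first by rewrite ler_wpM2r.
    rewrite mulrC; apply: ler_pM => //; try by nonneg.
    by apply: le_trans w_le.
  have t4 : Lam * w * th <= Q * (Lam * w * th) by rewrite ler_peMl //; nonneg.
  apply: (le_trans (fnD _ _)); apply: (le_trans (lerD (fnD _ _) (lexx _))); lra.
have colY j : Num.sqrt (\sum_k Y k j ^+ 2) <= gam ^+ q by exact: fn_col_le.
have colY' j : Num.sqrt (\sum_k Y k j ^+ 2) <= sd * (3 * (g ^+ q * th)).
  apply: sqrt_le; first by nonneg.
  rewrite exprMn sqr_sqrtr // [X in _ <= X]mulr_natl -[X in _ <= _ *+ X]card_ord -sumr_const.
  apply: ler_sum => k _.
  have h : fn (row k Y) <= g ^+ q * (th + 2 * th).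
    apply: (loo_iter_row_le gam0 H_opb g_large th0) => //; exact: rows.
  have h2 : `|Y k j| <= 3 * (g ^+ q * th).
    have := fn_entry_le (row k Y) 0 j; rewrite mxE => h3.
    have h4 := le_trans h3 h; lra.
  by rewrite -(real_normK (num_real (Y k j))) ler_pXn2r ?nnegrE //; nonneg.
have Xop : opb (Lam + (w + (39 * Q * w + 6 * (sD * sg)))) X.
  apply: opbD; last by have := opbD b_opb Z_opb; rewrite [b + Z]addrC.
  have := opbM Lam0 (opb_orthonormal U_orth) At_opb; by rewrite mul1r.
have Xn0 : 0 <= Lam + (w + (39 * Q * w + 6 * (sD * sg))) by nonneg.
have dv j : `|\sum_c (X^T *m Y) c j * (row i Z) 0 c| <= 642 * Q ^+ 2 * Lam * w * th * g ^+ q.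
  under eq_bigr => c _ do rewrite [row _ _ _ _]mxE.
  rewrite -XY; apply: (le_trans (deviation j)); rewrite XY.
  have n1 : Num.sqrt (\sum_c (X^T *m Y) c j ^+ 2) <= (Lam + (w + (39 * Q * w + 6 * (sD * sg)))) * gam ^+ q.
    apply: fn_col_le; first by nonneg.
    by apply: opbM => //; exact: opb_tr.
  have n2 : \big[Num.max/0]_c `|(X^T *m Y) c j| <= (Lam + 19 * Q * w) * (sd * (3 * (g ^+ q * th))).
    apply/bigmax_leP; split; first by nonneg.
    move=> c _; rewrite mxE; apply: (le_trans (sum_mul_le _ _)).
    apply: ler_pM; rewrite ?sqrtr_ge0 //.
    rewrite -fn_rowE linearD linearD /=; apply: (le_trans (fnD _ _)); apply: lerD; last by exact: E_col.
    apply: opb_row; apply: opb_tr => //.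
    by have := opbM Lam0 (opb_orthonormal U_orth) At_opb; rewrite mul1r.
  have sl0 : 0 <= sg * Num.sqrt l by nonneg.
  have s1 : sg * Num.sqrt l <= w * th by exact: sdth.
  have s2 : sg * Num.sqrt l * (sD * sg) <= w ^+ 2 * th.
    apply: sdth; first by nonneg.
    apply: le_trans sgDl; rewrite (_ : _ * sd = sg ^+ 2 * (sd * sD) * Num.sqrt l); last by ring.
    rewrite ler_wpM2l //; first by nonneg.
    apply: sqrt_le => //; by rewrite expr2 ler_peMl.
  have m1 : sg * Num.sqrt l * Num.sqrt (\sum_c (X^T *m Y) c j ^+ 2) <= 47 * (Q * Lam * w * th) * g ^+ q.
    apply: (@le_trans _ _ (sg * Num.sqrt l * ((Lam + (w + (39 * Q * w + 6 * (sD * sg)))) * gam ^+ q))).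
      by rewrite ler_wpM2l.
    rewrite mulrA; apply: ler_pM => //; first by nonneg.
    rewrite (_ : sg * Num.sqrt l * _ = sg * Num.sqrt l * (Lam + w + 39 * Q * w) + 6 * (sg * Num.sqrt l * (sD * sg))); last by ring.
    have q1 : sg * Num.sqrt l * (Lam + w + 39 * Q * w) <= w * th * (41 * (Q * Lam)).
      apply: ler_pM => //; first by nonneg.
      have a1 : Lam <= Q * Lam by rewrite ler_peMl.
      have a2 : Q * w <= Q * Lam by rewrite ler_wpM2l.
      have a3 := w_le; rewrite -mulrA; lra.
    have q2 : w ^+ 2 * th <= Q * Lam * w * th.
      rewrite expr2 ler_wpM2r // ler_wpM2r //; apply: (le_trans w_le); by rewrite ler_peMl.
    lra.
  have m2 : B * l * \big[Num.max/0]_c `|(X^T *m Y) c j| <= 60 * (Q * Lam * w * th) * g ^+ q.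
    apply: (@le_trans _ _ (B * l * ((Lam + 19 * Q * w) * (sd * (3 * (g ^+ q * th)))))).
      by rewrite ler_wpM2l //; nonneg.
    rewrite (_ : B * l * _ = (B * l * sd) * (Lam + 19 * Q * w) * (3 * (g ^+ q * th))); last by ring.
    rewrite (_ : 60 * _ * _ = w * (20 * (Q * Lam)) * (3 * (g ^+ q * th))); last by ring.
    apply: ler_wpM2r; first by nonneg.
    apply: ler_pM => //; [by nonneg|by nonneg|].
    have a1 : Lam <= Q * Lam by rewrite ler_peMl.
    have a2 : Q * w <= Q * Lam by rewrite ler_wpM2l.
    rewrite -mulrA; lra.
  apply: (@le_trans _ _ (6 * Q * (47 * (Q * Lam * w * th) * g ^+ q + 60 * (Q * Lam * w * th) * g ^+ q))).
    apply: ler_pM => //; [by nonneg| |by have h := Q_ge1; lra|exact: lerD].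
    rewrite addr_ge0 ?mulr_ge0 ?sqrtr_ge0 //.
    by apply: bigmax_ge_id.
  by rewrite le_eqVlt; apply/orP; left; apply/eqP; ring.
have c642 : 0 <= 642 * Q ^+ 2 * Lam * w * th * g ^+ q.
  have P0 : 0 <= Q ^+ 2 * Lam * w * th * g ^+ q by nonneg.
  by have := mulr_ge0 (ler0n R 642) P0; rewrite !mulrA.
have T2 : fn (row i Z *m (X^T *m Y)) <= Num.sqrt r%:R * (642 * Q ^+ 2 * Lam * w * th * g ^+ q).
  apply: fn_row_entries => // j; rewrite mxE.
  by under eq_bigr => c _ do rewrite mulrC; exact: dv.
apply: (le_trans (fnD _ _)); apply: (le_trans (lerD T1 (le_trans (fnD _ _) (lerD T2 T3)))).
set P := Num.sqrt r%:R * (Lam * w * th * g ^+ q).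
have P1 : Lam * w * th * g ^+ q <= P by rewrite ler_peMl //; nonneg.
have P0 : 0 <= Lam * w * th * g ^+ q by nonneg.
have QP : Q * P <= Q ^+ 2 * P by rewrite ler_wpM2r ?(le_trans P0) // expr2 ler_peMl.
have QP0 : Q * (Lam * w * th * g ^+ q) <= Q * P by rewrite ler_wpM2l.
have QP1 : 0 <= Q ^+ 2 * P by rewrite mulr_ge0 ?sqr_ge0 ?(le_trans P0).
(* 702 is 46 for the signal, 642 = 6 (47 + 60) for the fresh row and 14 for the bias; the half in
   the goal makes it 1404 in [g_ge]. *)
have gP : 702 * (Q ^+ 2 * P) <= g ^+ q.+1 * th / 2.
  rewrite ler_pdivlMr // [g ^+ q.+1]exprS (_ : 702 * _ * 2 = 1404 * (Q ^+ 2 * (Num.sqrt r%:R * (Lam * w))) * (g ^+ q * th)).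
    by rewrite -[leRHS]mulrA ler_wpM2r // mulr_ge0.
  by rewrite /P; ring.
rewrite (_ : 46 * _ * _ * _ * _ * _ * _ = 46 * (Q * P)); last by rewrite /P; ring.
rewrite (_ : 14 * _ * _ * _ * _ * _ = 14 * (Q * (Lam * w * th * g ^+ q))); last by ring.
rewrite (_ : _ * (642 * _ * _ * _ * _ * _) = 642 * (Q ^+ 2 * P)); last by rewrite /P; ring.
lra.
Qed.

End LooGram.

(** * The leave-one-out step for dilations *)

Section LooStep.
Variables (R : realType) (n N s : nat) (H : 'M[R]_N) (U : 'M[R]_(N, s)).
Variables (sig : 'I_n -> 'I_N) (a : 'I_N) (q : nat) (z b : 'rV[R]_n).
Variables (gam g Q w sg l B tha tho : R).
Local Notation Y := (loo_iter a H U q).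
Hypothesis sig_inj : injective sig.
Hypothesis H_sym : H^T = H.
Hypothesis gam0 : 0 <= gam.
Hypothesis H_opb : opb gam H.
Hypothesis g_large : 8 * gam <= g.
Hypothesis g_ge : 50 * (Q * (Num.sqrt s%:R * w)) <= g.
Hypothesis U_opb : opb 1 U.
Hypothesis s_gt0 : (0 < s)%N.
Hypothesis rowH : row a H *m Y = (z + b) *m rowsub sig Y.
Hypothesis Q_ge1 : 1 <= Q.
Hypothesis w0 : 0 <= w.
Hypothesis sg0 : 0 <= sg.
Hypothesis l0 : 0 <= l.
Hypothesis B0 : 0 <= B.
Hypothesis tha0 : 0 <= tha.
Hypothesis tho0 : 0 <= tho.
Hypothesis fb : fn b <= w * tha.
Hypothesis sgl : sg * Num.sqrt l <= w * tha.
Hypothesis Bl : B * l <= w.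
Hypothesis Blt : B * l * tho <= w * tha.
Hypothesis deviation : forall j, `|\sum_c Y (sig c) j * z 0 c|
  <= (2 * Q + 4) * (sg * Num.sqrt l * Num.sqrt (\sum_c Y (sig c) j ^+ 2)
       + B * l * \big[Num.max/0]_c `|Y (sig c) j|).
Hypothesis rows_a : forall p, (p <= q)%N -> fn (row a (mxp H p *m U)) <= g ^+ p * tha.
Hypothesis rows_o : forall c, fn (row (sig c) (mxp H q *m U)) <= g ^+ q * tho.

Lemma orthonormal_colsub1 : orthonormal_cols (colsub sig 1%:M : 'M[R]_(N, n)).
Proof.
apply/matrixP => i j; rewrite !mxE (bigD1 (sig i)) //= big1 => [|k ki].
  by rewrite !mxE eqxx mul1r addr0 (inj_eq sig_inj).
by rewrite !mxE (negbTE ki) mul0r.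
Qed.

(** Row a of the dilation is a row or a column of the noise, placed by [sig], and it multiplies the
    iterate directly. Deviation 24 = 6 (1 + 3) and bias 1 make 25, half of the 50 in [g_ge]. *)
Lemma loo_step : fn (row a H *m Y) <= g ^+ q.+1 * tha / 2.
Proof.
have Q0 := le_trans ler01 Q_ge1.
have s1 : 1 <= Num.sqrt s%:R :> R by rewrite -[leLHS]sqrtr1 ler_wsqrtr // ler1n.
have s0 := le_trans ler01 s1.
have gam_g : gam <= g by have h := g_large; have h' := gam0; lra.
have g0 := le_trans gam0 gam_g.
have gg : gam ^+ q <= g ^+ q by rewrite lerXn2r ?nnegrE.
have gq0 : 0 <= gam ^+ q by nonneg. have ggq0 : 0 <= g ^+ q by nonneg.
have Yop : opb (gam ^+ q) Y by apply: loo_iter_opb.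
have subE (Y0 : 'M[R]_(N, s)) : rowsub sig Y0 = (colsub sig 1%:M)^T *m Y0.
  apply/matrixP => i j; rewrite !mxE (bigD1 (sig i)) //= big1 => [|k ki].
    by rewrite !mxE eqxx mul1r addr0.
  by rewrite !mxE (negbTE ki) mul0r.
have Yop' : opb (gam ^+ q) (rowsub sig Y).
  rewrite subE -[gam ^+ q]mul1r; apply: opbM => //.
  exact: opb_orthonormalT orthonormal_colsub1.
have n1 j : Num.sqrt (\sum_c Y (sig c) j ^+ 2) <= g ^+ q.
  have := fn_col_le j gq0 Yop'; under eq_bigr => c _ do rewrite mxE.
  by move=> h; apply: le_trans gg.
have n2 j : \big[Num.max/0]_c `|Y (sig c) j| <= g ^+ q * (tho + 2 * tha).
  apply/bigmax_leP; split; first by nonneg.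
  move=> c _; have := fn_entry_le (row (sig c) Y) 0 j; rewrite mxE => h3.
  apply: (le_trans h3); by apply: (loo_iter_row_le gam0 H_opb g_large tha0).
pose dv := 24 * (Q * (w * tha * g ^+ q)).
have dvP j : `|\sum_c (rowsub sig Y) c j * z 0 c| <= dv.
  under eq_bigr => c _ do rewrite mxE.
  apply: (le_trans (deviation j)).
  have m1 : sg * Num.sqrt l * Num.sqrt (\sum_c Y (sig c) j ^+ 2) <= w * tha * g ^+ q.
    by apply: ler_pM => //; nonneg.
  have m2 : B * l * \big[Num.max/0]_c `|Y (sig c) j| <= 3 * (w * tha * g ^+ q).
    apply: (@le_trans _ _ (B * l * (g ^+ q * (tho + 2 * tha)))).
      by apply: ler_wpM2l; [nonneg|].
    rewrite (_ : B * l * _ = (B * l * tho + 2 * (B * l * tha)) * g ^+ q); last by ring.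
    rewrite [leRHS]mulrA ler_wpM2r //.
    have : B * l * tha <= w * tha by rewrite ler_wpM2r.
    have h := Blt; lra.
  apply: (@le_trans _ _ (6 * Q * (w * tha * g ^+ q + 3 * (w * tha * g ^+ q)))).
    apply: ler_pM => //; [by nonneg| |by have h := Q_ge1; lra|exact: lerD].
    rewrite addr_ge0 ?mulr_ge0 ?sqrtr_ge0 //.
    by apply: bigmax_ge_id.
  by rewrite le_eqVlt /dv; apply/orP; left; apply/eqP; ring.
have bP : fn (b *m rowsub sig Y) <= w * tha * g ^+ q.
  apply: (le_trans (Yop' b)); rewrite mulrC; apply: ler_pM => //; exact: fn_ge0.
have dv0 : 0 <= dv by rewrite /dv; nonneg.
rewrite rowH; apply: (le_trans (vec_mul_deviation dv0 dvP bP)).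
set P := Num.sqrt s%:R * (w * tha * g ^+ q).
have P1 : w * tha * g ^+ q <= P by rewrite ler_peMl //; nonneg.
have P0 : 0 <= w * tha * g ^+ q by nonneg.
have QP : P <= Q * P by rewrite ler_peMl // (le_trans P0).
rewrite (_ : _ * dv = 24 * (Q * P)); last by rewrite /dv /P; ring.
have gP : 25 * (Q * P) <= g ^+ q.+1 * tha / 2.
  rewrite ler_pdivlMr // exprS (_ : 25 * _ * 2 = 50 * (Q * (Num.sqrt s%:R * w)) * (g ^+ q * tha)).
    by rewrite -[leRHS]mulrA ler_wpM2r // mulr_ge0.
  by rewrite /P; ring.
lra.
Qed.

End LooStep.

(** * Events on which all rows of the iterates are bounded *)

Section ModeConcentration.
Variables (R : realType) (I A : finType) (p : I -> A -> R).
Hypothesis p_ge0 : forall i a, 0 <= p i a.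
Hypothesis p_sum1 : forall i, \sum_a p i a = 1.
Local Notation X := {ffun I -> A}.
Variables (d D r : nat) (io : 'I_d * 'I_D -> I) (f : 'I_d * 'I_D -> A -> R).
Hypothesis io_inj : injective io.
Variables (B sg v0 h2 beta l Q w Lam th : R) (pw q0 : nat).
Variables (U : 'M[R]_(d, r)) (At : 'M[R]_(r, D)).
Hypothesis B_gt0 : 0 < B.
Hypothesis sg_gt0 : 0 < sg.
Hypothesis l_ge1 : 1 <= l.
Hypothesis Q_ge1 : 1 <= Q.
Hypothesis beta_ge0 : 0 <= beta.
Hypothesis w_gt0 : 0 < w.
Hypothesis w_le : w <= Lam.
Hypothesis f_bound : forall ic a, `|centered p io f ic a| <= B.
Hypothesis f_var : forall ic, entry_var p io f ic <= sg ^+ 2.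
Hypothesis f_mean : forall ic, `|entry_mean p io f ic| <= beta.
Hypothesis v0_var : forall ic, `|entry_var p io f ic - v0| <= h2.
Hypothesis pw_ge : Q * l <= pw%:R.
Hypothesis pw_le : pw%:R <= 2 * Q * l.
Hypothesis Bl : B * l <= w.
Hypothesis dl : d%:R * l * sg ^+ 2 <= w ^+ 2.
Hypothesis dDl : sg ^+ 2 * (Num.sqrt d%:R * Num.sqrt D%:R) * l <= w ^+ 2.
Hypothesis BlD : (B * l) ^+ 2 * (D%:R * sg ^+ 2) <= w ^+ 4.
Hypothesis Dh : D%:R * h2 <= w ^+ 2.
Hypothesis mean_w : beta * (Num.sqrt d%:R * Num.sqrt D%:R) <= w.
Hypothesis Blbd : B * l * beta * d%:R <= w ^+ 2.
Hypothesis U_orth : orthonormal_cols U.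
Hypothesis At_opb : opb Lam At.
Hypothesis r_gt0 : (0 < r)%N.
Hypothesis D_gt0 : (0 < D)%N.
Hypothesis th_sd : 1 <= th * Num.sqrt d%:R.
Hypothesis U_row : forall i, fn (row i U) <= th.

Local Notation E := (noise_mx io f).
Local Notation Z := (centered_mx p io f).
Local Notation b := (mean_mx p io f).
Local Notation rt := (Num.sqrt (r%:R : R)).

Let Lam_ge0 : 0 <= Lam. Proof. exact: le_trans (ltW w_gt0) w_le. Qed.
Let pw_pos : (0 < pw)%N.
Proof. by rewrite -(ltr0n R); apply: lt_le_trans pw_ge; rewrite mulr_gt0 ?(lt_le_trans ltr01). Qed.

Definition gram_error (x : X) : 'M[R]_d :=
  (U *m At + (Z x + b)) *m (U *m At + (Z x + b))^T - (D%:R * v0)%:M - (U *m At) *m (U *m At)^T.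

(** The vectors met by row i of the centered noise in [loo_gram_step], written with row i of X
    erased so that they do not depend on it. *)
Definition gram_probe (i : 'I_d) (q : nat) (x : X) : 'M[R]_(D, r) :=
  (mxdrop R i *m (U *m At + (Z x + b)))^T *m loo_iter i (gram_error x) U q.

Lemma noise_mx_upd_off (x : X) i c a j c' : j != i ->
  E (upd x (io (i, c)) a) j c' = E x j c'.
Proof.
by move=> ji; rewrite -(@rmat_upd R I A d D io f io_inj x (i, c) a (j, c')) // xpair_eqE (negbTE ji).
Qed.

Lemma mxdrop_noise_upd (x : X) i c a :
  mxdrop R i *m (U *m At + (Z (upd x (io (i, c)) a) + b)) = mxdrop R i *m (U *m At + (Z x + b)).
Proof.
rewrite -!noise_mxE; apply/matrixP => j c'; rewrite !mxdrop_mulE; case: (eqVneq j i) => // ji.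
by rewrite ![(U *m At + _) j c']mxE noise_mx_upd_off.
Qed.

(** With row and column i erased, the Gram error is the Gram matrix of X without row i minus a
    deterministic matrix. *)
Lemma gram_probe_upd i q (x : X) c a : gram_probe i q (upd x (io (i, c)) a) = gram_probe i q x.
Proof.
have looE y : loo_mx i (gram_error y) = (mxdrop R i *m (U *m At + (Z y + b)))
    *m (mxdrop R i *m (U *m At + (Z y + b)))^T
    - loo_mx i ((D%:R * v0)%:M + (U *m At) *m (U *m At)^T).
  rewrite /loo_mx /gram_error; set Xy := U *m At + _.
  rewrite [(mxdrop R i *m Xy)^T]trmx_mul mxdrop_tr -addrA -opprD mulmxBr mulmxBl.
  by rewrite !mulmxA.
have looU : loo_mx i (gram_error (upd x (io (i, c)) a)) = loo_mx i (gram_error x).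
  by rewrite !looE mxdrop_noise_upd.
by rewrite /gram_probe /loo_iter looU mxdrop_noise_upd.
Qed.

Definition gram_rows_good (x : X) : bool :=
  [forall ipj : 'I_d * 'I_q0 * 'I_r,
    `|\sum_c gram_probe ipj.1.1 ipj.1.2 x c ipj.2 * Z x ipj.1.1 c|
     <= dev B sg l Q (vnorm (fun c x => gram_probe ipj.1.1 ipj.1.2 x c ipj.2) x)
                     (vmax (fun c x => gram_probe ipj.1.1 ipj.1.2 x c ipj.2) x)].

Lemma gram_rows_prob : Pr p (fun x => ~~ gram_rows_good x) <= (d * q0 * r)%:R * (2 * expR (- (Q * l))).
Proof.
have -> : (d * q0 * r = #|{: 'I_d * 'I_q0 * 'I_r}|)%N by rewrite !card_prod !card_ord.
apply: (Pr_forall p_ge0) => -[[i q] j] /=.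
apply: (row_deviation (I := I) p_ge0 p_sum1 io_inj B_gt0 sg_gt0 l_ge1 Q_ge1 f_bound f_var
  (u := fun c x => gram_probe i q x c j)).
by move=> c c' x a; rewrite gram_probe_upd.
Qed.

Theorem mode_gram gam g : B * l * Num.sqrt d%:R <= w ->
  gam = 1600 * Q ^+ 2 * rt * Lam * w -> g = 12800 * Q ^+ 2 * rt * Lam * w ->
  exists2 good : pred X,
    Pr p (fun x => ~~ good x)
      <= ((d.+1)%:R * (D + d)%:R + 2 * d%:R + 2 * (d * d)%:R + 2 * (d * r)%:R + 2 * (d * q0 * r)%:R)
         * expR (- (Q * l)) &
    forall x, good x ->
      opb gam (gram_error x) /\
      forall q, (q <= q0)%N -> forall i, fn (row i (mxp (gram_error x) q *m U)) <= g ^+ q * th.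
Proof.
move=> Bld gamE gE.
have Q0 := le_trans ler01 Q_ge1; have w0 := ltW w_gt0.
have rt1 : 1 <= rt by rewrite -[leLHS]sqrtr1 ler_wsqrtr // ler1n.
have rt0 := le_trans ler01 rt1.
have Y0 : 0 <= Q ^+ 2 * rt * Lam * w by nonneg.
have gamY : gam = 1600 * (Q ^+ 2 * rt * Lam * w) by rewrite gamE; ring.
have gY : g = 12800 * (Q ^+ 2 * rt * Lam * w) by rewrite gE; ring.
have gam0 : 0 <= gam by rewrite gamY mulr_ge0 ?ler0n.
have g_large : 8 * gam <= g by rewrite gY gamY; lra.
have g_ge : 1404 * (Q ^+ 2 * (rt * (Lam * w))) <= g by rewrite gY !mulrA; lra.
have g0 : 0 <= g by lra.
exists (fun x => noise_good p io f B sg beta l Q At Lam pw x && gram_rows_good x).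
  apply: (le_trans (Pr_and p_ge0 (noise_good_prob p_ge0 p_sum1 io_inj B_gt0 sg_gt0 l_ge1 Q_ge1
    f_bound f_var beta_ge0 f_mean Lam_ge0 At_opb pw_ge pw_pos) gram_rows_prob)).
  by rewrite le_eqVlt; apply/orP; left; apply/eqP; ring.
move=> x /andP[good /forallP rows].
have Hop : opb gam (gram_error x).
  have := opb_mode p_ge0 B_gt0 sg_gt0 l_ge1 Q_ge1 beta_ge0 f_mean Lam_ge0 At_opb pw_ge w_gt0
    pw_le Bl dl dDl BlD v0_var Dh mean_w Blbd good (or_introl Bld) U_orth w_le r_gt0.
  by rewrite -gamE (noise_mxE p).
split=> //.
apply: (loo_row_bound gam0 Hop g_large (th := fun=> th)) => // i q qq0 hrows.
have ord_q : (q < q0)%N := qq0.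
apply: (@loo_gram_step R d D r U At (Z x) b (D%:R * v0) w Lam Q sg l B beta th gam g i q (gram_error x)) => //.
- have := fn_signal_noise p_ge0 B_gt0 sg_gt0 l_ge1 Q_ge1 beta_ge0 f_mean Lam_ge0 At_opb pw_ge w_gt0
    pw_le Bl dl dDl BlD mean_w good (or_introl Bld).
  by rewrite (noise_mxE p).
- exact: (opb_centered p_ge0 B_gt0 sg_gt0 l_ge1 Q_ge1 pw_ge w_gt0 pw_le Bl dl dDl BlD good).
- move=> c; have := fn_noise_col p_ge0 B_gt0 sg_gt0 l_ge1 Q_ge1 beta_ge0 f_mean pw_ge w_gt0
    pw_le Bl dl dDl BlD mean_w good c D_gt0.
  by rewrite (noise_mxE p).
- exact (opb_mean beta_ge0 f_mean w_gt0 mean_w).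
- exact (fn_mean_row beta_ge0 f_mean mean_w i).
- exact: (fn_row_mean_centered B_gt0 sg_gt0 l_ge1 Q_ge1 beta_ge0 f_mean w_gt0 dl mean_w good).
- exact (sg_sqrt sg_gt0 l_ge1 w_gt0 dl).
- move=> j; exact: (rows (i, Ordinal ord_q, j)).
Qed.

Section Matrix.
Variables (t : nat) (Wm : 'M[R]_(D, t)) (thR : R).
Hypothesis W_orth : orthonormal_cols Wm.
Hypothesis W_row : forall c, fn (row c Wm) <= thR.
Hypothesis thR_sD : 1 <= thR * Num.sqrt D%:R.
Hypothesis d_gt0 : (0 < d)%N.
Hypothesis Dl : D%:R * l * sg ^+ 2 <= w ^+ 2.
Hypothesis BlR : B * l * thR <= w * th.
Hypothesis BlL : B * l * th <= w * thR.

Local Notation Ub := (block_mx U 0 0 Wm).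
Local Notation HD x := (dilation (E x)).

Lemma opb_noise (x : X) : noise_good p io f B sg beta l Q At Lam pw x -> opb (46 * Q * w) (E x).
Proof.
move=> good.
have l0 := le_trans ler01 l_ge1; have sg0 := ltW sg_gt0.
have Q0 := le_trans ler01 Q_ge1; have w0 := ltW w_gt0.
have ss : Num.sqrt D%:R * sg <= w.
  rewrite -(@ler_pXn2r _ 2) ?nnegrE; [|done| |]; try by nonneg.
  rewrite exprMn sqr_sqrtr //; apply: le_trans Dl.
  by rewrite mulrAC ler_peMr //; nonneg.
have h1 := opb_centered p_ge0 B_gt0 sg_gt0 l_ge1 Q_ge1 pw_ge w_gt0 pw_le Bl dl dDl BlD good.
have h2' := opb_mean beta_ge0 f_mean w_gt0 mean_w.
rewrite (noise_mxE p); apply: opb_le (opbD h1 h2').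
have t3 : w <= Q * w by rewrite ler_peMl.
rewrite -!mulrA; lra.
Qed.

(** Erasing an index of the left block of the dilation forgets a row of the noise, one of the right
    block forgets a column. *)
Lemma loo_dilation_upd a (F F' : 'M[R]_(d, D)) q :
  (forall j k, lshift D j != a -> rshift d k != a -> F j k = F' j k) ->
  loo_iter a (dilation F) Ub q = loo_iter a (dilation F') Ub q.
Proof.
move=> FF; suff E0 : loo_mx a (dilation F) = loo_mx a (dilation F') by rewrite /loo_iter E0.
apply/matrixP => j k; rewrite !loo_mxE.
case: ifP => // /negbT; rewrite negb_or => /andP[ja ka].
case: (split_ordP j) ja => j' -> ja; case: (split_ordP k) ka => k' -> ka.
- by rewrite !block_mxEul.
- by rewrite !block_mxEur FF.
- by rewrite !block_mxEdl !mxE FF.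
- by rewrite !block_mxEdr.
Qed.

Definition left_probe i q (x : X) : 'M[R]_(d + D, r + t) := loo_iter (lshift D i) (HD x) Ub q.
Definition right_probe c q (x : X) : 'M[R]_(d + D, r + t) := loo_iter (rshift d c) (HD x) Ub q.

Lemma left_probe_upd i q (x : X) c a : left_probe i q (upd x (io (i, c)) a) = left_probe i q x.
Proof.
apply: loo_dilation_upd => j k ji _; apply: noise_mx_upd_off.
by apply: contra ji => /eqP ->.
Qed.

Lemma right_probe_upd c q (x : X) i a : right_probe c q (upd x (io (i, c)) a) = right_probe c q x.
Proof.
apply: loo_dilation_upd => j k _ kc.
rewrite -(@rmat_upd R I A d D io f io_inj x (i, c) a (j, k)) // xpair_eqE negb_and; apply/orP; right.
by apply: contra kc => /eqP ->.
Qed.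

Definition dilation_rows_good (x : X) : bool :=
  [forall ipj : 'I_d * 'I_q0 * 'I_(r + t),
    `|\sum_c left_probe ipj.1.1 ipj.1.2 x (rshift d c) ipj.2 * Z x ipj.1.1 c|
     <= dev B sg l Q (vnorm (fun c x => left_probe ipj.1.1 ipj.1.2 x (rshift d c) ipj.2) x)
                     (vmax (fun c x => left_probe ipj.1.1 ipj.1.2 x (rshift d c) ipj.2) x)]
  && [forall ipj : 'I_D * 'I_q0 * 'I_(r + t),
    `|\sum_i right_probe ipj.1.1 ipj.1.2 x (lshift D i) ipj.2 * Z x i ipj.1.1|
     <= dev B sg l Q (vnorm (fun i x => right_probe ipj.1.1 ipj.1.2 x (lshift D i) ipj.2) x)
                     (vmax (fun i x => right_probe ipj.1.1 ipj.1.2 x (lshift D i) ipj.2) x)].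

Lemma dilation_rows_prob : Pr p (fun x => ~~ dilation_rows_good x)
  <= (d * q0 * (r + t))%:R * (2 * expR (- (Q * l))) + (D * q0 * (r + t))%:R * (2 * expR (- (Q * l))).
Proof.
have -> : (d * q0 * (r + t) = #|{: 'I_d * 'I_q0 * 'I_(r + t)}|)%N by rewrite !card_prod !card_ord.
have -> : (D * q0 * (r + t) = #|{: 'I_D * 'I_q0 * 'I_(r + t)}|)%N by rewrite !card_prod !card_ord.
apply: (Pr_and p_ge0); apply: (Pr_forall p_ge0) => -[[i q] j] /=.
  apply: (row_deviation (I := I) p_ge0 p_sum1 io_inj B_gt0 sg_gt0 l_ge1 Q_ge1 f_bound f_var
    (u := fun c x => left_probe i q x (rshift d c) j)).
  by move=> c c' x a; rewrite left_probe_upd.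
apply: (col_deviation (I := I) p_ge0 p_sum1 io_inj B_gt0 sg_gt0 l_ge1 Q_ge1 f_bound f_var
  (u := fun c x => right_probe i q x (lshift D c) j)).
by move=> c c' x a; rewrite right_probe_upd.
Qed.

Theorem mode_dilation gam g : gam = 46 * Q * w -> g = 400 * Q * Num.sqrt (r + t)%:R * w ->
  exists2 good : pred X,
    Pr p (fun x => ~~ good x)
      <= ((d.+1)%:R * (D + d)%:R + 2 * d%:R + 2 * (d * d)%:R + 2 * (d * r)%:R
          + 2 * (d * q0 * (r + t))%:R + 2 * (D * q0 * (r + t))%:R) * expR (- (Q * l)) &
    forall x, good x ->
      [/\ opb (1600 * Q ^+ 2 * rt * Lam * w) (gram_error x), opb gam (E x) &
      forall q, (q <= q0)%N -> forall i,
        fn (row (lshift D i) (mxp (HD x) q *m Ub)) <= g ^+ q * th].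
Proof.
move=> gamE gE.
have Q0 := le_trans ler01 Q_ge1; have w0 := ltW w_gt0.
have l0 := le_trans ler01 l_ge1; have sg0 := ltW sg_gt0; have B0 := ltW B_gt0.
have rt_gt0 : (0 < r + t)%N by rewrite addn_gt0 r_gt0.
have rt1 : 1 <= Num.sqrt (r + t)%:R :> R by rewrite -[leLHS]sqrtr1 ler_wsqrtr // ler1n.
have rt0 := le_trans ler01 rt1.
have Y0 : 0 <= Q * w by nonneg.
have gamY : gam = 46 * (Q * w) by rewrite gamE; ring.
have gY : g = 400 * (Q * Num.sqrt (r + t)%:R * w) by rewrite gE; ring.
have Y1 : Q * w <= Q * Num.sqrt (r + t)%:R * w by rewrite mulrAC ler_peMr.
have gam0 : 0 <= gam by rewrite gamY mulr_ge0 ?ler0n.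
have g_large : 8 * gam <= g by rewrite gY gamY; lra.
have g_ge : 50 * (Q * (Num.sqrt (r + t)%:R * w)) <= g by rewrite gY !mulrA; lra.
have sd0 := sqrtr_ge0 (d%:R : R); have sD0 := sqrtr_ge0 (D%:R : R).
have th0 : 0 <= th.
  by rewrite leNgt; apply/negP => /ltW h; have := mulr_le0_ge0 h sd0; have h' := th_sd; lra.
have thR0 : 0 <= thR.
  by rewrite leNgt; apply/negP => /ltW h; have := mulr_le0_ge0 h sD0; have h' := thR_sD; lra.
exists (fun x => noise_good p io f B sg beta l Q At Lam pw x && dilation_rows_good x).
  apply: (le_trans (Pr_and p_ge0 (noise_good_prob p_ge0 p_sum1 io_inj B_gt0 sg_gt0 l_ge1 Q_ge1
    f_bound f_var beta_ge0 f_mean Lam_ge0 At_opb pw_ge pw_pos) dilation_rows_prob)).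
  by rewrite le_eqVlt; apply/orP; left; apply/eqP; ring.
move=> x /andP[good /andP[/forallP rowsL /forallP rowsR]].
have Eop : opb gam (E x) by rewrite gamE; exact: opb_noise.
split=> //.
  have := opb_mode p_ge0 B_gt0 sg_gt0 l_ge1 Q_ge1 beta_ge0 f_mean Lam_ge0 At_opb pw_ge w_gt0
    pw_le Bl dl dDl BlD v0_var Dh mean_w Blbd good (or_intror Dl) U_orth w_le r_gt0.
  by rewrite (noise_mxE p).
have Hop : opb gam (HD x) by apply: opb_dilation.
have Uop : opb 1 Ub by apply: opb_orthonormal; exact: orthonormal_block.
(* The two blocks have factors of different incoherence, hence different row bounds; [BlR] and [BlL]
   make them compatible. *)
pose tha (a : 'I_(d + D)) := match fintype.split a with inl _ => th | inr _ => thR end.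
have thaL i : tha (lshift D i) = th by rewrite /tha (unsplitK (inl i : 'I_d + 'I_D)).
have thaR c : tha (rshift d c) = thR by rewrite /tha (unsplitK (inr c : 'I_d + 'I_D)).
have tha0 a : 0 <= tha a by rewrite /tha; case: fintype.split.
have sgl : sg * Num.sqrt l * Num.sqrt d%:R <= w by exact (sg_sqrt sg_gt0 l_ge1 w_gt0 dl).
have sglD : sg * Num.sqrt l * Num.sqrt D%:R <= w by exact (sg_sqrt sg_gt0 l_ge1 w_gt0 Dl).
have up (y s u : R) : 0 <= y -> y * s <= w -> 1 <= u * s -> 0 <= u -> y <= w * u.
  move=> y0 ys us u0; apply: (@le_trans _ _ (y * (u * s))); first by rewrite ler_peMr.
  by rewrite mulrCA mulrC ler_wpM2r.
have rowsE : forall q, (q <= q0)%N -> forall a, fn (row a (mxp (HD x) q *m Ub)) <= g ^+ q * tha a.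
  apply: (loo_row_bound gam0 Hop g_large (th := tha)).
    move=> a; case: (split_ordP a) => a' ->; rewrite ?thaL ?thaR.
      have -> : row (lshift D a') Ub = row_mx (row a' U) 0.
        by rewrite -row_usubmx block_mxEv col_mxKu row_row_mx row0.
      apply: (@le_trans _ _ (fn (row a' U))); last exact: U_row.
      by apply: fn_le_sqr; [exact: fn_ge0|rewrite fn_row_mx fn0 expr0n addr0].
    have -> : row (rshift d a') Ub = row_mx 0 (row a' Wm).
      by rewrite -row_dsubmx block_mxEv col_mxKd row_row_mx row0.
    apply: (@le_trans _ _ (fn (row a' Wm))); last exact: W_row.
    by apply: fn_le_sqr; [exact: fn_ge0|rewrite fn_row_mx fn0 expr0n add0r].
  move=> a q qq0 hrows; case: (split_ordP a) hrows => i -> hrows; rewrite ?thaL ?thaR.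
    apply: (@loo_step R D (d + D) (r + t) (HD x) Ub (@rshift d D) (lshift D i) q (row i (Z x)) (row i b)
      gam g Q w sg l B th thR) => //.
    - exact: rshift_inj.
    - rewrite -linearD /= -noise_mxE; move: (loo_iter _ _ _ _) => Y.
      apply/rowP => j; rewrite !mxE big_split_ord /= big1 ?add0r => [|k _].
        by apply: eq_bigr => k _; rewrite mxE block_mxEur !mxE.
      by rewrite mxE block_mxEul mxE mul0r.
    - apply: (up _ (Num.sqrt d%:R)) => //; [exact: fn_ge0|].
      exact (fn_mean_row beta_ge0 f_mean mean_w i).
    - by apply: (up _ (Num.sqrt d%:R)) => //; nonneg.
    - move=> j; under eq_bigr => c _ do rewrite [row _ _ _ _]mxE.
      exact: (rowsL (i, Ordinal qq0, j)).
    - by move=> s sq; rewrite -(thaL i); exact: hrows.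
    - by move=> c; rewrite -(thaR c); exact: hrows.
  apply: (@loo_step R d (d + D) (r + t) (HD x) Ub (@lshift d D) (rshift d i) q (row i (Z x)^T) (row i b^T)
    gam g Q w sg l B thR th) => //.
  - exact: lshift_inj.
  - rewrite -!linearD /= -noise_mxE; move: (loo_iter _ _ _ _) => Y.
    apply/rowP => j; rewrite !mxE big_split_ord /= [X in _ + X]big1 ?addr0 => [|k _].
      by apply: eq_bigr => k _; rewrite mxE block_mxEdl !mxE.
    by rewrite mxE block_mxEdr mxE mul0r.
  - apply: (up _ (Num.sqrt D%:R)) => //; [exact: fn_ge0|].
    rewrite fn_rowE; apply: le_trans mean_w.
    rewrite [leRHS]mulrA ler_wpM2r //.
    apply: sqrt_le; first by nonneg.
    rewrite exprMn sqr_sqrtr // [X in _ <= X]mulr_natr -[X in _ <= _ *+ X]card_ord -sumr_const.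
    apply: ler_sum => k _.
    by rewrite !mxE -(real_normK (num_real (entry_mean _ _ _ _))) ler_pXn2r ?nnegrE.
  - by apply: (up _ (Num.sqrt D%:R)) => //; nonneg.
  - move=> j; under eq_bigr => c _ do rewrite [row _ _ _ _]mxE [_^T _ _]mxE.
    exact: (rowsR (i, Ordinal qq0, j)).
  - by move=> s sq; rewrite -(thaR i); exact: hrows.
  - by move=> c; rewrite -(thaL c); exact: hrows.
by move=> q qq i; rewrite -(thaL i); exact: rowsE.
Qed.

End Matrix.
End ModeConcentration.

(** * Spectral norm of a random tensor *)

Section Hoeffding.
Variables (R : realType) (I A : finType) (p : I -> A -> R).
Hypothesis p_ge0 : forall i a, 0 <= p i a.
Hypothesis p_sum1 : forall i, \sum_a p i a = 1.
Local Notation X := {ffun I -> A}.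

(** The bound 9 = 3^2 fits products of grid vectors near unit vectors. At the parameter sqrt S / (3
    L) the exponent gains 4 S and loses at most 2 S. *)
Lemma hoeffding1 (f : I -> A -> R) (z : I -> R) (L S : R) :
  (forall i, \sum_a p i a * f i a = 0) -> (forall i a, `|f i a| <= L) -> 0 < L -> 0 < S ->
  \sum_i z i ^+ 2 <= 9 ->
  Pr p (fun x => 12 * (L * Num.sqrt S) < \sum_i z i * f i (x i)) <= expR (- (2 * S)).
Proof.
move=> f0 fL L0 S0 z9.
pose y := Num.sqrt S / (3 * L).
have sS : 0 < Num.sqrt S by rewrite sqrtr_gt0.
have y0 : 0 < y by rewrite divr_gt0 // mulr_gt0.
pose G i (_ : X) a := y * z i * f i a - 2 * L ^+ 2 * (y * z i) ^+ 2.
have E1 : Ex p (fun x => expR (\sum_i G i x (x i))) <= 1.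
  apply: (@Ex_expR_le1 R I A p p_ge0 p_sum1 I id G) => // i x.
  exact: mgf_bounded_le1.
apply: (@le_trans _ _ (Ex p (fun x => expR (\sum_i G i x (x i))) / expR (2 * S))).
  apply: (Pr_markov p_ge0); [exact: expR_gt0|by move=> x; exact: expR_ge0|move=> x h].
  rewrite ler_expR /G sumrB.
  have -> : \sum_i y * z i * f i (x i) = y * \sum_i z i * f i (x i).
    by rewrite mulr_sumr; apply: eq_bigr => i _; rewrite mulrA.
  have -> : \sum_i 2 * L ^+ 2 * (y * z i) ^+ 2 = 2 * (L * y) ^+ 2 * \sum_i z i ^+ 2.
    by rewrite mulr_sumr; apply: eq_bigr => i _; ring.
  have Ly : L * y = Num.sqrt S / 3 by rewrite /y; field; rewrite gt_eqF.
  have a1 : y * (12 * (L * Num.sqrt S)) = 4 * S.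
    rewrite (_ : _ * _ = 12 * Num.sqrt S * (L * y)); last by ring.
    rewrite Ly (_ : _ * _ = 4 * Num.sqrt S ^+ 2); last by field.
    by rewrite sqr_sqrtr // ltW.
  have a2 : 2 * (L * y) ^+ 2 * \sum_i z i ^+ 2 <= 2 * S.
    apply: (@le_trans _ _ (2 * (L * y) ^+ 2 * 9)); first by rewrite ler_wpM2l // mulr_ge0 ?sqr_ge0.
    rewrite Ly (_ : _ * 9 = 2 * Num.sqrt S ^+ 2); last by field.
    by rewrite sqr_sqrtr // ltW.
  have a3 : y * (12 * (L * Num.sqrt S)) <= y * \sum_i z i * f i (x i) by rewrite ler_wpM2l ?ltW.
  lra.
by rewrite expRN -[leRHS]mul1r ler_wpM2r // invr_ge0 expR_ge0.
Qed.

Lemma hoeffding (f : I -> A -> R) (z : I -> R) (L S : R) :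
  (forall i, \sum_a p i a * f i a = 0) -> (forall i a, `|f i a| <= L) -> 0 < L -> 0 < S ->
  \sum_i z i ^+ 2 <= 9 ->
  Pr p (fun x => ~~ (`|\sum_i z i * f i (x i)| <= 12 * (L * Num.sqrt S))) <= 2 * expR (- (2 * S)).
Proof.
move=> f0 fL L0 S0 z9.
have h1 := hoeffding1 f0 fL L0 S0 z9.
have h2 : Pr p (fun x => 12 * (L * Num.sqrt S) < \sum_i - z i * f i (x i)) <= expR (- (2 * S)).
  by apply: hoeffding1 => //; under eq_bigr => i _ do rewrite sqrrN.
rewrite (_ : 2 * _ = expR (- (2 * S)) + expR (- (2 * S))); last by ring.
apply: le_trans (lerD h1 h2); apply: le_trans (Pr_or p_ge0 _ _).
apply: (Pr_le p_ge0) => x /=; rewrite -ltNge ltr_normr; case/orP => [->//|h].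
apply/orP; right; apply: (lt_le_trans h).
by rewrite -sumrN; apply: ler_sum => i _; rewrite mulNr.
Qed.

End Hoeffding.

(** * Rounding the arguments of a multilinear form to a grid *)

Section GridRounding.
Variables (R : realType) (m : nat) (d : 'I_m -> nat) (K : nat) (dl : R).
Hypothesis dl_gt0 : 0 < dl.
Hypothesis K_large : dl^-1 + 1 <= K%:R.
Local Notation pt := {k : 'I_m & 'I_(d k)}.

(** One function on all pairs of a mode and a coordinate codes a whole tuple of grid vectors, so the
    union bound runs over a single finite type. *)
Definition grid_pt (v : {ffun pt -> 'I_(K + K).+1}) (k : 'I_m) (i : 'I_(d k)) : R :=
  dl * ((v (Tagged _ i))%:R - K%:R).

Lemma grid_bracket (x : R) : `|x| <= 1 -> exists lo hi : 'I_(K + K).+1,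
  [/\ dl * (lo%:R - K%:R) <= x, x <= dl * (hi%:R - K%:R),
      `|dl * (lo%:R - K%:R) - x| <= dl & `|dl * (hi%:R - K%:R) - x| <= dl].
Proof.
move=> x1; have d0 := ltW dl_gt0.
have xd : `|x / dl| <= dl^-1 by rewrite normrM (ger0_norm (x := dl^-1)) ?invr_ge0 // ler_piMl ?invr_ge0.
have Kl := K_large.
have y0 : 0 <= x / dl + K%:R by move: xd; rewrite ler_norml => /andP[]; lra.
have y1 : x / dl + K%:R <= (K + K)%:R - 1 by move: xd; rewrite natrD ler_norml => /andP[]; lra.
have /andP[n1 n2] := truncn_itv y0; set n := Num.truncn _ in n1 n2.
have nK : (n.+1 < (K + K).+1)%N.
  rewrite ltnS -(ler_nat R) -natr1; lra.
exists (Ordinal (ltnW nK)), (Ordinal nK) => /=.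
have xE : x = dl * (x / dl) by rewrite mulrC divfK // gt_eqF.
rewrite -natr1 in n2 *.
have a1 : dl * (n%:R - K%:R) <= x by apply: (@le_trans _ _ (dl * (x / dl))); [rewrite ler_wpM2l //; lra|rewrite -xE].
have a2 : x <= dl * (n%:R + 1 - K%:R) by apply: (@le_trans _ _ (dl * (x / dl))); [rewrite -xE|rewrite ler_wpM2l //; lra].
have a3 : dl * (n%:R + 1 - K%:R) = dl * (n%:R - K%:R) + dl by ring.
split=> //; rewrite ler_norml; lra.
Qed.

Definition mixed_pt (x : forall k, 'I_(d k) -> R) (n : nat) (v : {ffun pt -> 'I_(K + K).+1})
    (k : 'I_m) (i : 'I_(d k)) : R := if (k < n)%N then grid_pt v i else x k i.

Lemma mform_mode (T : tensor R d) (y : forall k, 'I_(d k) -> R) k :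
  mform T y = \sum_i y k i * \sum_(w : tidx d | w k == i) T w * \prod_(j | j != k) y j (w j).
Proof.
rewrite /mform (partition_big (fun w : tidx d => w k) predT) //=; apply: eq_bigr => i _.
rewrite mulr_sumr; apply: eq_bigr => w /eqP wk.
by rewrite (bigD1 k) //= wk mulrCA.
Qed.

(* A multilinear form is affine in each coordinate, so its maximum over the box
   of the grid that contains a point is attained at a vertex. *)
Lemma mform_grid (T : tensor R d) (x : forall k, 'I_(d k) -> R) :
  (forall k i, `|x k i| <= 1) ->
  exists2 v, `|mform T x| <= `|mform T (@grid_pt v)| & forall k i, `|@grid_pt v k i - x k i| <= dl.
Proof.
move=> x1.
have /choice [lo /choice [hi br]] : forall t : pt, exists lo : 'I_(K + K).+1, exists hi : 'I_(K + K).+1,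
  [/\ dl * (lo%:R - K%:R) <= x (tag t) (tagged t), x (tag t) (tagged t) <= dl * (hi%:R - K%:R),
      `|dl * (lo%:R - K%:R) - x (tag t) (tagged t)| <= dl &
      `|dl * (hi%:R - K%:R) - x (tag t) (tagged t)| <= dl].
  by move=> t; have [lo [hi h]] := grid_bracket (x1 _ (tagged t)); exists lo, hi.
pose ok (v : {ffun pt -> 'I_(K + K).+1}) n := forall (k : 'I_m) i, (k < n)%N -> `|@grid_pt v k i - x k i| <= dl.
suff H n : (n <= m)%N -> exists2 v, `|mform T x| <= `|mform T (mixed_pt x n v)| & ok v n.
  have [v v1 v2] := H m (leqnn m); exists v; last by move=> k i; exact: v2.
  apply: (le_trans v1); rewrite le_eqVlt; apply/orP; left; apply/eqP; congr `|_|.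
  by apply: eq_bigr => w _; congr (_ * _); apply: eq_bigr => k _; rewrite /mixed_pt ltn_ord.
elim: n => [_|n IH nm].
  by exists [ffun=> ord0].
have [v v1 v2] := IH (ltnW nm).
pose kn := Ordinal nm; pose sgnv := Num.sg (mform T (mixed_pt x n v)).
(* The coefficient of one coordinate of mode n, the earlier modes being rounded already. Its sign,
   relative to that of the form, decides between the upper and the lower neighbour, so the absolute
   value cannot decrease. *)
pose a (t : pt) := \sum_(w : tidx d | w (tag t) == tagged t)
  T w * \prod_(k | k != tag t) @mixed_pt x n v k (w k).
pose v' : {ffun pt -> 'I_(K + K).+1} := [ffun t => if tag t == kn then
   (if 0 <= sgnv * a t then hi t else lo t) else v t].
have v'E k (i : 'I_(d k)) : k != kn -> @grid_pt v' k i = @grid_pt v k i.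
  by move=> kk; rewrite /grid_pt ffunE /= (negbTE kk).
have ltE k : k != kn -> (k < n.+1)%N = (k < n)%N.
  move=> kk; rewrite ltnS leq_eqVlt; case: eqP => // kn'; case/eqP: kk; exact/val_inj.
have mixE k (i : 'I_(d k)) : k != kn -> @mixed_pt x n.+1 v' k i = @mixed_pt x n v k i.
  by move=> kk; rewrite /mixed_pt ltE // v'E.
exists v'; last first.
  move=> k i kn1; have [kk|kk] := eqVneq k kn; last by rewrite v'E // v2 // -ltE.
  rewrite /grid_pt ffunE /= (introT eqP kk); have [_ _ b1 b2] := br (Tagged (fun k => 'I_(d k)) i).
  by case: ifP.
apply: (le_trans v1).
have sg1 : `|mform T (@mixed_pt x n.+1 v')| >= sgnv * mform T (@mixed_pt x n.+1 v').
  apply: (le_trans (ler_norm _)); rewrite normrM /sgnv normr_sg.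
  by case: (_ != 0); rewrite ?mul1r ?mul0r ?normr_ge0.
apply: le_trans sg1; rewrite normrEsg -/sgnv !(mform_mode _ _ kn) -subr_ge0 -mulrBr -sumrB mulr_sumr.
apply: sumr_ge0 => i _.
set t : pt := Tagged (fun k => 'I_(d k)) i.
have aE : \sum_(w : tidx d | w kn == i) T w * \prod_(j | j != kn) @mixed_pt x n.+1 v' j (w j) = a t.
  by apply: eq_bigr => w _; congr (_ * _); apply: eq_bigr => k kk; exact: mixE.
rewrite aE -[\sum_(w : tidx d | w kn == i) _]/(a t) -mulrBl mulrCA.
have [b1 b2 _ _] := br t.
have -> : @mixed_pt x n.+1 v' kn i = dl * ((if 0 <= sgnv * a t then hi t else lo t)%:R - K%:R).
  by rewrite /mixed_pt /= ltnSn /grid_pt ffunE /= eqxx.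
have -> : @mixed_pt x n v kn i = x kn i by rewrite /mixed_pt /= ltnn.
case: (leP 0 (sgnv * a t)) => h; first by rewrite mulr_ge0 // subr_ge0.
by rewrite mulr_le0 ?(ltW h) // subr_le0.
Qed.

End GridRounding.

Section SpectralForms.
Variables (R : realType) (m : nat) (d : 'I_m -> nat).
Implicit Types (T : tensor R d).

Lemma vn_fn n (x : 'I_n -> R) : vn x = fn (\row_i x i).
Proof.
rewrite /fn /dotmx big_ord1 /vn; congr Num.sqrt; apply: eq_bigr => i _.
by rewrite !mxE expr2.
Qed.

Lemma vn_near n (x y : 'I_n -> R) a : 0 <= a -> (forall i, `|y i - x i| <= a) ->
  vn y <= vn x + a * Num.sqrt n%:R.
Proof.
move=> a0 xy; rewrite !vn_fn.
have -> : \row_i y i = \row_i x i + \row_i (y i - x i) by apply/rowP => i; rewrite !mxE addrC subrK.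
apply: (le_trans (fnD _ _)); rewrite lerD2l mulrC.
by apply: fn_row_entries => // i; rewrite mxE.
Qed.

Lemma spec_leD T T' g g' : spec_le g T -> spec_le g' T' -> spec_le (g + g') (T + T').
Proof.
move=> h h' x; rewrite mulrDl; apply: le_trans (lerD (h x) (h' x)).
apply: le_trans (ler_normD _ _); rewrite le_eqVlt; apply/orP; left; apply/eqP; congr `|_|.
by rewrite /mform -big_split; apply: eq_bigr => w _ /=; rewrite ffunE mulrDl.
Qed.

Lemma spec_le_trans T g g' : g <= g' -> spec_le g T -> spec_le g' T.
Proof.
move=> gg h x; apply: (le_trans (h x)); rewrite ler_wpM2r // prodr_ge0 // => k _; exact: vn_ge0.
Qed.

Lemma spec_le_opb T k g : 0 <= g -> opb g (matricize k T) -> spec_le g T.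
Proof. by move=> g0 h x; exact: mform_le h. Qed.

Lemma spec_le_unit T g : (forall x, (forall k, vn (x k) = 1) -> `|mform T x| <= g) -> spec_le g T.
Proof.
move=> h x; case: (pickP (fun k => vn (x k) == 0)) => [k /eqP xk|xn].
  rewrite (bigD1 k) //= xk mul0r mulr0 /mform big1 ?normr0 // => w _.
  rewrite (bigD1 k) //= (_ : x k (w k) = 0) ?mul0r ?mulr0 //.
  have h2 : vn (x k) ^+ 2 = 0 by rewrite xk expr0n.
  apply/eqP; rewrite -sqrf_eq0 eq_le sqr_ge0 andbT -[leRHS]h2 vn_sqr (bigD1 (w k)) //= lerDl.
  by apply: sumr_ge0 => i _; exact: sqr_ge0.
have vx k : vn (x k) != 0 by rewrite xn.
pose u k i := x k i / vn (x k).
have -> : mform T x = \prod_k vn (x k) * mform T u.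
  rewrite /mform mulr_sumr; apply: eq_bigr => w _; rewrite mulrCA; congr (_ * _).
  by rewrite -big_split /=; apply: eq_bigr => k _; rewrite /u mulrC divfK.
rewrite normrM mulrC [`|\prod_k vn (x k)|]ger0_norm; last by apply: prodr_ge0 => k _; exact: vn_ge0.
rewrite ler_wpM2r //; first by apply: prodr_ge0 => k _; exact: vn_ge0.
apply: h => k; apply/eqP; rewrite -(@eqrXn2 _ 2) ?vn_ge0 // vn_sqr expr1n /u.
under eq_bigr => i _ do rewrite exprMn.
by rewrite -mulr_suml -vn_sqr -exprMn mulfV // expr1n.
Qed.

Lemma sum_prod_vn (x : forall k, 'I_(d k) -> R) :
  \sum_(w : tidx d) (\prod_k x k (w k)) ^+ 2 = \prod_k vn (x k) ^+ 2.
Proof.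
transitivity (\sum_(w : tidx d) \prod_k x k (w k) ^+ 2).
  by apply: eq_bigr => w _; rewrite prodrXl.
rewrite (@sum_prod_dffun R 'I_m (fun k => 'I_(d k)) (fun k i => x k i ^+ 2)).
by apply: eq_bigr => k _; rewrite vn_sqr.
Qed.

Lemma prod_le_expR1 (y : 'I_m -> R) : (forall k, 0 <= y k <= 1 + m%:R^-1) -> \prod_k y k <= 3.
Proof.
move=> h; apply: le_trans (expR1_le3 R); case: (posnP m) => [m0|m0].
  rewrite big1 => [|k]; last by have := ltn_ord k; rewrite {2}m0.
  by rewrite -expR0 ler_expR.
apply: (@le_trans _ _ (\prod_(k < m) expR m%:R^-1)).
  apply: ler_prod => k _; have /andP[-> /= h2] := h k; exact: le_trans h2 (expR_ge1Dx _).
rewrite prodr_const card_ord -expRM_natl mulfV // pnatr_eq0 -lt0n //.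
Qed.

End SpectralForms.

Section LightSpectral.
Variables (R : realType) (m : nat) (d : 'I_m -> nat) (A : finType) (p : tidx d -> A -> R).
Hypothesis p_ge0 : forall i a, 0 <= p i a.
Hypothesis p_sum1 : forall i, \sum_a p i a = 1.
Variables (f : tidx d -> A -> R) (L S Ql dl : R) (K : nat).
Hypothesis f_mean : forall i, \sum_a p i a * f i a = 0.
Hypothesis f_bound : forall i a, `|f i a| <= L.
Hypothesis L_gt0 : 0 < L.
Hypothesis Ql_gt0 : 0 < Ql.
Hypothesis dl_gt0 : 0 < dl.
Hypothesis K_large : dl^-1 + 1 <= K%:R.
Hypothesis dl_small : forall k, dl * Num.sqrt (d k)%:R <= m%:R^-1.
Hypothesis S_large : (\sum_k d k)%:R * ln ((K + K).+1)%:R + Ql <= S.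

Definition field (x : {ffun tidx d -> A}) : tensor R d := [ffun w => f w (x w)].

(** The logarithm of the size of the grid is part of S. Rounding a unit vector lengthens it by at
    most 1/m, and (1 + 1/m)^m <= 3, so only grid points with square norm product at most 9 are
    tested. *)
Lemma light_spectral : exists2 good : pred {ffun tidx d -> A},
  Pr p (fun x => ~~ good x) <= 2 * expR (- Ql) &
  forall x, good x -> spec_le (12 * (L * Num.sqrt S)) (field x).
Proof.
pose J : finType := {ffun {k : 'I_m & 'I_(d k)} -> 'I_(K + K).+1}.
have lnK0 : 0 <= ln ((K + K).+1)%:R :> R by apply: ln_ge0; rewrite ler1n.
have S_gt0 : 0 < S.
  by apply: lt_le_trans S_large; rewrite ltr_wpDl // mulr_ge0.
pose small (v : J) := \sum_(w : tidx d) (\prod_k grid_pt dl v (w k)) ^+ 2 <= 9.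
exists (fun x => [forall v : J, small v ==>
    (`|\sum_(w : tidx d) (\prod_k grid_pt dl v (w k)) * f w (x w)| <= 12 * (L * Num.sqrt S))]).
  apply: (@le_trans _ _ (#|J|%:R * (2 * expR (- (2 * S))))).
    apply: (Pr_forall p_ge0) => v; have [sv|nsv] := boolP (small v).
      apply: le_trans (hoeffding p_ge0 p_sum1 f_mean f_bound L_gt0 S_gt0 sv).
      by apply: (Pr_le p_ge0) => x.
    apply: (@le_trans _ _ 0); last by rewrite mulr_ge0 ?expR_ge0.
    by rewrite -(Ex_cst p_sum1 0); apply: (Ex_le p_ge0) => x.
  have -> : #|J|%:R = expR ((\sum_k d k)%:R * ln ((K + K).+1)%:R) :> R.
    rewrite card_ffun card_ord card_tagged sumnE big_map big_enum /=.
    rewrite (eq_bigr d) => [|k _]; last by rewrite card_ord.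
    by rewrite natrX expRM_natl lnK // posrE.
  rewrite mulrCA ler_wpM2l // -expRD ler_expR.
  have := S_large; have := S_gt0; lra.
move=> x /forallP good; apply: spec_le_unit => y y1.
have y1' k i : `|y k i| <= 1.
  rewrite -(y1 k) -(@ler_pXn2r _ 2) ?nnegrE ?normr_ge0 ?vn_ge0 // real_normK ?num_real // vn_sqr.
  by rewrite (bigD1 i) //= lerDl sumr_ge0 // => j _; exact: sqr_ge0.
have [v v1 v2] := mform_grid dl_gt0 K_large (field x) y1'.
apply: (le_trans v1).
have mE : mform (field x) (@grid_pt R m d K dl v) = \sum_(w : tidx d) (\prod_k grid_pt dl v (w k)) * f w (x w).
  by apply: eq_bigr => w _; rewrite ffunE mulrC.
have := good v; rewrite -mE => /implyP; apply; rewrite /small.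
rewrite (sum_prod_vn (@grid_pt R m d K dl v)) prodrXl (_ : 9 = 3 ^+ 2); last by ring.
rewrite ler_pXn2r ?nnegrE //; last by apply: prodr_ge0 => k _; exact: vn_ge0.
apply: prod_le_expR1 => k; rewrite vn_ge0 /=.
by apply: (le_trans (vn_near (ltW dl_gt0) (v2 k))); rewrite y1 lerD2l.
Qed.

End LightSpectral.

(** * Perturbation of the truncated HOSVD *)

Section TuckerPerturbation.
Variables (R : realType) (m : nat) (d r : 'I_m -> nat) (T X T0 : tensor R d) (C : tensor R r).
Variable (U : forall k, 'M[R]_(d k, r k)).
Hypothesis tucker : tucker_decomposition T C U.
Variables (lam Lam s : R) (gam v th e : 'I_m -> R).
Hypothesis lam_gt0 : 0 < lam.
Hypothesis lam_le : forall k (y : 'rV[R]_(r k)), lam * fn y <= fn (y *m (U k)^T *m matricize k T).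
Hypothesis Lam_opb : forall k, opb Lam (matricize k T).
Hypothesis Lam_ge0 : 0 <= Lam.
Hypothesis s_ge0 : 0 <= s.
Hypothesis gam_ge0 : forall k, 0 <= gam k.
Hypothesis gram : forall k, opb (gam k)
  (matricize k X *m (matricize k X)^T - (v k)%:M - matricize k T *m (matricize k T)^T).
Hypothesis spec : spec_le s (X - T).
Hypothesis hosvd : is_hosvd r X T0.

(** Split T0 - T into the projection of X - T, controlled by the spectral norm and the size of the
    core, and the part of T lost by the projections, mode by mode. *)
Lemma hosvd_frobenius :
  frobenius_norm (T0 - T) <= Num.sqrt (dstar r)%:R * s + \sum_k 2 * gam k * Num.sqrt (r k)%:R / lam.
Proof.
case: hosvd => V [topV ->].
have U1 k : orthonormal_cols (U k) by case: tucker.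
have V1 k : orthonormal_cols (V k).
  by have [F [sv [W [le_rd [svd ->]]]]] := topV k; exact: V_orth svd.
pose P k := V k *m (V k)^T.
have -> : multilinear_prod X P - T = multilinear_prod (X - T) P + (multilinear_prod T P - T).
  by rewrite mprodB addrA subrK.
apply: (le_trans (frobeniusD _ _)); apply: lerD; first exact: frobenius_mprod_spec.
apply: (le_trans (frobenius_mprod_sub _ _ _)) => [k|k|].
- by rewrite /P trmx_mul trmxK.
- by rewrite /P mulmxA -[V k *m _ *m _]mulmxA V1 mulmx1.
apply: ler_sum => k _.
rewrite (_ : (P k - 1%:M) *m _ = - ((1%:M - P k) *m matricize k T)); last by rewrite -mulNmx opprB.
rewrite fnN.
have [F [sv [W [le_rd [svd VE]]]]] := topV k; rewrite /P VE.
exact (fn_compM le_rd svd (U1 k) (tucker_matricize tucker k) lam_gt0 (@lam_le k) (gam_ge0 k) (@gram k)).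
Qed.

Hypothesis th_ge0 : forall k, 0 <= th k.
Hypothesis U_row : forall k i, fn (row i (U k)) <= th k.
Hypothesis e_ge0 : forall k, 0 <= e k.
Hypothesis e_small : forall k, 2 * e k <= m%:R^-1.
Hypothesis gam_e : forall k, 2 * gam k / lam ^+ 2 <= e k.
Hypothesis row_e : forall k (F : 'M[R]_(d k)) sv W (le_rd : (r k <= d k)%N) i,
  is_svd (matricize k X) F sv W ->
  fn (row i (colsub (widen_ord le_rd) F - U k *m ((U k)^T *m colsub (widen_ord le_rd) F)))
  <= e k * th k.

(** An entry is a multilinear form at rows of the projections, so incoherent rows give small
    entries: X - T pays its spectral norm, and the change of projections is telescoped with one
    small factor at a time. *)
Lemma hosvd_max : max_norm (T0 - T) <= (3 * s + 6 * Lam * \sum_k e k) * \prod_k th k.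
Proof.
case: hosvd => V [topV ->].
have U1 k : orthonormal_cols (U k) by case: tucker.
have V1 k : orthonormal_cols (V k).
  by have [F [sv [W [le_rd [svd ->]]]]] := topV k; exact: V_orth svd.
pose P k := V k *m (V k)^T.
have rowV k i : fn (row i (V k)) <= th k * (1 + 2 * e k).
  have [F [sv [W [le_rd [svd VE]]]]] := topV k.
  have h := row_e le_rd i svd; rewrite -VE in h.
  have -> : row i (V k) = row i (V k - U k *m ((U k)^T *m V k)) + row i (U k) *m ((U k)^T *m V k).
    by rewrite -row_mul -linearD /= subrK.
  apply: (le_trans (fnD _ _)).
  have UV : opb (1 * 1) ((U k)^T *m V k).
    by apply: opbM => //; [exact: opb_orthonormalT|exact: opb_orthonormal].
  have h2 := UV (row i (U k)); have h3 := U_row i.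
  have h4 : 0 <= e k * th k by rewrite mulr_ge0.
  rewrite !mul1r in h2; lra.
have rowP k i : fn (row i (P k)) <= th k * (1 + 2 * e k).
  by rewrite /P row_mul fn_mulmxT.
have rowPU k i : fn (row i ((P k - 1%:M) *m U k)) <= 2 * e k * th k.
  have [F [sv [W [le_rd [svd VE]]]]] := topV k.
  have h := row_e le_rd i svd; rewrite /P VE.
  apply: (le_trans (row_compU le_rd svd (U1 k) (tucker_matricize tucker k) lam_gt0
    (@lam_le k) (gam_ge0 k) (@gram k) (U_row i))).
  have : th k * (2 * gam k / lam ^+ 2) <= th k * e k by rewrite ler_wpM2l.
  lra.
(* U U^T may be inserted because T is invariant under it; the difference with y then involves only
   (P - 1) U, whose rows are controlled. *)
pose x (w : tidx d) k i : R := (P k *m (U k *m (U k)^T)) (w k) i.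
pose y (w : tidx d) k i : R := (U k *m (U k)^T) (w k) i.
have factor k : 0 <= 1 + 2 * e k <= 1 + m%:R^-1.
  by rewrite addr_ge0 ?mulr_ge0 //= lerD2l.
have prod3 : \prod_k (1 + 2 * e k) <= 3 by exact: prod_le_expR1.
have Th0 : 0 <= \prod_k th k by apply: prodr_ge0.
have vnx w k : vn (x w k) <= th k * (1 + 2 * e k).
  rewrite /x vn_row mulmxA row_mul fn_mulmxT //.
  have -> : P k *m U k = U k + (P k - 1%:M) *m U k by rewrite mulmxBl mul1mx addrC subrK.
  rewrite linearD /=; apply: (le_trans (fnD _ _)); have h1 := U_row (w k); have h2 := rowPU k (w k); lra.
have vny w k : vn (y w k) <= th k * (1 + 2 * e k).
  rewrite /y vn_row row_mul fn_mulmxT //; apply: (le_trans (U_row _)).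
  by rewrite ler_peMr // lerDl mulr_ge0.
have vnxy w k : vn (fun i => x w k i - y w k i) <= 2 * e k * th k.
  have -> : vn (fun i => x w k i - y w k i) = vn (((P k - 1%:M) *m U k *m (U k)^T) (w k)).
    rewrite /vn; congr Num.sqrt; apply: eq_bigr => i _; rewrite /x /y -mulmxA mulmxBl mul1mx.
    by rewrite [in RHS]mxE [X in _ = (_ + X) ^+ 2]mxE.
  by rewrite vn_row row_mul fn_mulmxT.
apply/bigmax_leP; split.
  by rewrite mulr_ge0 // addr_ge0 ?mulr_ge0 // sumr_ge0.
move=> w _.
have -> : (multilinear_prod X P - T) w
   = multilinear_prod (X - T) P w + (mform T (x w) - mform T (y w)).
  have TP : mform T (x w) = multilinear_prod T P w.
    by rewrite -[in RHS](tucker_proj tucker) mprod_comp mprodE.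
  have TT : mform T (y w) = T w by rewrite -[in RHS](tucker_proj tucker) mprodE.
  rewrite TP TT mprodB ffunE [(- T) w]ffunE [(_ - multilinear_prod T P) w]ffunE [(- multilinear_prod T P) w]ffunE.
  by rewrite addrA subrK.
apply: (le_trans (ler_normD _ _)); rewrite mulrDl; apply: lerD.
  rewrite mprodE; apply: (le_trans (spec _)); rewrite [3 * s]mulrC -mulrA ler_wpM2l //.
  apply: (@le_trans _ _ (\prod_k (th k * (1 + 2 * e k)))).
    by apply: ler_prod => k _; rewrite vn_ge0 /= vn_row.
  by rewrite big_split /= mulrC ler_wpM2r.
rewrite mform_telescope; apply: (le_trans (ler_norm_sum _ _ _)).
rewrite mulrAC mulr_sumr; apply: ler_sum => k _.
apply: (le_trans (mform_le (k := k) _ Lam_ge0 (@Lam_opb k))).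
rewrite (_ : 6 * Lam * _ * e k = Lam * (2 * e k * (3 * \prod_k th k))); last by ring.
rewrite ler_wpM2l //.
apply: (@le_trans _ _ (2 * e k * \prod_j (th j * (1 + 2 * e j)))); last first.
  by rewrite ler_wpM2l ?mulr_ge0 // big_split /= mulrC ler_wpM2r.
rewrite (bigD1 k) //= [X in _ <= _ * X](bigD1 k) //= mulrA; apply: ler_pM.
- exact: vn_ge0.
- by apply: prodr_ge0 => j _; exact: vn_ge0.
- rewrite ltnn eqxx; apply: (le_trans (vnxy w k)).
  by rewrite ler_wpM2l ?mulr_ge0 // ler_peMr // lerDl mulr_ge0.
- apply: ler_prod => j jk; rewrite vn_ge0 /= (negbTE jk); case: (j < k)%N; [exact: vnx|exact: vny].
Qed.

End TuckerPerturbation.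

(** * Finite noise models *)

Section ModeHosvd.
Variables (R : realType) (d D r : nat).
Variables (Xm M Eh : 'M[R]_(d, D)) (U : 'M[R]_(d, r)) (v lam y G z gam th : R) (q0 : nat).
Hypothesis U_orth : orthonormal_cols U.
Hypothesis UM : U *m U^T *m M = M.
Hypothesis lam_gt0 : 0 < lam.
Hypothesis lam_le : forall u : 'rV[R]_r, lam * fn u <= fn (u *m U^T *m M).
Hypothesis v_ge0 : 0 <= v.
Hypothesis y_gt0 : 0 < y.
Hypothesis y_small : 400 * (800 * y) <= 1.
Hypothesis th_ge0 : 0 <= th.
Hypothesis G_ge0 : 0 <= G.
Hypothesis G_opb : opb G (M + Eh).
Hypothesis z_ge0 : 0 <= z.
Hypothesis z_opb : opb z (Xm - (M + Eh)).
Hypothesis zG : z * (2 * G + z) <= lam ^+ 2 / 2 * y.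
Hypothesis zGth : z * (2 * G + z) <= lam ^+ 2 / 2 * (y * th).
Hypothesis q0_large : 2 * (1 / 2) ^+ q0.+1 <= y * th.
Hypothesis gamE : gam = 40 * (40 * (y * lam ^+ 2)).
Local Notation Hh := ((M + Eh) *m (M + Eh)^T - v%:M - M *m M^T).
Local Notation H := (Xm *m Xm^T - v%:M - M *m M^T).
Hypothesis Hh_opb : opb gam Hh.

Lemma gram_residual : opb (z * (2 * G + z)) (H - Hh).
Proof.
set S := M + Eh; set N := Xm - S.
have -> : H - (S *m S^T - v%:M - M *m M^T) = S *m N^T + (N *m S^T + N *m N^T).
  have -> : Xm = S + N by rewrite /N addrC subrK.
  rewrite [(S + N)^T]linearD /= mulmxDl !mulmxDr.
  by apply/matrixP => i j; rewrite !mxE; ring.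
rewrite (_ : z * _ = G * z + (z * G + z * z)); last by ring.
by apply: opbD; [|apply: opbD]; apply: opbM => //; exact: opb_tr.
Qed.

Let l2 : 0 < lam ^+ 2. Proof. by rewrite exprn_gt0. Qed.
Let yl : 0 < y * lam ^+ 2. Proof. by rewrite mulr_gt0. Qed.

Lemma mode_gap : y * lam ^+ 2 * (400 * 800) <= lam ^+ 2.
Proof.
have -> : y * lam ^+ 2 * (400 * 800) = 400 * (800 * y) * lam ^+ 2 by ring.
by rewrite -[leRHS]mul1r; apply: ler_wpM2r; [exact: ltW|exact: y_small].
Qed.

Lemma gram_perturbed : opb (2 * gam) H.
Proof.
have -> : H = Hh + (H - Hh) by rewrite [RHS]addrC subrK.
apply: opb_le (opbD Hh_opb gram_residual).
rewrite gamE; have h := zG; have h' := yl; lra.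
Qed.

(** The budget 400 * 400 covers 320 * 480 for the series, 40 * 81 for its zeroth term, and at most 3
    for truncation and rounding. *)
Lemma gram_mode_rows g F sv W (le_rd : (r <= d)%N) i :
  g = 8 * gam ->
  (forall q, (q <= q0)%N -> fn (row i (mxp Hh q *m U)) <= g ^+ q * th) ->
  is_svd Xm F sv W ->
  fn (row i (colsub (widen_ord le_rd) F - U *m (U^T *m colsub (widen_ord le_rd) F)))
  <= 400 * (400 * y) * th.
Proof.
move=> gE rows svd.
have gap := mode_gap; have yl0 := yl; have ll := l2.
have gam0 : 0 <= gam by rewrite gamE; lra.
have g0 : 0 <= g by rewrite gE mulr_ge0.
have z0 : 0 <= z * (2 * G + z) by nonneg.
have ell0 : 0 < lam ^+ 2 / 2 by lra.
have gam_lam : 2 * gam <= lam ^+ 2 / 2 by rewrite gamE; lra.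
have h := gram_rows le_rd svd U_orth UM lam_gt0 lam_le gam_lam gram_perturbed gam0 Hh_opb z0
  gram_residual _ g0 _ rows (erefl _).
apply: (le_trans (h _ _)); [by rewrite gamE; lra|by rewrite gE gamE; lra|].
set ell := lam ^+ 2 / 2 in ell0 *.
have e1 : gam / ell = 40 * (80 * y).
  by rewrite gamE /ell; field; rewrite gt_eqF.
have e2 : g / ell = 160 * (160 * y).
  by rewrite gE gamE /ell; field; rewrite gt_eqF.
have e3 : z * (2 * G + z) / ell <= y by rewrite ler_pdivrMr // [leRHS]mulrC; exact: zG.
have e4 : z * (2 * G + z) / ell <= y * th by rewrite ler_pdivrMr // [leRHS]mulrC; exact: zGth.
set rho := z * (2 * G + z) / ell in e3 e4 *.
have rho0 : 0 <= rho by rewrite divr_ge0 // ltW.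
have e5 : rho <= 1 by apply: (le_trans e3); have h' := y_small; have h'' := y_gt0; lra.
rewrite -mulrA mulrDl -/rho e1 e2.
have yth : 0 <= y * th by have h' := ltW y_gt0; nonneg.
have t1 : th * (40 * (80 * y) + rho) <= 40 * (81 * (y * th)).
  have : th * rho <= th * y by rewrite ler_wpM2l.
  lra.
have t2 : 2 * (160 * (160 * y)) * (2 + rho) * th <= 320 * (480 * (y * th)).
  rewrite (_ : _ * th = 320 * (160 * ((2 + rho) * (y * th)))); last by ring.
  have : (2 + rho) * (y * th) <= 3 * (y * th) by rewrite ler_wpM2r //; lra.
  lra.
have t3 := q0_large; have t4 : 0 <= (1 / 2 : R) ^+ q0.+1 by rewrite exprn_ge0 // divr_ge0.
lra.
Qed.

(** The gap must now hold for the singular values: [s_top] and v >= 0 put the square of each of the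
    top r above lam^2 / 4. *)
Lemma dilation_mode_rows t (Wm : 'M[R]_(D, t)) gamh g F sv W (le_rd : (r <= d)%N) i :
  orthonormal_cols Wm -> M *m (Wm *m Wm^T) = M ->
  0 <= gamh -> gamh <= 46 * (y * lam) -> 0 <= g -> g <= 800 * (y * lam) -> opb gamh Eh ->
  z <= lam / 2 * y -> z <= lam / 2 * (y * th) ->
  (forall q, (q <= q0)%N ->
     fn (row (lshift D i) (mxp (dilation Eh) q *m block_mx U 0 0 Wm)) <= g ^+ q * th) ->
  is_svd Xm F sv W ->
  fn (row i (colsub (widen_ord le_rd) F - U *m (U^T *m colsub (widen_ord le_rd) F)))
  <= 400 * (400 * y) * th.
Proof.
move=> W_orth MW gamh0 gamh1 g0 g1 Eop zl zlth rows svd.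
have gap := mode_gap; have yl0 := yl; have ll := l2; have l0 := lam_gt0.
have gapl : y * lam * (400 * 800) <= lam.
  have -> : y * lam * (400 * 800) = 400 * (800 * y) * lam by ring.
  by rewrite -[leRHS]mul1r; apply: ler_wpM2r; [exact: ltW|exact: y_small].
have yl1 : 0 < y * lam by rewrite mulr_gt0.
have gam0 : 0 <= gam by rewrite gamE; lra.
have gam20 : 0 <= 2 * gam by lra.
have ell0 : 0 < lam / 2 by lra.
have sv_ge j : (j < r)%N -> lam / 2 <= sv j.
  move=> jr; have := s_top le_rd svd U_orth lam_gt0 lam_le gram_perturbed jr => h.
  have s0 := s_ge0 svd j.
  rewrite -(@ler_pXn2r _ 2) ?nnegrE ?(ltW ell0) //.
  have h3 := v_ge0; rewrite gamE in h; rewrite (_ : (lam / 2) ^+ 2 = lam ^+ 2 / 4); last by field.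
  lra.
have zop : opb z (Xm - M - Eh) by rewrite -addrA -opprD.
have h := @dilation_rows R d D r t Xm M Eh U Wm F sv W le_rd (lam / 2) gamh z g th q0 i svd U_orth W_orth
  UM MW ell0 sv_ge gamh0 Eop z_ge0 zop _ g0 _ rows.
apply: (le_trans (h _ _)); [lra|lra|].
set ell := lam / 2 in ell0 zl zlth *.
have lamE : lam = 2 * ell by rewrite /ell; field.
have e1 : gamh / ell <= 92 * y by rewrite ler_pdivrMr //; rewrite lamE in gamh1; lra.
have e2 : g / ell <= 40 * (40 * y) by rewrite ler_pdivrMr //; rewrite lamE in g1; lra.
have e3 : z / ell <= y by rewrite ler_pdivrMr // [leRHS]mulrC.
have e4 : z / ell <= y * th by rewrite ler_pdivrMr // [leRHS]mulrC.
set rho := z / ell in e3 e4 *.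
have rho0 : 0 <= rho by rewrite divr_ge0 // ltW.
have e5 : rho <= 1 by apply: (le_trans e3); have h' := y_small; have h'' := y_gt0; lra.
have yth : 0 <= y * th by have h' := ltW y_gt0; nonneg.
have t1 : th * (gamh * 2 + z * 2) / ell <= 186 * (y * th).
  rewrite (_ : _ / ell = th * (2 * (gamh / ell) + 2 * rho)); last by rewrite /rho; ring.
  rewrite (_ : 186 * _ = th * (186 * y)); last by ring.
  rewrite ler_wpM2l //; lra.
have t2 : 2 * (g / ell) * (2 * 2 + z * 2 / ell) * th <= 40 * (480 * (y * th)).
  rewrite (_ : z * 2 / ell = 2 * rho); last by rewrite /rho; ring.
  have gl0 : 0 <= g / ell by rewrite divr_ge0 // ltW.
  apply: (@le_trans _ _ (2 * (40 * (40 * y)) * 6 * th)).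
    rewrite ler_wpM2r //; apply: ler_pM; lra.
  by rewrite le_eqVlt; apply/orP; left; apply/eqP; ring.
have t3 := q0_large.
rewrite (_ : z * 2 / ell = 2 * rho) in t2 *; last by rewrite /rho; ring.
lra.
Qed.

End ModeHosvd.

Lemma orthonormal_leq (R : realType) p q (U : 'M[R]_(p, q)) : orthonormal_cols U -> (q <= p)%N.
Proof.
by move=> U1; rewrite -(mxrank1 R q) -U1 (leq_trans (mxrankM_maxr _ _)) // rank_leq_row.
Qed.

Lemma dilation_growth (R : realType) (Q w y : R) (n t : nat) : 0 <= Q -> 0 <= w ->
  Q * (Num.sqrt n%:R * w) <= y -> (t <= n)%N -> 400 * Q * Num.sqrt (n + t)%:R * w <= 800 * y.
Proof.
move=> Q0 w0 ny tn.
have s2 : Num.sqrt (n + t)%:R <= 2 * Num.sqrt n%:R :> R.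
  apply: sqrt_le; first by rewrite mulr_ge0 ?sqrtr_ge0.
  rewrite exprMn sqr_sqrtr // (_ : 2 ^+ 2 * _ = (4 * n)%:R); last by rewrite natrM; congr (_ * _); ring.
  by rewrite ler_nat; lia.
have : Q * w * Num.sqrt (n + t)%:R <= Q * w * (2 * Num.sqrt n%:R) by rewrite ler_wpM2l // mulr_ge0.
lra.
Qed.

Section ModeIndex.
Variables (R : realType) (m : nat) (d : 'I_m -> nat) (A : finType).

Definition mode_idx k (ic : 'I_(d k) * 'I_#|cotidx d k|) : tidx d := insert_idx ic.1 (enum_val ic.2).

Lemma mode_idx_inj k : injective (@mode_idx k).
Proof.
move=> [i c] [i' c'] /= e; congr (_, _).
  by rewrite -(insert_idx_at i (enum_val c)) -(insert_idx_at i' (enum_val c')) -/(mode_idx (i, c)) e.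
apply: enum_val_inj; rewrite -(drop_insert_idx i (enum_val c)) -(drop_insert_idx i' (enum_val c')).
by rewrite -[insert_idx _ _]/(mode_idx (i, c)) e.
Qed.

Lemma matricize_field k (f : tidx d -> A -> R) (x : {ffun tidx d -> A}) :
  matricize k (field f x) = noise_mx (@mode_idx k) (fun ic => f (mode_idx ic)) x.
Proof. by apply/matrixP => i c; rewrite !mxE ffunE. Qed.

Lemma dstar_mode k : (dstar d = d k * #|cotidx d k|)%N.
Proof. by rewrite card_cotidx /dstar (bigD1 k). Qed.

Lemma sqrt_dstar k : Num.sqrt (d k)%:R * Num.sqrt #|cotidx d k|%:R = Num.sqrt (dstar d)%:R :> R.
Proof. by rewrite (dstar_mode k) natrM sqrtrM. Qed.

Lemma fn_entries p q (M : 'M[R]_(p, q)) a : 0 <= a -> (forall i j, `|M i j| <= a) ->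
  fn M <= a * (Num.sqrt p%:R * Num.sqrt q%:R).
Proof.
move=> a0 h; rewrite mulrCA; apply: fn_rows_le; first by nonneg.
move=> i; rewrite mulrC; apply: fn_row_entries => // j; rewrite mxE; exact: h.
Qed.

End ModeIndex.

Section Counts.
Variables (d D r t q N : nat).
Hypothesis N_eq : N = (d * D)%N.
Hypothesis d_gt0 : (0 < d)%N.
Hypothesis D_gt0 : (0 < D)%N.

Let dN : (d <= N)%N. Proof. by rewrite N_eq leq_pmulr. Qed.
Let DN : (D <= N)%N. Proof. by rewrite N_eq leq_pmull. Qed.
Let N1 : (1 <= N)%N. Proof. exact: leq_trans d_gt0 dN. Qed.

Lemma heavy_countN : (d.+1 * (D + d) + 2 * d + 2 * (d * d) + 2 * (d * 0) <= 10 * N ^ 2)%N.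
Proof. have h1 := dN; have h2 := DN; have h3 := N1; nia. Qed.

Lemma gram_countN : (r <= d)%N ->
  (d.+1 * (D + d) + 2 * d + 2 * (d * d) + 2 * (d * r) + 2 * (d * q * r) <= (12 + 8 * q) * N ^ 2)%N.
Proof.
move=> rd; have h1 := dN; have h2 := DN; have h3 := N1.
have a1 : (d * r <= N ^ 2)%N by rewrite expnS expn1 leq_mul // (leq_trans rd).
have a2 := heavy_countN; nia.
Qed.

Lemma dilation_countN : (r <= d)%N -> (t <= r)%N ->
  (d.+1 * (D + d) + 2 * d + 2 * (d * d) + 2 * (d * r) + 2 * (d * q * (r + t)) + 2 * (D * q * (r + t))
   <= (12 + 8 * q) * N ^ 2)%N.
Proof.
move=> rd tr; have h1 := dN; have h2 := DN; have h3 := N1.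
have a1 : (d * r <= N ^ 2)%N by rewrite expnS expn1 leq_mul // (leq_trans rd).
have a2 := heavy_countN.
have a3 : (d * (r + t) <= 2 * N ^ 2)%N.
  have b1 : (d * t <= N ^ 2)%N by rewrite expnS expn1 leq_mul // (leq_trans tr) // (leq_trans rd).
  by rewrite mulnDr; lia.
have a4 : (D * (r + t) <= 2 * N ^ 2)%N.
  have b0 : (D * r <= N ^ 2)%N by rewrite expnS expn1 leq_mul // (leq_trans rd).
  have b1 : (D * t <= N ^ 2)%N by rewrite expnS expn1 leq_mul // (leq_trans tr) // (leq_trans rd).
  by rewrite mulnDr; lia.
nia.
Qed.

End Counts.

(** * Error of the truncated HOSVD in a finite noise model *)

Section FiniteModel.
Variables (R : realType) (m : nat) (d r : 'I_m -> nat) (T : tensor R d) (C : tensor R r).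
Variable (U : forall k, 'M[R]_(d k, r k)).
Hypothesis tucker : tucker_decomposition T C U.
Variables (A : finType) (p : tidx d -> A -> R) (f : tidx d -> A -> R).
Hypothesis p_ge0 : forall i a, 0 <= p i a.
Hypothesis p_sum1 : forall i, \sum_a p i a = 1.
Local Notation X := {ffun tidx d -> A}.

Definition emean (f : tidx d -> A -> R) w := \sum_a p w a * f w a.
Definition ecenter (f : tidx d -> A -> R) w a := f w a - emean f w.
Definition evar (f : tidx d -> A -> R) w := \sum_a p w a * ecenter f w a ^+ 2.

Variables (B sg h v0 beta l Q w lam Lam zeta : R) (th : 'I_m -> R) (pw q0 : nat).
Hypothesis r_gt0 : forall k, (0 < r k)%N.
Hypothesis D_gt0 : forall k, (0 < #|cotidx d k|)%N.
Hypothesis B_gt0 : 0 < B.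
Hypothesis sg_gt0 : 0 < sg.
Hypothesis l_ge1 : 1 <= l.
Hypothesis Q_ge1 : 1 <= Q.
Hypothesis beta_ge0 : 0 <= beta.
Hypothesis w_gt0 : 0 < w.
Hypothesis w_le : w <= Lam.
Hypothesis lam_gt0 : 0 < lam.
Hypothesis lam_Lam : lam <= Lam.
Hypothesis v0_ge0 : 0 <= v0.
Hypothesis zeta_ge0 : 0 <= zeta.
Hypothesis lam_le : forall k (y : 'rV[R]_(r k)), lam * fn y <= fn (y *m (U k)^T *m matricize k T).
Hypothesis Lam_opb : forall k, opb Lam (matricize k T).
Hypothesis f_bound : forall i a, `|ecenter f i a| <= B.
Hypothesis f_var : forall i, evar f i <= sg ^+ 2.
Hypothesis f_mean : forall i, `|emean f i| <= beta.
Hypothesis v0_var : forall i, `|evar f i - v0| <= h ^+ 2.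
Hypothesis pw_ge : Q * l <= pw%:R.
Hypothesis pw_le : pw%:R <= 2 * Q * l.

Let D k : R := #|cotidx d k|%:R.
Let dr k : R := (d k)%:R.
Let sN : R := Num.sqrt (dstar d)%:R.

Hypothesis Bl : B * l <= w.
Hypothesis dl : forall k, dr k * l * sg ^+ 2 <= w ^+ 2.
Hypothesis sNl : sg ^+ 2 * sN * l <= w ^+ 2.
Hypothesis BlD : forall k, (B * l) ^+ 2 * (D k * sg ^+ 2) <= w ^+ 4.
Hypothesis Dh : forall k, D k * h ^+ 2 <= w ^+ 2.
Hypothesis mean_w : beta * sN <= w.
Hypothesis Blbd : forall k, B * l * beta * dr k <= w ^+ 2.
Hypothesis th_ge0 : forall k, 0 <= th k.
Hypothesis th_d : forall k, 1 <= th k * Num.sqrt (dr k).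
Hypothesis U_row : forall k i, fn (row i (U k)) <= th k.

(** The relative perturbation of mode k: the Gram error is at most 1600 times this number times
    lam^2. *)
Definition step k : R := Q ^+ 2 * Num.sqrt (r k)%:R * (Lam / lam) * (w / lam).
Let z : R := zeta * sN.
Let G : R := Lam + (B + beta) * sN.

Hypothesis step_small : forall k, 400 * (800 * step k) <= 1.
Hypothesis zG : forall k, z * (2 * G + z) <= lam ^+ 2 / 2 * step k.
Hypothesis zGth : forall k, z * (2 * G + z) <= lam ^+ 2 / 2 * (step k * th k).
Hypothesis q0_large : forall k, 2 * (1 / 2) ^+ q0.+1 <= step k * th k.

Let Lam_gt0 : 0 < Lam. Proof. exact: lt_le_trans w_le. Qed.

Lemma step_gt0 k : 0 < step k.
Proof.
have Q0 := lt_le_trans ltr01 Q_ge1.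
by rewrite /step !mulr_gt0 ?invr_gt0 ?exprn_gt0 ?sqrtr_gt0 ?ltr0n.
Qed.

Definition near_field (x : X) (Y : tensor R d) := forall i, `|Y i - (T i + f i (x i))| <= zeta.

(** Quantified over all tensors within zeta of the finite model, so that the conclusions pass to the
    data before rounding. *)
Definition mode_ok k (x : X) := forall Y, near_field x Y ->
  opb (2 * (40 * (40 * (step k * lam ^+ 2))))
    (matricize k Y *m (matricize k Y)^T - (D k * v0)%:M - matricize k T *m (matricize k T)^T) /\
  forall (F : 'M[R]_(d k)) sv W (le_rd : (r k <= d k)%N) i, is_svd (matricize k Y) F sv W ->
    fn (row i (colsub (widen_ord le_rd) F - U k *m ((U k)^T *m colsub (widen_ord le_rd) F)))
    <= 400 * (400 * step k) * th k.

Definition mode_count : R := ((12 + 8 * q0) * dstar d ^ 2)%:R.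

Section OneMode.
Variable k : 'I_m.
Let fk ic := f (@mode_idx m d k ic).
Let Mk := matricize k T.
Let At := (U k)^T *m Mk.
Let UAt : U k *m At = Mk. Proof. by rewrite mulmxA (tucker_matricize tucker). Qed.
Let U_orth : orthonormal_cols (U k). Proof. by case: tucker. Qed.
Let At_opb : opb Lam At.
Proof. by have := opbM (ltW Lam_gt0) (opb_orthonormalT U_orth) (@Lam_opb k); rewrite mul1r. Qed.

Let rd : (r k <= d k)%N. Proof. exact: orthonormal_leq U_orth. Qed.
Let d_pos : (0 < d k)%N. Proof. exact: leq_trans (r_gt0 k) rd. Qed.

Lemma mode_close (x : X) Y : near_field x Y ->
  opb z (matricize k Y - (Mk + noise_mx (@mode_idx m d k) fk x)).
Proof.
move=> Yx y; apply: (le_trans (opb_fn _ y)); rewrite ler_wpM2r ?fn_ge0 //.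
rewrite /z /sN -(sqrt_dstar R d k); apply: fn_entries => // i c.
by have := Yx (mode_idx (i, c)); rewrite !mxE.
Qed.

Lemma mode_size (x : X) : opb G (Mk + noise_mx (@mode_idx m d k) fk x).
Proof.
apply: opbD; first exact: Lam_opb.
move=> y; apply: (le_trans (opb_fn _ y)); rewrite ler_wpM2r ?fn_ge0 //.
rewrite /sN -(sqrt_dstar R d k); apply: fn_entries => [|i c]; first by rewrite addr_ge0 ?(ltW B_gt0).
rewrite mxE /fk; set a := x _; set j := mode_idx _.
rewrite -(subrK (emean f j) (f j a)); apply: (le_trans (ler_normD _ _)).
by apply: lerD; [exact: f_bound|exact: f_mean].
Qed.

Let gamE : 1600 * Q ^+ 2 * Num.sqrt (r k)%:R * Lam * w = 40 * (40 * (step k * lam ^+ 2)).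
Proof. by rewrite /step; field; rewrite gt_eqF. Qed.

Let z_ge0 : 0 <= z. Proof. by rewrite mulr_ge0 ?sqrtr_ge0. Qed.
Let G_ge0 : 0 <= G. Proof. by rewrite addr_ge0 ?mulr_ge0 ?addr_ge0 ?sqrtr_ge0 ?(ltW Lam_gt0) ?(ltW B_gt0). Qed.
Let Dv_ge0 : 0 <= D k * v0. Proof. by rewrite mulr_ge0. Qed.

Lemma gram_mode_event : B * l * Num.sqrt (dr k) <= w ->
  exists2 good : pred X, Pr p (fun x => ~~ good x) <= mode_count * expR (- (Q * l)) &
  forall x, good x -> mode_ok k x.
Proof.
move=> Bld.
have dDl : sg ^+ 2 * (Num.sqrt (d k)%:R * Num.sqrt #|cotidx d k|%:R) * l <= w ^+ 2.
  by rewrite sqrt_dstar.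
have meanw : beta * (Num.sqrt (d k)%:R * Num.sqrt #|cotidx d k|%:R) <= w by rewrite sqrt_dstar.
have [good Pg goodP] := @mode_gram R (tidx d) A p p_ge0 p_sum1 (d k) #|cotidx d k| (r k)
  (@mode_idx m d k) fk (@mode_idx_inj m d k) B sg v0 (h ^+ 2) beta l Q w Lam (th k) pw q0 (U k) At
  B_gt0 sg_gt0 l_ge1 Q_ge1 beta_ge0 w_gt0 w_le (fun ic a => f_bound _ a) (fun ic => f_var _)
  (fun ic => f_mean _) (fun ic => v0_var _) pw_ge pw_le Bl (dl k) dDl (BlD k) (Dh k) meanw (Blbd k) U_orth At_opb
  (r_gt0 k) (D_gt0 k) (th_d k) (fun i => U_row _) _ _ Bld (erefl _) (erefl _).
exists good.
  apply: (le_trans Pg); rewrite ler_wpM2r ?expR_ge0 //; by rewrite -!natrM -!natrD ler_nat; exact: (gram_countN _ (dstar_mode d k) d_pos (D_gt0 k) rd).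
move=> x /goodP[]; rewrite /gram_error UAt -noise_mxE gamE => Hop rows Y Yx.
have cl := mode_close Yx; have sz := mode_size x.
split.
  exact: (gram_perturbed lam_gt0 (step_gt0 k) G_ge0 sz z_ge0 cl (zG k) (erefl _) Hop).
move=> F sv W le_rd i svd.
apply: (gram_mode_rows U_orth (tucker_matricize tucker k) lam_gt0 (@lam_le k) (step_gt0 k) (step_small k)
  (th_ge0 k) G_ge0 sz z_ge0 cl (zG k) (zGth k) (q0_large k) (erefl _) Hop le_rd (erefl _) _ svd).
move=> q qq; have := rows q qq i.
rewrite (_ : 12800 * Q ^+ 2 * Num.sqrt (r k)%:R * Lam * w = 8 * (40 * (40 * (step k * lam ^+ 2)))) //.
by rewrite -gamE; ring.
Qed.

Lemma dilation_mode_event (co : R) :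
  D k * l * sg ^+ 2 <= w ^+ 2 -> B * l * co <= w * th k -> B * l * th k <= w * co ->
  1 <= co * Num.sqrt (D k) -> (forall c, fn (row c (cofactor_mx U k)) <= co) ->
  (dminus r k <= r k)%N -> (0 < d k)%N ->
  z <= lam / 2 * step k -> z <= lam / 2 * (step k * th k) ->
  exists2 good : pred X, Pr p (fun x => ~~ good x) <= mode_count * expR (- (Q * l)) &
  forall x, good x -> mode_ok k x /\ spec_le (46 * Q * w) (field f x).
Proof.
move=> Dl BlR BlL co_D co_row tr d_gt0 zl zlth.
have Q0 := le_trans ler01 Q_ge1; have w0 := ltW w_gt0.
have dDl : sg ^+ 2 * (Num.sqrt (d k)%:R * Num.sqrt #|cotidx d k|%:R) * l <= w ^+ 2.
  by rewrite sqrt_dstar.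
have meanw : beta * (Num.sqrt (d k)%:R * Num.sqrt #|cotidx d k|%:R) <= w by rewrite sqrt_dstar.
have [good Pg goodP] := @mode_dilation R (tidx d) A p p_ge0 p_sum1 (d k) #|cotidx d k| (r k)
  (@mode_idx m d k) fk (@mode_idx_inj m d k) B sg v0 (h ^+ 2) beta l Q w Lam (th k) pw q0 (U k) At
  B_gt0 sg_gt0 l_ge1 Q_ge1 beta_ge0 w_gt0 w_le (fun ic a => f_bound _ a) (fun ic => f_var _)
  (fun ic => f_mean _) (fun ic => v0_var _) pw_ge pw_le Bl (dl k) dDl (BlD k) (Dh k) meanw (Blbd k) U_orth At_opb
  (r_gt0 k) (th_d k) (fun i => U_row _) #|cotidx r k| (cofactor_mx U k) co (cofactor_orth tucker k) co_row
  co_D Dl BlR BlL _ _ (erefl _) (erefl _).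
exists good.
  apply: (le_trans Pg); rewrite ler_wpM2r ?expR_ge0 //; rewrite -!natrM -!natrD ler_nat.
  by apply: (dilation_countN _ (dstar_mode d k) d_pos (D_gt0 k) rd); rewrite card_cotidx.
move=> x /goodP[]; rewrite /gram_error UAt -noise_mxE gamE => Hop Eop rows.
split; last by apply: (spec_le_opb (k := k)); [nonneg|rewrite matricize_field].
move=> Y Yx; have cl := mode_close Yx; have sz := mode_size x.
split.
  exact: (gram_perturbed lam_gt0 (step_gt0 k) G_ge0 sz z_ge0 cl (zG k) (erefl _) Hop).
move=> F sv W le_rd i svd.
have sr0 : 0 <= Num.sqrt (r k)%:R :> R by exact: sqrtr_ge0.
have stepl : Q * (Num.sqrt (r k)%:R * w) <= step k * lam.
  have -> : step k * lam = Q * (Q * (Num.sqrt (r k)%:R * w) * (Lam / lam)).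
    by rewrite /step; field; rewrite gt_eqF.
  rewrite ler_wpM2l // -[leLHS]mulr1; apply: ler_pM; [nonneg|done| |].
    by rewrite ler_peMl //; nonneg.
  by rewrite ler_pdivlMr // mul1r.
have sr1 : 1 <= Num.sqrt (r k)%:R :> R by rewrite -[leLHS]sqrtr1 ler_wsqrtr // ler1n.
have stepl' : Q * w <= step k * lam by apply: le_trans stepl; rewrite ler_wpM2l // ler_peMl.
apply: (dilation_mode_rows (Wm := cofactor_mx U k) (gamh := 46 * Q * w)
  (g := 400 * Q * Num.sqrt (r k + #|cotidx r k|)%:R * w)
  U_orth (tucker_matricize tucker k) lam_gt0 (@lam_le k) Dv_ge0 (step_gt0 k) (step_small k)
  (th_ge0 k) G_ge0 sz z_ge0 cl (zG k) (q0_large k) (erefl _) Hop le_rd (cofactor_orth tucker k)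
  (matricize_cofactor tucker k) _ _ _ _ Eop zl zlth _ svd).
- by rewrite !mulr_ge0 ?ler0n.
- by rewrite -mulrA ler_wpM2l ?ler0n.
- by rewrite !mulr_ge0 ?ler0n.
- by apply: (dilation_growth Q0 w0 stepl); rewrite card_cotidx.
- by move=> q qq; exact: rows.
Qed.

End OneMode.

Section LightHeavy.
Variables (fl fh : tidx d -> A -> R) (L S dt : R) (K : nat) (k0 : 'I_m).
Hypothesis f_split : forall i a, f i a = fl i a + fh i a.
Hypothesis h_gt0 : 0 < h.
Hypothesis h_le : h <= sg.
Hypothesis fl_bound : forall i a, `|ecenter fl i a| <= L.
Hypothesis fh_bound : forall i a, `|ecenter fh i a| <= B.
Hypothesis fh_var : forall i, evar fh i <= h ^+ 2.
Hypothesis fh_mean : forall i, `|emean fh i| <= beta.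
Hypothesis L_gt0 : 0 < L.
Hypothesis dt_gt0 : 0 < dt.
Hypothesis K_large : dt^-1 + 1 <= K%:R.
Hypothesis dt_small : forall k, dt * Num.sqrt (dr k) <= m%:R^-1.
Hypothesis S_large : (\sum_k d k)%:R * ln ((K + K).+1)%:R + Q * l <= S.
Hypothesis L_w : 12 * (L * Num.sqrt S) <= w.

(** The 47 is 1 for the light part by the grid, 45 for the heavy part by its matricization in mode
    [k0], and 1 for the mean. *)
Lemma light_heavy_event :
  exists2 good : pred X, Pr p (fun x => ~~ good x) <= (mode_count + 2) * expR (- (Q * l)) &
  forall x, good x -> spec_le (47 * Q * w) (field f x).
Proof.
have Q0 := lt_le_trans ltr01 Q_ge1; have l0 := lt_le_trans ltr01 l_ge1; have w0 := ltW w_gt0.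
have cmean (g : tidx d -> A -> R) i : \sum_a p i a * ecenter g i a = 0.
  rewrite /ecenter; under eq_bigr => a _ do rewrite mulrBr.
  by rewrite sumrB -mulr_suml p_sum1 mul1r subrr.
have [gl Pl glP] := light_spectral p_ge0 p_sum1 (cmean fl) fl_bound L_gt0 (mulr_gt0 Q0 l0) dt_gt0
  K_large dt_small S_large.
pose fhk ic := fh (@mode_idx m d k0 ic).
have hs : h ^+ 2 <= sg ^+ 2 by rewrite ler_pXn2r ?nnegrE ?(ltW h_gt0) ?(ltW sg_gt0).
have h0 := ltW h_gt0; have B0 := ltW B_gt0; have l0' := ltW l0.
have dl' : (d k0)%:R * l * h ^+ 2 <= w ^+ 2 by apply: le_trans (dl k0); rewrite ler_wpM2l //; nonneg.
have dDl' : h ^+ 2 * (Num.sqrt (d k0)%:R * Num.sqrt #|cotidx d k0|%:R) * l <= w ^+ 2.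
  by rewrite sqrt_dstar; apply: le_trans sNl; rewrite !ler_wpM2r // sqrtr_ge0.
have BlD' : (B * l) ^+ 2 * (#|cotidx d k0|%:R * h ^+ 2) <= w ^+ 4.
  by apply: le_trans (BlD k0); rewrite ler_wpM2l ?sqr_ge0 // ler_wpM2l.
(* With a signal matrix of zero rows, the last condition of [noise_good] is empty. *)
have At0 : opb 0 (0 : 'M[R]_(0, #|cotidx d k0|)) by exact: opb0.
have pw0 : (0 < pw)%N by rewrite -(ltr0n R); apply: lt_le_trans pw_ge; rewrite mulr_gt0.
have Ph := @noise_good_prob R (tidx d) A p p_ge0 p_sum1 (d k0) #|cotidx d k0| 0 (@mode_idx m d k0) fhk
  (@mode_idx_inj m d k0) B h beta l Q B_gt0 h_gt0 l_ge1 Q_ge1 (fun ic a => fh_bound _ a)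
  (fun ic => fh_var _) beta_ge0 (fun ic => fh_mean _) 0 0 pw (lexx _) At0 pw_ge pw0.
exists (fun x => noise_good p (@mode_idx m d k0) fhk B h beta l Q (0 : 'M[R]_(0, #|cotidx d k0|)) 0 pw x && gl x).
  rewrite mulrDl; apply: (Pr_and p_ge0) => //.
  apply: (le_trans Ph); rewrite ler_wpM2r ?expR_ge0 //; rewrite -!natrM -!natrD ler_nat.
  apply: (leq_trans (heavy_countN (dstar_mode d k0) _ (D_gt0 k0))).
    by apply: leq_trans (r_gt0 k0) _; apply: (@orthonormal_leq R _ _ (U k0)); case: tucker.
  by rewrite leq_mul2r; apply/orP; right; apply: (@leq_trans 12) => //; exact: leq_addr.
move=> x /andP[gh /glP specl].
have specm : spec_le w [ffun i => emean f i].
  apply: (spec_le_opb (k := k0)) => // y; apply: (le_trans (opb_fn _ y)); rewrite ler_wpM2r ?fn_ge0 //.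
  apply: le_trans mean_w; rewrite /sN -(sqrt_dstar R d k0).
  by apply: fn_entries => // i c; rewrite mxE ffunE; exact: f_mean.
have spech : spec_le (45 * Q * w) (field (ecenter fh) x).
  apply: (spec_le_opb (k := k0)); first by nonneg.
  rewrite matricize_field; apply: opb_le (opb_centered p_ge0 B_gt0 h_gt0 l_ge1 Q_ge1 pw_ge w_gt0 pw_le Bl dl' dDl' BlD' gh).
  have : Num.sqrt #|cotidx d k0|%:R * h <= w.
    rewrite -(@ler_pXn2r _ 2) ?nnegrE //; last by nonneg.
    by rewrite exprMn sqr_sqrtr //; exact: Dh.
  have : w <= Q * w by rewrite ler_peMl.
  rewrite -!mulrA; lra.
have fE : field f x = field (ecenter fl) x + (field (ecenter fh) x + [ffun i => emean f i]).
  apply/ffunP => i; rewrite !ffunE f_split /ecenter.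
  have -> : emean f i = emean fl i + emean fh i.
    by rewrite /emean -big_split; apply: eq_bigr => a _ /=; rewrite f_split mulrDr.
  ring.
rewrite fE; apply: spec_le_trans (spec_leD specl (spec_leD spech specm)).
have : w <= Q * w by rewrite ler_peMl.
have := L_w; rewrite -!mulrA; lra.
Qed.

End LightHeavy.

Lemma hosvd_bounds s x Y T0 (k0 : 'I_m) :
  (forall k, 400 * (800 * step k) <= m%:R^-1) -> 0 <= s -> (forall k, mode_ok k x) ->
  spec_le s (field f x) -> near_field x Y -> is_hosvd r Y T0 ->
  frobenius_norm (T0 - T) <= Num.sqrt (dstar r)%:R * (s + z)
    + \sum_k 80 * (80 * (step k * lam * Num.sqrt (r k)%:R)) /\
  max_norm (T0 - T) <= (3 * (s + z) + 6 * Lam * \sum_k 400 * (400 * step k)) * \prod_k th k.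
Proof.
move=> step_m s0 ok specx Yx hosvd.
have z0 : 0 <= z by rewrite mulr_ge0 ?sqrtr_ge0.
have sz0 : 0 <= s + z by rewrite addr_ge0.
have specY : spec_le (s + z) (Y - T).
  have -> : Y - T = field f x + (Y - T - field f x) by rewrite [RHS]addrC subrK.
  apply: spec_leD => //; apply: (spec_le_opb (k := k0)) => // y.
  apply: (le_trans (opb_fn _ y)); rewrite ler_wpM2r ?fn_ge0 // /z /sN -(sqrt_dstar R d k0).
  apply: fn_entries => // i c; have := Yx (mode_idx (i, c)).
  by rewrite !mxE !ffunE opprD addrA.
have l2 : 0 < lam ^+ 2 by rewrite exprn_gt0.
have st0 k := ltW (step_gt0 k).
have gam0 k : 0 <= 2 * (40 * (40 * (step k * lam ^+ 2))).
  by have h' := mulr_ge0 (st0 k) (ltW l2); lra.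
have gram k := (ok k Y Yx).1.
split.
  have := hosvd_frobenius tucker lam_gt0 lam_le sz0 gam0 gram specY hosvd.
  rewrite (eq_bigr (fun k => 80 * (80 * (step k * lam * Num.sqrt (r k)%:R)))) // => k _.
  by field; rewrite gt_eqF.
apply: (hosvd_max tucker lam_gt0 lam_le Lam_opb (ltW Lam_gt0) sz0 gam0 gram specY hosvd th_ge0 U_row
  (e := fun k => 400 * (400 * step k))).
- by move=> k; have h' := st0 k; lra.
- by move=> k; apply: le_trans (step_m k); have := st0 k; lra.
- move=> k; rewrite (_ : _ / _ = 80 * (80 * step k)); last by field; rewrite gt_eqF.
  have := st0 k; lra.
move=> k F sv W le_rd i svd; have [_ hrows] := ok k Y Yx; exact (hrows F sv W le_rd i svd).
Qed.

Theorem finite_hosvd (s c c' : R) (k0 : 'I_m) :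
  (forall k, 400 * (800 * step k) <= m%:R^-1) -> 0 <= s ->
  (forall k, exists2 good : pred X, Pr p (fun x => ~~ good x) <= c & forall x, good x -> mode_ok k x) ->
  (exists2 good : pred X, Pr p (fun x => ~~ good x) <= c' & forall x, good x -> spec_le s (field f x)) ->
  exists2 good : pred X, Pr p (fun x => ~~ good x) <= m%:R * c + c' &
    forall x Y T0, good x -> near_field x Y -> is_hosvd r Y T0 ->
      frobenius_norm (T0 - T) <= Num.sqrt (dstar r)%:R * (s + z)
        + \sum_k 80 * (80 * (step k * lam * Num.sqrt (r k)%:R)) /\
      max_norm (T0 - T) <= (3 * (s + z) + 6 * Lam * \sum_k 400 * (400 * step k)) * \prod_k th k.
Proof.
move=> step_m s0 modes [gs Pgs gsP].
have /choice [gm gmP] : forall k, exists good : pred X,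
    Pr p (fun x => ~~ good x) <= c /\ forall x, good x -> mode_ok k x.
  by move=> k; have [g g1 g2] := modes k; exists g.
exists (fun x => [forall k, gm k x] && gs x).
  apply: (Pr_and p_ge0) => //; have := Pr_forall p_ge0 (B := gm) (fun k => (gmP k).1).
  by rewrite card_ord.
move=> x Y T0 /andP[/forallP gx /gsP gsx] Yx hosvd.
by apply: (hosvd_bounds k0 step_m s0 _ gsx Yx hosvd) => k; exact: (gmP k).2.
Qed.

End FiniteModel.

(** * Noise scales *)

Lemma sqr_mono (R : realType) (x y : R) : 0 <= x -> x <= y -> x ^+ 2 <= y ^+ 2.
Proof. by move=> x0 xy; rewrite ler_pXn2r ?nnegrE ?(le_trans x0). Qed.

Section NoiseScales.
Variables (R : realType) (n8 q4 nu tau l pmin db lb : R).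
Hypothesis nu_gt0 : 0 < nu.
Hypothesis q4_gt0 : 0 < q4.
Hypothesis q4_le1 : q4 <= 1.
Hypothesis n8_ge1 : 1 <= n8.
Hypothesis tau_gt0 : 0 < tau.
Hypothesis l_ge2 : 2 <= l.
Hypothesis p_gt0 : 0 < pmin.
Hypothesis db_gt0 : 0 < db.
Hypothesis lb_ge0 : 0 <= lb.

Local Notation a := (q4 ^+ 4).
Local Notation sN := (n8 ^+ 4).
Local Notation NN := (n8 ^+ 8).
Local Notation g := (a * tau).

Hypothesis a_p : l / 2 <= a * pmin.
Hypothesis p_sN : pmin <= sN.
Hypothesis nu_tau : 4 * (nu * n8) <= tau.

(** The noise level of the conclusion. Here n8^8 is the number N of entries, q4^4 the corruption
    rate and l = log N; taking the roots as variables makes every power an integer. The second term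
    is the bias alpha tau summed over all entries in Euclidean norm. *)
Definition omega : R := nu * Num.sqrt (db * lb) + g * sN.
(** The left alternative is the one of three or more modes, the right one that of two modes. *)
Definition dims_ok : Prop :=
  (pmin ^+ 2 * db <= NN /\ pmin ^+ 3 <= NN) \/ (l <= 2 * lb /\ sN <= db).
Hypothesis dims : dims_ok.

Let a_gt0 : 0 < a. Proof. by rewrite exprn_gt0. Qed.
Let a_le1 : a <= 1. Proof. by rewrite exprn_ile1 // ltW. Qed.
Let n8_gt0 : 0 < n8. Proof. exact: lt_le_trans n8_ge1. Qed.
Let g_gt0 : 0 < g. Proof. by rewrite mulr_gt0. Qed.
Let l_gt0 : 0 < l. Proof. exact: lt_le_trans l_ge2. Qed.
Let sN_gt0 : 0 < sN. Proof. by rewrite exprn_gt0. Qed.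
Let NE : NN = sN ^+ 2. Proof. by ring. Qed.

Lemma gsN_omega : g * sN <= omega.
Proof. by rewrite lerDr mulr_ge0 ?sqrtr_ge0 // ltW. Qed.

Lemma omega_gt0 : 0 < omega.
Proof. by apply: lt_le_trans gsN_omega; rewrite mulr_gt0. Qed.

Lemma gsN_omega2 : g ^+ 2 * NN <= omega ^+ 2.
Proof.
rewrite NE -exprMn ler_pXn2r ?nnegrE ?(ltW omega_gt0) ?gsN_omega //.
by rewrite ltW // mulr_gt0.
Qed.

Lemma asN_ge1 : 1 <= a * sN.
Proof.
have h : a * pmin <= a * sN by rewrite ler_wpM2l ?(ltW a_gt0).
have h1 := a_p; have h2 := l_ge2; lra.
Qed.

Lemma q4n8_ge1 : 1 <= q4 * n8.
Proof.
have h := asN_ge1; rewrite -exprMn in h.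
rewrite leNgt; apply/negP => h1; have := h; apply/negP; rewrite -ltNge.
by rewrite exprn_ilt1 // mulr_ge0 ?ltW.
Qed.

(** The level tau is at least 4 nu N^(1/8): the square of the bias term exceeds nu^2 alpha^2 N by a
    factor of order N^(1/4), which absorbs logarithms. *)
Lemma noise_gain : 16 * (nu ^+ 2 * (a * sN) ^+ 2 * n8 ^+ 2) <= g ^+ 2 * NN.
Proof.
have h : (4 * (nu * n8)) ^+ 2 <= tau ^+ 2.
  by rewrite ler_pXn2r ?nnegrE ?(ltW tau_gt0) // mulr_ge0 // mulr_ge0 ?ltW.
have h2 : (a * sN) ^+ 2 * (4 * (nu * n8)) ^+ 2 <= (a * sN) ^+ 2 * tau ^+ 2.
  by rewrite ler_wpM2l // sqr_ge0.
apply: le_trans (_ : _ <= (a * sN) ^+ 2 * tau ^+ 2) _; last first.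
  by rewrite le_eqVlt; apply/orP; left; apply/eqP; ring.
by apply: le_trans h2; rewrite le_eqVlt; apply/orP; left; apply/eqP; ring.
Qed.

(** Since l <= 2 a pmin, two logarithms times the largest dimension fit in a^2 N. *)
Lemma three_gain : pmin ^+ 2 * db <= NN -> l ^+ 2 * db <= 4 * (a * sN) ^+ 2.
Proof.
move=> h.
have h1 : (l / 2) ^+ 2 <= (a * pmin) ^+ 2.
  by apply: sqr_mono a_p; rewrite divr_ge0 // ltW.
have h2 : (a * pmin) ^+ 2 * db <= a ^+ 2 * NN.
  by rewrite exprMn -mulrA ler_wpM2l // sqr_ge0.
have h3 : (l / 2) ^+ 2 * db <= (a * pmin) ^+ 2 * db by rewrite ler_wpM2r // ltW.
rewrite (_ : (a * sN) ^+ 2 = a ^+ 2 * NN); last by ring.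
rewrite (_ : l ^+ 2 * db = 4 * ((l / 2) ^+ 2 * db)); last by field.
by rewrite ler_wpM2l // (le_trans h3).
Qed.

Lemma noise_omega2 : nu ^+ 2 * (db * lb) <= omega ^+ 2.
Proof.
have h : (nu * Num.sqrt (db * lb)) ^+ 2 <= omega ^+ 2.
  apply: sqr_mono; first by rewrite mulr_ge0 ?sqrtr_ge0 // ltW.
  by rewrite lerDl mulr_ge0 // ltW.
by rewrite exprMn sqr_sqrtr // mulr_ge0 // ltW in h.
Qed.

(** Concentration costs log N where the level has the logarithm of the largest dimension. For two
    modes they are comparable; for more modes the bias term pays, through [three_gain] and
    [noise_gain]. *)
Lemma noise_db : nu ^+ 2 * (db * l) <= 2 * omega ^+ 2.
Proof.
have l1 : 1 <= l by apply: le_trans l_ge2; rewrite ler1n.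
case: dims => [[h _]|[h _]].
  have h1 := three_gain h; have h2 := noise_gain; have h3 := gsN_omega2.
  have h4 : nu ^+ 2 * (a * sN) ^+ 2 <= nu ^+ 2 * (a * sN) ^+ 2 * n8 ^+ 2.
    by rewrite ler_peMr ?(mulr_ge0 (sqr_ge0 _) (sqr_ge0 _)) // exprn_ege1.
  have h5 : nu ^+ 2 * (l ^+ 2 * db) <= nu ^+ 2 * (4 * (a * sN) ^+ 2) by rewrite ler_wpM2l ?sqr_ge0.
  have h6 : nu ^+ 2 * (db * l) <= nu ^+ 2 * (l ^+ 2 * db).
    rewrite ler_wpM2l ?sqr_ge0 // mulrC ler_wpM2r ?(ltW db_gt0) // expr2 ler_peMl ?(ltW l_gt0) //.
  have h7 : 0 <= omega ^+ 2 by rewrite sqr_ge0.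
  lra.
have h1 : nu ^+ 2 * (db * l) <= nu ^+ 2 * (db * (2 * lb)).
  by rewrite ler_wpM2l ?sqr_ge0 // ler_wpM2l // ltW.
have h2 := noise_omega2; lra.
Qed.

Lemma noise_sN : nu ^+ 2 * (sN * l) <= 2 * omega ^+ 2.
Proof.
case: dims => [[_ h]|[_ h]]; last first.
  apply: le_trans noise_db; rewrite ler_wpM2l ?sqr_ge0 // ler_wpM2r //; exact: ltW.
have h2 := noise_gain; have h3 := gsN_omega2.
have l1 : 1 <= l by apply: le_trans l_ge2; rewrite ler1n.
have n8_0 := ltW n8_gt0; have p0 := ltW p_gt0; have a0 := ltW a_gt0; have l0 := ltW l_gt0.
(* N / p^2 >= N^(1/3) >= N^(1/4) as p^3 <= N *)
have h4 : pmin ^+ 2 * n8 ^+ 2 <= NN.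
  rewrite -(@ler_pXn2r _ 3) ?nnegrE; [|by []|by nonneg|by nonneg].
  rewrite exprMn -!exprM (_ : (2 * 3 = 3 * 2)%N) // (exprM pmin 3 2).
  apply: (@le_trans _ _ (NN ^+ 2 * n8 ^+ (3 * 2))).
    by rewrite ler_wpM2r ?exprn_ge0 // ler_pXn2r ?nnegrE ?exprn_ge0.
  rewrite -!exprM -exprD; apply: ler_weXn2l => //.
have h5 : (l / 2) ^+ 2 <= (a * pmin) ^+ 2.
  by apply: sqr_mono a_p; rewrite divr_ge0.
have h6 : (l / 2) ^+ 2 * n8 ^+ 2 <= (a * sN) ^+ 2.
  apply: (@le_trans _ _ ((a * pmin) ^+ 2 * n8 ^+ 2)); first by rewrite ler_wpM2r ?sqr_ge0.
  rewrite (_ : (a * pmin) ^+ 2 * n8 ^+ 2 = a ^+ 2 * (pmin ^+ 2 * n8 ^+ 2)); last by ring.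
  rewrite (_ : (a * sN) ^+ 2 = a ^+ 2 * NN); last by ring.
  by apply: ler_wpM2l => //; exact: sqr_ge0.
have h7 : nu ^+ 2 * (sN * l) <= nu ^+ 2 * (4 * ((l / 2) ^+ 2 * n8 ^+ 2 * n8 ^+ 2)).
  rewrite ler_wpM2l ?sqr_ge0 // (_ : 4 * _ = sN * l ^+ 2); last by field.
  by rewrite ler_wpM2l ?(ltW sN_gt0) // expr2 ler_peMl.
have h8 : nu ^+ 2 * (4 * ((l / 2) ^+ 2 * n8 ^+ 2 * n8 ^+ 2)) <= 4 * (nu ^+ 2 * (a * sN) ^+ 2 * n8 ^+ 2).
  rewrite (_ : nu ^+ 2 * (4 * _) = 4 * (nu ^+ 2 * ((l / 2) ^+ 2 * n8 ^+ 2) * n8 ^+ 2)); last by ring.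
  apply: ler_wpM2l => //; apply: ler_wpM2r; first exact: sqr_ge0.
  by apply: ler_wpM2l => //; exact: sqr_ge0.
have h9 : 0 <= omega ^+ 2 by rewrite sqr_ge0.
lra.
Qed.

(** The lower bound on the corruption rate converts the logarithm in the sup-norm part of Bernstein
    into a dimension. *)
Lemma taul : tau * l <= 2 * (g * pmin).
Proof.
rewrite (_ : 2 * _ = tau * (2 * (a * pmin))); last by ring.
rewrite ler_wpM2l ?(ltW tau_gt0) //; have h := a_p; lra.
Qed.

Lemma gp_omega : g * pmin <= omega.
Proof. by apply: le_trans gsN_omega; rewrite ler_wpM2l // ltW. Qed.

Variables (h sg B beta : R).
Hypothesis hE : h = 7 * (q4 ^+ 2 * tau).
Hypothesis sgE : sg = nu + h.
Hypothesis BE : B = 4 * tau.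
Hypothesis betaE : beta = 6 * g.

Lemma Bl_gp : B * l <= 8 * (g * pmin).
Proof. by rewrite BE; have := taul; lra. Qed.

Lemma scale_Bl : B * l <= 8 * omega.
Proof. by have := Bl_gp; have := gp_omega; lra. Qed.

Lemma h_sqr : h ^+ 2 = 49 * (a * tau ^+ 2).
Proof. by rewrite hE; ring. Qed.

Lemma sg_sqr : sg ^+ 2 <= 2 * nu ^+ 2 + 98 * (a * tau ^+ 2).
Proof.
have := sqr_ge0 (nu - h); have := h_sqr; rewrite sgE => h2.
have -> : (nu - h) ^+ 2 = nu ^+ 2 - 2 * (nu * h) + h ^+ 2 by ring.
have -> : (nu + h) ^+ 2 = nu ^+ 2 + 2 * (nu * h) + h ^+ 2 by ring.
lra.
Qed.

Lemma scale_mean : beta * sN <= 6 * omega.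
Proof. by rewrite betaE -mulrA ler_wpM2l // gsN_omega. Qed.

Lemma scale_sN : sg ^+ 2 * sN * l <= 200 * omega ^+ 2.
Proof.
have l0 := ltW l_gt0; have s0 := ltW sN_gt0; have t0 := ltW tau_gt0; have a0 := ltW a_gt0.
have h1 : sg ^+ 2 * (sN * l) <= (2 * nu ^+ 2 + 98 * (a * tau ^+ 2)) * (sN * l).
  by apply: ler_wpM2r; [rewrite mulr_ge0|exact: sg_sqr].
have h2 := noise_sN; have h3 := gsN_omega2.
have h4 : a * tau ^+ 2 * (sN * l) <= 2 * (g ^+ 2 * NN).
  have l2 : l <= 2 * (a * sN) by have := a_p; have : a * pmin <= a * sN by [rewrite ler_wpM2l]; lra.
  have : a * tau ^+ 2 * sN * l <= a * tau ^+ 2 * sN * (2 * (a * sN)).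
    by apply: ler_wpM2l => //; exact: mulr_ge0 (mulr_ge0 a0 (sqr_ge0 _)) s0.
  rewrite (_ : a * tau ^+ 2 * sN * (2 * (a * sN)) = 2 * (g ^+ 2 * NN)); last by ring.
  by rewrite [X in _ -> X <= _]mulrA.
rewrite -mulrA; lra.
Qed.

(** Light entries are of size nu / q4. As q4 n8 >= 1, the square of this exceeds nu^2 by at most
    N^(1/4), the spare factor of [noise_gain]. *)
Lemma scale_light (Q S : R) : 1 <= Q -> 0 <= S -> S <= 8 * Q * (db * l ^+ 2) ->
  pmin ^+ 2 * db <= NN -> 12 * (2 * (nu / q4) * Num.sqrt S) <= 36 * Q * omega.
Proof.
move=> Q1 S0 SQ pdb.
have Q0 := le_trans ler01 Q1; have w0 := ltW omega_gt0; have nu0 := ltW nu_gt0.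
rewrite -(@ler_pXn2r _ 2) ?nnegrE //; last first.
- by rewrite !mulr_ge0.
- by rewrite !mulr_ge0 ?sqrtr_ge0 ?invr_ge0 // ltW.
rewrite (_ : (12 * _) ^+ 2 = 576 * ((nu / q4) ^+ 2 * Num.sqrt S ^+ 2)); last by ring.
rewrite sqr_sqrtr // (_ : (36 * Q * omega) ^+ 2 = 36 * 36 * (Q ^+ 2 * omega ^+ 2)); last by ring.
have X0 : 0 <= nu ^+ 2 * (a * sN) ^+ 2 by rewrite mulr_ge0 // sqr_ge0.
have h1 : (nu / q4) ^+ 2 * (l ^+ 2 * db) <= 4 * (nu ^+ 2 * (a * sN) ^+ 2 * n8 ^+ 2).
  apply: (@le_trans _ _ ((nu / q4) ^+ 2 * (4 * (a * sN) ^+ 2))).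
    by rewrite ler_wpM2l ?sqr_ge0 // three_gain.
  rewrite (_ : (nu / q4) ^+ 2 * _ = 4 * (nu ^+ 2 * (a * sN) ^+ 2 * q4^-1 ^+ 2)); last by ring.
  apply: ler_wpM2l => //; apply: ler_wpM2l => //; apply: sqr_mono; first by rewrite invr_ge0 ltW.
  by rewrite -[leLHS]mul1r ler_pdivrMr // mulrC q4n8_ge1.
have h2 := noise_gain; have h3 := gsN_omega2.
have h4 : (nu / q4) ^+ 2 * S <= 8 * (Q * ((nu / q4) ^+ 2 * (l ^+ 2 * db))).
  apply: (@le_trans _ _ ((nu / q4) ^+ 2 * (8 * Q * (db * l ^+ 2)))); first by rewrite ler_wpM2l ?sqr_ge0.
  by rewrite le_eqVlt; apply/orP; left; apply/eqP; ring.
have h5 : 4 * ((nu / q4) ^+ 2 * (l ^+ 2 * db)) <= omega ^+ 2 by lra.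
have h6 : Q * (4 * ((nu / q4) ^+ 2 * (l ^+ 2 * db))) <= Q ^+ 2 * omega ^+ 2.
  by apply: ler_pM => //; [rewrite !mulr_ge0 ?invr_ge0 ?ltW|rewrite expr2 ler_peMl].
have h7 : 0 <= Q ^+ 2 * omega ^+ 2 by rewrite mulr_ge0 ?sqr_ge0.
lra.
Qed.

Section OneDim.
Variables (dk Dk : R).
Hypothesis dk_gt0 : 0 < dk.
Hypothesis Dk_gt0 : 0 < Dk.
Hypothesis dD : dk * Dk = NN.
Hypothesis p_dk : pmin <= dk.
Hypothesis dk_db : dk <= db.
Hypothesis pdk : pmin * dk <= NN.

Lemma scale_dl : dk * l * sg ^+ 2 <= 200 * omega ^+ 2.
Proof.
have l0 := ltW l_gt0; have t0 := ltW tau_gt0; have a0 := ltW a_gt0; have d0 := ltW dk_gt0.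
have h1 : dk * l * sg ^+ 2 <= dk * l * (2 * nu ^+ 2 + 98 * (a * tau ^+ 2)).
  by apply: ler_wpM2l; [rewrite mulr_ge0|exact: sg_sqr].
have h2 : nu ^+ 2 * (dk * l) <= 2 * omega ^+ 2.
  by apply: le_trans noise_db; rewrite ler_wpM2l ?sqr_ge0 // ler_wpM2r.
have h4 : a * tau ^+ 2 * (dk * l) <= 2 * (g ^+ 2 * NN).
  have l2 : l <= 2 * (a * pmin) by have := a_p; lra.
  apply: (@le_trans _ _ (a * tau ^+ 2 * (dk * (2 * (a * pmin))))).
    by apply: ler_wpM2l; [exact: mulr_ge0 a0 (sqr_ge0 _)|rewrite ler_wpM2l].
  rewrite (_ : _ * _ = 2 * (a ^+ 2 * tau ^+ 2 * (pmin * dk))); last by ring.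
  rewrite (_ : g ^+ 2 * NN = a ^+ 2 * tau ^+ 2 * NN); last by ring.
  by apply: ler_wpM2l => //; apply: ler_wpM2l => //; exact: mulr_ge0 (sqr_ge0 _) (sqr_ge0 _).
have h3 := gsN_omega2; lra.
Qed.

(** From a dk >= 1/2 follows Dk <= 2 a N, so the variance a tau^2 summed over the columns is of
    order a^2 tau^2 N, the square of the bias term. *)
Lemma scale_Dh : Dk * h ^+ 2 <= 98 * omega ^+ 2.
Proof.
have t0 := ltW tau_gt0; have a0 := ltW a_gt0; have D0 := ltW Dk_gt0.
have h1 : Dk <= 2 * (a * NN).
  have : 1 <= 2 * (a * dk).
    have := a_p; have := l_ge2; have : a * pmin <= a * dk by rewrite ler_wpM2l.
    lra.
  move=> h1; rewrite -dD (_ : 2 * _ = 2 * (a * dk) * Dk); last by ring.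
  by rewrite ler_peMl.
rewrite h_sqr; have h3 := gsN_omega2.
have : a * tau ^+ 2 * Dk <= a * tau ^+ 2 * (2 * (a * NN)) by apply: ler_wpM2l => //; exact: mulr_ge0 a0 (sqr_ge0 _).
rewrite (_ : a * tau ^+ 2 * (2 * (a * NN)) = 2 * (g ^+ 2 * NN)); last by ring.
lra.
Qed.

Lemma scale_BlD : (B * l) ^+ 2 * (Dk * sg ^+ 2) <= 12800 * omega ^+ 4.
Proof.
have l0 := ltW l_gt0; have t0 := ltW tau_gt0; have a0 := ltW a_gt0; have d0 := ltW dk_gt0.
have D0 := ltW Dk_gt0; have p0 := ltW p_gt0; have g0 := ltW g_gt0.
have B0 : 0 <= B by rewrite BE; lra.
have h1 : (B * l) ^+ 2 <= (8 * (g * pmin)) ^+ 2.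
  by apply: sqr_mono; [exact: mulr_ge0|exact: Bl_gp].
have h2 : Dk * sg ^+ 2 <= Dk * (2 * nu ^+ 2 + 98 * (a * tau ^+ 2)) by rewrite ler_wpM2l // sg_sqr.
apply: (@le_trans _ _ ((8 * (g * pmin)) ^+ 2 * (Dk * (2 * nu ^+ 2 + 98 * (a * tau ^+ 2))))).
  by apply: ler_pM => //; [exact: sqr_ge0|exact: mulr_ge0 D0 (sqr_ge0 _)].
have pD : pmin ^+ 2 * Dk <= pmin * NN.
  by rewrite expr2 -mulrA ler_wpM2l // -dD ler_wpM2r.
have h3 := gsN_omega2; have h30 : 0 <= g ^+ 2 * NN by rewrite mulr_ge0 ?sqr_ge0 // exprn_ge0 // ltW.
have w2 : 0 <= omega ^+ 2 by exact: sqr_ge0.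
have w4 : omega ^+ 4 = omega ^+ 2 * omega ^+ 2 by rewrite -exprD.
have h4 : nu ^+ 2 * pmin <= 2 * omega ^+ 2.
  apply: le_trans noise_db; rewrite ler_wpM2l ?sqr_ge0 //.
  apply: (@le_trans _ _ db); first exact: le_trans p_dk dk_db.
  by rewrite ler_peMr ?(ltW db_gt0) // (le_trans _ l_ge2) // ler1n.
have h5 : a * tau ^+ 2 * pmin <= 2 * omega ^+ 2.
  apply: (@le_trans _ _ (2 * (g ^+ 2 * NN))); last by rewrite ler_wpM2l.
  have h6 : 1 <= 2 * (a * pmin) by have := a_p; have := l_ge2; lra.
  have h7 : pmin <= 2 * (a * NN).
    apply: (@le_trans _ _ (2 * (a * pmin) * pmin)); first by rewrite ler_peMl.
    have pos_tac : pmin * pmin <= NN by rewrite NE -expr2; exact: sqr_mono.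
    have : a * (pmin * pmin) <= a * NN by rewrite ler_wpM2l.
    lra.
  rewrite (_ : 2 * _ = a * tau ^+ 2 * (2 * (a * NN))); last by ring.
  by apply: ler_wpM2l => //; exact: mulr_ge0 a0 (sqr_ge0 _).
have h8 : g ^+ 2 * NN * (nu ^+ 2 * pmin) <= 2 * omega ^+ 4.
  rewrite (_ : 2 * omega ^+ 4 = omega ^+ 2 * (2 * omega ^+ 2)); last by ring.
  by apply: ler_pM => //; exact: mulr_ge0 (sqr_ge0 _) p0.
have h9 : g ^+ 2 * NN * (a * tau ^+ 2 * pmin) <= 2 * omega ^+ 4.
  rewrite (_ : 2 * omega ^+ 4 = omega ^+ 2 * (2 * omega ^+ 2)); last by ring.
  by apply: ler_pM => //; exact: mulr_ge0 (mulr_ge0 a0 (sqr_ge0 _)) p0.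
have h10 : g ^+ 2 * (pmin ^+ 2 * Dk) * nu ^+ 2 <= g ^+ 2 * (pmin * NN) * nu ^+ 2.
  by rewrite ler_wpM2r ?sqr_ge0 // ler_wpM2l ?sqr_ge0.
have h11 : g ^+ 2 * (pmin ^+ 2 * Dk) * (a * tau ^+ 2) <= g ^+ 2 * (pmin * NN) * (a * tau ^+ 2).
  by rewrite ler_wpM2r ?(mulr_ge0 a0 (sqr_ge0 _)) // ler_wpM2l ?sqr_ge0.
rewrite (_ : _ * (Dk * _) = 64 * (2 * (g ^+ 2 * (pmin ^+ 2 * Dk) * nu ^+ 2)
   + 98 * (g ^+ 2 * (pmin ^+ 2 * Dk) * (a * tau ^+ 2)))); last by ring.
rewrite (_ : 12800 * _ = 64 * (200 * omega ^+ 4)); last by ring.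
rewrite ler_wpM2l //.
rewrite (_ : g ^+ 2 * (pmin * NN) * nu ^+ 2 = g ^+ 2 * NN * (nu ^+ 2 * pmin)) in h10; last by ring.
rewrite (_ : g ^+ 2 * (pmin * NN) * (a * tau ^+ 2) = g ^+ 2 * NN * (a * tau ^+ 2 * pmin)) in h11; last by ring.
lra.
Qed.

Lemma scale_Blbd : B * l * beta * dk <= 48 * omega ^+ 2.
Proof.
have t0 := ltW tau_gt0; have a0 := ltW a_gt0; have d0 := ltW dk_gt0; have g0 := ltW g_gt0.
apply: (@le_trans _ _ (8 * (g * pmin) * beta * dk)).
  by rewrite !ler_wpM2r // ?Bl_gp // betaE mulr_ge0.
rewrite betaE (_ : _ * dk = 48 * (g ^+ 2 * (pmin * dk))); last by ring.
rewrite ler_wpM2l //; apply: le_trans gsN_omega2.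
by rewrite ler_wpM2l // sqr_ge0.
Qed.

Lemma scale_Bld (sd : R) : 0 <= sd -> pmin * sd <= sN -> B * l * sd <= 8 * omega.
Proof.
move=> sd0 ps; apply: (@le_trans _ _ (8 * (g * pmin) * sd)); first by rewrite ler_wpM2r // Bl_gp.
rewrite (_ : _ * sd = 8 * (g * (pmin * sd))); last by ring.
rewrite ler_wpM2l //; apply: le_trans gsN_omega; rewrite ler_wpM2l // ltW //.
Qed.

End OneDim.
End NoiseScales.

(** * Truncated entries *)

Section TruncatedEntry.
Variables (R : realType) (A1 A2 : finType) (px zeta : A1 -> R) (ps sr : A2 -> R).
Hypothesis px_ge0 : forall u, 0 <= px u.
Hypothesis px_sum1 : \sum_u px u = 1.
Hypothesis ps_ge0 : forall v, 0 <= ps v.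
Hypothesis ps_sum1 : \sum_v ps v = 1.
Variables (T tau nu q4 n8 t0 : R).
Local Notation a := (q4 ^+ 4).
Local Notation g := (a * tau).
Hypothesis q4_gt0 : 0 < q4.
Hypothesis q4_le1 : q4 <= 1.
Hypothesis nu_gt0 : 0 < nu.
Hypothesis n8_ge1 : 1 <= n8.
Hypothesis q4n8_ge1 : 1 <= q4 * n8.
Hypothesis nu_tau : 4 * (nu * n8) <= tau.
Hypothesis T_tau : 4 * `|T| <= tau.
Hypothesis zeta_mean : `|\sum_u px u * zeta u| <= t0.
Hypothesis t0_g : t0 <= g.
Hypothesis zeta4 : \sum_u px u * zeta u ^+ 4 <= nu ^+ 4.
Hypothesis sr_ne0 : \sum_(v | sr v != 0) ps v <= a.

Definition clip (y : R) : R := if `|y| <= tau then y else tau * Num.sg y.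
Definition pe (b : A1 * A2) : R := px b.1 * ps b.2.
(** By the fourth moment, the noise exceeds this level with probability at most q4^4, the bound on
    the corruption rate. *)
Definition level : R := nu / q4.
Definition light (b : A1 * A2) : bool := (`|zeta b.1| <= level) && (sr b.2 == 0).
Definition entry (b : A1 * A2) : R := clip (T + zeta b.1 + sr b.2) - T.
Definition light_entry b : R := if light b then zeta b.1 else 0.
Definition heavy_entry b : R := if light b then 0 else entry b.

Let a_gt0 : 0 < a. Proof. by rewrite exprn_gt0. Qed.
Let a_le1 : a <= 1. Proof. by rewrite exprn_ile1 // ltW. Qed.
Let n8_gt0 : 0 < n8. Proof. exact: lt_le_trans n8_ge1. Qed.
Let tau_gt0 : 0 < tau.
Proof. by apply: lt_le_trans nu_tau; rewrite !mulr_gt0. Qed.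
Let level_gt0 : 0 < level. Proof. exact: divr_gt0. Qed.

Lemma pe_ge0 b : 0 <= pe b. Proof. exact: mulr_ge0. Qed.

Lemma sum_pe (F : A1 -> R) (G : A2 -> R) :
  \sum_b pe b * (F b.1 * G b.2) = (\sum_u px u * F u) * (\sum_v ps v * G v).
Proof.
rewrite mulr_suml.
under [RHS]eq_bigr => u _ do rewrite mulr_sumr.
by rewrite pair_big /=; apply: eq_bigr => -[u v] _; rewrite /pe /=; ring.
Qed.

Lemma pe_sum1 : \sum_b pe b = 1.
Proof.
have := sum_pe (fun=> 1) (fun=> 1).
under eq_bigr => b _ do rewrite mulr1 mulr1.
under [X in _ = X * _]eq_bigr => u _ do rewrite mulr1.
by under [X in _ = _ * X]eq_bigr => u _ do rewrite mulr1; rewrite px_sum1 ps_sum1 mulr1.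
Qed.

Lemma pe_variance (F : A1 * A2 -> R) :
  \sum_b pe b * (F b - \sum_c pe c * F c) ^+ 2 = \sum_b pe b * F b ^+ 2 - (\sum_b pe b * F b) ^+ 2.
Proof.
pose mu := \sum_c pe c * F c; rewrite -/mu.
transitivity (\sum_b (pe b * F b ^+ 2 - 2 * mu * (pe b * F b) + mu ^+ 2 * pe b)).
  by apply: eq_bigr => b _; ring.
by rewrite big_split sumrB /= -!mulr_sumr pe_sum1 -/mu; ring.
Qed.

Lemma clip_le y : `|clip y| <= tau.
Proof.
rewrite /clip; case: ifP => // _; rewrite normrM normr_sg (ger0_norm (ltW tau_gt0)).
by case: (y != 0); rewrite ?mulr1 ?mulr0 // ltW.
Qed.

Lemma entry_bound b : `|entry b| <= 2 * tau.
Proof.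
rewrite /entry; apply: (le_trans (ler_normB _ _)).
have := clip_le (T + zeta b.1 + sr b.2); have := T_tau; have := tau_gt0; lra.
Qed.

Lemma level_tau : 4 * level <= tau.
Proof.
apply: le_trans nu_tau; rewrite ler_wpM2l // /level ler_pdivrMr // -mulrA ler_peMr ?(ltW nu_gt0) //.
by rewrite mulrC.
Qed.

(** A light entry is never clipped: both T and the level are at most tau / 4. *)
Lemma entry_split b : entry b = light_entry b + heavy_entry b.
Proof.
rewrite /light_entry /heavy_entry; case: ifP => [/andP[z /eqP s0]|_]; last by rewrite add0r.
rewrite addr0 /entry s0 addr0 /clip ifT; first by rewrite addrC addKr.
apply: (le_trans (ler_normD _ _)); have := T_tau; have := level_tau; have := tau_gt0; lra.
Qed.

Lemma light_bound b : `|light_entry b| <= level.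
Proof. by rewrite /light_entry; case: ifP => [/andP[]|]; rewrite ?normr0 // ltW. Qed.

Lemma heavy_bound b : `|heavy_entry b| <= 2 * tau.
Proof.
rewrite /heavy_entry; case: ifP => _; last exact: entry_bound.
by rewrite normr0 mulr_ge0 // ltW.
Qed.

Lemma tail_sum (F : A1 -> R) (c : R) : (forall u, level < `|zeta u| -> F u <= c * zeta u ^+ 4) -> 0 <= c ->
  \sum_(u | ~~ (`|zeta u| <= level)) px u * F u <= c * nu ^+ 4.
Proof.
move=> h c0; apply: (@le_trans _ _ (\sum_u c * (px u * zeta u ^+ 4))); last first.
  by rewrite -mulr_sumr ler_wpM2l.
rewrite [leRHS](bigID (fun u => `|zeta u| <= level)) /= -[leLHS]add0r; apply: lerD.
  by apply: sumr_ge0 => u _; have z4 : 0 <= zeta u ^+ 4 by [exact: exprn_even_ge0]; exact: mulr_ge0 c0 (mulr_ge0 (px_ge0 u) z4).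
apply: ler_sum => u; rewrite -ltNge => /h hu; rewrite mulrCA ler_wpM2l //.
Qed.

Let nu4_level k : (k <= 4)%N -> (level ^+ k)^-1 * nu ^+ 4 = nu ^+ (4 - k) * q4 ^+ k.
Proof.
move=> k4; rewrite /level expr_div_n invf_div -{1}(subnK k4) exprD [nu ^+ (4 - k) * _]mulrC mulrA divfK //.
  by rewrite mulrC.
by rewrite expf_neq0 // gt_eqF.
Qed.

Lemma pow_tail (u : A1) k j : (k + j = 4)%N -> level < `|zeta u| ->
  `|zeta u| ^+ j <= (level ^+ k)^-1 * zeta u ^+ 4.
Proof.
move=> kj hu; have -> : zeta u ^+ 4 = `|zeta u| ^+ k * `|zeta u| ^+ j.
  by rewrite -exprD kj -normrX ger0_norm // exprn_even_ge0.
rewrite mulrA ler_peMl ?exprn_ge0 // mulrC ler_pdivlMr ?exprn_gt0 // mul1r.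
by rewrite lerXn2r ?nnegrE // ltW.
Qed.

Lemma heavy_prob : \sum_(b | ~~ light b) pe b <= 2 * a.
Proof.
apply: (@le_trans _ _ (\sum_b pe b * ((~~ (`|zeta b.1| <= level))%:R * 1)
   + \sum_b pe b * (1 * (sr b.2 != 0)%:R))).
  rewrite big_mkcond -big_split /=; apply: ler_sum => b _; rewrite /light negb_and -mulrDr.
  have h := pe_ge0 b; case: (`|zeta b.1| <= level); case: (sr b.2 == 0) => /=;
    rewrite ?mul1r ?mulr1 ?mul0r ?addr0 ?add0r ?mulr0 ?mulr1 //; lra.
rewrite (sum_pe (fun u => (~~ (`|zeta u| <= level))%:R) (fun=> 1)).
rewrite (sum_pe (fun=> 1) (fun v => (sr v != 0)%:R)).
have e1 : \sum_v ps v * 1 = 1 by rewrite -[RHS]ps_sum1; apply: eq_bigr => v _; rewrite mulr1.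
have e2 : \sum_u px u * 1 = 1 by rewrite -[RHS]px_sum1; apply: eq_bigr => v _; rewrite mulr1.
rewrite e1 e2 mulr1 mul1r (_ : 2 * a = a + a); last by ring.
apply: lerD.
  have := @tail_sum (fun=> 1) (level ^+ 4)^-1 _ _; rewrite nu4_level // expr0 mul1r => h.
  apply: le_trans (h _ _).
  - rewrite [leRHS]big_mkcond /=; apply: ler_sum => u _; case: (_ <= level) => /=; rewrite ?mulr0 //.
  - by move=> u hu; have := pow_tail (k := 4) (j := 0) erefl hu; rewrite expr0.
  - by rewrite invr_ge0 exprn_ge0 // ltW.
apply: le_trans sr_ne0; rewrite [leRHS]big_mkcond /=; apply: ler_sum => v _.
by case: (sr v == 0) => /=; rewrite ?mulr0 ?mulr1.
Qed.

Lemma light_sum (F : A1 -> R) : \sum_b pe b * (if light b then F b.1 else 0)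
  = (\sum_(u | `|zeta u| <= level) px u * F u) * (\sum_(v | sr v == 0) ps v).
Proof.
rewrite (big_mkcond (fun u => `|zeta u| <= level)) (big_mkcond (fun v => sr v == 0)) /=.
transitivity (\sum_b pe b * ((if `|zeta b.1| <= level then F b.1 else 0) * (if sr b.2 == 0 then 1 else 0))).
  apply: eq_bigr => b _; congr (_ * _); rewrite /light.
  by case: (`|zeta b.1| <= level); case: (sr b.2 == 0); rewrite /= ?mulr1 ?mulr0 ?mul0r.
rewrite (sum_pe (fun u => if `|zeta u| <= level then F u else 0) (fun v => if sr v == 0 then 1 else 0)).
congr (_ * _); apply: eq_bigr => u _; first by case: ifP; rewrite ?mulr0.
by case: ifP; rewrite ?mulr0 ?mulr1.
Qed.

Let p0 := \sum_(v | sr v == 0) ps v.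
Let p0_ge : 1 - a <= p0.
Proof.
have h := ps_sum1; rewrite (bigID (fun v => sr v == 0)) /= -/p0 in h; have := sr_ne0; lra.
Qed.
Let p0_le1 : p0 <= 1.
Proof.
rewrite -ps_sum1 [leRHS](bigID (fun v => sr v == 0)) /= lerDl; exact: sumr_ge0.
Qed.
Let p0_ge0 : 0 <= p0. Proof. exact: sumr_ge0. Qed.

(** The noise is nearly centered, so its light part has almost the opposite mean of its tail, at
    most nu q4^3 by the fourth moment; q4 n8 >= 1 and the size of tau turn this into g. *)
Lemma light_mean : `|\sum_b pe b * light_entry b| <= 2 * g.
Proof.
have -> : \sum_b pe b * light_entry b = \sum_b pe b * (if light b then zeta b.1 else 0) by [].
rewrite light_sum -/p0 normrM (ger0_norm p0_ge0).
apply: (@le_trans _ _ (`|\sum_(u | `|zeta u| <= level) px u * zeta u|)); first by rewrite ler_piMr.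
have -> : \sum_(u | `|zeta u| <= level) px u * zeta u
  = \sum_u px u * zeta u - \sum_(u | ~~ (`|zeta u| <= level)) px u * zeta u.
  by rewrite [\sum_u _](bigID (fun u => `|zeta u| <= level)) /= addrK.
apply: (le_trans (ler_normB _ _)).
have t1 : `|\sum_(u | ~~ (`|zeta u| <= level)) px u * zeta u| <= nu * q4 ^+ 3.
  apply: (le_trans (ler_norm_sum _ _ _)).
  under eq_bigr => u _ do rewrite normrM (ger0_norm (px_ge0 u)).
  have := @tail_sum (fun u => `|zeta u|) (level ^+ 3)^-1 _ _; rewrite nu4_level // => h.
  apply: h; last by rewrite invr_ge0 exprn_ge0 // ltW.
  by move=> u hu; exact: (pow_tail (k := 3) (j := 1) erefl hu).
have t2 : nu * q4 ^+ 3 <= g.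
  have h1 : nu * q4 ^+ 3 <= nu * q4 ^+ 3 * (q4 * n8) by rewrite ler_peMr // mulr_ge0 ?exprn_ge0 // ltW.
  have h2 : a * (4 * (nu * n8)) <= a * tau by rewrite ler_wpM2l // ltW.
  have h3 : 0 <= a * (nu * n8) by rewrite !mulr_ge0 // ltW.
  rewrite (_ : nu * q4 ^+ 3 * (q4 * n8) = a * (nu * n8)) in h1; last by ring.
  lra.
have := zeta_mean; have := t0_g; lra.
Qed.

Lemma heavy_sum (F : A1 * A2 -> R) c : 0 <= c -> (forall b, `|F b| <= c) ->
  `|\sum_b pe b * (if light b then 0 else F b)| <= 2 * a * c.
Proof.
move=> c0 Fc; apply: (le_trans (ler_norm_sum _ _ _)).
apply: (@le_trans _ _ (\sum_(b | ~~ light b) pe b * c)); last by rewrite -mulr_suml ler_wpM2r // heavy_prob.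
rewrite [leRHS]big_mkcond /=; apply: ler_sum => b _; case: (light b); first by rewrite mulr0 normr0.
by rewrite normrM (ger0_norm (pe_ge0 b)) ler_wpM2l ?pe_ge0.
Qed.

Lemma heavy_mean : `|\sum_b pe b * heavy_entry b| <= 4 * g.
Proof.
have := heavy_sum (F := entry) (c := 2 * tau) _ entry_bound; rewrite mulr_ge0 ?(ltW tau_gt0) // => h.
by rewrite (_ : 4 * g = 2 * a * (2 * tau)); [exact: h|ring].
Qed.

Lemma entry_mean_bound : `|\sum_b pe b * entry b| <= 6 * g.
Proof.
have -> : \sum_b pe b * entry b = \sum_b pe b * light_entry b + \sum_b pe b * heavy_entry b.
  by rewrite -big_split; apply: eq_bigr => b _ /=; rewrite entry_split mulrDr.
apply: (le_trans (ler_normD _ _)); have := light_mean; have := heavy_mean; lra.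
Qed.

Lemma heavy_second : \sum_b pe b * heavy_entry b ^+ 2 <= 8 * (a * tau ^+ 2).
Proof.
have h := heavy_sum (F := fun b => entry b ^+ 2) (c := 4 * tau ^+ 2) _ _.
rewrite (_ : \sum_b _ = \sum_b pe b * (if light b then 0 else entry b ^+ 2)); last first.
  by apply: eq_bigr => b _; rewrite /heavy_entry; case: (light b); rewrite ?expr0n.
apply: (le_trans (ler_norm _)); apply: (le_trans (h _ _)).
- by rewrite mulr_ge0 ?sqr_ge0.
- move=> b; rewrite normrX (_ : 4 * _ = (2 * tau) ^+ 2); last by ring.
  by rewrite ler_pXn2r ?nnegrE ?mulr_ge0 ?entry_bound // ltW.
- by rewrite le_eqVlt; apply/orP; left; apply/eqP; ring.
Qed.

Definition base_var : R := \sum_u px u * zeta u ^+ 2.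

Lemma base_var_ge0 : 0 <= base_var.
Proof. by apply: sumr_ge0 => u _; rewrite mulr_ge0 ?sqr_ge0. Qed.

(** Jensen's inequality, as nonnegativity of the variance of the square of zeta. *)
Lemma base_var_le : base_var <= nu ^+ 2.
Proof.
rewrite -(@ler_pXn2r _ 2) ?nnegrE ?base_var_ge0 ?sqr_ge0 //.
apply: (@le_trans _ _ (\sum_u px u * zeta u ^+ 4)); last by rewrite -exprM.
rewrite -subr_ge0 (_ : _ - _ = \sum_u px u * (zeta u ^+ 2 - base_var) ^+ 2).
  by apply: sumr_ge0 => u _; rewrite mulr_ge0 ?sqr_ge0.
transitivity (\sum_u (px u * zeta u ^+ 4 - 2 * base_var * (px u * zeta u ^+ 2) + base_var ^+ 2 * px u)).
  by rewrite big_split sumrB /= -!mulr_sumr px_sum1 -/base_var; ring.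
by apply: eq_bigr => u _; ring.
Qed.

Lemma light_second : `|\sum_b pe b * light_entry b ^+ 2 - base_var| <= a * tau ^+ 2.
Proof.
have -> : \sum_b pe b * light_entry b ^+ 2 = \sum_b pe b * (if light b then zeta b.1 ^+ 2 else 0).
  by apply: eq_bigr => b _; rewrite /light_entry; case: (light b); rewrite ?expr0n.
rewrite (light_sum (fun u => zeta u ^+ 2)) -/p0.
set s1 := \sum_(u | _) _.
pose s2 := \sum_(u | ~~ (`|zeta u| <= level)) px u * zeta u ^+ 2.
have bE : base_var = s1 + s2 by rewrite /base_var (bigID (fun u => `|zeta u| <= level)).
have s10 : 0 <= s1 by apply: sumr_ge0 => u _; rewrite mulr_ge0 ?sqr_ge0.
have s20 : 0 <= s2 by apply: sumr_ge0 => u _; rewrite mulr_ge0 ?sqr_ge0.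
have s2le : s2 <= nu ^+ 2 * q4 ^+ 2.
  have := @tail_sum (fun u => zeta u ^+ 2) (level ^+ 2)^-1 _ _; rewrite nu4_level // => h.
  apply: h; last by rewrite invr_ge0 exprn_ge0 // ltW.
  by move=> u hu; have := pow_tail (k := 2) (j := 2) erefl hu; rewrite -normrX ger0_norm ?sqr_ge0.
have s1le : s1 <= nu ^+ 2 by have := base_var_le; rewrite bE; lra.
have m1 : s1 * (1 - p0) <= nu ^+ 2 * a by apply: ler_pM; [|have := p0_le1; lra| |have := p0_ge; lra].
have m0 : 0 <= s1 * (1 - p0) by rewrite mulr_ge0 // subr_ge0.
have t1 : 16 * (nu ^+ 2 * n8 ^+ 2) <= tau ^+ 2.
  rewrite (_ : 16 * _ = (4 * (nu * n8)) ^+ 2); last by ring.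
  by apply: sqr_mono => //; rewrite !mulr_ge0 // ltW.
have n82 : 1 <= n8 ^+ 2 by rewrite exprn_ege1.
have t2 : a * (16 * (nu ^+ 2 * n8 ^+ 2)) <= a * tau ^+ 2 by rewrite ler_wpM2l // ltW.
have t3 : nu ^+ 2 * a <= a * (nu ^+ 2 * n8 ^+ 2).
  by rewrite mulrC ler_wpM2l ?(ltW a_gt0) // ler_peMr ?sqr_ge0.
have t4 : nu ^+ 2 * q4 ^+ 2 <= a * (nu ^+ 2 * n8 ^+ 2).
  rewrite (_ : a * _ = nu ^+ 2 * q4 ^+ 2 * (q4 * n8) ^+ 2); last by ring.
  by rewrite ler_peMr ?exprn_ege1 //; exact: mulr_ge0 (sqr_ge0 _) (sqr_ge0 _).
have t5 : 0 <= a * (nu ^+ 2 * n8 ^+ 2) by apply: le_trans t4; exact: mulr_ge0 (sqr_ge0 _) (sqr_ge0 _).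
rewrite bE (_ : s1 * p0 - (s1 + s2) = - (s1 * (1 - p0) + s2)); last by ring.
rewrite normrN ger0_norm ?addr_ge0 //; lra.
Qed.

Lemma entry_second : `|\sum_b pe b * entry b ^+ 2 - base_var| <= 9 * (a * tau ^+ 2).
Proof.
have -> : \sum_b pe b * entry b ^+ 2
  = \sum_b pe b * light_entry b ^+ 2 + \sum_b pe b * heavy_entry b ^+ 2.
  rewrite -big_split; apply: eq_bigr => b _ /=; rewrite -mulrDr entry_split; congr (_ * _).
  by rewrite /light_entry /heavy_entry; case: (light b); rewrite ?addr0 ?add0r expr0n ?addr0 ?add0r.
rewrite addrAC; apply: (le_trans (ler_normD _ _)).
have h0 : 0 <= \sum_b pe b * heavy_entry b ^+ 2.
  by apply: sumr_ge0 => b _; rewrite mulr_ge0 ?sqr_ge0 ?pe_ge0.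
rewrite (ger0_norm h0); have := light_second; have := heavy_second; lra.
Qed.

(** The reference value depends neither on T nor on the corruption law, so one multiple of the
    identity suits all rows. Of the 49, the second moment takes 9 and the squared mean 36. *)
Lemma entry_variance :
  `|\sum_b pe b * (entry b - \sum_c pe c * entry c) ^+ 2 - base_var| <= (7 * (q4 ^+ 2 * tau)) ^+ 2.
Proof.
rewrite pe_variance; set mu := (X in _ - X ^+ 2 - _).
have m : mu ^+ 2 <= 36 * (a * tau ^+ 2).
  have h1 : `|mu| ^+ 2 <= (6 * g) ^+ 2 by apply: sqr_mono => //; exact: entry_mean_bound.
  rewrite real_normK ?num_real // in h1; apply: (le_trans h1).
  rewrite (_ : (6 * g) ^+ 2 = 36 * (a * (a * tau ^+ 2))); last by ring.
  by rewrite ler_wpM2l // ler_piMl //; exact: mulr_ge0 (ltW a_gt0) (sqr_ge0 _).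
rewrite (_ : (7 * _) ^+ 2 = 49 * (a * tau ^+ 2)); last by ring.
rewrite addrAC; apply: (le_trans (ler_normB _ _)); rewrite (ger0_norm (sqr_ge0 mu)).
have := entry_second; have : 0 <= a * tau ^+ 2 by exact: mulr_ge0 (ltW a_gt0) (sqr_ge0 _).
lra.
Qed.

Lemma heavy_variance :
  \sum_b pe b * (heavy_entry b - \sum_c pe c * heavy_entry c) ^+ 2 <= (7 * (q4 ^+ 2 * tau)) ^+ 2.
Proof.
rewrite pe_variance; set mu := (X in _ - X ^+ 2).
rewrite (_ : (7 * _) ^+ 2 = 49 * (a * tau ^+ 2)); last by ring.
have := heavy_second; have := sqr_ge0 mu; have : 0 <= a * tau ^+ 2 by exact: mulr_ge0 (ltW a_gt0) (sqr_ge0 _).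
lra.
Qed.

Lemma mean_le (F : A1 * A2 -> R) c : (forall b, `|F b| <= c) -> `|\sum_b pe b * F b| <= c.
Proof.
move=> Fc; apply: (le_trans (ler_norm_sum _ _ _)).
rewrite -[leRHS]mul1r -pe_sum1 mulr_suml; apply: ler_sum => b _.
by rewrite normrM (ger0_norm (pe_ge0 b)) ler_wpM2l ?pe_ge0.
Qed.

Lemma centered_le (F : A1 * A2 -> R) c b : (forall b, `|F b| <= c) ->
  `|F b - \sum_c pe c * F c| <= 2 * c.
Proof.
move=> Fc; apply: (le_trans (ler_normB _ _)); have := mean_le Fc; have := Fc b; lra.
Qed.

End TruncatedEntry.

(** * Discretization of the noise *)

Section Cells.
Variables (R : realType) (eta : R) (n : nat).
Hypothesis eta_gt0 : 0 < eta.

(* The cells have width eta inside ]-n eta, n eta[; everything outside is sent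
   to the cells around 0. Their representatives are rounded toward 0. *)
Definition cell_of (x : R) : 'I_n.+1 * bool :=
  (inord (if `|x| < n%:R * eta then Num.truncn (`|x| / eta) else 0), 0 <= x).

Definition cell_rep (u : 'I_n.+1 * bool) : R := (if u.2 then 1 else -1) * (u.1%:R * eta).

Lemma cell_of_index x : `|x| < n%:R * eta ->
  ((cell_of x).1 : nat) = Num.truncn (`|x| / eta).
Proof.
move=> xn; rewrite /cell_of /= xn inordK // -(ltr_nat R).
apply: (@le_lt_trans _ _ (`|x| / eta)); first by rewrite truncn_le divr_ge0 // ltW.
by rewrite ltr_pdivrMr //; apply: (lt_trans xn); rewrite ltr_pM2r // ltr_nat.
Qed.

Lemma cell_rep_far x : n%:R * eta <= `|x| -> cell_rep (cell_of x) = 0.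
Proof. by move=> xn; rewrite /cell_rep /cell_of /= ltNge xn /= inordK // mul0r mulr0. Qed.

Lemma cell_rep_near x : `|x| < n%:R * eta ->
  `|cell_rep (cell_of x)| <= `|x| /\ `|cell_rep (cell_of x) - x| <= eta.
Proof.
move=> xn; rewrite /cell_rep cell_of_index //=.
set t := Num.truncn _.
have /andP[t1 t2] : t%:R <= `|x| / eta < t.+1%:R by apply: truncn_itv; rewrite divr_ge0 // ltW.
rewrite ler_pdivlMr // in t1; rewrite ltr_pdivrMr // -natr1 mulrDl mul1r in t2.
have t0 : 0 <= t%:R * eta by rewrite mulr_ge0 // ltW.
have [x0|x0] := leP 0 x.
  rewrite !mul1r; rewrite (ger0_norm x0) in t1 t2 *; rewrite ger0_norm //; split => //.
  rewrite ler_norml; lra.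
rewrite !mulN1r; rewrite (ltr0_norm x0) in t1 t2 *; rewrite normrN ger0_norm //; split => //.
rewrite ler_norml; lra.
Qed.

(** Rounding toward 0 never increases absolute values: moments do not grow, and an entry without
    corruption stays exactly 0. *)
Lemma cell_rep_le x : `|cell_rep (cell_of x)| <= `|x|.
Proof.
have [xn|xn] := ltP `|x| (n%:R * eta); first by case: (cell_rep_near xn).
by rewrite cell_rep_far // normr0.
Qed.

Let measurable_ball c : measurable [set x : R | `|x| < c].
Proof.
rewrite (_ : [set x : R | `|x| < c] = [set` `]- c, c[]); first exact: measurable_itv.
by apply/seteqP; split => x /=; rewrite in_itv /= ltr_norml.
Qed.

Lemma measurable_cell u : measurable (cell_of @^-1` [set u]).
Proof.
case: u => k b.
pose H : set R := [set x | (0 <= x) = b].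
pose J : set R := [set x | `|x| < k.+1%:R * eta] `\` [set x | `|x| < k%:R * eta].
pose N : set R := [set x | `|x| < n%:R * eta].
(* Values out of range are sent to index 0, so the two cells of index 0 also receive the complement
   of the range. *)
pose Z : set R := if k == 0 :> nat then ~` N else set0.
have mH : measurable H.
  rewrite /H; case: (b).
    rewrite (_ : [set x | _] = [set` `[0, +oo[]); first exact: measurable_itv.
    by apply/seteqP; split => x /=; rewrite in_itv /= andbT.
  rewrite (_ : [set x | _] = [set` `]-oo, 0[]); first exact: measurable_itv.
  by apply/seteqP; split => x /=; rewrite in_itv /= leNgt; case: (x < 0).
rewrite (_ : _ @^-1` _ = H `&` ((N `&` J) `|` Z)).
  apply: measurableI => //; apply: measurableU.
    by apply: measurableI; [exact: measurable_ball|apply: measurableD; exact: measurable_ball].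
  by rewrite /Z; case: ifP => // _; apply: measurableC; exact: measurable_ball.
have tE x : (Num.truncn (`|x| / eta) = k) <-> J x.
  rewrite /J /=; split.
    move=> <-; have /andP[t1 t2] := @truncn_itv _ (`|x| / eta) (divr_ge0 (normr_ge0 x) (ltW eta_gt0)).
    rewrite -ltr_pdivrMr // t2; split => //; rewrite -ltr_pdivrMr //.
    by apply/negP; rewrite -leNgt.
  move=> [t1 /negP]; rewrite -leNgt -ler_pdivlMr // => t2; apply: truncn_def.
  by rewrite t2 /= ltr_pdivrMr.
apply/seteqP; split => x /=.
  move=> xE; have hb : (0 <= x) = b by case: xE.
  have hk : inord (if `|x| < n%:R * eta then Num.truncn (`|x| / eta) else 0) = k by case: xE.
  split => //; have [xn|xn] := ltP `|x| (n%:R * eta).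
    left; split => //; apply/tE; rewrite -hk; have := cell_of_index xn; rewrite /cell_of /= => ->.
    by [].
  right; rewrite ltNge xn /= in hk; rewrite /Z -hk inordK //= /N => /=; apply/negP; by rewrite -leNgt.
move=> [hb [[xn /tE tk]|]].
  rewrite /cell_of hb xn tk; congr (_, _); apply: val_inj => /=; exact: inordK.
rewrite /Z; case: ifP => // /eqP k0; rewrite /N /= => /negP; rewrite -leNgt => xn.
rewrite /cell_of hb ltNge xn /=; congr (_, _); apply: val_inj; by rewrite /= inordK.
Qed.

End Cells.

(** * Joint law of the rounded entries *)

Section JointLaw.
Variables (R : realType) (disp : measure_display) (Omega : measurableType disp).
Variables (P : probability Omega R) (I : finType).
Variables (X S : I -> {RV P >-> R}).
Variables (A : finType) (cl : R -> A).
Hypothesis measurable_cl : forall a, measurable (cl @^-1` [set a]).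
Hypothesis indep : mutually_independent
  (fun i : I + I => match i with inl w => X w | inr w => S w end).

Definition cell_prob (Z : {RV P >-> R}) (a : A) : R := fine (P (Z @^-1` (cl @^-1` [set a]))).
Definition cells (o : Omega) : {ffun I -> A * A} := [ffun w => (cl (X w o), cl (S w o))].

Lemma measurable_cl_rv (Z : {RV P >-> R}) a : measurable (Z @^-1` (cl @^-1` [set a])).
Proof. by rewrite -[_ @^-1` _]setTI; exact: measurable_funP. Qed.

Lemma cell_probE (Z : {RV P >-> R}) a : P (Z @^-1` (cl @^-1` [set a])) = (cell_prob Z a)%:E.
Proof. by rewrite fineK // fin_num_measure //; exact: measurable_cl_rv. Qed.

Lemma cell_prob_ge0 (Z : {RV P >-> R}) a : 0 <= cell_prob Z a.
Proof. exact: fine_ge0. Qed.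

Lemma prob_cells (T : finType) (F : Omega -> T) (G : pred T) :
  (forall t, measurable (F @^-1` [set t])) ->
  measurable [set o | G (F o)] /\
  P [set o | G (F o)] = (\sum_(t | G t) P (F @^-1` [set t]))%E.
Proof.
move=> mF.
have -> : [set o | G (F o)] = \bigcup_(t in [set` G]) (F @^-1` [set t]).
  apply/seteqP; split => o /=; first by move=> Go; exists (F o).
  by case=> t Gt /= ->.
have fG : finite_set [set` G] by exact: finite_finset.
split; first by apply: fin_bigcup_measurable.
rewrite measure_fin_bigcup //; last first.
  by move=> i j _ _ [y [] /= <- <-].
rewrite -big_enum /= (fsbig_seq _ _ (enum_uniq _)).
by rewrite (_ : [set` enum G] = [set` G]) //; apply/seteqP; split => t /=; rewrite mem_enum.
Qed.

Lemma sum_cell_prob (Z : {RV P >-> R}) : \sum_a cell_prob Z a = 1.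
Proof.
have [_] := @prob_cells A (cl \o Z) predT (measurable_cl_rv Z).
rewrite (_ : [set o | _] = setT); last by apply/seteqP; split.
rewrite probability_setT => /esym.
under eq_bigr => a _ do rewrite (cell_probE Z a).
by rewrite sumEFin => -[].
Qed.

Lemma cells_law (x : {ffun I -> A * A}) :
  measurable (cells @^-1` [set x]) /\
  P (cells @^-1` [set x]) = (\prod_w (cell_prob (X w) (x w).1 * cell_prob (S w) (x w).2))%:E.
Proof.
pose B (i : I + I) : set R := cl @^-1` [set (match i with inl w => (x w).1 | inr w => (x w).2 end)].
have mB i : measurable (B i) by exact: measurable_cl.
have := indep mB.
pose Y (i : I + I) : {RV P >-> R} := match i with inl w => X w | inr w => S w end.
rewrite -/Y.
have -> : [set o | forall i, B i (Y i o)] = cells @^-1` [set x].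
  apply/seteqP; split => o /=.
    move=> h; apply/ffunP => w; rewrite ffunE; have := h (inl w); have := h (inr w).
    by rewrite /B /= => -> ->; case: (x w).
  by move=> e [w|w]; rewrite /B /= -e ffunE.
move=> ->; split; last first.
  rewrite big_sumType /=.
  under eq_bigr => w _ do rewrite cell_probE.
  under [X in (_ * X)%E]eq_bigr => w _ do rewrite cell_probE.
  by rewrite !prodEFin -EFinM big_split.
rewrite (_ : _ @^-1` _ = \bigcap_(w in setT) (X w @^-1` (cl @^-1` [set (x w).1]) `&` S w @^-1` (cl @^-1` [set (x w).2]))).
  apply: fin_bigcap_measurable; first exact: finite_finset.
  by move=> w _; apply: measurableI; exact: measurable_cl_rv.
apply/seteqP; split => o /=.
  by move=> <- w _; rewrite /= ffunE.
by move=> h; apply/ffunP => w; rewrite ffunE; have [/= -> ->] := h w Logic.I; case: (x w).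
Qed.

Lemma prob_cells_Pr (p : I -> A * A -> R) (G : pred {ffun I -> A * A}) :
  (forall w b, p w b = cell_prob (X w) b.1 * cell_prob (S w) b.2) ->
  measurable [set o | G (cells o)] /\ P [set o | G (cells o)] = (Pr p G)%:E.
Proof.
move=> pE; have [mG PG] := @prob_cells _ cells G (fun x => (cells_law x).1).
split => //; rewrite PG; under eq_bigr => x _ do rewrite (cells_law x).2.
rewrite sumEFin /Pr /Ex big_mkcond; congr (_%:E); apply: eq_bigr => x _.
rewrite /pweight; case: (G x); rewrite ?mulr1 ?mulr0 //.
by apply: eq_bigr => w _; rewrite pE.
Qed.

End JointLaw.

(** * Moments of the rounded noise *)

Section CellMoments.
Variables (R : realType) (disp : measure_display) (Omega : measurableType disp).
Variables (P : probability Omega R) (xi : {RV P >-> R}).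

Section Integrals.
Variables (A : finType) (cl : R -> A).
Hypothesis measurable_cl : forall a, measurable (cl @^-1` [set a]).

Let cellE (F : A -> R) o : (F (cl (xi o)))%:E
  = (\sum_a (F a)%:E * (\1_(xi @^-1` (cl @^-1` [set a])) o)%:E)%E.
Proof.
rewrite (bigD1 (cl (xi o))) //= big1 => [|a ae].
  by rewrite adde0 indicE mem_set //= mule1.
by rewrite indicE memNset ?mule0 //= => e; move: ae; rewrite -e eqxx.
Qed.

Let mcell a : measurable (xi @^-1` (cl @^-1` [set a])).
Proof. exact: measurable_cl_rv. Qed.

Let integrable_term (F : A -> R) a : P.-integrable setT
  (fun o => ((F a)%:E * (\1_(xi @^-1` (cl @^-1` [set a])) o)%:E)%E).
Proof. by apply: integrableZl => //; exact: integrable_indic. Qed.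

Lemma integrable_cells (F : A -> R) : P.-integrable setT (fun o => (F (cl (xi o)))%:E).
Proof.
rewrite (_ : (fun o => _) = (fun o => \sum_a (F a)%:E * (\1_(xi @^-1` (cl @^-1` [set a])) o)%:E)%E).
  by apply: integrable_sum => // a _; exact: integrable_term.
by apply/funext => o; exact: cellE.
Qed.

Lemma integral_cells (F : A -> R) :
  (\int[P]_o (F (cl (xi o)))%:E = (\sum_a cell_prob cl xi a * F a)%:E)%E.
Proof.
under eq_integral => o _ do rewrite cellE.
rewrite (integral_sum measurableT (integrable_term F)).
rewrite -sumEFin; apply: eq_bigr => a _.
rewrite integralZl //; last exact: integrable_indic.
rewrite integral_indic // setIT muleC EFinM; congr (_ * _)%E; exact: cell_probE.
Qed.

End Integrals.

Variable eps : R.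
Hypothesis eps_gt0 : 0 < eps.
Hypothesis xi_moment : ('E_P[(fun o => `|xi o| `^ (4 + eps))%R] < +oo)%E.
Hypothesis xi_mean : ('E_P[xi] = 0)%E.

Let mxi : measurable_fun setT xi. Proof. exact: measurable_funP. Qed.

Let integrable1 : P.-integrable setT (fun=> 1%:E).
Proof. exact: finite_measure_integrable_cst. Qed.

(** Dominated by 1 + |x|^(4 + eps). *)
Lemma integrable_xi4 : P.-integrable setT (fun o => (xi o ^+ 4)%:E).
Proof.
have m2 : measurable_fun setT (fun o => `|xi o| `^ (4 + eps)).
  apply: (measurableT_comp (measurable_powR _)).
  exact: (measurableT_comp (@normr_measurable _ setT)).
have i2 : P.-integrable setT (fun o => (`|xi o| `^ (4 + eps))%:E).
  apply/integrableP; split; first exact/measurable_EFinP.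
  move: xi_moment; rewrite unlock; under [X in _ -> (X < _)%E]eq_integral => o _ do rewrite gee0_abs ?lee_fin ?powR_ge0 //.
  by [].
have := integrableD measurableT integrable1 i2; apply: le_integrable => //.
  by apply/measurable_EFinP; exact: measurable_funX.
move=> o _ /=; rewrite lee_fin ger0_norm ?exprn_even_ge0 //.
have p0 := powR_ge0 `|xi o| (4 + eps).
rewrite ger0_norm; last by rewrite addr_ge0.
have -> : xi o ^+ 4 = `|xi o| ^+ 4 by rewrite -normrX ger0_norm // exprn_even_ge0.
have [x1|x1] := leP `|xi o| 1.
  by apply: (@le_trans _ _ 1); rewrite ?exprn_ile1 // lerDl.
apply: (@le_trans _ _ (`|xi o| `^ (4 + eps))); last by rewrite lerDr.
rewrite -powR_mulrn // ler_powR // ?(ltW x1) // lerDl; exact: ltW.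
Qed.

Lemma norm_L4_ge0 : 0 <= norm_L4 xi.
Proof. by rewrite fine_ge0 // Lnorm_ge0. Qed.

Lemma integral_xi4 : (\int[P]_o (xi o ^+ 4)%:E = (norm_L4 xi ^+ 4)%:E)%E.
Proof.
have e4 : ('N[P]_(4%:R%:E) [EFin \o xi] `^ 4%:R = \int[P]_o (xi o ^+ 4)%:E)%E.
  rewrite poweR_Lnorm ?pnatr_eq0 //; apply: eq_integral => o _ /=.
  by rewrite powR_mulrn ?normr_ge0 // -normrX ger0_norm // exprn_even_ge0.
have fin4 := integrable_fin_num measurableT integrable_xi4.
have n0 := Lnorm_ge0 P 4%:R%:E (EFin \o xi).
have finN : ('N[P]_(4%:R%:E) [EFin \o xi])%E \is a fin_num.
  rewrite ge0_fin_numE // (@lty_poweRy _ _ 4) ?pnatr_eq0 // e4.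
  by rewrite -ge0_fin_numE // integral_ge0 // => o _; rewrite lee_fin exprn_even_ge0.
by rewrite -e4 /norm_L4 -[in LHS](fineK finN) poweR_EFin powR_mulrn // fine_ge0.
Qed.

Lemma integrable_xi : P.-integrable setT (fun o => (xi o)%:E).
Proof.
have := integrableD measurableT integrable1 integrable_xi4; apply: le_integrable => //.
  exact/measurable_EFinP.
move=> o _ /=; rewrite lee_fin [leRHS]ger0_norm; last by rewrite addr_ge0 ?exprn_even_ge0.
have -> : xi o ^+ 4 = `|xi o| ^+ 4 by rewrite -normrX ger0_norm // exprn_even_ge0.
have [x1|x1] := leP `|xi o| 1; first by apply: (le_trans x1); rewrite lerDl exprn_ge0.
apply: (@le_trans _ _ (`|xi o| ^+ 4)); last by rewrite lerDr.
by rewrite exprS ler_peMr // exprn_ege1 // ltW.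
Qed.

Variables (eta : R) (n : nat).
Hypothesis eta_gt0 : 0 < eta.
Hypothesis n_gt0 : (0 < n)%N.
Local Notation cl := (@cell_of R eta n).
Local Notation rep := (@cell_rep R eta n).
Let mcl a : measurable (cl @^-1` [set a]). Proof. exact: measurable_cell. Qed.

Lemma cell_fourth_moment : \sum_a cell_prob cl xi a * rep a ^+ 4 <= norm_L4 xi ^+ 4.
Proof.
rewrite -lee_fin -(integral_cells mcl (fun a => rep a ^+ 4)) -integral_xi4.
apply: (le_integral measurableT (integrable_cells mcl (fun a => rep a ^+ 4)) integrable_xi4).
move=> o _; rewrite lee_fin.
have e x : x ^+ 4 = `|x| ^+ 4 :> R by rewrite -normrX ger0_norm // exprn_even_ge0.
by rewrite e [leRHS]e lerXn2r ?nnegrE // cell_rep_le.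
Qed.

(** In range, rounding moves a value by at most eta; out of range, the whole value is lost, and
    there |x| <= x^4 / (n eta)^3. *)
Lemma cell_mean : `|\sum_a cell_prob cl xi a * rep a|
  <= eta + ((n%:R * eta) ^+ 3)^-1 * norm_L4 xi ^+ 4.
Proof.
have c0 : 0 < n%:R * eta by rewrite mulr_gt0 ?ltr0n.
have mean0 : (\int[P]_o (xi o)%:E = 0)%E by rewrite -expectation_def.
have ir := integrable_cells mcl rep.
have id := integrableB measurableT ir integrable_xi.
rewrite -lee_fin -[X in (`|X|%:E)%E]/(fine (EFin _)) -(integral_cells mcl rep).
rewrite (_ : (`|fine _|%:E)%E = `|\int[P]_o (rep (cl (xi o)))%:E - \int[P]_o (xi o)%:E|%E); last first.
  by rewrite mean0 sube0 (integral_cells mcl rep).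
rewrite -(integralB measurableT ir integrable_xi); have [mid _] := integrableP _ _ _ id.
apply: (le_trans (le_abse_integral _ measurableT mid)).
have iu : P.-integrable setT (fun o => ((eta%:E * 1%:E) + ((((n%:R * eta) ^+ 3)^-1)%:E * (xi o ^+ 4)%:E))%E).
  by apply: integrableD => //; apply: integrableZl => //; exact: integrable_xi4.
apply: (@le_trans _ _ (\int[P]_o ((eta%:E * 1%:E) + ((((n%:R * eta) ^+ 3)^-1)%:E * (xi o ^+ 4)%:E)))%E).
  apply: le_integral => //; first exact: integrable_abse.
  move=> o _; rewrite -EFinB abse_EFin !lee_fin mulr1.
  have x4 : xi o ^+ 4 = `|xi o| ^+ 3 * `|xi o| by rewrite -exprSr -normrX ger0_norm // exprn_even_ge0.
  have [xn|xn] := ltP `|xi o| (n%:R * eta).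
    apply: (@le_trans _ _ eta); first by case: (cell_rep_near eta_gt0 xn).
    by rewrite lerDl mulr_ge0 ?exprn_even_ge0 // invr_ge0 exprn_ge0 // ltW.
  rewrite cell_rep_far // sub0r normrN; apply: (@le_trans _ _ (((n%:R * eta) ^+ 3)^-1 * xi o ^+ 4)); last first.
    by rewrite lerDr ltW.
  rewrite x4 mulrA ler_peMl // mulrC ler_pdivlMr ?exprn_gt0 // mul1r.
  by rewrite lerXn2r ?nnegrE // ltW.
rewrite integralD //; [|by apply: integrableZl|by apply: integrableZl => //; exact: integrable_xi4].
rewrite integralZl // integralZl //; last exact: integrable_xi4.
have -> : (\int[P]_x 1%:E = 1)%E by rewrite integral_cst // mul1e; exact: probability_setT.
by rewrite integral_xi4 mule1 -EFinM -EFinD.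
Qed.

End CellMoments.

Section FiniteModelOfNoise.
Variables (R : realType) (disp : measure_display) (Omega : measurableType disp).
Variables (P : probability Omega R).

(** Continuity from above: the events decrease to the empty set because M is finite everywhere. *)
Lemma tail_small (M : Omega -> R) (eta delta : R) (n0 : nat) :
  measurable_fun setT M -> 0 < eta -> 0 < delta ->
  exists2 n, (n0 <= n)%N & (P [set o | (n%:R * eta <= M o)%R] <= delta%:E)%E.
Proof.
move=> mM eta0 delta0.
pose F n := [set o | n%:R * eta <= M o].
have mF n : measurable (F n).
  rewrite (_ : F n = M @^-1` [set` `[n%:R * eta, +oo[]).
    by rewrite -[_ @^-1` _]setTI; apply: mM => //; exact: measurable_itv.
  by apply/seteqP; split => o /=; rewrite in_itv /= andbT.
have noninc : nonincreasing_seq F.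
  move=> i j ij; apply/subsetPset => o; apply: le_trans.
  by rewrite ler_pM2r // ler_nat.
have cap0 : \bigcap_n F n = set0.
  apply/seteqP; split => o //= h.
  have := h (Num.truncn (`|M o| / eta)).+1 Logic.I; apply/negP; rewrite -ltNge.
  apply: (le_lt_trans (ler_norm _)); rewrite -ltr_pdivrMr //.
  by have /andP[] := @truncn_itv _ (`|M o| / eta) (divr_ge0 (normr_ge0 _) (ltW eta0)).
have := @nonincreasing_cvg_mu _ _ _ P F _ mF _ noninc; rewrite cap0 measure0 => h.
have F0 : (P (F 0%N) < +oo)%E by rewrite ltey_eq fin_num_measure.
have {h} := h F0 measurable0.
move=> /fine_cvgP [_ /cvgrPdist_le /(_ _ delta0) h].
have {h} [N _ h] := h.
exists (maxn n0 N); first exact: leq_maxl.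
have := h (maxn n0 N) (leq_maxr _ _) => /=; rewrite sub0r normrN ger0_norm ?fine_ge0 // => hd.
by rewrite (_ : P _ = (fine (P (F (maxn n0 N))))%:E) ?lee_fin // fineK // fin_num_measure.
Qed.

Variables (I : finType) (xi : {RV P >-> R}) (X S : I -> {RV P >-> R}).
Variables (eps alpha : R) (Q : I -> probability (measurableTypeR R) R).
Hypothesis eps_gt0 : 0 < eps.
Hypothesis xi_moment : ('E_P[(fun o => `|xi o| `^ (4 + eps))%R] < +oo)%E.
Hypothesis xi_mean : ('E_P[xi] = 0)%E.
Hypothesis X_law : forall w, identically_distributed (X w) xi.
Hypothesis alpha01 : 0 <= alpha <= 1.
Hypothesis S_law : forall w, contaminated alpha (Q w) (S w).
Hypothesis indep : mutually_independent
  (fun i : I + I => match i with inl w => X w | inr w => S w end).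

Lemma contaminated_neq0 w : (P (S w @^-1` (~` [set (0 : R)%R])) <= alpha%:E)%E.
Proof.
have m0 : measurable (~` [set (0 : R)]) by apply: measurableC; exact: measurable_set1.
have := S_law w m0; rewrite /distribution /pushforward => ->.
have a0 : 0 <= alpha by case/andP: alpha01.
rewrite diracE memNset /=; last by [].
rewrite mule0 add0e -[leRHS]mule1; apply: lee_pmul => //; exact: probability_le1.
Qed.

(** The law of the cells is exactly the product law; [E0] is the event that all entries are in
    range, where the representatives are close to the data. *)
Lemma finite_noise_model (eta delta : R) : 0 < eta -> 0 < delta ->
  exists (A : finType) (rep px : A -> R) (ps : I -> A -> R)
    (cells : Omega -> {ffun I -> A * A}) (E0 : set Omega),
  [/\ (forall a, 0 <= px a) /\ \sum_a px a = 1,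
      (forall w a, 0 <= ps w a) /\ (forall w, \sum_a ps w a = 1),
      [/\ `|\sum_a px a * rep a| <= 2 * eta,
          \sum_a px a * rep a ^+ 4 <= norm_L4 xi ^+ 4 &
          forall w, \sum_(a | rep a != 0) ps w a <= alpha],
      [/\ measurable E0, (P (~` E0) <= delta%:E)%E &
          forall o, E0 o -> forall w, `|X w o - rep (cells o w).1| <= eta /\
                                      `|S w o - rep (cells o w).2| <= eta] &
      forall (p : I -> A * A -> R) (G : pred {ffun I -> A * A}),
        (forall w b, p w b = px b.1 * ps w b.2) ->
        measurable [set o | G (cells o)] /\ P [set o | G (cells o)] = (Pr p G)%:E].
Proof.
move=> eta0 delta0.
pose M o := \sum_w (`|X w o| + `|S w o|).
have mM : measurable_fun setT M.
  apply: measurable_sum => w; apply: measurable_funD;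
    exact: (measurableT_comp (@normr_measurable _ setT)).
pose nu4 := norm_L4 xi ^+ 4.
have nu40 : 0 <= nu4 by rewrite exprn_ge0 // norm_L4_ge0.
(* Taking n above nu^4 / eta^4 makes the tail term of [cell_mean] at most eta. *)
have [n n0 tail] := tail_small (Num.truncn (nu4 / eta ^+ 4)).+1 mM eta0 delta0.
have n_gt0 : (0 < n)%N by exact: leq_trans n0.
have nu4n : nu4 <= n%:R * eta ^+ 4.
  rewrite -ler_pdivrMr ?exprn_gt0 //; apply: (@le_trans _ _ (Num.truncn (nu4 / eta ^+ 4)).+1%:R); last by rewrite ler_nat.
  by have /andP[_ /ltW] := @truncn_itv _ (nu4 / eta ^+ 4) (divr_ge0 nu40 (exprn_ge0 _ (ltW eta0))).
pose cl := @cell_of R eta n; pose rep := @cell_rep R eta n.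
have mcl a : measurable (cl @^-1` [set a]) by exact: measurable_cell.
exists ('I_n.+1 * bool)%type, rep, (cell_prob cl xi), (fun w => cell_prob cl (S w)), (cells X S cl), (~` [set o | n%:R * eta <= M o]).
split.
- by split => [a|]; [exact: cell_prob_ge0|exact: sum_cell_prob].
- by split => w => [a|]; [exact: cell_prob_ge0|exact: sum_cell_prob].
- split.
  + apply: (le_trans (cell_mean eps_gt0 xi_moment xi_mean eta0 n_gt0)).
    rewrite [leRHS]mulr_natl mulr2n lerD2l mulrC ler_pdivrMr ?exprn_gt0 ?mulr_gt0 ?ltr0n //.
    apply: (le_trans nu4n); rewrite (_ : eta * _ = n%:R ^+ 3 * eta ^+ 4); last by [ring]; rewrite ler_wpM2r ?exprn_ge0 ?(ltW eta0) //.
    by rewrite -natrX ler_nat; exact: leq_pexp2l n_gt0 (isT : (1 <= 3)%N).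
  + exact: (cell_fourth_moment eps_gt0 xi_moment n eta0).
  + move=> w; rewrite -lee_fin -sumEFin.
    have [mG PG] := @prob_cells _ _ _ P _ (cl \o S w) (fun a => rep a != 0) (measurable_cl_rv mcl (S w)).
    rewrite (eq_bigr (fun a => P ((cl \o S w) @^-1` [set a]))); last first.
      by move=> a _; exact/esym/cell_probE.
    rewrite -PG; apply: (le_trans _ (contaminated_neq0 w)); apply: le_measure; rewrite ?inE //.
      rewrite -[_ @^-1` _]setTI; apply: measurable_funP => //.
      by apply: measurableC; exact: measurable_set1.
    move=> o /= h s0; move: h; rewrite s0 -normr_eq0.
    have := cell_rep_le n eta0 0; rewrite normr0 -/rep -/cl => h.
    by rewrite eq_le h normr_ge0.
- split.
  + apply: measurableC; rewrite (_ : [set o | _] = M @^-1` [set` `[n%:R * eta, +oo[]).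
      by rewrite -[_ @^-1` _]setTI; apply: mM => //; exact: measurable_itv.
    by apply/seteqP; split => o /=; rewrite in_itv /= andbT.
  + by rewrite setCK.
  + move=> o /negP; rewrite -ltNge => Mo w; rewrite !ffunE /=.
    have s0 : 0 <= \sum_(j | j != w) (`|X j o| + `|S j o|) by apply: sumr_ge0 => j _; exact: addr_ge0.
    move: Mo; rewrite /M (bigD1 w) //= => Mo.
    have := normr_ge0 (X w o); have := normr_ge0 (S w o) => hs hx.
    by split; rewrite distrC; [case: (@cell_rep_near R eta n eta0 (X w o))|case: (@cell_rep_near R eta n eta0 (S w o))] => //; lra.
- move=> p G pE; apply: (prob_cells_Pr mcl indep) => w b; rewrite pE; congr (_ * _).
  by rewrite /cell_prob; congr fine; exact/esym/(X_law w (mcl b.1)).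
Qed.

End FiniteModelOfNoise.

(** * Assembly *)

Section Dimensions.
Variables (m : nat) (d : 'I_m -> nat) (k0 : 'I_m).
Hypothesis d_gt0 : forall k, (0 < d k)%N.
Hypothesis k0_min : forall k, (d k0 <= d k)%N.

Lemma leq_dbar k : (d k <= dbar d)%N.
Proof. exact: (leq_bigmax (F := d)). Qed.

Lemma dbar_attained : exists k, dbar d = d k.
Proof.
have m0 : (0 < #|'I_m|)%N by rewrite card_ord; exact: leq_ltn_trans (ltn_ord k0).
by have [k e] := @bigop.eq_bigmax _ d m0; exists k.
Qed.

Lemma dstar_gt0 : (0 < dstar d)%N.
Proof. by rewrite prodn_gt0. Qed.

Lemma dstar_split k : dstar d = (d k * dminus d k)%N.
Proof. by rewrite /dstar (bigD1 k). Qed.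

Lemma mul_expn_le_dstar e k : (e < m)%N -> (d k * d k0 ^ e <= dstar d)%N.
Proof.
move=> em; rewrite (dstar_split k) leq_mul2l; apply/orP; right.
apply: (@leq_trans (d k0 ^ m.-1)); first by rewrite leq_pexp2l //; case: (m) em.
rewrite /dminus (_ : m.-1 = #|[pred j : 'I_m | j != k]|); last by rewrite cardC1 card_ord.
by rewrite -prod_nat_const; apply: leq_prod.
Qed.

Lemma exp2_le_dstar : (1 < d k0)%N -> (2 ^ m <= dstar d)%N.
Proof.
move=> d1; rewrite -{1}(card_ord m) -prod_nat_const; apply: leq_prod => k _.
exact: leq_trans d1 (k0_min k).
Qed.

End Dimensions.

Lemma norm_2inf_row (R : realType) p q (U : 'M[R]_(p, q)) i : fn (row i U) <= norm_2inf U.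
Proof.
rewrite -vn_row /vn /norm_2inf.
by rewrite (bigD1 i) //= le_max lexx.
Qed.

Lemma norm_2inf_ge0 (R : realType) p q (U : 'M[R]_(p, q)) : 0 <= norm_2inf U.
Proof. by rewrite /norm_2inf; elim/big_ind: _ => // x y x0 y0; rewrite le_max x0. Qed.

Section Incoherence.
Variables (R : realType) (m : nat) (d r : 'I_m -> nat) (T : tensor R d) (C : tensor R r).
Variable (U : forall k, 'M[R]_(d k, r k)).
Hypothesis tucker : tucker_decomposition T C U.
Hypothesis r_gt0 : forall k, (0 < r k)%N.
Local Notation mu := (incoherence U).

Lemma tucker_dim_gt0 k : (0 < d k)%N.
Proof. by apply: leq_trans (r_gt0 k) _; have [Uo _] := tucker; exact: orthonormal_leq (Uo k). Qed.

Lemma incoherence_le k : norm_2inf (U k) ^+ 2 * (d k)%:R / (r k)%:R <= mu.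
Proof. by rewrite /incoherence (bigD1 k) //= le_max lexx. Qed.

(** The largest square row norm is at least the average one, which is r / d since the square norm of
    U is r. *)
Lemma incoherence_ge1 (k : 'I_m) : 1 <= mu.
Proof.
have d0 := tucker_dim_gt0 k; apply: le_trans (incoherence_le k).
rewrite ler_pdivlMr ?ltr0n // mul1r.
have [Uo _] := tucker.
have -> : (r k)%:R = fn (U k) ^+ 2 by rewrite fn_orthonormal // sqr_sqrtr.
rewrite fn_sqr_rows mulrC mulr_natl -[X in _ *+ X](card_ord (d k)) -sumr_const.
by apply: ler_sum => i _; apply: sqr_mono; [exact: fn_ge0|exact: norm_2inf_row].
Qed.

(** The row bound granted by incoherence; the product over all modes is the extra factor of the
    entrywise bound. *)
Definition incoherent_row k : R := Num.sqrt (mu * (r k)%:R / (d k)%:R).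

Lemma incoherent_row_ge0 k : 0 <= incoherent_row k. Proof. exact: sqrtr_ge0. Qed.

Lemma incoherent_rowP k i : fn (row i (U k)) <= incoherent_row k.
Proof.
have d0 := tucker_dim_gt0 k; have r0 := r_gt0 k.
apply: (le_trans (norm_2inf_row _ _)); rewrite -(ger0_norm (norm_2inf_ge0 _)) -sqrtr_sqr ler_wsqrtr //.
by rewrite ler_pdivlMr ?ltr0n // -ler_pdivrMr ?ltr0n //; exact: incoherence_le.
Qed.

Lemma incoherent_row_sqrt k : incoherent_row k * Num.sqrt (d k)%:R = Num.sqrt (mu * (r k)%:R).
Proof.
have d0 := tucker_dim_gt0 k.
have mu0 : 0 <= mu by apply: le_trans (incoherence_ge1 k).
rewrite /incoherent_row -sqrtrM ?divrK ?unitfE ?pnatr_eq0 -?lt0n //.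
by rewrite !mulr_ge0 ?invr_ge0 ?ler0n.
Qed.

Lemma incoherent_row_dim k : 1 <= incoherent_row k * Num.sqrt (d k)%:R.
Proof.
rewrite incoherent_row_sqrt -[leLHS]sqrtr1 ler_wsqrtr // -[leLHS]mulr1.
by apply: ler_pM => //; [exact: incoherence_ge1|rewrite ler1n].
Qed.

Lemma prod_incoherent_row (k0 : 'I_m) :
  \prod_k incoherent_row k = Num.sqrt (mu ^+ m * (dstar r)%:R / (dstar d)%:R).
Proof.
have mu0 : 0 <= mu by apply: le_trans (incoherence_ge1 k0).
have P0 : 0 <= \prod_k incoherent_row k by apply: prodr_ge0 => k _; exact: incoherent_row_ge0.
rewrite -[LHS](ger0_norm P0) -sqrtr_sqr; congr Num.sqrt.
rewrite -prodrXl (eq_bigr (fun k => mu * (r k)%:R / (d k)%:R)); last first.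
  by move=> k _; rewrite sqr_sqrtr // !mulr_ge0 ?invr_ge0 ?ler0n.
rewrite !big_split /= prodr_const card_ord prodfV !natr_prod.
by [].
Qed.

(** Lets the part of tau that comes from the largest entry of T be compared with the singular values
    in [omega_small]. *)
Lemma max_norm_incoherent (Lam : R) (k0 : 'I_m) : opb Lam (matricize k0 T) -> 0 <= Lam ->
  max_norm T <= Lam * \prod_k incoherent_row k.
Proof.
move=> LT L0; have P0 : 0 <= \prod_k incoherent_row k by apply: prodr_ge0 => k _; exact: incoherent_row_ge0.
have c0 := mulr_ge0 L0 P0; have h w : `|T w| <= Lam * \prod_k incoherent_row k; last first.
  rewrite /max_norm; move: (Lam * _) c0 h => c c0 h.
  by elim/big_ind: _ => // x y hx hy; rewrite ge_max hx hy.
have -> : T w = mform T (fun k i => (U k *m (U k)^T) (w k) i).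
  by rewrite -mprodE (tucker_proj tucker).
apply: (le_trans (mform_le _ L0 LT)); rewrite ler_wpM2l //.
apply: ler_prod => k _; rewrite vn_ge0 /= vn_row.
have Uo : orthonormal_cols (U k) by case: tucker.
by rewrite row_mul fn_mulmxT // incoherent_rowP.
Qed.

End Incoherence.

(** A reciprocal of sums of reciprocals serves as a lower bound for an empty family too. *)
Lemma positive_lower_bound (R : realType) (I : finType) (F : I -> R) : (forall i, 0 < F i) ->
  exists2 b : R, 0 < b & forall i, b <= F i.
Proof.
move=> F0; have s0 : 0 <= \sum_i (F i)^-1 by apply: sumr_ge0 => i _; rewrite invr_ge0 ltW.
exists (1 + \sum_i (F i)^-1)^-1; first by rewrite invr_gt0; lra.
move=> i; rewrite -[leRHS]invrK lef_pV2 ?posrE ?invr_gt0 //; last by lra.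
rewrite (bigD1 i) //= addrCA lerDl addr_ge0 //.
by apply: sumr_ge0 => j _; rewrite invr_ge0 ltW.
Qed.

Lemma ln_ge4 (R : realType) (x : R) : 100 <= x -> 4 <= ln x.
Proof.
move=> x100; have x0 : 0 < x by lra.
rewrite -(expRK (4 : R)) ler_ln ?posrE ?expR_gt0 //; apply: le_trans x100.
have -> : (4 : R) = 4%:R * 1 by rewrite mulr1.
rewrite expRM_natl; apply: (@le_trans _ _ (3 ^+ 4)).
  by rewrite lerXn2r ?nnegrE ?expR_ge0 ?expR1_le3.
lra.
Qed.

Lemma scale_mono (R : realType) (x y : R) : x <= y -> 400 * (800 * x) <= 400 * (800 * y).
Proof. lra. Qed.

Lemma scale_mono2 (R : realType) (c x y : R) : 0 <= c -> x <= y -> c * (c * (36 * x)) <= c * (c * (36 * y)).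
Proof. by move=> c0 xy; rewrite !ler_wpM2l. Qed.

Lemma scale_swap (R : realType) (n x c : R) : n * (400 * (800 * x)) * c = 400 * (800 * (n * x * c)).
Proof. ring. Qed.

Lemma scale_assoc (R : realType) (x c : R) : 400 * (800 * x) * c = 400 * (800 * (x * c)).
Proof. ring. Qed.

Lemma cube_bound (n q : nat) : (4 <= n)%N -> (q <= n * n)%N -> ((q.+1 + q.+1).+1 <= n ^ 3)%N.
Proof. move=> n4 qn; rewrite !expnS expn0 muln1; nia. Qed.

Lemma frobenius_total (R : realType) (Q sr om X z S : R) : 1 <= Q -> 0 <= om -> 0 <= sr -> z <= om ->
  sr * om <= X -> S <= 80 * (80 * (36 * (Q ^+ 3 * X))) ->
  sr * (47 * Q * (36 * Q * om) + z) + S <= 1000 * (1000 * (36 * Q ^+ 3)) * X.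
Proof.
move=> Q1 o0 s0 zo X1 SX.
have so : 0 <= sr * om by exact: mulr_ge0.
have X0 : 0 <= X by exact: le_trans X1.
have h1 : sr * z <= sr * om by exact: ler_wpM2l.
have h2 : Q ^+ 2 * (sr * om) <= Q ^+ 2 * X by rewrite ler_wpM2l // sqr_ge0.
have h3 : Q ^+ 2 * X <= Q ^+ 3 * X by rewrite ler_wpM2r // [leRHS]exprS ler_peMl // sqr_ge0.
have h4 : X <= Q ^+ 3 * X by rewrite ler_peMl // exprn_ege1.
rewrite (_ : sr * _ = 47 * 36 * (Q ^+ 2 * (sr * om)) + sr * z); last by ring.
rewrite (_ : 1000 * _ * X = 1000 * (1000 * (36 * (Q ^+ 3 * X)))); last by ring.
lra.
Qed.

Lemma max_total (R : realType) (Q om X z S : R) : 1 <= Q -> 0 <= om -> z <= om ->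
  om <= X -> S <= 400 * (400 * (36 * (Q ^+ 3 * X))) ->
  3 * (47 * Q * (36 * Q * om) + z) + 6 * S <= 1000 * (1000 * (36 * Q ^+ 3)) * X.
Proof.
move=> Q1 o0 zo X1 SX.
have X0 : 0 <= X by exact: le_trans X1.
have h2 : Q ^+ 2 * om <= Q ^+ 2 * X by rewrite ler_wpM2l // sqr_ge0.
have h3 : Q ^+ 2 * X <= Q ^+ 3 * X by rewrite ler_wpM2r // [leRHS]exprS ler_peMl // sqr_ge0.
have h4 : X <= Q ^+ 3 * X by rewrite ler_peMl // exprn_ege1.
rewrite (_ : 3 * _ = 3 * (47 * 36 * (Q ^+ 2 * om)) + 3 * z); last by ring.
rewrite (_ : 1000 * _ * X = 1000 * (1000 * (36 * (Q ^+ 3 * X)))); last by ring.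
lra.
Qed.

(** Here s is the root of a dimension and t the row bound of that mode. The row bounds of a matrix
    scale inversely to the roots, and p <= s2^2 moves the factor s2 t2 over to s1 t1. *)
Lemma two_mode_balance (R : realType) (g p s1 s2 t1 t2 o x : R) : 0 <= g -> 0 <= t1 -> 0 <= t2 -> 0 <= s1 -> 0 <= s2 ->
  p <= s2 ^+ 2 -> t2 * s2 = t1 * s1 -> g * (s1 * s2) <= o -> x <= 8 * (g * p) -> x * t2 <= 8 * o * t1.
Proof.
move=> g0 t10 t20 s10 s20 ps e go xg.
apply: (@le_trans _ _ (8 * (g * p) * t2)); first exact: ler_wpM2r.
have h1 : g * t2 * p <= g * t2 * s2 ^+ 2 by rewrite ler_wpM2l // mulr_ge0.
have h2 : g * t2 * s2 ^+ 2 = g * (s1 * s2) * t1.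
  by rewrite (_ : g * t2 * s2 ^+ 2 = g * s2 * (t2 * s2)); [rewrite e; ring|ring].
have h3 : g * (s1 * s2) * t1 <= o * t1 by exact: ler_wpM2r.
lra.
Qed.

(** * From the hypotheses on the signal to those of the finite model *)

Section TensorScales.
Variables (R : realType) (m : nat) (d r : 'I_m -> nat) (T : tensor R d) (C : tensor R r).
Variable (U : forall k, 'M[R]_(d k, r k)).
Hypothesis tucker : tucker_decomposition T C U.
Hypothesis r_gt0 : forall k, (0 < r k)%N.
Hypothesis T_rank : has_tucker_rank r T.
Hypothesis m_gt1 : (1 < m)%N.
Variable k0 : 'I_m.
Hypothesis k0_min : forall k, (d k0 <= d k)%N.
Variables (n8 q4 nu tau lam Lam Q : R).
Local Notation N := ((dstar d)%:R : R).
Local Notation db := ((dbar d)%:R : R).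
Local Notation lb := (ln db).
Local Notation l := (ln N).
Local Notation pmin := ((d k0)%:R : R).
Local Notation a := (q4 ^+ 4).
Local Notation g := (a * tau).
Local Notation sr := (Num.sqrt (dstar r)%:R : R).
Local Notation kap := (Lam / lam).
Local Notation th := (incoherent_row U).
Local Notation om := (omega n8 q4 nu tau db lb).
Local Notation sN := (n8 ^+ 4).
Hypothesis n8_ge1 : 1 <= n8.
Hypothesis n8N : n8 ^+ 8 = N.
Hypothesis N_large : 100 <= N.
Hypothesis nu_gt0 : 0 < nu.
Hypothesis q4_gt0 : 0 < q4.
Hypothesis q4_le1 : q4 <= 1.
Hypothesis a_p : l / 2 <= a * pmin.
Hypothesis tau_ge : 4 * (max_norm T + n8 * nu) <= tau.
Hypothesis lam_gt0 : 0 < lam.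
Hypothesis lam_le : forall k (y : 'rV[R]_(r k)), lam * fn y <= fn (y *m (U k)^T *m matricize k T).
Hypothesis Lam_opb : forall k, opb Lam (matricize k T).
Hypothesis lam_Lam : lam <= Lam.
Hypothesis Q_ge6 : 6 <= Q.
Hypothesis om_small : 400 * (800 * (36 * Q ^+ 3)) * (m%:R * kap * sr * om) <= lam.

Let d_gt0 k : (0 < d k)%N. Proof. exact: tucker_dim_gt0 tucker r_gt0 k. Qed.

Lemma max_norm_entry w : `|T w| <= max_norm T.
Proof. by rewrite /max_norm (bigD1 w) //= le_max lexx. Qed.

Lemma max_norm_ge0 : 0 <= max_norm T.
Proof. by rewrite /max_norm; elim/big_ind: _ => // x y x0 _; rewrite le_max x0. Qed.

Lemma logN_ge4 : 4 <= l. Proof. exact: ln_ge4. Qed.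

Let n8_gt0 : 0 < n8. Proof. exact: lt_le_trans n8_ge1. Qed.
Let sN_gt0 : 0 < sN. Proof. exact: exprn_gt0. Qed.
Let sNE : sN ^+ 2 = N. Proof. by rewrite -n8N -exprM. Qed.

Lemma nu_tau : 4 * (nu * n8) <= tau.
Proof. by have h := tau_ge; have h0 := max_norm_ge0; rewrite [nu * _]mulrC; lra. Qed.

Lemma T_tau w : 4 * `|T w| <= tau.
Proof.
have h := tau_ge; have h0 := max_norm_entry w.
have h1 : 0 <= n8 * nu by rewrite mulr_ge0 // ltW.
lra.
Qed.

Lemma tau_gt0 : 0 < tau.
Proof. by apply: lt_le_trans nu_tau; rewrite !mulr_gt0. Qed.

Let a_le1 : a <= 1. Proof. by rewrite exprn_ile1 // ltW. Qed.
Let a_gt0 : 0 < a. Proof. by rewrite exprn_gt0. Qed.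

Lemma pmin_ge2 : 2 <= pmin.
Proof.
have h := logN_ge4; have h1 := a_p; have h2 : a * pmin <= 1 * pmin by rewrite ler_wpM2r.
lra.
Qed.

Lemma dims_ge2 k : (2 <= d k)%N.
Proof. by apply: leq_trans (k0_min k); rewrite -(ler_nat R); exact: pmin_ge2. Qed.

Lemma dim_prod_le e k : (e < m)%N -> (d k)%:R * pmin ^+ e <= N.
Proof. by move=> em; rewrite -natrX -natrM ler_nat; exact: mul_expn_le_dstar. Qed.

Lemma pmin_sN : pmin <= sN.
Proof.
rewrite -(@ler_pXn2r _ 2) ?nnegrE ?ler0n ?(ltW sN_gt0) // sNE.
by have := dim_prod_le k0 m_gt1; rewrite expr1.
Qed.

Lemma pdim_le k : pmin * (d k)%:R <= n8 ^+ 8.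
Proof. by rewrite n8N mulrC -[pmin]expr1; exact: dim_prod_le. Qed.

Lemma cotidx_dim k : (d k)%:R * (#|cotidx d k|)%:R = n8 ^+ 8 :> R.
Proof. by rewrite n8N -natrM -dstar_mode. Qed.

Lemma cotidx_gt0 k : (0 < #|cotidx d k|)%N.
Proof. by have := dstar_gt0 d_gt0; rewrite (dstar_mode d k) muln_gt0 => /andP[]. Qed.

Lemma dim_db k : (d k)%:R <= db. Proof. by rewrite ler_nat leq_dbar. Qed.

Lemma db_ge2 : 2 <= db.
Proof. by apply: le_trans (dim_db k0); exact: pmin_ge2. Qed.

Lemma lb_ge0 : 0 <= lb.
Proof. by rewrite ln_ge0 //; have := db_ge2; lra. Qed.

Lemma three_dims : (2 < m)%N -> pmin ^+ 2 * db <= n8 ^+ 8 /\ pmin ^+ 3 <= n8 ^+ 8.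
Proof.
move=> m3; have [k1 e] := dbar_attained d k0.
split; first by rewrite n8N e mulrC; exact: dim_prod_le.
by rewrite n8N exprS; exact: dim_prod_le.
Qed.

Lemma two_dims : (m <= 2)%N -> l <= 2 * lb /\ sN <= db.
Proof.
move=> m2; have h : N <= db ^+ 2.
  rewrite -natrX ler_nat; apply: (@leq_trans (dbar d ^ m)).
    by rewrite -{3}(card_ord m) -prod_nat_const; apply: leq_prod => k _; exact: leq_dbar.
  by rewrite leq_pexp2l // (leq_trans (d_gt0 k0)) // leq_dbar.
have db0 : 0 < db by have := db_ge2; lra.
split; last by rewrite -(@ler_pXn2r _ 2) ?nnegrE ?ler0n ?(ltW sN_gt0) // sNE.
rewrite mulr_natl -lnXn // ler_ln ?posrE ?exprn_gt0 //; have h1 := N_large; lra.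
Qed.

Lemma dimsP : dims_ok n8 l pmin db lb.
Proof.
by case: (ltnP 2 m) => [/three_dims|/two_dims]; [left|right].
Qed.

Lemma om_gt0 : 0 < om. Proof. exact: (omega_gt0 db lb nu_gt0 q4_gt0 n8_ge1 tau_gt0). Qed.

Lemma m_lt_N : (m < dstar d)%N.
Proof. exact: leq_trans (ltn_expl m (isT : (1 < 2)%N)) (exp2_le_dstar k0_min (dims_ge2 k0)). Qed.

Local Notation w := (36 * Q * om).
Local Notation stp := (step r Q w lam Lam).

(** The rank of one matricization is at most the product of the other ranks, so its square is at
    most the product of all. *)
Lemma rank_sqrt k : Num.sqrt (r k)%:R <= sr /\ (r k)%:R <= sr.
Proof.
have h : (r k * r k <= dstar r)%N.
  rewrite (dstar_split r k) leq_mul2l; apply/orP; right.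
  by rewrite -[X in (X <= _)%N](T_rank k); exact: rank_matricize_le tucker k.
split; first by rewrite ler_wsqrtr // ler_nat (leq_trans _ h) // leq_pmull.
by rewrite -[leLHS]ger0_norm ?ler0n // -sqrtr_sqr ler_wsqrtr // -natrX ler_nat.
Qed.

Lemma sr_ge1 : 1 <= sr.
Proof. by have [_] := rank_sqrt k0; apply: le_trans; rewrite ler1n. Qed.

Lemma kap_ge1 : 1 <= kap. Proof. by rewrite ler_pdivlMr // mul1r. Qed.

Let base k : m%:R * stp k <= 36 * Q ^+ 3 * (m%:R * kap * sr * om) / lam.
Proof.
have [h _] := rank_sqrt k; have K1 := kap_ge1; have o0 := om_gt0; have q6 := Q_ge6.
have q0 : 0 <= Q by lra.
rewrite (_ : _ / lam = m%:R * (Q ^+ 2 * sr * kap * (w / lam))); last by rewrite /=; ring.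
rewrite ler_wpM2l // /step ler_wpM2r //; first by rewrite divr_ge0 ?mulr_ge0 // ltW.
by rewrite ler_wpM2r ?(le_trans _ K1) // ler_wpM2l // sqr_ge0.
Qed.

Lemma step_m k : 400 * (800 * stp k) <= m%:R^-1.
Proof.
have m0 : 0 < m%:R :> R by rewrite ltr0n; exact: ltnW.
have h := base k; have h1 := om_small.
have h2 : m%:R * stp k * lam <= 36 * Q ^+ 3 * (m%:R * kap * sr * om).
  by move: h; rewrite ler_pdivlMr.
have h3 : 400 * (800 * (m%:R * stp k * lam)) <= lam.
  by apply: le_trans h1; rewrite [leRHS]scale_assoc; exact: (scale_mono h2).
have h5 : m%:R * (400 * (800 * stp k)) <= 1.
  rewrite -(ler_pM2r lam_gt0) mul1r.
  by rewrite [leLHS]scale_swap; exact: h3.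
by rewrite -(ler_pM2l m0) (mulfV (lt0r_neq0 m0)).
Qed.

Let Q_gt0 : 0 < Q. Proof. have h := Q_ge6; lra. Qed.
Lemma w_gt0 : 0 < w. Proof. by rewrite mulr_gt0 ?om_gt0 // mulr_gt0. Qed.

Lemma stp_gt0 k : 0 < stp k.
Proof.
have L0 : 0 < Lam by exact: lt_le_trans lam_Lam.
rewrite /step; apply: mulr_gt0; last exact: divr_gt0 w_gt0 lam_gt0.
apply: mulr_gt0; last exact: divr_gt0.
by apply: mulr_gt0; [exact: exprn_gt0|rewrite sqrtr_gt0 ltr0n r_gt0].
Qed.

Lemma step_1 k : 400 * (800 * stp k) <= 1.
Proof.
by apply: (le_trans (step_m k)); rewrite invf_le1 ?ler1n ?ltr0n //; exact: ltnW.
Qed.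

Lemma w_div_step k : w / lam <= stp k.
Proof.
have K1 := kap_ge1; rewrite /step ler_peMl ?divr_ge0 ?(ltW w_gt0) ?(ltW lam_gt0) //.
have q6 := Q_ge6; have q1 : 1 <= Q ^+ 2 by rewrite exprn_ege1 //; lra.
have r1 : 1 <= Num.sqrt (r k)%:R :> R by rewrite -[leLHS]sqrtr1 ler_wsqrtr // ler1n.
by rewrite -[leLHS]mulr1 ler_pM // -[leLHS]mulr1 ler_pM.
Qed.

Lemma w_le_lam : w <= lam.
Proof.
have h := step_1 k0; have h1 := w_div_step k0; have h2 := stp_gt0 k0.
have h3 : w / lam <= 1 by lra.
by rewrite ler_pdivrMr // mul1r in h3.
Qed.

(** The signal is at most the Frobenius norm of T, hence sqrt N times its largest entry. This bounds
    om / lam from below, as the order of the Neumann series requires. *)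
Lemma lam_le_tau : 4 * lam <= sN * tau.
Proof.
have [Uo _] := tucker; pose y : 'rV[R]_(r k0) := const_mx 1.
have y0 : 0 < fn y.
  rewrite lt_neqAle fn_ge0 andbT eq_sym; apply/eqP => /fn_eq0 /matrixP /(_ 0 (Ordinal (r_gt0 k0))).
  by rewrite !mxE => /eqP; rewrite oner_eq0.
have h : lam <= fn (matricize k0 T).
  rewrite -(ler_pM2r y0); apply: (le_trans (lam_le _)).
  by apply: (le_trans (fn_mulmx _ _)); rewrite fn_mulmxT // mulrC.
have h2 : fn (matricize k0 T) <= max_norm T * sN.
  have -> : sN = Num.sqrt (d k0)%:R * Num.sqrt #|cotidx d k0|%:R.
    by rewrite sqrt_dstar -sNE sqrtr_sqr ger0_norm // ltW.
  apply: fn_entries => [|i j]; first exact: max_norm_ge0.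
  by rewrite mxE max_norm_entry.
have h3 : 4 * max_norm T <= tau.
  by have h4 := tau_ge; have h5 : 0 <= n8 * nu by [rewrite mulr_ge0 // ltW]; lra.
apply: (@le_trans _ _ (4 * (max_norm T * sN))); first by rewrite ler_wpM2l // (le_trans h).
by rewrite mulrA mulrC ler_wpM2l // ltW.
Qed.

(** The series is cut at order N: both the step and the row bound are at least 1 / sqrt N, and
    2^(-N) <= 1 / N. *)
Lemma q0_large k : 2 * (1 / 2) ^+ (dstar d).+1 <= stp k * th k.
Proof.
have h1 : (1 / 2) ^+ dstar d <= N^-1.
  rewrite expr_div_n expr1n div1r lef_pV2 ?posrE ?exprn_gt0 ?ltr0n ?dstar_gt0 //.
  by rewrite -natrX ler_nat ltnW // ltn_expl.
have h2 : 2 * (1 / 2) ^+ (dstar d).+1 = (1 / 2) ^+ dstar d :> R by rewrite exprS; field.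
rewrite h2; apply: (le_trans h1).
have as1 := asN_ge1 q4_gt0 (le_trans _ logN_ge4) a_p pmin_sN.
have {}as1 : 1 <= a * sN by apply: as1; lra.
have gs := gsN_omega n8 q4 tau db lb nu_gt0.
have h3 : 4 / sN <= om / lam.
  rewrite ler_pdivlMr // mulrAC ler_pdivrMr //; apply: (le_trans lam_le_tau).
  apply: (@le_trans _ _ (g * sN * sN)); last by rewrite ler_wpM2r // ltW.
  by rewrite (_ : g * sN * sN = a * sN * (sN * tau)); [rewrite ler_peMl // mulr_ge0 // ltW // tau_gt0|ring].
have h4 : 1 / sN <= stp k.
  apply: le_trans (w_div_step k); rewrite -mulrA.
  have h5 : 1 / sN <= 4 / sN by rewrite ler_pM2r ?invr_gt0 //; lra.
  apply: (le_trans h5); apply: (le_trans h3); rewrite ler_peMl ?divr_ge0 ?(ltW om_gt0) ?(ltW lam_gt0) //.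
  have q6 := Q_ge6; lra.
have h6 : 1 / sN <= th k.
  have hd := incoherent_row_dim tucker r_gt0 k.
  have ds : Num.sqrt (d k)%:R <= sN.
    apply: sqrt_le; first exact: ltW.
    by rewrite sNE ler_nat (dstar_mode d k) leq_pmulr // cotidx_gt0.
  rewrite ler_pdivrMr //; apply: (le_trans hd); rewrite ler_wpM2l //; exact: incoherent_row_ge0.
rewrite -sNE (_ : (sN ^+ 2)^-1 = (1 / sN) * (1 / sN)); last by rewrite expr2 invfM !div1r.
by apply: ler_pM => //; rewrite divr_ge0 // ltW.
Qed.

Lemma th_gt0 k : 0 < th k.
Proof.
have hd := incoherent_row_dim tucker r_gt0 k; have h0 := incoherent_row_ge0 U k.
by rewrite lt_neqAle h0 andbT eq_sym; apply/eqP => e; move: hd; rewrite e mul0r; lra.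
Qed.

Lemma small_precision (G : R) : 0 <= G -> exists2 z0 : R, 0 < z0 & forall z, 0 <= z <= z0 ->
  [/\ z <= om, forall k, z * (2 * G + z) <= lam ^+ 2 / 2 * stp k,
      forall k, z * (2 * G + z) <= lam ^+ 2 / 2 * (stp k * th k),
      forall k, z <= lam / 2 * stp k & forall k, z <= lam / 2 * (stp k * th k)].
Proof.
move=> G0.
have [b1 b10 hb1] : exists2 b : R, 0 < b & forall k, b <= stp k.
  by apply: positive_lower_bound => k; exact: stp_gt0.
have [b2 b20 hb2] : exists2 b : R, 0 < b & forall k, b <= stp k * th k.
  by apply: positive_lower_bound => k; rewrite mulr_gt0 ?stp_gt0 ?th_gt0.
have o0 := om_gt0.
pose b := Num.min b1 b2.
have b0 : 0 < b by rewrite lt_min b10.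
have bs k : b <= stp k by rewrite ge_min hb1.
have bt k : b <= stp k * th k by rewrite ge_min hb2 orbT.
have l0 : 0 < lam ^+ 2 / 2 by rewrite divr_gt0 ?exprn_gt0.
pose z0 := Num.min (Num.min 1 om) (Num.min (lam / 2 * b) (lam ^+ 2 / 2 * b / (2 * G + 1))).
have G1 : 0 < 2 * G + 1 by lra.
exists z0.
  by rewrite !lt_min ltr01 o0 !mulr_gt0 ?divr_gt0 ?mulr_gt0 ?invr_gt0 ?exprn_gt0.
move=> z /andP[zp]; rewrite !le_min => /andP[/andP[z1 zo] /andP[zl zg]].
have zG : z * (2 * G + z) <= lam ^+ 2 / 2 * b.
  rewrite ler_pdivlMr // in zg; apply: le_trans zg; rewrite ler_wpM2l //; lra.
split => // k.
- by apply: (le_trans zG); rewrite ler_wpM2l // ltW.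
- by apply: (le_trans zG); rewrite ler_wpM2l // ltW.
- by apply: (le_trans zl); rewrite ler_wpM2l // divr_ge0 // ltW.
- by apply: (le_trans zl); rewrite ler_wpM2l // divr_ge0 // ltW.
Qed.

(** * Good events of the finite tensor model *)

Section Events.
Variables (A : finType) (rep px : A -> R) (ps : tidx d -> A -> R) (zeta : R).
Local Notation h := (7 * (q4 ^+ 2 * tau)).
Local Notation sg := (nu + h).
Local Notation B := (4 * tau).
Local Notation beta := (6 * g).
Local Notation z := (zeta * Num.sqrt N).
Hypothesis px_ge0 : forall v, 0 <= px v.
Hypothesis px_sum1 : \sum_v px v = 1.
Hypothesis ps_ge0 : forall i v, 0 <= ps i v.
Hypothesis ps_sum1 : forall i, \sum_v ps i v = 1.
Hypothesis rep_mean : `|\sum_v px v * rep v| <= zeta.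
Hypothesis rep4 : \sum_v px v * rep v ^+ 4 <= nu ^+ 4.
Hypothesis rep_ne0 : forall i, \sum_(v | rep v != 0) ps i v <= a.
Hypothesis zeta_ge0 : 0 <= zeta.
Hypothesis zeta_g : zeta <= g.
Hypothesis z_om : z <= om.
Hypothesis zG : forall k, z * (2 * (Lam + (B + beta) * Num.sqrt N) + z) <= lam ^+ 2 / 2 * stp k.
Hypothesis zGth : forall k, z * (2 * (Lam + (B + beta) * Num.sqrt N) + z) <= lam ^+ 2 / 2 * (stp k * th k).
Hypothesis z_step : forall k, z <= lam / 2 * stp k.
Hypothesis z_stepth : forall k, z <= lam / 2 * (stp k * th k).

Definition tensor_prob (i : tidx d) (b : A * A) : R := px b.1 * ps i b.2.
Definition tensor_entry (i : tidx d) (b : A * A) : R := entry rep rep (T i) tau b.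
Definition tensor_light (i : tidx d) (b : A * A) : R := light_entry rep rep nu q4 b.
Definition tensor_heavy (i : tidx d) (b : A * A) : R := heavy_entry rep rep (T i) tau nu q4 b.
Local Notation p := tensor_prob.
Local Notation f := tensor_entry.

Lemma prob_ge0 i b : 0 <= p i b. Proof. exact: mulr_ge0. Qed.
Lemma prob_sum1 i : \sum_b p i b = 1. Proof. exact: (pe_sum1 px_sum1 (ps_sum1 i)). Qed.

Lemma q4n8 : 1 <= q4 * n8.
Proof. by apply: (q4n8_ge1 q4_gt0 n8_ge1 _ a_p pmin_sN); have := logN_ge4; lra. Qed.

Lemma B_gt0 : 0 < B. Proof. by rewrite mulr_gt0 // tau_gt0. Qed.
Lemma h_gt0 : 0 < h. Proof. by have := tau_gt0 => t0; rewrite !mulr_gt0 ?exprn_gt0. Qed.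
Lemma sg_gt0 : 0 < sg. Proof. by rewrite addr_gt0 // h_gt0. Qed.
Lemma beta_ge0 : 0 <= beta. Proof. by have := tau_gt0 => t0; rewrite !mulr_ge0 // ltW. Qed.

Lemma f_bound i b : `|ecenter p f i b| <= B.
Proof.
rewrite (_ : B = 2 * (2 * tau)); last by ring.
exact: (centered_le px_ge0 px_sum1 (ps_ge0 i) (ps_sum1 i) b (entry_bound rep rep nu_gt0 n8_ge1 nu_tau (T_tau i))).
Qed.

Lemma fl_bound i b : `|ecenter p tensor_light i b| <= 2 * (nu / q4).
Proof.
exact: (centered_le px_ge0 px_sum1 (ps_ge0 i) (ps_sum1 i) b (light_bound rep rep q4_gt0 nu_gt0)).
Qed.

Lemma fh_bound i b : `|ecenter p tensor_heavy i b| <= B.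
Proof.
rewrite (_ : B = 2 * (2 * tau)); last by ring.
exact: (centered_le px_ge0 px_sum1 (ps_ge0 i) (ps_sum1 i) b (heavy_bound rep rep q4 nu_gt0 n8_ge1 nu_tau (T_tau i))).
Qed.

Lemma fh_mean i : `|emean p tensor_heavy i| <= beta.
Proof.
have h1 := heavy_mean px_ge0 px_sum1 (ps_ge0 i) (ps_sum1 i) q4_gt0 nu_gt0 n8_ge1 nu_tau (T_tau i) rep4 (rep_ne0 i).
have g0 : 0 <= g by rewrite mulr_ge0 ?(ltW tau_gt0) // ltW.
apply: (le_trans h1); lra.
Qed.

Lemma f_mean i : `|emean p f i| <= beta.
Proof.
exact: (entry_mean_bound px_ge0 px_sum1 (ps_ge0 i) (ps_sum1 i) q4_gt0 nu_gt0 n8_ge1 q4n8 nu_tau (T_tau i) rep_mean zeta_g rep4 (rep_ne0 i)).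
Qed.

Lemma fh_var i : evar p tensor_heavy i <= h ^+ 2.
Proof.
exact: (heavy_variance px_ge0 px_sum1 (ps_ge0 i) (ps_sum1 i) q4_gt0 nu_gt0 n8_ge1 nu_tau (T_tau i) rep4 (rep_ne0 i)).
Qed.

Lemma v0_var i : `|evar p f i - base_var px rep| <= h ^+ 2.
Proof.
exact: (entry_variance px_ge0 px_sum1 (ps_ge0 i) (ps_sum1 i) q4_gt0 q4_le1 nu_gt0 n8_ge1 q4n8 nu_tau (T_tau i) rep_mean zeta_g rep4 (rep_ne0 i)).
Qed.

Lemma f_var i : evar p f i <= sg ^+ 2.
Proof.
have h1 := v0_var i; have h2 := base_var_le px_ge0 px_sum1 rep4.
have h3 : 0 <= nu * h by rewrite mulr_ge0 ?(ltW h_gt0) // ltW.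
have h4 : sg ^+ 2 = nu ^+ 2 + h ^+ 2 + 2 * (nu * h) by ring.
have h5 := ler_norm (evar p f i - base_var px rep).
rewrite h4; lra.
Qed.

Lemma f_split i b : f i b = tensor_light i b + tensor_heavy i b.
Proof. exact: (entry_split rep rep q4_gt0 nu_gt0 n8_ge1 q4n8 nu_tau (T_tau i)). Qed.

Let K1 (x y c : R) : 0 <= c <= 36 -> x <= c * om -> x <= w.
Proof.
move=> /andP[c0 c1] hx; apply: (le_trans hx); rewrite ler_wpM2r ?(ltW om_gt0) //.
have q6 := Q_ge6; lra.
Qed.

Let w2 : (36 ^+ 2) * om ^+ 2 <= w ^+ 2.
Proof.
rewrite -exprMn; apply: sqr_mono; first by rewrite mulr_ge0 // ltW // om_gt0.
rewrite ler_wpM2r ?(ltW om_gt0) //; have q6 := Q_ge6; lra.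
Qed.

Let K2 (x c : R) : c <= 1000 -> x <= c * om ^+ 2 -> x <= w ^+ 2.
Proof.
move=> c1 hx; apply: (le_trans hx); apply: le_trans w2; rewrite ler_wpM2r ?sqr_ge0 //.
apply: (le_trans c1); rewrite expr2; lra.
Qed.

Let K4 (x : R) : x <= 12800 * om ^+ 4 -> x <= w ^+ 4.
Proof.
move=> hx; apply: (le_trans hx).
have h1 : (36 ^+ 2 * om ^+ 2) ^+ 2 <= (w ^+ 2) ^+ 2.
  by apply: sqr_mono w2; rewrite mulr_ge0 ?sqr_ge0.
rewrite -exprM in h1; apply: le_trans h1.
have o4 : 0 <= om ^+ 4 by rewrite exprn_ge0 // ltW // om_gt0.
rewrite (_ : (36 ^+ 2 * om ^+ 2) ^+ 2 = 36 * (36 * (36 * (36 * om ^+ 4)))); last by ring.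
lra.
Qed.

Let sNs : Num.sqrt N = sN. Proof. by rewrite -sNE sqrtr_sqr ger0_norm // ltW. Qed.

Let l2 : 2 <= l. Proof. by have := logN_ge4; lra. Qed.
Let pm0 : 0 < pmin. Proof. by have := pmin_ge2; lra. Qed.
Let db0 : 0 < db. Proof. by have := db_ge2; lra. Qed.
Let dk0 k : 0 < (d k)%:R :> R. Proof. by rewrite ltr0n. Qed.
Let Dk0 k : 0 < #|cotidx d k|%:R :> R. Proof. by rewrite ltr0n cotidx_gt0. Qed.
Let pdk k : pmin <= (d k)%:R. Proof. by rewrite ler_nat. Qed.

Lemma sc_Bl : B * l <= w.
Proof.
by apply: (@K1 _ 0 8); [lra|exact: (scale_Bl db lb nu_gt0 q4_gt0 tau_gt0 a_p pmin_sN erefl)].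
Qed.

Lemma sc_dl k : (d k)%:R * l * sg ^+ 2 <= w ^+ 2.
Proof.
apply: (@K2 _ 200); first by lra.
exact: (scale_dl nu_gt0 q4_gt0 n8_ge1 tau_gt0 l2 db0 lb_ge0 a_p nu_tau dimsP erefl erefl (dk0 k) (dim_db k) (pdim_le k)).
Qed.

Lemma sc_sN : sg ^+ 2 * Num.sqrt N * l <= w ^+ 2.
Proof.
rewrite sNs; apply: (@K2 _ 200); first by lra.
exact: (scale_sN nu_gt0 q4_gt0 n8_ge1 tau_gt0 l2 pm0 db0 lb_ge0 a_p pmin_sN nu_tau dimsP erefl erefl).
Qed.

Lemma sc_BlD k : (B * l) ^+ 2 * (#|cotidx d k|%:R * sg ^+ 2) <= w ^+ 4.
Proof.
apply: K4.
exact: (scale_BlD nu_gt0 q4_gt0 n8_ge1 tau_gt0 l2 pm0 db0 lb_ge0 a_p pmin_sN nu_tau dimsP erefl erefl erefl (dk0 k) (Dk0 k) (cotidx_dim k) (pdk k) (dim_db k)).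
Qed.

Lemma sc_Dh k : #|cotidx d k|%:R * h ^+ 2 <= w ^+ 2.
Proof.
apply: (@K2 _ 98); first by lra.
exact: (scale_Dh db lb nu_gt0 q4_gt0 n8_ge1 tau_gt0 l2 a_p erefl (Dk0 k) (cotidx_dim k) (pdk k)).
Qed.

Lemma sc_mean : beta * Num.sqrt N <= w.
Proof.
rewrite sNs; apply: (@K1 _ 0 6); first by lra.
exact: (scale_mean n8 db lb nu_gt0 erefl).
Qed.

Lemma sc_Blbd k : B * l * beta * (d k)%:R <= w ^+ 2.
Proof.
apply: (@K2 _ 48); first by lra.
exact: (scale_Blbd db lb nu_gt0 q4_gt0 n8_ge1 tau_gt0 a_p erefl erefl (dk0 k) (pdim_le k)).
Qed.

Lemma power_between : exists pw : nat, Q * l <= pw%:R /\ pw%:R <= 2 * Q * l.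
Proof.
have ql : 1 <= Q * l.
  by rewrite -[leLHS]mulr1; apply: ler_pM => //; have := Q_ge6; have := logN_ge4; lra.
have /andP[t1 t2] := @truncn_itv _ (Q * l) (le_trans ler01 ql).
exists (Num.truncn (Q * l)).+1; rewrite -natr1 in t2 *; split; first exact: ltW.
rewrite -mulrA; lra.
Qed.

Local Notation cnt := ((12 + 8 * dstar d) * dstar d ^ 2)%:R.
Local Notation fail := ((cnt + 2) * expR (- (Q * l))).

Let Q1 : 1 <= Q. Proof. by have := Q_ge6; lra. Qed.
Let l1 : 1 <= l. Proof. by have := logN_ge4; lra. Qed.

Lemma three_mode_events : (2 < m)%N ->
  (forall k, exists2 good : pred {ffun tidx d -> A * A}, Pr p (fun x => ~~ good x) <= fail &
    forall x, good x -> mode_ok T U f (base_var px rep) Q w lam Lam zeta th k x) /\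
  exists2 good : pred {ffun tidx d -> A * A}, Pr p (fun x => ~~ good x) <= fail &
    forall x, good x -> spec_le (47 * Q * w) (field f x).
Proof.
move=> m3; have [pw [pw1 pw2]] := power_between.
have [d3 p3] := three_dims m3.
have cnt_le : cnt * expR (- (Q * l)) <= fail by rewrite ler_wpM2r ?expR_ge0 // lerDl.
split.
  move=> k.
  have Bld : B * l * Num.sqrt (d k)%:R <= w.
    apply: (@K1 _ 0 8); first by lra.
    apply: (scale_Bld db lb nu_gt0 q4_gt0 tau_gt0 a_p erefl (sqrtr_ge0 _)).
    rewrite -sNs -[pmin]ger0_norm ?(ltW pm0) // -sqrtr_sqr -sqrtrM ?sqr_ge0 // ler_wsqrtr // mulrC.
    exact: dim_prod_le.
  have [good g1 g2] := gram_mode_event tucker prob_ge0 prob_sum1 r_gt0 cotidx_gt0 B_gt0 sg_gt0 l1 Q1 beta_ge0 w_gt0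
    (le_trans w_le_lam lam_Lam) lam_gt0 zeta_ge0 lam_le Lam_opb f_bound f_var f_mean v0_var pw1 pw2 sc_Bl sc_dl sc_sN
    sc_BlD sc_Dh sc_mean sc_Blbd (incoherent_row_ge0 U) (incoherent_row_dim tucker r_gt0) (incoherent_rowP tucker r_gt0)
    step_1 zG zGth q0_large Bld.
  by exists good => //; exact: le_trans g1 cnt_le.
(* A grid with at most N^3 values per coordinate has logarithmic size at most 3 l m db, and m <= 2 l
   makes this 6 db l^2; the failure exponent adds Q l. *)
pose S := 8 * Q * (db * l ^+ 2).
(* This mesh moves a vector of any mode by at most 1/m in norm. *)
pose dt := (m%:R * Num.sqrt db)^-1.
have m0 : 0 < m%:R :> R by rewrite ltr0n; exact: ltnW m_gt1.
have sdb : 0 < Num.sqrt db by rewrite sqrtr_gt0.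
have dt0 : 0 < dt by rewrite invr_gt0 mulr_gt0.
have sdb_db : Num.sqrt db <= db.
  by apply: sqrt_le (ltW db0) _; rewrite expr2 ler_peMl ?(ltW db0) //; have := db_ge2; lra.
pose K := (m * dbar d).+1.
have Klarge : dt^-1 + 1 <= K%:R.
  by rewrite /dt invrK /K -natr1 natrM lerD2r ler_wpM2l // ltW.
have dts k : dt * Num.sqrt (d k)%:R <= m%:R^-1.
  rewrite /dt invfM -mulrA ler_piMr ?invr_ge0 ?(ltW m0) // mulrC ler_pdivrMr // mul1r.
  by rewrite ler_wsqrtr // dim_db.
have Slarge : (\sum_k d k)%:R * ln ((K + K).+1)%:R + Q * l <= S.
  have N0 : 0 < N by have := N_large; lra.
  have lnK : ln ((K + K).+1)%:R <= 3 * l.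
    rewrite mulr_natl -lnXn // ler_ln ?posrE ?ltr0n ?exprn_gt0 // -natrX ler_nat.
    have h1 := m_lt_N; have h2 : (dbar d <= dstar d)%N.
      have [k1 e] := dbar_attained d k0; rewrite e (dstar_mode d k1) leq_pmulr //; exact: cotidx_gt0.
    have h3 : (4 <= dstar d)%N by rewrite -(ler_nat R); have := N_large; lra.
    have h4 : (m * dbar d <= dstar d * dstar d)%N by apply: leq_mul => //; exact: ltnW.
    exact: cube_bound h3 h4.
  have sumd : (\sum_k d k)%:R <= m%:R * db.
    have e : (\sum_(k < m) dbar d = m * dbar d)%N by rewrite sum_nat_const card_ord.
    rewrite -natrM ler_nat -e; apply: leq_sum => k _; exact: leq_dbar.
  have ml : m%:R <= 2 * l.
    have e2 : (2 ^ m <= dstar d)%N := exp2_le_dstar k0_min (dims_ge2 k0).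
    have ln2 : 1 / 2 <= ln 2 :> R.
      have h1 := @le_ln1Dx R (- (1 / 2)); have := h1 _; rewrite (_ : 1 + - (1 / 2) = 2^-1); last by lra.
      by rewrite lnV ?posrE //; have -> : -1 < - (1 / 2) :> R by [lra]; move=> /(_ isT); lra.
    have h2 : m%:R * ln 2 <= l.
      by rewrite mulr_natl -lnXn // ler_ln ?posrE ?exprn_gt0 // -natrX ler_nat.
    have h3 : m%:R * (1 / 2) <= m%:R * ln 2 :> R by apply: ler_wpM2l ln2; exact: ltW.
    lra.
  have l0 : 0 <= l by lra.
  have dl0 : 0 <= db * l ^+ 2 by rewrite mulr_ge0 ?sqr_ge0 // ltW.
  have t1 : (\sum_k d k)%:R * ln ((K + K).+1)%:R <= 6 * (db * l ^+ 2).
    apply: (@le_trans _ _ (m%:R * db * (3 * l))); first by apply: ler_pM => //; rewrite ln_ge0 // ler1n.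
    apply: (@le_trans _ _ (2 * l * db * (3 * l))); last by rewrite le_eqVlt; apply/orP; left; apply/eqP; ring.
    by rewrite ler_wpM2r ?mulr_ge0 // ler_wpM2r // ltW.
  have t2 : 6 * (db * l ^+ 2) <= Q * (db * l ^+ 2) by rewrite ler_wpM2r // Q_ge6.
  have t3 : Q * l <= Q * (db * l ^+ 2).
    rewrite ler_wpM2l ?(ltW Q_gt0) // expr2 mulrA ler_peMl //.
    by rewrite -[leLHS]mulr1; apply: ler_pM => //; have := db_ge2; lra.
  have t4 : 0 <= Q * (db * l ^+ 2) by exact: mulr_ge0 (ltW Q_gt0) dl0.
  rewrite /S -mulrA; lra.
have S0 : 0 <= S := mulr_ge0 (mulr_ge0 (ler0n _ 8) (ltW Q_gt0)) (mulr_ge0 (ltW db0) (sqr_ge0 _)).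
have L0 : 0 < 2 * (nu / q4) by rewrite mulr_gt0 // divr_gt0.
have h_sg : h <= sg by rewrite lerDr; exact: ltW nu_gt0.
have Lw := scale_light lb nu_gt0 q4_gt0 n8_ge1 tau_gt0 l2 db0 a_p pmin_sN nu_tau Q1 S0 (lexx S) d3.
exact: (light_heavy_event tucker prob_ge0 prob_sum1 (dstar d) r_gt0 cotidx_gt0 B_gt0 sg_gt0 l1 Q1 beta_ge0 w_gt0
  f_mean pw1 pw2 sc_Bl sc_dl sc_sN sc_BlD sc_Dh sc_mean k0 f_split h_gt0 h_sg fl_bound fh_bound fh_var fh_mean
  L0 dt0 Klarge dts Slarge Lw).
Qed.

Lemma other_mode k : (m <= 2)%N -> exists2 k' : 'I_m, k' != k & forall j, (j != k) = (j == k').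
Proof.
move=> m2.
have c1 : #|[pred j : 'I_m | j != k]| = 1%N.
  rewrite (_ : #|_| = #|predC1 k|) // cardC1 card_ord.
  by apply/eqP; rewrite -eqSS prednK ?(ltnW m_gt1) // eqn_leq m2 m_gt1.
have [k' hk'] := mem_card1 c1.
by exists k' => [|j]; [have := hk' k'; rewrite !inE eqxx|have := hk' j; rewrite !inE].
Qed.

Lemma two_mode_events : (m <= 2)%N ->
  forall k, exists2 good : pred {ffun tidx d -> A * A}, Pr p (fun x => ~~ good x) <= fail &
    forall x, good x -> mode_ok T U f (base_var px rep) Q w lam Lam zeta th k x /\
      spec_le (46 * Q * w) (field f x).
Proof.
move=> m2 k; have [pw [pw1 pw2]] := power_between.
have cnt_le : cnt * expR (- (Q * l)) <= fail by rewrite ler_wpM2r ?expR_ge0 // lerDl.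
have [k' k'k oth] := other_mode k m2.
have dm (e : 'I_m -> nat) : dminus e k = e k'.
  by rewrite /dminus (eq_bigl (pred1 k')) ?big_pred1_eq.
have dm' (e : 'I_m -> nat) : dminus e k' = e k.
  rewrite /dminus (eq_bigl (pred1 k)) ?big_pred1_eq // => j /=.
  by apply/idP/idP => [|/eqP -> //]; [case: (eqVneq j k) => // jk; rewrite oth in jk; rewrite jk|rewrite eq_sym].
(* For a matrix each of the two ranks bounds the other one. *)
have rr : (r k' <= r k)%N by rewrite -(dm' r) -[X in (X <= _)%N](T_rank k'); exact: rank_matricize_le tucker k'.
have rr' : (r k <= r k')%N by rewrite -(dm r) -[X in (X <= _)%N](T_rank k); exact: rank_matricize_le tucker k.
have re : r k = r k' by apply/eqP; rewrite eqn_leq rr rr'.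
have De : #|cotidx d k| = d k' by rewrite card_cotidx dm.
have ths : th k' * Num.sqrt (d k')%:R = th k * Num.sqrt (d k)%:R.
  by rewrite !(incoherent_row_sqrt tucker r_gt0) re.
have ss : Num.sqrt (d k)%:R * Num.sqrt (d k')%:R = sN by rewrite -De sqrt_dstar sNs.
have g0 : 0 <= g by rewrite mulr_ge0 ?(ltW tau_gt0) // ltW.
have go := gsN_omega n8 q4 tau db lb nu_gt0.
have Bg := Bl_gp tau_gt0 a_p (erefl B).
have sqk j : pmin <= Num.sqrt (d j)%:R ^+ 2 by rewrite sqr_sqrtr.
(* Equal ranks give both row bounds the same product with the root of their dimension, as
   [two_mode_balance] needs. *)
have thr (j j' : 'I_m) : th j' * Num.sqrt (d j')%:R = th j * Num.sqrt (d j)%:R ->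
    Num.sqrt (d j)%:R * Num.sqrt (d j')%:R = sN -> B * l * th j' <= w * th j.
  move=> e1 e2; apply: (@le_trans _ _ (8 * om * th j)).
    apply: (two_mode_balance g0 (incoherent_row_ge0 U j) (incoherent_row_ge0 U j') (sqrtr_ge0 _) (sqrtr_ge0 _) (sqk j') e1) => //.
    by rewrite e2.
  by apply: (ler_wpM2r (incoherent_row_ge0 U j)); apply: (@K1 _ 0 8); lra.
have Dl : #|cotidx d k|%:R * l * sg ^+ 2 <= w ^+ 2 by rewrite De; exact: sc_dl.
have co1 : 1 <= th k' * Num.sqrt #|cotidx d k|%:R by rewrite De; exact: (incoherent_row_dim tucker r_gt0 k').
have cow c : fn (row c (cofactor_mx U k)) <= th k'.
  have := fn_cofactor_row c (incoherent_row_ge0 U) (incoherent_rowP tucker r_gt0).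
  by rewrite (eq_bigl (pred1 k')) ?big_pred1_eq.
have [|good g1 g2] := dilation_mode_event tucker prob_ge0 prob_sum1 r_gt0 cotidx_gt0 B_gt0 sg_gt0 l1 Q1 beta_ge0 w_gt0
  (le_trans w_le_lam lam_Lam) lam_gt0 lam_Lam (base_var_ge0 rep px_ge0) zeta_ge0 lam_le Lam_opb f_bound f_var f_mean v0_var
  pw1 pw2 sc_Bl sc_dl sc_sN sc_BlD sc_Dh sc_mean sc_Blbd (incoherent_row_ge0 U) (incoherent_row_dim tucker r_gt0)
  (incoherent_rowP tucker r_gt0) step_1 zG q0_large Dl (thr k k' ths ss) (thr k' k (esym ths) (etrans (mulrC _ _) ss))
  co1 cow _ (d_gt0 k) (z_step k) (z_stepth k).
  by rewrite dm.
by exists good => //; exact: le_trans g1 cnt_le.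
Qed.

Theorem finite_tensor_bound :
  exists2 good : pred {ffun tidx d -> A * A}, Pr p (fun x => ~~ good x) <= (m%:R + 1) * fail &
  forall x Y T0, good x -> near_field T f zeta x Y -> is_hosvd r Y T0 ->
    frobenius_norm (T0 - T) <= 1000 * (1000 * (36 * Q ^+ 3)) * (m%:R * kap * sr * om) /\
    max_norm (T0 - T) <= 1000 * (1000 * (36 * Q ^+ 3)) * (m%:R * kap ^+ 2 * sr * om) * \prod_k th k.
Proof.
pose s := 47 * Q * w.
have s0 : 0 <= s := mulr_ge0 (mulr_ge0 (ler0n _ 47) (ltW Q_gt0)) (ltW w_gt0).
have ev : (forall k, exists2 good : pred {ffun tidx d -> A * A}, Pr p (fun x => ~~ good x) <= fail &
    forall x, good x -> mode_ok T U f (base_var px rep) Q w lam Lam zeta th k x) /\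
  exists2 good : pred {ffun tidx d -> A * A}, Pr p (fun x => ~~ good x) <= fail &
    forall x, good x -> spec_le s (field f x).
  case: (ltnP 2 m) => [|m2]; first exact: three_mode_events.
  split => [k|]; first by have [good g1 g2] := two_mode_events m2 k; exists good => // x /g2[].
  have [good g1 g2] := two_mode_events m2 k0; exists good => // x /g2[_ sp] y.
  apply: (le_trans (sp y)); apply: ler_wpM2r; first by apply: prodr_ge0 => k _; exact: vn_ge0.
  by apply: (ler_wpM2r (ltW w_gt0)); apply: (ler_wpM2r (ltW Q_gt0)); lra.
have [ev1 ev2] := ev.
have [good g1 g2] := finite_hosvd tucker prob_ge0 r_gt0 Q1 w_gt0 (le_trans w_le_lam lam_Lam) lam_gt0 zeta_ge0 lam_le Lam_opb
  (incoherent_row_ge0 U) (incoherent_rowP tucker r_gt0) k0 step_m s0 ev1 ev2.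
exists good; first by rewrite mulrDl mul1r.
move=> x Y T0 gx nf hv; have [F1 F2] := g2 x Y T0 gx nf hv.
have o0 := ltW om_gt0; have m1 : 1 <= m%:R :> R by rewrite ler1n ltnW.
have K0 := kap_ge1; have s1 := sr_ge1; have k00 : 0 <= kap by exact: le_trans K0.
have sr0 : 0 <= sr by exact: sqrtr_ge0.
have l00 := lt0r_neq0 lam_gt0.
split.
  apply: (le_trans F1); apply: frobenius_total => //.
    by rewrite -[_ * kap * _ * _]mulrA ler_peMl ?mulr_ge0 // -[leLHS]mulr1; apply: ler_pM.
  apply: (@le_trans _ _ (\sum_(k < m) 80 * (80 * (36 * (Q ^+ 3 * (kap * sr * om)))))).
    apply: ler_sum => k _; have [_ rk] := rank_sqrt k.
    rewrite (_ : stp k * lam * Num.sqrt (r k)%:R = 36 * (Q ^+ 3 * (kap * Num.sqrt (r k)%:R ^+ 2 * om))); last first.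
      by rewrite /step; field.
    rewrite sqr_sqrtr //; apply: (scale_mono2 (ler0n _ 80)).
    by apply: (ler_wpM2l (exprn_ge0 _ (ltW Q_gt0))); apply: (ler_wpM2r o0); exact: ler_wpM2l.
  by rewrite sumr_const card_ord -mulr_natl le_eqVlt; apply/orP; left; apply/eqP; ring.
apply: (le_trans F2); apply: ler_wpM2r; first by apply: prodr_ge0 => k _; exact: incoherent_row_ge0.
rewrite -[6 * Lam * _]mulrA; apply: max_total => //.
  rewrite ler_peMl // -[leLHS]mulr1; apply: ler_pM => //; rewrite -[leLHS]mulr1; apply: ler_pM => //.
  by rewrite exprn_ege1.
rewrite mulr_sumr; apply: (@le_trans _ _ (\sum_(k < m) 400 * (400 * (36 * (Q ^+ 3 * (kap ^+ 2 * sr * om)))))).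
  apply: ler_sum => k _; have [rk _] := rank_sqrt k.
  rewrite (_ : Lam * (400 * (400 * stp k)) = 400 * (400 * (36 * (Q ^+ 3 * (kap ^+ 2 * Num.sqrt (r k)%:R * om))))); last first.
    by rewrite /step; field.
  apply: (scale_mono2 (ler0n _ 400)); apply: (ler_wpM2l (exprn_ge0 _ (ltW Q_gt0))).
  by apply: (ler_wpM2r o0); apply: ler_wpM2l rk; exact: sqr_ge0.
by rewrite sumr_const card_ord -mulr_natl le_eqVlt; apply/orP; left; apply/eqP; ring.
Qed.

End Events.
End TensorScales.

Section ModeSingularValues.
Variables (R : realType) (m : nat) (d r : 'I_m -> nat) (T : tensor R d) (C : tensor R r).
Variable (U : forall k, 'M[R]_(d k, r k)).
Hypothesis tucker : tucker_decomposition T C U.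
Hypothesis r_gt0 : forall k, (0 < r k)%N.
Hypothesis T_rank : has_tucker_rank r T.
Variable k0 : 'I_m.
Local Notation lam := (lambda_min r T).
Local Notation Lam := (lambda_max T).

Let sv k := singular_value (matricize k T) (r k).-1.

Let svP k : 0 < sv k /\ forall y : 'rV[R]_(r k), sv k * fn y <= fn (y *m (U k)^T *m matricize k T).
Proof.
have [Uo _] := tucker.
exact: (singular_value_rank (Uo k) (tucker_matricize tucker k) (T_rank k) (r_gt0 k)).
Qed.

Lemma lambda_min_gt0 : 0 < lam.
Proof.
have [b b0 hb] := positive_lower_bound (fun k => (svP k).1).
apply: (lt_le_trans b0); apply: lb_le_inf; first by exists (sv k0), k0.
by move=> _ [k _ <-]; exact: hb.
Qed.

Lemma lambda_min_le k : lam <= sv k.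
Proof.
apply: ge_inf; last by exists k.
by exists 0 => _ [j _ <-]; exact: ltW (svP j).1.
Qed.

Lemma lambda_min_fn k (y : 'rV[R]_(r k)) : lam * fn y <= fn (y *m (U k)^T *m matricize k T).
Proof.
by apply: le_trans ((svP k).2 y); rewrite ler_wpM2r ?fn_ge0 ?lambda_min_le.
Qed.

Lemma lambda_max_opb k : opb Lam (matricize k T).
Proof.
apply: opb_le (singular_value_opb (matricize k T)); apply: ub_le_sup; last by exists k.
exists (\sum_j singular_value (matricize j T) 0) => _ [j _ <-].
by rewrite (bigD1 j) //= lerDl; apply: sumr_ge0 => i _; exact: singular_value_ge0.
Qed.

Lemma lambda_min_max : lam <= Lam.
Proof.
have [Uo _] := tucker; pose y : 'rV[R]_(r k0) := const_mx 1.
have y0 : 0 < fn y.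
  rewrite lt_neqAle fn_ge0 andbT eq_sym; apply/eqP => /fn_eq0 /matrixP /(_ 0 (Ordinal (r_gt0 k0))).
  by rewrite !mxE => /eqP; rewrite oner_eq0.
rewrite -(ler_pM2r y0); apply: (le_trans (lambda_min_fn y)).
have h := @lambda_max_opb k0; by apply: (le_trans (h _)); rewrite fn_mulmxT.
Qed.

End ModeSingularValues.

(** Clipping is the projection on the interval from - tau to tau. *)
Lemma clip_lipschitz (R : realType) (tau x y : R) : 0 < tau -> `|clip tau x - clip tau y| <= `|x - y|.
Proof.
have clipE t : 0 < tau -> clip tau t = Num.max (- tau) (Num.min t tau).
  move=> t0; rewrite /clip; case: (lerP `|t| tau) => [|h].
    by rewrite ler_norml => /andP[h1 h2]; rewrite (min_idPl h2) (max_idPr h1).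
  have [t1|t1] := leP 0 t.
    rewrite ger0_norm // in h; rewrite gtr0_sg ?(lt_trans t0) // mulr1 (min_idPr (ltW h)).
    by rewrite (max_idPr _) //; lra.
  rewrite ltr0_norm // in h; rewrite ltr0_sg // mulrN1.
  have h1 : t <= tau by lra. have h2 : t <= - tau by lra.
  by rewrite (min_idPl h1) (max_idPl h2).
move=> t0; rewrite !clipE //; wlog xy : x y / x <= y.
  by move=> h; case: (leP x y) => [/h //|/ltW/h]; rewrite distrC [X in _ <= X -> _]distrC.
rewrite [leRHS]distrC (ger0_norm (_ : 0 <= y - x)) ?subr_ge0 //.
have a1 : Num.min x tau <= Num.min y tau by rewrite le_min ge_min xy ge_min lexx orbT.
have a2 : Num.max (- tau) (Num.min x tau) <= Num.max (- tau) (Num.min y tau).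
  by rewrite ge_max le_max lexx le_max a1 orbT.
rewrite distrC ger0_norm ?subr_ge0 // lerBlDr ge_max; apply/andP; split.
  by rewrite -[leLHS]add0r; apply: lerD; rewrite ?subr_ge0 // le_max lexx.
have [yt|yt] := leP y tau.
  by rewrite -[leLHS](subrK x); apply: lerD => //; rewrite le_max (min_idPl (le_trans xy yt)) lexx orbT.
have [xt|xt] := leP x tau.
  by apply: (@le_trans _ _ (y - x + x)); [lra|rewrite lerD2l le_max lexx orbT].
by apply: (@le_trans _ _ (y - x + tau)); [lra|rewrite lerD2l le_max lexx orbT].
Qed.

(** The two terms of the minimum answer the two parts of tau: the first controls nu N^(1/8), the
    second the largest entry of T through [Tle]. Together they take 10 of the 12 that c1 = 1 / (6
    C3) leaves. *)
Lemma corruption_small (R : realType) (C3 c1 a m kap sr lam Lam nu n8 tau Tm M th0 : R) :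
  0 < C3 -> c1 = (6 * C3)^-1 -> 0 < m -> 1 <= kap -> 0 < sr -> 0 < lam -> 0 < nu -> 1 <= n8 -> 1 <= M -> 0 <= a ->
  Lam = kap * lam -> 0 <= Tm -> Tm * n8 ^+ 4 <= Lam * Num.sqrt M ->
  tau <= 5 * (Tm + n8 * nu) ->
  a <= c1 * Num.min (lam / nu / n8 ^+ 5) (1 / M) / (m * kap ^+ 2 * sr) ->
  C3 * (m * kap * sr * (a * tau * n8 ^+ 4)) <= 2 * lam.
Proof.
move=> C30 c1E m0 kap1 sr0 lam0 nu0 n81 M1 a0 LE T0 Tle tle ale.
have kap0 : 0 < kap by lra. have n80 : 0 < n8 by lra. have M0 : 0 < M by lra.
have D0 : 0 < m * kap ^+ 2 * sr by rewrite !mulr_gt0 ?exprn_gt0.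
have c10 : 0 < c1 by rewrite c1E invr_gt0 mulr_gt0.
rewrite ler_pdivlMr // in ale.
have b1 : a * (m * kap ^+ 2 * sr) * (nu * n8 ^+ 5) <= c1 * lam.
  have h : a * (m * kap ^+ 2 * sr) <= c1 * (lam / nu / n8 ^+ 5).
    by apply: (le_trans ale); rewrite ler_wpM2l ?(ltW c10) // ge_min lexx.
  apply: (le_trans (ler_wpM2r _ h)); first by rewrite mulr_ge0 ?exprn_ge0 // ltW.
  by rewrite le_eqVlt; apply/orP; left; apply/eqP; field; rewrite ?gt_eqF.
have b2 : a * (m * kap ^+ 2 * sr) * M <= c1.
  have h : a * (m * kap ^+ 2 * sr) <= c1 * (1 / M).
    by apply: (le_trans ale); rewrite ler_wpM2l ?(ltW c10) // ge_min lexx orbT.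
  by move: h; rewrite div1r ler_pdivlMr.
have sM : Num.sqrt M <= M.
  rewrite -[leRHS]ger0_norm ?(ltW M0) // -sqrtr_sqr ler_wsqrtr // expr2 ler_peMl //; exact: ltW.
have aD0 : 0 <= a * (m * kap ^+ 2 * sr) by rewrite mulr_ge0 // ltW.
have Lam0 : 0 <= Lam by rewrite LE mulr_ge0 // ltW.
have b3 : a * (m * kap ^+ 2 * sr) * (Tm * n8 ^+ 4) <= c1 * Lam.
  apply: (le_trans (ler_wpM2l aD0 Tle)).
  have h1 : a * (m * kap ^+ 2 * sr) * (Lam * Num.sqrt M) <= a * (m * kap ^+ 2 * sr) * (Lam * M).
    by apply: (ler_wpM2l aD0); apply: ler_wpM2l.
  apply: (le_trans h1); rewrite mulrCA [leRHS]mulrC; exact: ler_wpM2l.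
have b4 : a * (m * kap ^+ 2 * sr) * (tau * n8 ^+ 4) <= 5 * (c1 * Lam + c1 * lam).
  have h1 : tau * n8 ^+ 4 <= 5 * (Tm * n8 ^+ 4 + nu * n8 ^+ 5).
    rewrite (_ : 5 * _ = 5 * (Tm + n8 * nu) * n8 ^+ 4); last by ring.
    by rewrite ler_wpM2r // exprn_ge0 // ltW.
  apply: (le_trans (ler_wpM2l aD0 h1)); rewrite mulrCA mulrDr; lra.
have b5 : c1 * lam <= c1 * Lam.
  by rewrite ler_wpM2l ?(ltW c10) // LE ler_peMl // ltW.
have b6 : kap * (C3 * (m * kap * sr * (a * tau * n8 ^+ 4))) <= kap * (2 * lam).
  rewrite (_ : kap * (C3 * _) = C3 * (a * (m * kap ^+ 2 * sr) * (tau * n8 ^+ 4))); last by ring.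
  rewrite (_ : kap * (2 * lam) = C3 * (12 * (c1 * Lam))); last first.
    by rewrite LE c1E; field; rewrite gt_eqF.
  rewrite ler_wpM2l ?(ltW C30) //; apply: (le_trans b4).
  have h : 0 <= c1 * Lam by rewrite mulr_ge0 // ltW.
  lra.
by rewrite ler_pM2l in b6.
Qed.

(** * What a positive probability bound implies *)

Section Vacuity.
Variables (R : realType) (eps c alpha : R) (m : nat) (d : 'I_m -> nat).
Hypothesis eps_gt0 : 0 < eps.
Hypothesis c_ge : 100 `^ (eps / 4) <= c.
Hypothesis d_gt0 : forall k, (0 < d k)%N.
Local Notation N := ((dstar d)%:R : R).
Hypothesis nonvacuous :
  0 < 1 - c * N `^ (- (eps / 4)) - \sum_(k < m) (dminus d k)%:R * expR (- alpha * (d k)%:R).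

Let N0 : 0 < N. Proof. by rewrite ltr0n dstar_gt0. Qed.
Let sum_ge0 : 0 <= \sum_(k < m) (dminus d k)%:R * expR (- alpha * (d k)%:R).
Proof. by apply: sumr_ge0 => k _; rewrite mulr_ge0 ?expR_ge0. Qed.

Let c0 : 0 < c. Proof. by apply: lt_le_trans c_ge; rewrite powR_gt0. Qed.

(** If N < 100, the choice of c alone would make the bound nonpositive. *)
Lemma nonvacuous_size : 100 <= N.
Proof.
have h := nonvacuous; have h2 := sum_ge0.
rewrite leNgt; apply/negP => N1.
have p0 : 0 < N `^ (eps / 4) by rewrite powR_gt0.
have : c * N `^ (- (eps / 4)) < 1 by lra.
rewrite powRN ltr_pdivrMr // mul1r => h3.
have : N `^ (eps / 4) <= 100 `^ (eps / 4).
  by apply: ge0_ler_powR; rewrite ?nnegrE ?divr_ge0 ?(ltW eps_gt0) ?(ltW N0) // ltW.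
move=> h4; have := lt_le_trans h3 (le_trans h4 c_ge); by rewrite ltxx.
Qed.

Lemma nonvacuous_rate k : ln (dminus d k)%:R <= alpha * (d k)%:R.
Proof.
have h := nonvacuous.
have D0 : 0 < (dminus d k)%:R :> R by rewrite ltr0n prodn_gt0.
have h1 : 0 <= c * N `^ (- (eps / 4)) by rewrite mulr_ge0 ?powR_ge0 // ltW.
have h2 : (dminus d k)%:R * expR (- alpha * (d k)%:R)
    <= \sum_(k < m) (dminus d k)%:R * expR (- alpha * (d k)%:R).
  by rewrite (bigD1 k) //= lerDl sumr_ge0 // => j _; rewrite mulr_ge0 ?expR_ge0.
have h3 : (dminus d k)%:R * expR (- alpha * (d k)%:R) < 1 by lra.
rewrite mulNr expRN ltr_pdivrMr ?expR_gt0 // mul1r in h3.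
by rewrite -(expRK (alpha * _)) ler_ln ?posrE ?expR_gt0 // ltW.
Qed.

(** With at least two modes, the smallest dimension is at most the product of the others, whose
    logarithm is therefore at least half of log N. *)
Lemma nonvacuous_min_rate (k0 : 'I_m) : (1 < m)%N -> (forall k, (d k0 <= d k)%N) ->
  ln N / 2 <= alpha * (d k0)%:R.
Proof.
move=> m1 kmin; apply: le_trans (nonvacuous_rate k0).
have D0 : 0 < (dminus d k0)%:R :> R by rewrite ltr0n prodn_gt0.
rewrite ler_pdivrMr // mulrC mulr_natl -lnXn // ler_ln ?posrE ?exprn_gt0 // -natrX ler_nat.
rewrite (dstar_split d k0) expnS expn1 leq_mul2r; apply/orP; right.
have := @mul_expn_le_dstar m d k0 d_gt0 kmin 1 k0 m1.
by rewrite (dstar_split d k0) expn1 leq_mul2l; case/orP => // /eqP h; have := d_gt0 k0; rewrite h.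
Qed.

End Vacuity.

(** In the exponent 6 + eps, the 6 pays for the number of events, N^5 times the m + 1 <= N families,
    and eps remains. *)
Lemma failure_small (R : realType) (eps : R) (N m : nat) : 0 < eps -> 100 <= N%:R :> R -> (m < N)%N ->
  (m%:R + 1) * ((((12 + 8 * N) * N ^ 2)%:R + 2) * expR (- ((6 + eps) * ln N%:R))) <= N%:R `^ (- (eps / 4)) :> R.
Proof.
move=> e0 N100 mN; have N0 : 0 < N%:R :> R by lra.
have e1 : expR (- ((6 + eps) * ln N%:R)) = N%:R ^- 6 * N%:R `^ (- eps).
  rewrite -powR_invn ?(ltW N0) // -powRD; last by rewrite (gt_eqF N0) implybT.
  by rewrite /powR (gt_eqF N0); congr expR; ring.
have p0 : 0 <= N%:R `^ (- eps) :> R := powR_ge0 _ _.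
have p1 : N%:R `^ (- eps) <= N%:R `^ (- (eps / 4)) :> R.
  by apply: ler_powR; [lra|rewrite lerN2 ler_pdivrMr //; lra].
apply: (le_trans _ p1); rewrite e1 !mulrA; apply: ler_piMl => //.
rewrite ler_pdivrMr ?exprn_gt0 // mul1r.
have h1 : m%:R + 1 <= N%:R :> R by rewrite natr1 ler_nat.
have h2 : ((12 + 8 * N) * N ^ 2)%:R + 2 <= N%:R ^+ 5 :> R.
  rewrite -natrX -natrD ler_nat; have n100 : (100 <= N)%N by rewrite -(ler_nat R).
  rewrite !expnS expn0 muln1; nia.
rewrite exprS; apply: ler_pM => //; lra.
Qed.

Lemma dstar_le_dbar (m : nat) (d : 'I_m -> nat) : (dstar d <= dbar d ^ m)%N.
Proof.
have e : (\prod_(k < m) dbar d = dbar d ^ m)%N by rewrite prod_nat_const card_ord.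
by rewrite -e; apply: leq_prod => k _; exact: leq_dbar.
Qed.

Section SignalStrength.
Variables (R : realType) (eps : R) (m : nat) (d r : 'I_m -> nat) (T : tensor R d) (C : tensor R r).
Variable (U : forall k, 'M[R]_(d k, r k)).
Hypothesis tucker : tucker_decomposition T C U.
Hypothesis r_gt0 : forall k, (0 < r k)%N.
Hypothesis T_rank : has_tucker_rank r T.
Variables (k00 : 'I_m) (alpha tau nu c Q C3 : R).
Hypothesis C3_gt0 : 0 < C3.
Hypothesis C3_Q : 3 * (400 * (800 * (36 * Q ^+ 3))) <= C3.
Local Notation N := ((dstar d)%:R : R).
Local Notation db := ((dbar d)%:R : R).
Local Notation mu := (incoherence U).
Local Notation lam := (lambda_min r T).
Local Notation Lam := (lambda_max T).
Local Notation kap := (Lam / lam).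
Local Notation sr := (Num.sqrt (dstar r)%:R : R).
Hypothesis eps_gt0 : 0 < eps.
Hypothesis c_ge : 100 `^ (eps / 4) <= c.
Hypothesis alpha01 : 0 <= alpha <= 1.
Hypothesis nu_ge0 : 0 <= nu.
Hypothesis dims_large : mu ^+ m * (dstar r)%:R * kap * db * ln db <= N.
Hypothesis tau_range : 4 * (max_norm T + N `^ (1 / 8) * nu) <= tau <= 5 * (max_norm T + N `^ (1 / 8) * nu).
Hypothesis signal : C3 * m%:R * kap * sr *
  Num.max (Num.sqrt (db * ln db)) (N `^ (1 / 4) * (ln db) `^ (1 / 4)) <= lam / nu.
Hypothesis corruption : alpha <= (6 * C3)^-1 * Num.min (lam / nu / N `^ (5 / 8)) (1 / (mu ^+ m * (dstar r)%:R))
  / (m%:R * kap ^+ 2 * sr).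
Hypothesis nonvacuous :
  0 < 1 - c * N `^ (- (eps / 4)) - \sum_(k < m) (dminus d k)%:R * expR (- alpha * (d k)%:R).

Let d_gt0 k : (0 < d k)%N. Proof. exact: tucker_dim_gt0 tucker r_gt0 k. Qed.

Lemma size_ge100 : 100 <= N.
Proof. exact: (nonvacuous_size eps_gt0 c_ge d_gt0 nonvacuous). Qed.

Let N0 : 0 < N. Proof. have := size_ge100; lra. Qed.
Let mu1 : 1 <= mu. Proof. exact: (incoherence_ge1 tucker r_gt0 k00). Qed.
Let lam0 : 0 < lam. Proof. exact: (lambda_min_gt0 tucker r_gt0 T_rank k00). Qed.
Let lamLam : lam <= Lam. Proof. exact: (lambda_min_max tucker r_gt0 T_rank k00). Qed.
Let kap1 : 1 <= kap. Proof. by rewrite ler_pdivlMr // mul1r. Qed.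
Let M1 : 1 <= mu ^+ m * (dstar r)%:R.
Proof. by rewrite -[leLHS]mulr1; apply: ler_pM => //; [exact: exprn_ege1|rewrite ler1n dstar_gt0]. Qed.

(** With one mode, N would be at most the largest dimension d, and [dims_large] would give d log d
    <= d although log d >= 4. *)
Lemma order_gt1 : (1 < m)%N.
Proof.
rewrite ltnNge; apply/negP => m1.
have Ndb : N <= db.
  rewrite ler_nat; apply: (leq_trans (dstar_le_dbar d)); rewrite -[X in (_ <= X)%N]expn1.
  by rewrite leq_pexp2l // (leq_trans (d_gt0 k00)) // leq_dbar.
have h100 := size_ge100; have l4 : 4 <= ln db by apply: ln_ge4; lra.
have h : db * ln db <= mu ^+ m * (dstar r)%:R * kap * db * ln db.
  rewrite -[leRHS]mulrA ler_peMl //; first by rewrite mulr_ge0 //; lra.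
  by rewrite -[leLHS]mulr1; apply: ler_pM.
have h1 : db * ln db <= db := le_trans h (le_trans dims_large Ndb).
have h2 : db * 4 <= db * ln db by rewrite ler_wpM2l.
lra.
Qed.

Lemma smallest_mode : exists k0, forall k, (d k0 <= d k)%N.
Proof. by case: (@arg_minnP _ k00 xpredT d isT) => k _ h; exists k => j; exact: h. Qed.

Lemma rate_min k0 : (forall k, (d k0 <= d k)%N) -> ln N / 2 <= alpha * (d k0)%:R.
Proof. by move=> kmin; exact: (nonvacuous_min_rate c_ge d_gt0 nonvacuous order_gt1 kmin). Qed.

Lemma alpha_gt0 : 0 < alpha.
Proof.
have [k0 kmin] := smallest_mode; have h := rate_min kmin; have l4 := ln_ge4 size_ge100.
rewrite lt_neqAle eq_sym; case/andP: alpha01 => -> _; rewrite andbT; apply/eqP => a0.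
by move: h; rewrite a0 mul0r; lra.
Qed.

Lemma dbar_ge2 : 2 <= db.
Proof.
have [k0 kmin] := smallest_mode; have h := rate_min kmin; have l4 := ln_ge4 size_ge100.
have h1 : alpha * (d k0)%:R <= 1 * (d k0)%:R by rewrite ler_wpM2r //; case/andP: alpha01.
have h2 : (d k0)%:R <= db by rewrite ler_nat leq_dbar.
lra.
Qed.

Let lb0 : 0 < ln db. Proof. by rewrite ln_gt0 //; have := dbar_ge2; lra. Qed.
Let m0 : 0 < m%:R :> R. Proof. by rewrite ltr0n ltnW // order_gt1. Qed.
Let sr0 : 0 < sr. Proof. by rewrite sqrtr_gt0 ltr0n dstar_gt0. Qed.
Let kap0 : 0 < kap. Proof. exact: lt_le_trans kap1. Qed.

Let pre_gt0 : 0 < C3 * m%:R * kap * sr. Proof. exact: mulr_gt0 (mulr_gt0 (mulr_gt0 C3_gt0 m0) kap0) sr0. Qed.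
Let mks_gt0 : 0 < m%:R * kap * sr. Proof. exact: mulr_gt0 (mulr_gt0 m0 kap0) sr0. Qed.

(** For nu = 0 the quotient in [signal] is 0 by the convention on division, while the other side is
    positive. *)
Lemma noise_gt0 : 0 < nu.
Proof.
rewrite lt_neqAle nu_ge0 andbT eq_sym; apply/eqP => nu0.
have h := signal; rewrite nu0 invr0 mulr0 in h.
have db0 : 0 < db by have := dbar_ge2; lra.
have : 0 < C3 * m%:R * kap * sr *
  Num.max (Num.sqrt (db * ln db)) (N `^ (1 / 4) * (ln db) `^ (1 / 4)).
  by rewrite (mulr_gt0 pre_gt0) // lt_max sqrtr_gt0 mulr_gt0.
by rewrite ltNge h.
Qed.

Let n8 := N `^ (1 / 8).
Let q4 := alpha `^ (1 / 4).

Lemma powR_frac (x : R) (p q : nat) : 0 <= x -> (0 < q)%N -> x `^ (p%:R / q%:R) = (x `^ (1 / q%:R)) ^+ p.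
Proof. by move=> x0 q0; rewrite -powR_mulrn ?powR_ge0 // -powRrM; congr powR; rewrite div1r mulrC. Qed.

Lemma n8_pow8 : n8 ^+ 8 = N.
Proof. by rewrite /n8 -(@powR_frac N 8 8 (ltW N0) isT) divff // powRr1 // ltW. Qed.

Lemma n8_ge1 : 1 <= n8.
Proof.
rewrite /n8 -[leLHS](powRr0 N); apply: ler_powR; last by rewrite divr_ge0.
by have := size_ge100; lra.
Qed.

Lemma q4_pow4 : q4 ^+ 4 = alpha.
Proof. by case/andP: alpha01 => a0 _; rewrite /q4 -(@powR_frac alpha 4 4 a0 isT) divff // powRr1. Qed.

Lemma q4_gt0 : 0 < q4. Proof. exact: powR_gt0 alpha_gt0. Qed.

Lemma q4_le1 : q4 <= 1.
Proof.
case/andP: alpha01 => a0 a1; have e : 1 `^ (1 / 4) = 1 :> R by rewrite powR1.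
rewrite /q4 -[leRHS]e; by apply: ge0_ler_powR; rewrite ?nnegrE.
Qed.

Let sN : Num.sqrt N = n8 ^+ 4.
Proof.
have e : n8 ^+ 8 = (n8 ^+ 4) ^+ 2 by rewrite -exprM.
by rewrite -n8_pow8 e sqrtr_sqr ger0_norm // exprn_ge0 // powR_ge0. Qed.

Local Notation om := (omega n8 q4 nu tau db (ln db)).

Let T_inf : max_norm T * n8 ^+ 4 <= Lam * Num.sqrt (mu ^+ m * (dstar r)%:R).
Proof.
have L0 : 0 <= Lam := le_trans (ltW lam0) lamLam.
have h := max_norm_incoherent tucker r_gt0 (@lambda_max_opb _ _ _ T k00) L0.
rewrite (prod_incoherent_row tucker r_gt0 k00) in h.
have n0 : 0 <= n8 ^+ 4 by rewrite exprn_ge0 // powR_ge0.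
apply: (le_trans (ler_wpM2r n0 h)); rewrite -[leLHS]mulrA; apply: (ler_wpM2l L0).
have M0 : 0 <= mu ^+ m * (dstar r)%:R := le_trans ler01 M1.
by rewrite -sN -sqrtrM ?divr_ge0 // divfK // gt_eqF.
Qed.

(** C3 times the gaussian part of omega, with its prefactor, is at most lam by [signal], and C3
    times the corruption part at most 2 lam by [corruption]; this is the 3 of [C3_Q]. *)
Lemma omega_small : 400 * (800 * (36 * Q ^+ 3)) * (m%:R * kap * sr * om) <= lam.
Proof.
have nu0 := noise_gt0; case/andP: alpha01 => a0 _; case/andP: tau_range => _ tle.
have Tm0 : 0 <= max_norm T := max_norm_ge0 T.
have h2 : C3 * (m%:R * kap * sr * (alpha * tau * n8 ^+ 4)) <= 2 * lam.
  apply: (@corruption_small _ C3 (6 * C3)^-1 alpha m%:R kap sr lam Lam nu n8 tau (max_norm T) (mu ^+ m * (dstar r)%:R)) => //.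
  - exact: n8_ge1.
  - by rewrite divfK // gt_eqF.
  - have := corruption; rewrite (@powR_frac N 5 8 (ltW N0) isT) => hc; exact: hc.
have h1 : C3 * (m%:R * kap * sr * (nu * Num.sqrt (db * ln db))) <= lam.
  rewrite (_ : _ * _ = C3 * m%:R * kap * sr * Num.sqrt (db * ln db) * nu); last by ring.
  rewrite -ler_pdivlMr //; apply: le_trans signal.
  by apply: (ler_wpM2l (ltW pre_gt0)); rewrite le_max lexx.
rewrite /omega q4_pow4 mulrDr [leLHS]mulrDr.
move: h1 h2; set X := m%:R * kap * sr * (nu * _); set Y := m%:R * kap * sr * (alpha * _ * _) => h1 h2.
have X0 : 0 <= X by apply: (mulr_ge0 (ltW mks_gt0)); rewrite mulr_ge0 // ?sqrtr_ge0.
have Y0 : 0 <= Y.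
  have t0 : 0 <= tau.
    case/andP: tau_range => t _; apply: le_trans t; rewrite mulr_ge0 // addr_ge0 // mulr_ge0 ?powR_ge0 //.
  by apply: (mulr_ge0 (ltW mks_gt0)); apply: mulr_ge0; [exact: mulr_ge0|rewrite exprn_ge0 ?powR_ge0].
have XY : 0 <= X + Y by exact: addr_ge0.
have h3 := ler_wpM2r XY C3_Q; rewrite [leRHS]mulrDr in h3.
have h4 : 3 * (400 * (800 * (36 * Q ^+ 3)) * (X + Y)) <= 3 * lam.
  by rewrite mulrA; apply: (le_trans h3); move: h1 h2; set x := C3 * X; set y := C3 * Y; lra.
have c3 : 0 < 3 :> R by [].
by rewrite -(ler_pM2l c3) -mulrDr.
Qed.

Lemma omega_err : om <= (nu + max_norm T) *
        (Num.sqrt (db * ln db) + 4 * N `^ (1 / 4) * (ln db) `^ (1 / 4)) +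
      2 * alpha * tau * Num.sqrt N.
Proof.
have nu0 := noise_gt0; case/andP: alpha01 => a0 _.
have Tm0 : 0 <= max_norm T := max_norm_ge0 T.
have t0 : 0 <= tau.
  case/andP: tau_range => t _; apply: le_trans t; rewrite mulr_ge0 // addr_ge0 // mulr_ge0 ?powR_ge0 //.
rewrite /omega q4_pow4 sN; apply: lerD.
  by apply: ler_pM; rewrite ?(ltW nu0) ?sqrtr_ge0 ?lerDl // !mulr_ge0 ?powR_ge0.
have h : 0 <= alpha * tau * n8 ^+ 4 by rewrite !mulr_ge0 ?exprn_ge0 ?powR_ge0.
rewrite -!mulrA [leRHS]mulrA in h *; lra.
Qed.

End SignalStrength.

Lemma constant_choice (R : realType) (q : R) : 0 < q ->
  exists K, [/\ K = 1000 * (1000 * (36 * q)), 0 < K & 3 * (400 * (800 * (36 * q))) <= K].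
Proof. by move=> q0; exists (1000 * (1000 * (36 * q))); split; [reflexivity|lra|lra]. Qed.

Lemma frobenius_rescale (R : realType) (K m kap sr o err x : R) : 0 <= K -> 0 <= m -> 0 <= kap -> 0 <= sr ->
  o <= err -> x <= K * (m * kap * sr * o) -> x <= K * m * kap * sr * err.
Proof.
move=> K0 m0 kap0 sr0 oe xle; apply: (le_trans xle).
rewrite (_ : K * m * kap * sr * err = K * (m * kap * sr * err)); last by ring.
by rewrite !ler_wpM2l ?mulr_ge0.
Qed.

Lemma max_rescale (R : realType) (K m kap sr th o err x : R) : 0 <= K -> 1 <= m -> 0 <= sr -> 0 <= th ->
  0 <= o -> o <= err -> x <= K * (m * kap ^+ 2 * sr * o) * th -> x <= K * m ^+ 2 * kap ^+ 2 * sr * th * err.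
Proof.
move=> K0 m1 sr0 th0 o0 oe xle; apply: (le_trans xle).
have k2 := sqr_ge0 kap.
rewrite (_ : _ * th = K * kap ^+ 2 * sr * th * (m * o)); last by ring.
rewrite (_ : K * _ * _ * _ * _ * _ = K * kap ^+ 2 * sr * th * (m ^+ 2 * err)); last by ring.
have c0 : 0 <= K * kap ^+ 2 * sr * th := mulr_ge0 (mulr_ge0 (mulr_ge0 K0 k2) sr0) th0.
apply: (ler_wpM2l c0); apply: ler_pM => //; first by lra.
by rewrite expr2 ler_peMl //; lra.
Qed.

Lemma probability_rescale (R : realType) (x b pr del s c : R) : 1 <= x + (b + pr) -> b <= del -> pr <= del ->
  0 <= s -> 2 <= c -> 0 <= del -> 1 - c * del - s <= x.
Proof.
move=> h hb hp s0 c2 d0; have : 2 * del <= c * del by rewrite ler_wpM2r.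
lra.
Qed.

Section FieldApproximation.
Variables (R : realType) (m : nat) (d : 'I_m -> nat) (T : tensor R d) (tau : R) (A : finType) (rep : A -> R).
Hypothesis tau_gt0 : 0 < tau.

Lemma truncate_near (zeta : R) (u v : tensor R d) (x : {ffun tidx d -> A * A}) :
  (forall w, `|u w - rep (x w).1| <= zeta / 2 /\ `|v w - rep (x w).2| <= zeta / 2) ->
  near_field T (tensor_entry T tau rep) zeta x (truncate tau [ffun w => T w + u w + v w]).
Proof.
move=> h w; have [h1 h2] := h w.
rewrite (_ : T w + _ = clip tau (T w + rep (x w).1 + rep (x w).2)); last first.
  by rewrite /tensor_entry /entry; ring.
rewrite !ffunE -/(clip tau _).
apply: (le_trans (clip_lipschitz _ _ tau_gt0)).
rewrite (_ : _ - _ = (u w - rep (x w).1) + (v w - rep (x w).2)); last by ring.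
by apply: (le_trans (ler_normD _ _)); lra.
Qed.

End FieldApproximation.

Theorem theorem4 (R : realType) (eps : R) (eps_gt0 : 0 < eps) :
  exists c c1 C1 C2 C3 : R,
    [/\ 0 < c, 0 < c1, 0 < C1, C1 < C2 & 0 < C3] /\
    forall (m : nat) (d r : 'I_m -> nat)
      (Tstar : tensor R d) (C : tensor R r)
      (U : forall k : 'I_m, 'M[R]_(d k, r k))
      (disp : measure_display) (Omega : measurableType disp)
      (P : probability Omega R)
      (xi : {RV P >-> R}) (Xi S : tidx d -> {RV P >-> R})
      (alpha : R) (Q : tidx d -> probability (measurableTypeR R) R)
      (tau : R) (T0 : Omega -> tensor R d),
    let m' : R := m%:R in
    let d' : R := (dstar d)%:R in
    let r' : R := (dstar r)%:R in
    let db : R := (dbar d)%:R in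
    let mu := incoherence U in
    let lam := lambda_min r Tstar in
    let kappa := lambda_max Tstar / lam in
    let nxi := norm_L4 xi in
    let Y (o : Omega) : tensor R d :=
      [ffun w => Tstar w + Xi w o + S w o] in
    let err : R :=
      (nxi + max_norm Tstar) *
        (Num.sqrt (db * ln db) + 4 * d' `^ (1 / 4) * (ln db) `^ (1 / 4)) +
      2 * alpha * tau * Num.sqrt d' in
    (0 < m)%N ->
    (forall k : 'I_m, (0 < r k)%N) ->
    has_tucker_rank r Tstar ->
    tucker_decomposition Tstar C U ->
    ('E_P[xi] = 0)%E ->
    ('E_P[(fun o => `|xi o| `^ (4 + eps))%R] < +oo)%E ->
    (forall w, identically_distributed (Xi w) xi) ->
    0 <= alpha <= 1 ->
    (forall w, contaminated alpha (Q w) (S w)) ->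
    mutually_independent
      (fun i : tidx d + tidx d =>
         match i with inl w => Xi w | inr w => S w end) ->
    (forall o, is_hosvd r (truncate tau (Y o)) (T0 o)) ->
    mu ^+ m * r' * kappa * db * ln db <= d' ->
    C1 * (max_norm Tstar + d' `^ (1 / 8) * nxi) <= tau
      <= C2 * (max_norm Tstar + d' `^ (1 / 8) * nxi) ->
    C3 * m' * kappa * Num.sqrt r' *
      Num.max (Num.sqrt (db * ln db)) (d' `^ (1 / 4) * (ln db) `^ (1 / 4))
      <= lam / nxi ->
    alpha <= c1 * Num.min (lam / nxi / d' `^ (5 / 8)) (1 / (mu ^+ m * r')) /
               (m' * kappa ^+ 2 * Num.sqrt r') ->
    exists E : set Omega,
      [/\ measurable E,
          ((1 - c * d' `^ (- (eps / 4)) -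
            \sum_(k < m) (dminus d k)%:R * expR (- alpha * (d k)%:R))%:E
             <= P E)%E,
          forall o, E o ->
            frobenius_norm (T0 o - Tstar) <=
              C3 * m' * kappa * Num.sqrt r' * err &
          forall o, E o ->
            max_norm (T0 o - Tstar) <=
              C3 * m' ^+ 2 * kappa ^+ 2 * Num.sqrt r' *
                Num.sqrt (mu ^+ m * r' / d') * err].

Proof.
pose Q := 6 + eps.
(* The 2 counts two failures of probability N^(- eps / 4), rounding and the finite model; the power
   of 100 forces N to be large. *)
pose c := Num.max 2 (100 `^ (eps / 4)) : R.
have Q0 : 0 < Q by rewrite addr_gt0.
have Q6 : 6 <= Q by rewrite lerDl ltW.
have q3 : 0 < Q ^+ 3 by rewrite exprn_gt0.
have [C3 [C3E C30 C3Q]] : exists C3, [/\ C3 = 1000 * (1000 * (36 * Q ^+ 3)), 0 < C3 &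
    3 * (400 * (800 * (36 * Q ^+ 3))) <= C3].
  exact: constant_choice.
have c2 : 2 <= c by rewrite le_max lexx.
have cp : 100 `^ (eps / 4) <= c by rewrite le_max lexx orbT.
exists c, (6 * C3)^-1, 4, 5, C3; split.
  split => //; [by apply: lt_le_trans c2|by rewrite invr_gt0 mulr_gt0|by rewrite ltr_nat].
move=> m d r T C U disp Omega P xi Xi S alpha Qd tau T0 m' d' r' db mu lam kappa nxi Y err
  m_gt0 r_gt0 T_rank tucker xi_mean xi_moment X_law alpha01 S_law indep hosvd dims taub sig cor.
(* If the claimed probability is not positive, the empty event will do. *)
case: (leP (1 - c * d' `^ (- (eps / 4)) - \sum_(k < m) (dminus d k)%:R * expR (- alpha * (d k)%:R)) 0) => [vac|nonvac].
  by exists set0; split => //; rewrite measure0 lee_fin.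
pose k00 : 'I_m := Ordinal m_gt0.
have nxi0 : 0 <= nxi := norm_L4_ge0 xi.
have N100 := size_ge100 tucker r_gt0 eps_gt0 cp nonvac.
have m1 := order_gt1 tucker r_gt0 T_rank k00 eps_gt0 cp dims nonvac.
have [k0 kmin] := smallest_mode d k00.
have ap := rate_min tucker r_gt0 T_rank k00 eps_gt0 cp dims nonvac kmin.
have nu0 := noise_gt0 tucker r_gt0 T_rank k00 C30 eps_gt0 cp alpha01 nxi0 dims sig nonvac.
pose n8 := d' `^ (1 / 8); pose q4 := alpha `^ (1 / 4).
have q4E : q4 ^+ 4 = alpha := q4_pow4 alpha01.
have n8E : n8 ^+ 8 = d' := n8_pow8 tucker r_gt0 eps_gt0 cp nonvac.
have a0 := alpha_gt0 tucker r_gt0 T_rank k00 eps_gt0 cp alpha01 dims nonvac.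
have q40 : 0 < q4 := powR_gt0 _ a0.
have q41 : q4 <= 1 := q4_le1 alpha01.
have n81 : 1 <= n8 := n8_ge1 tucker r_gt0 eps_gt0 cp nonvac.
have tau_ge : 4 * (max_norm T + n8 * nxi) <= tau by case/andP: taub.
have Tm0 := max_norm_ge0 T.
have tau0 : 0 < tau.
  by apply: lt_le_trans tau_ge; rewrite mulr_gt0 // ltr_wpDl // mulr_gt0 // (lt_le_trans ltr01).
have oms := omega_small tucker r_gt0 T_rank k00 C30 C3Q eps_gt0 cp alpha01 nxi0 dims taub sig cor nonvac.
have ome := omega_err tucker r_gt0 T_rank k00 C30 eps_gt0 cp alpha01 nxi0 dims taub sig nonvac.
have lam0 : 0 < lam := lambda_min_gt0 tucker r_gt0 T_rank k00.
have lamLam : lam <= lambda_max T := lambda_min_max tucker r_gt0 T_rank k00.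
have lamfn := lambda_min_fn tucker r_gt0 T_rank.
have ap4 : ln d' / 2 <= q4 ^+ 4 * (d k0)%:R by rewrite q4E.
have g0 : 0 < q4 ^+ 4 * tau by rewrite q4E mulr_gt0.
have d0 : 0 < d' by apply: lt_le_trans N100.
have sd0 : 0 < Num.sqrt d' by rewrite sqrtr_gt0.
have L0 : 0 <= lambda_max T := le_trans (ltW lam0) lamLam.
pose G := lambda_max T + (4 * tau + 6 * (q4 ^+ 4 * tau)) * Num.sqrt d'.
have G0 : 0 <= G.
  by rewrite /G addr_ge0 // mulr_ge0 ?sqrtr_ge0 // addr_ge0 // mulr_ge0 // ltW.
have [z0 z00 hz] := small_precision tucker r_gt0 n81 nu0 q40 tau_ge lam0 lamLam Q6 G0.
(* An entrywise error zeta costs zeta sqrt N in Frobenius norm, which z0 bounds; the other term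
   keeps the rounding below the bias. *)
pose zeta := Num.min (q4 ^+ 4 * tau) (z0 / Num.sqrt d').
have zeta0 : 0 < zeta by rewrite lt_min g0 divr_gt0.
have zetag : zeta <= q4 ^+ 4 * tau by rewrite ge_min lexx.
have zz : 0 <= zeta * Num.sqrt d' <= z0.
  by rewrite mulr_ge0 ?sqrtr_ge0 ?(ltW zeta0) //= -ler_pdivlMr // ge_min lexx orbT.
have [zo zG zGth zs zst] := hz _ zz.
have delta0 : 0 < d' `^ (- (eps / 4)) by rewrite powR_gt0.
have zeta20 : 0 < zeta / 2 by rewrite divr_gt0.
have [A [rep [px [ps [cells [E0 [[px0 px1] [ps0 ps1] [rmean rep4 ne0] [mE0 PE0 near] law]]]]]]] :=
  finite_noise_model eps_gt0 xi_moment xi_mean X_law alpha01 S_law indep zeta20 delta0.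
have rm : `|\sum_v px v * rep v| <= zeta by apply: le_trans rmean _; rewrite mulrC divfK.
have ne4 i : \sum_(v | rep v != 0) ps i v <= q4 ^+ 4 by rewrite q4E.
have [good Pg hg] := finite_tensor_bound tucker r_gt0 T_rank m1 kmin n81 n8E N100 nu0 q40 q41 ap4 tau_ge lam0 lamfn
  (@lambda_max_opb _ _ _ T) lamLam Q6 oms px0 px1 ps0 ps1 rm rep4 ne4 (ltW zeta0) zetag zo zG zGth zs zst.
have [mB PB] := law (tensor_prob px ps) (fun x => ~~ good x) (fun w b => erefl _).
have fs := failure_small eps_gt0 N100 (m_lt_N kmin N100 q40 q41 ap4).
(* On [E0] the data are close to the finite model; removing the bad set leaves the outcomes where
   that model obeys both bounds. *)
exists (E0 `\` [set o | ~~ good (cells o)]).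
have kap0 : 0 <= kappa by rewrite divr_ge0 // ltW.
split.
- exact: measurableD.
- have mE : measurable (E0 `\` [set o | ~~ good (cells o)]) by exact: measurableD.
  (* The event and the two failures cover the whole space, so subadditivity bounds its probability
     from below. *)
  have cov : (P setT <= P (E0 `\` [set o | ~~ good (cells o)]) + (P (~` E0) + P [set o | ~~ good (cells o)]))%E.
    have mC : measurable (~` E0) by exact: measurableC.
    apply: (@le_trans _ _ (P ((E0 `\` [set o | ~~ good (cells o)]) `|` (~` E0 `|` [set o | ~~ good (cells o)])))).
      apply: le_measure; rewrite ?inE //; first by apply: measurableU => //; exact: measurableU.
      move=> y _ /=; case: (pselect (E0 y)) => Ey; last by right; left.
      by case: (boolP (good (cells y))) => gy; [left; split => //; exact/negP|right; right].
    apply: (le_trans (measureU2 _ _ _)) => //; first exact: measurableU.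
    by apply: leeD => //; exact: measureU2.
  have fE : P (E0 `\` [set o | ~~ good (cells o)]) \is a fin_num by rewrite fin_num_measure.
  have fC : P (~` E0) \is a fin_num by rewrite fin_num_measure //; exact: measurableC.
  rewrite -(fineK fE) in cov *; rewrite probability_setT PB -(fineK fC) -!EFinD lee_fin in cov.
  rewrite -(fineK fC) lee_fin in PE0; rewrite lee_fin.
  have sg : 0 <= \sum_(k < m) (dminus d k)%:R * expR (- alpha * (d k)%:R).
    by apply: sumr_ge0 => k _; rewrite mulr_ge0 ?expR_ge0.
  exact: (probability_rescale cov PE0 (le_trans Pg fs) sg c2 (ltW delta0)).
- move=> y [Ey /= gy].
  have gyy : good (cells y) by apply/negP => h; apply: gy; exact/negP.
  have nf : near_field T (tensor_entry T tau rep) zeta (cells y) (truncate tau (Y y)).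
    rewrite (_ : Y y = [ffun w => T w + [ffun w => Xi w y] w + [ffun w => S w y] w]).
      by apply: truncate_near => // w; rewrite !ffunE; exact: near.
    by apply/ffunP => w; rewrite !ffunE.
  have [F1 _] := hg _ _ _ gyy nf (hosvd y).
  rewrite -C3E in F1.
  exact: (frobenius_rescale (ltW C30) (ler0n _ m) kap0 (sqrtr_ge0 _) ome F1).
- move=> y [Ey /= gy].
  have gyy : good (cells y) by apply/negP => h; apply: gy; exact/negP.
  have nf : near_field T (tensor_entry T tau rep) zeta (cells y) (truncate tau (Y y)).
    rewrite (_ : Y y = [ffun w => T w + [ffun w => Xi w y] w + [ffun w => S w y] w]).
      by apply: truncate_near => // w; rewrite !ffunE; exact: near.
    by apply/ffunP => w; rewrite !ffunE.
  have [_ F2] := hg _ _ _ gyy nf (hosvd y).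
  rewrite -C3E (prod_incoherent_row tucker r_gt0 k00) in F2.
  have m1' : 1 <= m' by rewrite ler1n.
  have o0 := omega_gt0 db (ln db) nu0 q40 n81 tau0.
  exact: (max_rescale (ltW C30) m1' (sqrtr_ge0 _) (sqrtr_ge0 _) (ltW o0) ome F2).
Qed.
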